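(* Let $K\ge2$ be fixed and assume the following. (Boundedness) There exist constants $C,C'>0$ such that for every $\theta\in\Theta$: the $\mathcal G_t^\theta$-intensity $\boldsymbol\lambda^\theta$ of $N^\theta$ is càglàd with $\sup_{0\le t\le 1}\boldsymbol\lambda_t^\theta\le C$ almost surely; the residual process $G^\theta$ is càglàd with $\sup_{0\le t\le 1}|G_t^\theta|\le C'$ almost surely; and for each fold $k$ the estimators satisfy the same bounds, $\sup_t|\hat\lambda_t^{k,(n),\theta}|\le C$ and $\sup_t|\hat G_t^{k,(n),\theta}|\le C'$ almost surely. (Rates for every split) For every $k=1,\dots,K$: $|J_n^k|\to\infty$ as $n\to\infty$, and with $g_k^\theta(n)=\||G^\theta-\hat G^{k,(n),\theta}\||_2$ and $h_k^\theta(n)=\||\lambda^\theta-\hat\lambda^{k,(n),\theta}\||_2$, $$\lim_{n\to\infty}\sup_{\theta\in\Theta}\max\{g_k^\theta(n),\,h_k^\theta(n),\,\sqrt{|J_n^k|}\,g_k^\theta(n)h_k^\theta(n)\}=0 .$$ (Variance) There exists $\delta_1>0$ such that $\mathcal V^\theta(1)\ge\delta_1$ for all $\theta\in\Theta$. Then the cross-fitted test statistic satisfies $\check T_n^{K,\theta}\xrightarrow{\mathcal D/\Theta_0}S$ as $n\to\infty$. In particular, the $K$-fold cross-fitted Local Covariance Test (X-LCT) $\check\Psi_n^K$ has uniform asymptotic level: for every significance level $\alpha\in(0,1)$, $\limsup_{n\to\infty}\sup_{\theta\in\Theta_0}\mathbb P(\check\Psi_n^{K,\theta}=1)\le\alp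ha$.
   Context: Setting. $\Theta$ is an arbitrary set indexing sampling distributions; every object below depends on $\theta\in\Theta$, with the superscript $\theta$ often suppressed. Time is $[0,1]$. $N$ is a counting process adapted to a right-continuous complete filtration $\mathcal F_t$; $X$ is a real-valued càglàd process; $\mathcal G_t$ is the right-continuous complete filtration generated by $\mathcal F_t$ and $X_t$. $N$ has an $\mathcal F_t$-intensity $\lambda$ (i.e. $\lambda$ is $\mathcal F_t$-predictable and $M_t=N_t-\int_0^t\lambda_s\,ds$ is a local $\mathcal F_t$-martingale) and a $\mathcal G_t$-intensity $\boldsymbol\lambda$. The hypothesis $H_0$ (conditional local independence of $N$ from $X$ given $\mathcal F_t$) is: $M$ is also a local $\mathcal G_t$-martingale. $\Theta_0=\{\theta\in\Theta: H_0\text{ is valid}\}$. A residual process $G$ of $X$ given $\mathcal F_t$ is a càglàd $\mathcal G_t$-adapted process with $E(G_t\mid\mathcal F_{t-})=0$ for all $t\in[0,1]$. A residual process $G$ is fixed for each $\theta$. The variance function is $\mathcal V(t)=E\int_0^tG_s^2\,dN_s$. Data, folds and estimators. $(N_j,X_j,\mathcal F_j)$, $j=1,\dots,n$, are i.i.d. replications of $(N,X,\mathcal F)$. $J_n^1\cup\dots\cup J_n^K=\{1,\dots,n\}$ is a partition into $K$ disjoint folds with $|J_n^k|/n\to1/K$ for each $k$. For each $k$, the estimates $\hat\lambda^{k,(n)}$ of $\lambda$ and $\hat G^{k,(n)}$ of $G$ are fitted on data indexed by $(J_n^k)^c$ only; given those data they are fixed maps, evaluated on the $\mathcal F$-history resp.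 $\mathcal G$-history of a new observation, yielding (conditionally on the training data) an $\mathcal F_t$-predictable process resp. a $\mathcal G_t$-predictable process. $\hat\lambda_j^{k,(n)},\hat G_j^{k,(n)}$ are the evaluations on observation $j\in J_n^k$, $\hat\lambda_t^{k,(n)},\hat G_t^{k,(n)}$ the evaluations on one additional copy $(N,X,\mathcal F)$ independent of the data, and $\hat M_{j,t}^{k,(n)}=N_{j,t}-\int_0^t\hat\lambda_{j,s}^{k,(n)}ds$. Define $$\check\gamma_t^{K,(n)}=\frac1K\sum_{k=1}^K\frac1{|J_n^k|}\sum_{j\in J_n^k}\int_0^t\hat G_{j,s}^{k,(n)}\,d\hat M_{j,s}^{k,(n)},\qquad \check{\mathcal V}_{K,n}(t)=\frac1K\sum_{k=1}^K\frac1{|J_n^k|}\sum_{j\in J_n^k}\int_0^t(\hat G_{j,s}^{k,(n)})^2\,dN_{j,s},$$ $$\check T_n^K=\sqrt{\frac{n}{\check{\mathcal V}_{K,n}(1)}}\;\sup_{0\le t\le1}|\check\gamma_t^{K,(n)}|$$ (set to $0$ if $\check{\mathcal V}_{K,n}(1)=0$). For a process $W$ on $[0,1]$, $\||W\||_2^2=E\int_0^1W_s^2\,ds$. $S$ is a random variable distributed as $\sup_{0\le t\le1}|B_t|$ for a standard Brownian motion $B$, and $z_{1-\alpha}$ is its $(1-\alpha)$-quantile. The X-LCT with significance level $\alpha$ is $\check\Psi_n^K=1$ if $\check T_n^K>z_{1-\alpha}$ and $0$ otherwise. Uniform convergence. For real random variables, $Y_n^\theta\xrightarrow{\mathcal D/\Theta_0}Y$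 means $\sup_{\theta\in\Theta_0}\sup_f|E f(Y_n^\theta)-E f(Y)|\to0$, the inner supremum over $f:\mathbb R\to\mathbb R$ with $\|f\|_\infty\le1$ and Lipschitz constant at most $1$. *)

(* Defs.v *)
From HB Require Import structures.
From mathcomp Require Import all_boot all_order all_algebra.
From mathcomp Require Import all_classical all_reals all_analysis.

Import Order.TTheory GRing.Theory Num.Theory.
Import numFieldNormedType.Exports.

Local Open Scope classical_set_scope.
Local Open Scope ring_scope.

(* Time is [0, 1].  A process is a function [W : R -> E -> R]; only its values
   at times in [0, 1] matter. *)

Section filtrations.
Context {R : realType} {d : measure_display} {E : measurableType d}.
Implicit Types (P : probability E R) (F : R -> set_system E) (W : R -> E -> R).

Definition measurable_wrt (S : set_system E) (Y : E -> R) : Prop :=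
  forall B : set R, measurable B -> S (Y @^-1` B).

Definition adapted F W : Prop :=
  forall t, 0 <= t <= 1 -> measurable_wrt (F t) (W t).

Definition filtration F : Prop :=
  [/\ forall t, 0 <= t <= 1 -> sigma_algebra setT (F t),
      forall t, 0 <= t <= 1 -> F t `<=` measurable
    & forall s t, 0 <= s -> s <= t -> t <= 1 -> F s `<=` F t].

Definition right_continuous_filtration F : Prop :=
  forall t, 0 <= t < 1 -> F t = \bigcap_(s in [set s | t < s <= 1]) F s.

(* Together with [F t `<=` measurable] this forces [P] to be complete. *)
Definition complete_filtration P F : Prop :=
  forall t, 0 <= t <= 1 -> P.-negligible `<=` F t.

(* The right-continuous filtration generated by a complete filtration [F] and
   [X].  For t < 1 the index set amounts to ]t, 1]; for t = 1 it is {1}. *)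
Definition enlargement F W : R -> set_system E := fun t =>
  \bigcap_(s in [set s | s = 1 \/ t < s < 1])
    <<s F s `|` [set A | exists u (B : set R),
          [/\ 0 <= u <= s, measurable B & A = W u @^-1` B]] >>.

(* F_{t-}, with the usual convention F_{0-} = F_0. *)
Definition left_limit F : R -> set_system E := fun t =>
  if t == 0 then F 0 else <<s \bigcup_(s in [set s | 0 <= s < t]) F s >>.

(* The predictable sigma-algebra is a sigma-algebra on [0, 1] x E. *)
Definition predictable_rectangle F : set_system (R * E) :=
  [set Q | (exists2 A, F 0 A & Q = [set 0] `*` A) \/
           (exists s t A, [/\ 0 <= s, s < t, t <= 1, F s A &
                              Q = `]s, t]%classic `*` A])].

Definition predictable F W : Prop :=
  let D := `[0, 1]%classic `*` [set: E] in
  forall B : set R, measurable B ->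
    <<s D, predictable_rectangle F >> (D `&` [set p | B (W p.1 p.2)]).

(* [Z] is a version of the conditional expectation E(Y | S). *)
Definition is_cond_exp P (S : set_system E) (Y Z : E -> R) : Prop :=
  [/\ P.-integrable setT (EFin \o Y), P.-integrable setT (EFin \o Z),
      measurable_wrt S Z
    & forall A, S A -> (\int[P]_(e in A) (Z e)%:E = \int[P]_(e in A) (Y e)%:E)%E].

Definition martingale P F W : Prop :=
  forall s t, 0 <= s -> s <= t -> t <= 1 -> is_cond_exp P (F s) (W t) (W s).

Definition stopping_time F (tau : E -> R) : Prop :=
  (forall e, 0 <= tau e) /\ forall t, 0 <= t <= 1 -> F t [set e | tau e <= t].

(* As time is [0, 1], a localizing sequence eventually reaches the end point 1
   (stopping at any time >= 1 has no effect). *)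
Definition local_martingale P F W : Prop :=
  exists tau : nat -> E -> R,
    [/\ forall n, stopping_time F (tau n),
        forall e, {homo tau ^~ e : n m / (n <= m)%N >-> n <= m},
        {ae P, forall e, \forall n \near \oo, 1 <= tau n e}
      & forall n, martingale P F
          (fun t e => W (Order.min t (tau n e)) e - W 0 e)].

End filtrations.

Section paths.
Context {R : realType}.

Definition caglad (f : R -> R) : Prop :=
  (forall t, 0 < t <= 1 -> f s @[s --> t^'-] --> f t) /\
  (forall t, 0 <= t < 1 -> cvg (f s @[s --> t^'+])).

(* Paths of counting processes are bundled as [cumulative] functions
   (nondecreasing and right-continuous), so as to use the library's
   Lebesgue-Stieltjes measure; their extension outside [0, 1] is irrelevant. *)
Definition counting_path (f : cumulative R R) : Prop :=
  [/\ f 0 = 0,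
      forall t, 0 <= t <= 1 -> exists m : nat, f t = m%:R
    & forall t, 0 < t <= 1 -> f t - lim (f s @[s --> t^'-]) <= 1].

(* \int_0^t g_s dM_s for M_t = N_t - \int_0^t l_s ds. *)
Definition integral_dM (N : cumulative R R) (l g : R -> R) (t : R) : R :=
  \int[lebesgue_stieltjes_measure N]_(s in `]0, t]) g s -
  \int[lebesgue_measure]_(s in `[0, t]) (g s * l s).

End paths.

Section intensities.
Context {R : realType} {d : measure_display} {E : measurableType d}.

Definition compensated (N : E -> cumulative R R) (l : R -> E -> R)
    : R -> E -> R :=
  fun t e => N e t - \int[lebesgue_measure]_(s in `[0, t]) l s e.

Definition is_intensity (P : probability E R) (F : R -> set_system E)
    (N : E -> cumulative R R) (l : R -> E -> R) : Prop :=
  [/\ predictable F l,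
      {ae P, forall e, lebesgue_measure.-integrable `[0, 1]%classic
                         (EFin \o (l ^~ e))}
    & local_martingale P F (compensated N l)].

End intensities.

Definition mutually_independent {R : realType} {d d' : measure_display}
    {T : measurableType d} {T' : measurableType d'} (P : probability T R)
    {I : eqType} (Y : I -> T -> T') : Prop :=
  forall (s : seq I) (A : I -> set T'), uniq s -> (forall i, measurable (A i)) ->
    P (\bigcap_(i in [set` s]) (Y i @^-1` A i)) =
    (\prod_(i <- s) P (Y i @^-1` A i))%E.

(* One sampling distribution.  A single observation is a point of [obs_space],
   on which N, X, F_t, the intensities and the residual process live.
   A replication (N_j, X_j, F_j) is the pull-back of (N, X, F) along a random
   element [sample j] of [obs_space]: [sample (Some j)] for observation j + 1,
   [sample None] for the additional copy independent of the data. *)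
Record lct_model (R : realType) := LctModel {
  obs_disp : measure_display;
  obs_space : measurableType obs_disp;
  obs_law : probability obs_space R;
  fil : R -> set_system obs_space;
  Nproc : obs_space -> cumulative R R;
  Xproc : R -> obs_space -> R;
  lambda : R -> obs_space -> R;
  blambda : R -> obs_space -> R;
  Gres : R -> obs_space -> R;
  data_disp : measure_display;
  data_space : measurableType data_disp;
  data_law : probability data_space R;
  sample : option nat -> data_space -> obs_space }.

Arguments obs_disp {R} m : rename.
Arguments obs_space {R} m : rename.
Arguments obs_law {R} m : rename.
Arguments fil {R} m : rename.
Arguments Nproc {R} m : rename.
Arguments Xproc {R} m : rename.
Arguments lambda {R} m : rename.
Arguments blambda {R} m : rename.
Arguments Gres {R} m : rename.
Arguments data_disp {R} m : rename.
Arguments data_space {R} m : rename.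
Arguments data_law {R} m : rename.
Arguments sample {R} m : rename.

Definition big_fil {R : realType} (m : lct_model R) :
    R -> set_system (obs_space m) :=
  enlargement (fil m) (Xproc m).

Definition residual_process {R : realType} (m : lct_model R)
    (G : R -> obs_space m -> R) : Prop :=
  [/\ forall e, caglad (G ^~ e),
      adapted (big_fil m) G
    & forall t, 0 <= t <= 1 ->
        is_cond_exp (obs_law m) (left_limit (fil m) t) (G t) (cst 0)].

(* [data_complete] is the usual completeness of the underlying space; it makes
   events determined up to null sets measurable. *)
Record lct_setting {R : realType} (m : lct_model R) : Prop := {
  fil_filtration : filtration (fil m);
  fil_right_continuous : right_continuous_filtration (fil m);
  fil_complete : complete_filtration (obs_law m) (fil m);
  N_path : forall e, counting_path (Nproc m e);
  N_adapted : adapted (fil m) (fun t e => Nproc m e t);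
  X_measurable : forall t, 0 <= t <= 1 ->
    measurable_fun [set: obs_space m] (Xproc m t);
  X_caglad : forall e, caglad (Xproc m ^~ e);
  lambdaP : is_intensity (obs_law m) (fil m) (Nproc m) (lambda m);
  blambdaP :
    is_intensity (obs_law m) (big_fil m) (Nproc m) (blambda m);
  GresP : residual_process m (Gres m);
  data_complete : measure_is_complete (data_law m);
  sample_measurable : forall i,
    measurable_fun [set: data_space m] (sample m i);
  sample_law : forall i (A : set (obs_space m)), measurable A ->
    data_law m (sample m i @^-1` A) = obs_law m A;
  sample_independent : mutually_independent (data_law m) (sample m) }.

(* Conditional local independence. *)
Definition H0 {R : realType} (m : lct_model R) : Prop :=
  local_martingale (obs_law m) (big_fil m)
    (compensated (Nproc m) (lambda m)).

Definition variance_function {R : realType} (m : lct_model R) (t : R) : \bar R :=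
  (\int[obs_law m]_e \int[lebesgue_stieltjes_measure (Nproc m e)]_(s in `]0%R, t])
      ((Gres m s e) ^+ 2)%:E)%E.

Section estimators.
Context {R : realType} {m : lct_model R} {n : nat}.

Definition estimator := n.-tuple (obs_space m) -> R -> obs_space m -> R.

(* [H] is fitted on the observations indexed by [D] only, and for fixed training
   data is an [F]-predictable process of a new observation. *)
Definition fitted_estimator (D : {set 'I_n}) (F : R -> set_system (obs_space m))
    (H : estimator) : Prop :=
  [/\ forall x y, (forall i, i \in D -> tnth x i = tnth y i) -> H x = H y,
      measurable_fun [set p : n.-tuple (obs_space m) * (R * obs_space m) |
                        0 <= p.2.1 <= 1] (fun p => H p.1 p.2.1 p.2.2)
    & forall x, predictable F (H x)].

Definition data (w : data_space m) : n.-tuple (obs_space m) :=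
  [tuple sample m (Some (val i)) w | i < n].

Definition eval_obs (H : estimator) (j : 'I_n) (w : data_space m) : R -> R :=
  fun t => H (data w) t (sample m (Some (val j)) w).

Definition eval_new (H : estimator) (w : data_space m) : R -> R :=
  fun t => H (data w) t (sample m None w).

(* ||| W - H |||_2, where both are evaluated on the additional copy and the
   expectation is over that copy and the data. *)
Definition L2_error (W : R -> obs_space m -> R) (H : estimator) : \bar R :=
  sqrte (\int[data_law m]_w \int[lebesgue_measure]_(s in `[0%R, 1%R])
           ((W s (sample m None w) - eval_new H w s) ^+ 2)%:E)%E.

Context {K : nat} (J : 'I_K -> {set 'I_n}) (lhat Ghat : 'I_K -> estimator).

Definition gamma_check (w : data_space m) (t : R) : R :=
  K%:R^-1 * \sum_(k < K) (#|J k|%:R^-1 * \sum_(j in J k)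
    integral_dM (Nproc m (sample m (Some (val j)) w))
      (eval_obs (lhat k) j w) (eval_obs (Ghat k) j w) t).

Definition V_check (w : data_space m) (t : R) : R :=
  K%:R^-1 * \sum_(k < K) (#|J k|%:R^-1 * \sum_(j in J k)
    \int[lebesgue_stieltjes_measure (Nproc m (sample m (Some (val j)) w))]_(s in `]0, t])
      (eval_obs (Ghat k) j w s ^+ 2)).

Definition T_check (w : data_space m) : R :=
  if V_check w 1 == 0 then 0
  else Num.sqrt (n%:R / V_check w 1) *
       sup [set `|gamma_check w t| | t in `[0, 1]%classic].

Definition XLCT (z : R) (w : data_space m) : bool := z < T_check w.

End estimators.

Arguments estimator {R} m n.

Definition is_fold_partition {n K : nat} (J : 'I_K -> {set 'I_n}) : Prop :=
  forall i, exists! k, i \in J k.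

Definition standard_brownian_motion {R : realType} {d : measure_display}
    {T : measurableType d} (P : probability T R) (B : R -> T -> R) : Prop :=
  [/\ forall t, 0 <= t <= 1 -> measurable_fun [set: T] (B t),
      forall w, B 0 w = 0 /\ {within `[0, 1]%classic, continuous (B ^~ w)},
      forall s t, 0 <= s -> s < t -> t <= 1 ->
        forall A : set R, measurable A ->
          P ((fun w => B t w - B s w) @^-1` A) =
          normal_prob 0 (Num.sqrt (t - s)) A
    & forall (k : nat) (t : nat -> R), 0 <= t 0%N -> t k <= 1 ->
        {homo t : i j / (i <= j)%N >-> i <= j} ->
        mutually_independent P
          (fun (i : 'I_k) w => B (t i.+1) w - B (t i) w)].

Definition quantile {R : realType} {d : measure_display} {T : measurableType d}
    (P : probability T R) (Y : T -> R) (p : R) : R :=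
  inf [set x | (p%:E <= P [set w | Y w <= x]%R)%E].

Section uniform_convergence.
Context {R : realType}.
Local Open Scope ereal_scope.

(* Supremum of a nonnegative function, with value 0 over the empty set. *)
Definition sup_ge0 {I : Type} (A : set I) (f : I -> \bar R) : \bar R :=
  ereal_sup (0 |` (f @` A)).

Definition bounded_lipschitz (f : R -> R) : Prop :=
  (forall x, `|f x| <= 1)%R /\ (forall x y, `|f x - f y| <= `|x - y|)%R.

Definition BL_distance {d d' : measure_display} {T : measurableType d}
    {T' : measurableType d'} (P : probability T R) (Y : T -> R)
    (Q : probability T' R) (Z : T' -> R) : \bar R :=
  sup_ge0 bounded_lipschitz (fun f => `| 'E_P[f \o Y] - 'E_Q[f \o Z] |).

End uniform_convergence.

(* Submission.v *)
Require Import Defs.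
From HB Require Import structures.
From mathcomp Require Import all_boot all_order all_algebra.
From mathcomp Require Import all_classical all_reals all_analysis.
From mathcomp Require Import measurable_realfun.
From mathcomp Require Import ring lra.

(** The estimators and the intensity are truncated, which changes nothing almost
    surely. Then sqrt n times the cross-fitted process is the martingale score
    n^(-1/2) sum_j int G_j dM_j plus three remainders, small uniformly in theta by
    Doob's inequality, by the orthogonality of G to F-predictable errors, and by
    Cauchy-Schwarz with the product rate. The score is compared with Brownian
    motion on a grid equidistant for the variance clock, by Lindeberg's exchange
    on a smoothed maximum, and between grid points by Doob's inequality for fourth
    moments. Since sup |B| has no atom in (0, oo), tail probabilities converge
    uniformly, and step functions carry this over to Lipschitz test functions. *)

Set Implicit Arguments.
Unset Strict Implicit.
Unset Printing Implicit Defensive.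

Import Order.TTheory GRing.Theory Num.Theory.
Import numFieldNormedType.Exports.

Local Open Scope classical_set_scope.
Local Open Scope ring_scope.

Notation integ P X := (integrable P setT (EFin \o X)).
Notation meas X := (measurable_fun setT X).
Notation I01 R := (`[0, 1]%classic : set R).
Notation bdd H c := (forall s e, `|H s e| <= c).
Notation mcomp := measurableT_comp.
Notation mEFinP := measurable_EFinP.
Notation has_law Q P Y := (forall i A, measurable A -> Q (Y i @^-1` A) = P A).
Notation mfunM := measurable_funM.
Notation mfunD := measurable_funD.
Notation mfunB := measurable_funB.
Notation mfunX := measurable_funX.
Notation mfun_ler := measurable_fun_ler.
Notation mfun_ltr := measurable_fun_ltr.
Notation mpair := measurable_fun_pair.
Notation mcst := measurable_cst.
Notation ls_measure := lebesgue_stieltjes_measure.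
Notation sigmaT := g_sigma_algebraType.

(** Stochastic integrals are taken path by path: N has finitely many jumps, so the integral of H
    against dM is a finite sum over jump times minus a Lebesgue integral. All that is needed from
    martingale theory is then one identity, E int H dN = E int H b ds for bounded predictable H,
    which the null hypothesis supplies for the large filtration; centring, isometry and moments of
    every order of N follow from it. The bounded version b of the intensity is obtained from the
    estimators, since an L2 limit of processes bounded by C is bounded by C.

    The set of parameters carries no structure, so no compactness argument can give uniformity.
    Every estimate is therefore an inequality for fixed n, with constants that depend only on the
    bounds C and C', on K, on the lower bound of the variance and on the threshold. Dividing G by
    the square root of its variance makes one Brownian limit serve all parameters at once. The
    sample and the Brownian motion are never put on a common space: their laws are compared through
    double integrals. *)

Lemma eq_ler {R : numDomainType} (x y : R) : x = y -> x <= y.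
Proof. by move->. Qed.

Lemma norm_sum_le {R : numDomainType} (I : Type) (r : seq I) (p : pred I) (f g : I -> R) :
  (forall i, p i -> `|f i| <= g i) -> `|\sum_(i <- r | p i) f i| <= \sum_(i <- r | p i) g i.
Proof. by move=> fg; apply: le_trans (ler_norm_sum _ _ _) _; exact: ler_sum. Qed.

Lemma cvg_ler {R : realType} (u : nat -> R) (l c : R) :
  u n @[n --> \oo] --> l -> (forall n, u n <= c) -> l <= c.
Proof.
move=> ul uc; rewrite -(cvg_lim _ ul)//; apply: limr_le; first by apply/cvg_ex; eexists; exact: ul.
exact: nearW.
Qed.

(** * Expectations of real random variables *)

Section expectation.
Context {d} {T : measurableType d} {R : realType} (P : probability T R).
Implicit Types (X Y : T -> R).

Lemma integ_le X Y : meas X -> integ P Y -> (forall w, `|X w| <= Y w) -> integ P X.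
Proof.
move=> mX iY XY; apply: (le_integrable _ _ _ iY) => //; first exact/mEFinP.
by move=> w _; rewrite /= lee_fin (le_trans (XY w))// ler_norm.
Qed.

Lemma integ_cst (c : R) : integ P (fun=> c).
Proof. exact: (finite_measure_integrable_cst P c measurableT). Qed.

Lemma integ_bnd X (c : R) : meas X -> (forall w, `|X w| <= c) -> integ P X.
Proof. by move=> mX; exact: (integ_le mX (integ_cst c)). Qed.

Lemma integ_meas X : integ P X -> meas X.
Proof. by move=> /integrableP[/mEFinP]. Qed.

Lemma integD X Y : integ P X -> integ P Y -> integ P (fun w => X w + Y w).
Proof. by move=> iX iY; have := integrableD measurableT iX iY. Qed.

Lemma integB X Y : integ P X -> integ P Y -> integ P (fun w => X w - Y w).
Proof. by move=> iX iY; have := integrableB measurableT iX iY. Qed.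

Lemma integZ c X : integ P X -> integ P (fun w => c * X w).
Proof. by move=> iX; have := integrableZl measurableT c iX. Qed.

Lemma integ_sum (I : Type) (s : seq I) (p : pred I) (X : I -> T -> R) :
  (forall i, integ P (X i)) -> integ P (fun w => \sum_(i <- s | p i) X i w).
Proof.
move=> iX; have := @integrable_sum _ _ _ P setT measurableT _ s p
  (fun i => EFin \o X i) (fun i _ => iX i).
by apply: eq_integrable => // w _ /=; rewrite sumEFin.
Qed.

Lemma integ_abs X : integ P X -> integ P (fun w => `|X w|).
Proof. by move=> /integrable_norm. Qed.

Lemma integMb X Y (c : R) : meas X -> (forall w, `|X w| <= c) -> integ P Y ->
  integ P (fun w => X w * Y w).
Proof.
move=> mX bX iY; apply: (@integ_le _ (fun w => c * `|Y w|)).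
- by apply: mfunM => //; exact: integ_meas iY.
- exact/integZ/integ_abs.
- by move=> w; rewrite normrM ler_wpM2r.
Qed.

Lemma ExD X Y : integ P X -> integ P Y ->
  \int[P]_w (X w + Y w) = \int[P]_w X w + \int[P]_w Y w.
Proof. exact: RintegralD. Qed.

Lemma ExB X Y : integ P X -> integ P Y ->
  \int[P]_w (X w - Y w) = \int[P]_w X w - \int[P]_w Y w.
Proof. exact: RintegralB. Qed.

Lemma ExZ c X : integ P X -> \int[P]_w (c * X w) = c * \int[P]_w X w.
Proof. exact: RintegralZl. Qed.

Lemma EFin_Ex X : integ P X -> (\int[P]_w X w)%:E = (\int[P]_w (X w)%:E)%E.
Proof. by move=> iX; rewrite /Rintegral fineK//; exact: integrable_fin_num iX. Qed.

Lemma Ex_sum (I : Type) (s : seq I) (p : pred I) (X : I -> T -> R) :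
  (forall i, integ P (X i)) ->
  \int[P]_w (\sum_(i <- s | p i) X i w) = \sum_(i <- s | p i) \int[P]_w X i w.
Proof.
move=> iX; apply: EFin_inj; rewrite EFin_Ex; last exact: integ_sum.
rewrite -sumEFin; under [RHS]eq_bigr do rewrite EFin_Ex//.
rewrite -(integral_sum measurableT iX).
by apply: eq_integral => w _; rewrite sumEFin.
Qed.

Lemma Ex_cst (c : R) : \int[P]_w c = c.
Proof. by rewrite Rintegral_cst//= (probability_setT P) mulr1. Qed.

Lemma le_Ex X Y : integ P X -> integ P Y -> (forall w, X w <= Y w) ->
  \int[P]_w X w <= \int[P]_w Y w.
Proof. by move=> iX iY XY; apply: le_Rintegral. Qed.

Lemma ge0_Ex X : (forall w, 0 <= X w) -> 0 <= \int[P]_w X w.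
Proof. by move=> X0; apply: Rintegral_ge0. Qed.

Lemma abs_Ex X : integ P X -> `|\int[P]_w X w| <= \int[P]_w `|X w|.
Proof. by move=> iX; exact: le_normr_Rintegral. Qed.

Lemma eq_Ex X Y : X =1 Y -> \int[P]_w X w = \int[P]_w Y w.
Proof. by move=> XY; apply: eq_Rintegral => w _; exact: XY. Qed.

Lemma Ex_le_cst X (c : R) : integ P X -> (forall w, X w <= c) -> \int[P]_w X w <= c.
Proof.
by move=> iX Xc; rewrite -[leRHS]Ex_cst; apply: le_Ex => //; exact: integ_cst.
Qed.

Lemma abs_Ex_le X (c : R) : meas X -> (forall w, `|X w| <= c) -> `|\int[P]_w X w| <= c.
Proof.
move=> mX Xc; have iX := integ_bnd mX Xc.
by apply: (le_trans (abs_Ex iX)); apply: Ex_le_cst => //; exact: integ_abs.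
Qed.

Lemma Ex_dct (X : nat -> T -> R) Y Z : (forall n, meas (X n)) -> integ P Y ->
  (forall n w, `|X n w| <= Y w) -> (forall w, X n w @[n --> \oo] --> Z w) ->
  integ P Z /\ \int[P]_w X n w @[n --> \oo] --> \int[P]_w Z w.
Proof.
move=> mX iY XY XZ.
have mZ : meas Z by apply: (measurable_fun_cvg mX) => w _; exact: XZ.
have [iZ c] : integ P Z /\ ((\int[P]_w (X n w)%:E)%E @[n --> \oo] -->
    (\int[P]_w (Z w)%:E)%E).
  suff [? _ ?] : [/\ integ P Z, True & (\int[P]_w (X n w)%:E)%E @[n --> \oo] -->
    (\int[P]_w (Z w)%:E)%E] by [].
  have [//||||? _ ?] := (@dominated_convergence _ _ _ P setT measurableT
    (fun n w => (X n w)%:E) (EFin \o Z) (EFin \o Y) _ _ _ iY); last by split.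
  - by move=> n; exact/mEFinP.
  - exact/mEFinP.
  - by apply: aeW => w _; apply: cvg_EFin; [exact: nearW|exact: XZ].
  - by apply: aeW => w n _; rewrite lee_fin.
split => //; apply: fine_cvg; rewrite fineK//; exact: integrable_fin_num iZ.
Qed.

Lemma Ex_indic A : measurable A -> \int[P]_w (\1_A w) = fine (P A).
Proof.
move=> mA; rewrite /Rintegral; congr fine.
by have := integral_indic P measurableT mA; rewrite setIT.
Qed.

Lemma integ_indic A : measurable A -> integ P (\1_A : T -> R).
Proof.
move=> mA; apply: (@integ_bnd _ 1) => [|w]; first exact: measurable_indic.
by rewrite indicE; case: (w \in A); rewrite ?normr1 ?normr0.
Qed.

Lemma Ex_markov X A (a : R) : integ P X -> measurable A -> (forall w, 0 <= X w) ->
  (forall w, A w -> a <= X w) -> a * fine (P A) <= \int[P]_w X w.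
Proof.
move=> iX mA X0 AX; rewrite -Ex_indic// -ExZ; last exact: integ_indic.
apply: le_Ex => //; first exact/integZ/integ_indic.
move=> w; rewrite indicE; case: (boolP (w \in A)) => [/set_mem/AX|_].
  by rewrite mulr1.
by rewrite mulr0.
Qed.

Lemma Ex_eq0_ae X : integ P X -> (forall w, 0 <= X w) -> \int[P]_w X w = 0 ->
  {ae P, forall w, X w = 0}.
Proof.
move=> iX X0 E0.
have : (\int[P]_w `|(X w)%:E|)%E = 0%E.
  under eq_integral do rewrite gee0_abs ?lee_fin//.
  by rewrite -EFin_Ex// E0.
move=> /(@ae_eq_integral_abs _ _ _ P _ measurableT (EFin \o X)).
by move=> /(_ (measurable_int _ iX)); apply: filterS => w /(_ Logic.I) [].
Qed.

End expectation.

(** The real integral is [fine] of the difference of two Tonelli integrals, each measurable in x,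
    and [fine] is measurable; points x where the integral is infinite or undefined get a default
    value and do no harm. *)
Lemma meas_Ex {d1 d2} {T1 : measurableType d1} {T2 : measurableType d2}
    {R : realType} (P : probability T2 R) (F : T1 * T2 -> R) :
  meas F -> meas (fun x => \int[P]_y F (x, y)).
Proof.
move=> mF; have mE : meas (EFin \o F) by exact/mEFinP.
have -> : (fun x => \int[P]_y F (x, y)) = fine \o (fun x =>
    \int[P]_y ((EFin \o F)^\+ (x, y)) - \int[P]_y ((EFin \o F)^\- (x, y)))%E.
  by apply/funext => x; apply: (congr1 fine); rewrite integralE; congr (_ - _)%E; apply: eq_integral => y _; rewrite ?funeposE ?funenegE.
apply: mcomp => //; apply: emeasurable_funB.
- by apply: (measurable_fun_fubini_tonelli_F ((EFin \o F)^\+)%E) => //; exact: measurable_funepos.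
- by apply: (measurable_fun_fubini_tonelli_F ((EFin \o F)^\-)%E) => //; exact: measurable_funeneg.
Qed.

(** * Fubini's theorem under a bound that depends on one variable *)

Section fubini.
Context {d1 d2} {T1 : measurableType d1} {T2 : measurableType d2} {R : realType}.
Context (P1 : probability T1 R) (P2 : probability T2 R).

Lemma integ_prod (F : T1 * T2 -> R) (Y : T1 -> R) : meas F -> integ P1 Y ->
  (forall x y, `|F (x, y)| <= Y x) -> (P1 \x P2)%E.-integrable setT (EFin \o F).
Proof.
move=> mF iY FY; have mF' : meas (EFin \o F) by exact/mEFinP.
apply/(@integrable12ltyP _ _ _ _ _ P1 P2 _ mF').
have /integrableP[_ lt] := iY; apply: le_lt_trans lt.
apply: ge0_le_integral => //.
- by move=> x _; exact: integral_ge0.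
- apply: (measurable_fun_fubini_tonelli_F (abse \o (EFin \o F))); last by move=> ?; exact: abse_ge0.
  exact: mcomp.
- by apply: (@mcomp _ _ _ _ _ _ abse) => //; exact: measurable_int iY.
move=> x _; rewrite /=; apply: (@le_trans _ _ (\int[P2]_y `|Y x|%:E)%E).
  apply: ge0_le_integral => //; last by move=> y _; rewrite lee_fin (le_trans (FY _ _))// ler_norm.
  by apply/mEFinP/mcomp => //; exact: mcomp mF (measurable_pair1 x).
by rewrite integral_cst//= (probability_setT P2) mule1.
Qed.

Lemma fubini_dom (F : T1 * T2 -> R) (Y : T1 -> R) : meas F -> integ P1 Y ->
  (forall x y, `|F (x, y)| <= Y x) ->
  [/\ integ P1 (fun x => \int[P2]_y F (x, y)),
      integ P2 (fun y => \int[P1]_x F (x, y))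
    & \int[P1]_x \int[P2]_y F (x, y) = \int[P2]_y \int[P1]_x F (x, y)].
Proof.
move=> mF iY FY; have iF := integ_prod mF iY FY.
have m1 x : meas (fun y => F (x, y)) by apply: mcomp mF (measurable_pair1 x).
have m2 y : meas (fun x => F (x, y)) by apply: mcomp mF (measurable_pair2 y).
have i1 x : integ P2 (fun y => F (x, y)) by apply: (integ_bnd P2 (m1 x) (c := Y x)) => y; exact: FY.
have i2 y : integ P1 (fun x => F (x, y)) by apply: (integ_le (m2 y) iY) => x; exact: FY.
have e1 : fubini_F P2 (EFin \o F) = EFin \o (fun x => \int[P2]_y F (x, y)).
  by apply/funext => x; rewrite /= EFin_Ex.
have e2 : fubini_G P1 (EFin \o F) = EFin \o (fun y => \int[P1]_x F (x, y)).
  by apply/funext => y; rewrite /= EFin_Ex.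
have I1 : integ P1 (fun x => \int[P2]_y F (x, y)).
  by rewrite -e1; exact: integrable_fubini_F iF.
have I2 : integ P2 (fun y => \int[P1]_x F (x, y)).
  apply: (@integ_bnd _ _ _ P2 _ (\int[P1]_x Y x)) => [|y].
    by apply: (@meas_Ex _ _ _ _ _ P1 (F \o unstable.swap)); exact: mcomp mF (@measurable_swap _ _ T2 T1).
  by apply: (le_trans (abs_Ex (i2 y))); apply: le_Ex => //; exact: integ_abs.
split => //; apply: EFin_inj; rewrite !EFin_Ex//.
have := integral12_prod_meas1 iF; have := integral21_prod_meas1 iF.
by rewrite e1 e2 /= => -> ->.
Qed.

Lemma fubini_bnd (F : T1 * T2 -> R) (c : R) : meas F -> (forall x y, `|F (x, y)| <= c) ->
  [/\ integ P1 (fun x => \int[P2]_y F (x, y)),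
      integ P2 (fun y => \int[P1]_x F (x, y))
    & \int[P1]_x \int[P2]_y F (x, y) = \int[P2]_y \int[P1]_x F (x, y)].
Proof. by move=> mF Fc; apply: (fubini_dom mF (integ_cst P1 c)). Qed.

End fubini.

(** * Counting paths: jump times and the Stieltjes measure *)

Definition njump {R : realType} (f : R -> R) : nat := Num.truncn (f 1).

(* The value 2 encodes a jump that does not occur in [0, 1]. *)
Definition jtime {R : realType} (f : R -> R) (i : nat) : R :=
  if (i < njump f)%N then inf [set t | 0 <= t <= 1 /\ i.+1%:R <= f t] else 2.

Section counting_path.
Context {R : realType} (f : cumulative R R).
Hypothesis cf : counting_path f.

Let f_homo : {homo f : x y / x <= y}.
Proof. exact: cumulative_is_nondecreasing. Qed.

Lemma njumpE : f 1 = (njump f)%:R.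
Proof.
case: cf => _ /(_ 1) [|n fn _]; first by rewrite ler01 lexx.
by rewrite /njump fn natrK.
Qed.

Lemma counting_path_nat t : 0 <= t <= 1 -> exists2 n, f t = n%:R & (n <= njump f)%N.
Proof.
move=> t01; case: cf => _ /(_ t t01) [n fn] _; exists n => //.
by rewrite -(ler_nat R) -fn -njumpE f_homo//; case/andP: t01.
Qed.

(** Right continuity makes the infimum attained. This equivalence is all that is used later about
    the infimum, and the default 2 respects it because a path on [0, 1] never exceeds [njump f]. *)
Lemma jtime_le t i : 0 <= t <= 1 -> (jtime f i <= t) = (i.+1%:R <= f t).
Proof.
move=> t01; have [n fn nN] := counting_path_nat t01.
rewrite /jtime; case: ltnP => [iN|Ni]; last first.
  rewrite fn ler_nat ltnNge (leq_trans nN Ni)/= leNgt.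
  by case/andP: t01 => _ t1; rewrite (le_lt_trans t1) ?ltr1n.
set S := [set s | _].
have S1 : S 1 by split; [rewrite ler01 lexx|rewrite njumpE ler_nat].
have lS : has_lbound S by exists 0 => s [/andP[]].
have hS : has_inf S by split => //; exists 1.
apply/idP/idP => [it|ft]; last by apply: (ge_inf lS); split.
apply: le_trans (f_homo it).
rewrite leNgt; apply/negP => lt.
have e0 : 0 < (i.+1%:R - f (inf S)) / 2 by rewrite divr_gt0// subr_gt0.
have [e fe] := nondecreasing_right_continuousP (inf S) f e0.
have [s Ss se] := inf_adherent [elaborate gt0 e] hS.
have /le_lt_trans/(_ lt) : i.+1%:R <= f (inf S); last by rewrite ltxx.
have := le_trans (le_trans Ss.2 (f_homo (ltW se))) fe.
lra.
Qed.

Lemma jtime_gt0 i : 0 < jtime f i.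
Proof.
rewrite ltNge jtime_le ?lexx ?ler01//; case: cf => -> _ _.
by rewrite -ltNge ltr0Sn.
Qed.

Lemma jtime_le1 i : (jtime f i <= 1) = (i < njump f)%N.
Proof. by rewrite jtime_le ?lexx ?ler01// njumpE ler_nat. Qed.

Lemma counting_path_sum t : 0 <= t <= 1 ->
  f t = \sum_(i < njump f) (jtime f i <= t)%R%:R.
Proof.
move=> t01; have [n fn nN] := counting_path_nat t01.
under eq_bigr do rewrite jtime_le// fn ler_nat.
rewrite fn -natr_sum; congr _%:R.
rewrite -(subnKC nN) big_split_ord/= [X in (X + _)%N](eq_bigr (fun=> 1%N)) => [|i _]; last by rewrite ltn_ord.
by rewrite sum1_card card_ord big1 ?addn0// => i _; rewrite ltnNge leq_addr.
Qed.

(** If two consecutive jump times met at t, the path would stay at most i before t and be at least i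
    + 2 at t, a jump larger than 1. *)
Lemma jtime_ltS i : (i.+1 < njump f)%N -> jtime f i < jtime f i.+1.
Proof.
move=> iN; set t := jtime f i.+1.
have t0 : 0 < t by exact: jtime_gt0.
have t1 : t <= 1 by rewrite jtime_le1.
have t01 : 0 <= t <= 1 by rewrite ltW.
have ft : i.+2%:R <= f t by rewrite -jtime_le.
rewrite ltNge; apply/negP => tle.
case: cf => _ _ /(_ t); rewrite t0 t1 => /(_ isT); apply/negP; rewrite -ltNge.
have cv : cvg (f s @[s --> t^'-]).
  apply: nondecreasing_at_left_is_cvgr; first by near=> x => y z _ _; exact: f_homo.
  near=> x; exists (f t) => _ /= [s /[!in_itv]/= /andP[_ /ltW st] <-]; exact: f_homo.
have le : lim (f s @[s --> t^'-]) <= i%:R.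
  apply: limr_le => //; near=> s.
  have st : s < t by near: s; exact: nbhs_left_lt.
  have s0 : 0 < s by near: s; exact: nbhs_left_gt.
  have s01 : 0 <= s <= 1 by rewrite (ltW s0) (le_trans (ltW st)).
  have := lt_le_trans st tle; rewrite ltNge jtime_le// -ltNge.
  by have [n -> _] := counting_path_nat s01; rewrite ltr_nat ltnS ler_nat.
by rewrite -!natr1 in ft; lra.
Unshelve. all: by end_near. Qed.

Lemma jtime_lt i j : (i < j)%N -> (j < njump f)%N -> jtime f i < jtime f j.
Proof.
elim: j => // j IH; rewrite ltnS leq_eqVlt => /orP[/eqP ->|ij] jN; first exact: jtime_ltS.
exact: lt_trans (IH ij (ltn_trans (ltnSn j) jN)) (jtime_ltS jN).
Qed.

Lemma lebesgue_stieltjes_itv a b : a <= b ->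
  ls_measure f `]a, b] = (f b - f a)%:E.
Proof.
move=> ab; rewrite /ls_measure /measure_extension measurable_mu_extE/=; last exact: is_ocitv.
by rewrite wlength_itv_bnd.
Qed.

Let D : set R := `]0, 1]%classic.
Let mD : measurable D. Proof. exact: measurable_itv. Qed.
Let mDc : measurable (~` D). Proof. exact: measurableC. Qed.

(** The measure built here must agree with the Stieltjes measure on all half-open intervals, also
    those leaving ]0, 1]. Index 0 therefore copies the Stieltjes measure outside ]0, 1], and the
    later indices put a unit mass at each jump. *)
Let jump_part (i : nat) : {measure set (measurableTypeR R) -> \bar R} :=
  if i is i'.+1 then [the measure (measurableTypeR R) R of \d_(jtime f i' : measurableTypeR R)]
  else [the measure (measurableTypeR R) R of mrestr (ls_measure f) mDc].

Lemma lebesgue_stieltjes_jumps A : measurable A -> A `<=` D ->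
  ls_measure f A = (\sum_(i < njump f) \d_(jtime f i) A)%E.
Proof.
move=> mA AD.
pose mu : {measure set (measurableTypeR R) -> \bar R} := [the measure (measurableTypeR R) R of msum jump_part (njump f).+1].
have muE B : mu B = (ls_measure f (B `&` ~` D) + \sum_(i < njump f) \d_(jtime f i) B)%E.
  by rewrite /mu /= /msum big_ord_recl.
rewrite (@lebesgue_stieltjes_measure_unique _ f mu) ?muE//.
  have -> : A `&` ~` D = set0 by rewrite -subset0 => x [/AD].
  by rewrite measure0 add0e.
move=> _ [[a b] _ <-]; rewrite muE [fst _]/= [snd _]/=.
have mI : measurable (`]a, b]%classic : set (measurableTypeR R)) by exact: measurable_itv.
rewrite (measureDI (ls_measure f) mI mD) setDE.
congr (_ + _)%E; under eq_bigr do rewrite diracE.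
rewrite sumEFin.
have [ab|ba] := ltP (Num.max a 0) (Num.min b 1).
  have -> : `]a, b]%classic `&` D = `]Num.max a 0, Num.min b 1]%classic.
    apply/seteqP; split => x; rewrite /D /= !in_itv/= gt_max le_min.
      by move=> [/andP[-> ->] /andP[-> ->]].
    by move=> /andP[/andP[-> ->] /andP[-> ->]].
  have a0 : 0 <= Num.max a 0 by rewrite le_max lexx orbT.
  have b1 : Num.min b 1 <= 1 by rewrite ge_min lexx orbT.
  transitivity (f (Num.min b 1) - f (Num.max a 0))%:E; first exact: lebesgue_stieltjes_itv (ltW ab).
  congr EFin.
  rewrite !counting_path_sum ?(le_trans a0 (ltW ab))// ?a0 ?(le_trans (ltW ab) b1)//.
  rewrite -sumrB; apply: eq_bigr => i _.
  have i0 := jtime_gt0 i; have i1 : jtime f i <= 1 by rewrite jtime_le1.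
  rewrite mem_setE/= in_itv/= le_min i1 andbT le_max (leNgt _ 0) i0 orbF.
  have ab' : a < b by rewrite (le_lt_trans _ (lt_le_trans ab _)) ?le_max ?lexx// ge_min lexx.
  case: (ltP a) => ai /=; first by rewrite subr0.
  by rewrite (le_trans ai (ltW ab')) subrr.
have -> : `]a, b]%classic `&` D = set0.
  rewrite -subset0 => x []; rewrite /D /= !in_itv/= => /andP[ax xb] /andP[x0 x1].
  by have := lt_le_trans (_ : Num.max a 0 < x) (_ : x <= Num.min b 1);
    rewrite gt_max le_min ax xb x0 x1 => /(_ isT isT); rewrite ltNge ba.
rewrite measure0 big1// => i _.
have i0 := jtime_gt0 i; have i1 : jtime f i <= 1 by rewrite jtime_le1.
rewrite mem_setE/= in_itv/=; case: (ltP a) => //= ai; case: leP => //= ib.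
have := lt_le_trans (_ : Num.max a 0 < jtime f i) (_ : jtime f i <= Num.min b 1).
by rewrite gt_max le_min ai i0 ib i1 => /(_ isT isT); rewrite ltNge ba.
Qed.

Lemma ge0_integral_stieltjes (g : R -> R) (t : R) : 0 <= t <= 1 ->
  measurable_fun (I01 R) g -> (forall s, 0 <= g s) ->
  (\int[ls_measure f]_(s in `]0%R, t]) (g s)%:E)%E =
  (\sum_(i < njump f) (jtime f i <= t)%R%:R * g (jtime f i))%:E.
Proof.
move=> /andP[t0 t1] mg g0.
pose nu : {measure set (measurableTypeR R) -> \bar R} :=
  [the measure (measurableTypeR R) R of msum (fun i => [the measure (measurableTypeR R) R of \d_(jtime f i : measurableTypeR R)]) (njump f)].
have mT : measurable (`]0%R, t]%classic : set R) by exact: measurable_itv.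
have mg' : measurable_fun (`]0, t]%classic : set R) (EFin \o g).
  apply/mEFinP; apply: measurable_funS mg => //.
  by apply: subset_itv; rewrite bnd_simp.
rewrite (@eq_measure_integral _ _ _ _ nu); last first.
  move=> A mA AT; apply: lebesgue_stieltjes_jumps => //.
  by apply: subset_trans AT _; apply: subset_itv; rewrite bnd_simp.
rewrite ge0_integral_measure_sum//; last by move=> x _; rewrite lee_fin.
rewrite -sumEFin; apply: eq_bigr => i _.
rewrite integral_dirac// diracE EFinM mem_setE/= in_itv/=.
by rewrite jtime_gt0.
Qed.

Lemma Rintegral_stieltjes (g : R -> R) (t : R) : 0 <= t <= 1 ->
  measurable_fun (I01 R) g ->
  \int[ls_measure f]_(s in `]0, t]) g s =
  \sum_(i < njump f) (jtime f i <= t)%R%:R * g (jtime f i).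
Proof.
move=> t01 mg; rewrite /Rintegral integralE.
have -> : (EFin \o g)^\+%E = EFin \o (fun s => Num.max (g s) 0).
  by apply/funext => s; rewrite funeposE/= -EFin_max.
have -> : (EFin \o g)^\-%E = EFin \o (fun s => Num.max (- g s) 0).
  by apply/funext => s; rewrite funenegE/= -EFin_max.
rewrite !ge0_integral_stieltjes//.
- rewrite /= -sumrB; apply: eq_bigr => i _; rewrite -mulrBr; congr (_ * _).
  by case: (leP (g (jtime f i)) 0) => gi; case: leP => gi'; lra.
- exact: measurable_maxr (measurable_funN mg) (mcst _).
- by move=> s; rewrite le_max lexx orbT.
- exact: measurable_maxr mg (mcst _).
- by move=> s; rewrite le_max lexx orbT.
Qed.

End counting_path.

(** * Time integrals as expectations under the uniform law on [0, 1] *)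

Definition leb01 {R : realType} := uniform_prob (@ltr01 R).

Section leb01.
Context {R : realType}.

HB.instance Definition _ := Probability.on (@leb01 R).

Lemma ge0_integral_leb01 (f : R -> R) : meas f -> (forall s, 0 <= f s) ->
  (\int[lebesgue_measure]_(s in `[0%R, 1%R]) (f s)%:E)%E = (\int[@leb01 R]_s (f s)%:E)%E.
Proof.
move=> mf f0; rewrite integral_uniform//; last exact/mEFinP.
by rewrite subr0 invr1 mul1e.
Qed.

Lemma Rintegral_leb01 (f : R -> R) : meas f ->
  \int[lebesgue_measure]_(s in `[0, 1]) f s = \int[@leb01 R]_s f s.
Proof.
move=> mg; rewrite /Rintegral integralE [in RHS]integralE.
have -> : (EFin \o f)^\+%E = EFin \o (fun s => Num.max (f s) 0).
  by apply/funext => s; rewrite funeposE/= -EFin_max.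
have -> : (EFin \o f)^\-%E = EFin \o (fun s => Num.max (- f s) 0).
  by apply/funext => s; rewrite funenegE/= -EFin_max.
rewrite !ge0_integral_leb01//.
- exact: measurable_maxr (measurable_funN mg) (mcst _).
- by move=> s; rewrite le_max lexx orbT.
- exact: measurable_maxr mg (mcst _).
- by move=> s; rewrite le_max lexx orbT.
Qed.

End leb01.

(** * Filtrations and the predictable sigma-algebra *)

Lemma fil_sigma {d} {T : measurableType d} {R : realType} (F : R -> set_system T) :
  filtration F -> forall t, 0 <= t <= 1 -> sigma_algebra setT (F t).
Proof. by case. Qed.

Lemma fil_sub {d} {T : measurableType d} {R : realType} (F : R -> set_system T) :
  filtration F -> forall t, 0 <= t <= 1 -> F t `<=` measurable.
Proof. by case. Qed.

Lemma sigmaT_id {T : pointedType} (G : set_system T) : sigma_algebra setT G ->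
  (measurable : set_system (sigmaT G)) = G.
Proof. exact: sigma_algebra_id. Qed.

Notation pred_indic b := (b%R%:R) (only parsing).

Lemma mb2r {d} {T : measurableType d} {R : realType} (f : T -> bool) :
  meas f -> meas (fun x => (f x)%:R : R).
Proof. by move=> mf; apply: (mcomp (f := fun b : bool => b%:R : R)). Qed.

Lemma meas_ray {d} {T : measurableType d} {R : realType} (X : T -> R) :
  (forall x, measurable [set w | X w <= x]) -> meas X.
Proof.
move=> h; apply: (measurability _ (RGenOInfty.measurableE R)).
move=> _ [_ [x ->] <-]; rewrite setTI.
have -> : X @^-1` `]x, +oo[ = ~` [set w | X w <= x].
  by apply/seteqP; split => w /=; rewrite in_itv/= andbT ltNge => /negP.
exact: measurableC.
Qed.

Lemma meas_wrtP {T : pointedType} {R : realType} (S : set_system T) (X : T -> R) :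
  sigma_algebra setT S ->
  (forall B, measurable B -> S (X @^-1` B)) <-> meas (X : sigmaT S -> R).
Proof.
move=> sS; have SE : (measurable : set_system (sigmaT S)) = S.
  exact: (@sigma_algebra_id _ setT).
split => [h _ B mB|h B mB]; first by rewrite setTI SE; exact: h.
by rewrite -SE -[X in measurable X]setTI; exact: h.
Qed.

Section predictable.
Context {R : realType} {d} {E : measurableType d} (F : R -> set_system E).
Hypothesis fF : filtration F.

Let D : set (R * E) := `[0, 1]%classic `*` [set: E].

Let Fs := fil_sigma fF.

Let FT t : 0 <= t <= 1 -> F t setT.
Proof. by move=> /Fs[F0 FC _]; rewrite -[setT](setD0); exact: FC. Qed.

Let Fm := fil_sub fF.

Let Fmono s t : 0 <= s -> s <= t -> t <= 1 -> F s `<=` F t.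
Proof. by case: fF => _ _; exact. Qed.

(** The sets whose trace on [0, 1] x E is predictable. They form a sigma-algebra on the whole of
    [R * E], so predictability becomes plain measurability from the type [sigmaT pset]. *)
Definition pset : set_system (R * E) :=
  [set Q | <<s D, predictable_rectangle F >> (D `&` Q)].

Lemma sigma_algebra_pset : sigma_algebra setT pset.
Proof.
have [s0 sC sU] := smallest_sigma_algebra D (predictable_rectangle F).
split; first by rewrite /pset/= setI0.
- move=> A pA; rewrite /pset/= setTD.
  have -> : D `&` ~` A = D `\` (D `&` A) by rewrite setDIr setDv set0U.
  exact: sC.
- by move=> A pA; rewrite /pset/= setI_bigcupr; exact: sU.
Qed.

Notation pT := (sigmaT pset).

Lemma psetE : (measurable : set_system pT) = pset.
Proof. exact: (sigma_algebra_id sigma_algebra_pset). Qed.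

Lemma predictableP (H : R -> E -> R) :
  predictable F H <-> meas ((fun p => H p.1 p.2) : pT -> R).
Proof. by rewrite -meas_wrtP; [split|exact: sigma_algebra_pset]. Qed.

Lemma pset_rectangle s t A : 0 <= s -> s < t -> t <= 1 -> F s A ->
  pset (`]s, t]%classic `*` A).
Proof.
move=> s0 st t1 FA; rewrite /pset/= setIidr.
  by apply: sub_sigma_algebra; right; exists s, t, A.
move=> [u e] [/=]; rewrite !in_itv/= => /andP[su ut] _; split => //=.
by rewrite in_itv/= (le_trans s0 (ltW su)) (le_trans ut).
Qed.

Lemma pset_rectangle0 A : F 0 A -> pset ([set 0] `*` A).
Proof.
move=> FA; rewrite /pset/= setIidr; first by apply: sub_sigma_algebra; left; exists A.
by move=> [u e] [/= -> _]; split => //=; rewrite in_itv/= lexx ler01.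
Qed.

Lemma eq_pset Q Q' : (forall u e, 0 <= u <= 1 -> Q (u, e) <-> Q' (u, e)) ->
  pset Q -> pset Q'.
Proof.
move=> QQ'; rewrite /pset/=; suff -> : D `&` Q' = D `&` Q by [].
by apply/seteqP; split => -[u e] [Du]; split => //; apply/QQ' => //; case: Du; rewrite /= in_itv.
Qed.

Lemma psetU Q Q' : pset Q -> pset Q' -> pset (Q `|` Q').
Proof. by rewrite -psetE => ? ?; exact: measurableU. Qed.

Lemma pset_setT : pset setT.
Proof. by rewrite -psetE; exact: measurableT. Qed.

Lemma pset_set0 : pset set0.
Proof. by rewrite -psetE; exact: measurable0. Qed.

Let h0 : 0 <= (0 : R) <= 1. Proof. by rewrite lexx ler01. Qed.

Lemma meas_time : meas (fst : pT -> R).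
Proof.
apply: meas_ray => x; rewrite psetE.
have [x0|x0] := ltP x 0.
  apply: eq_pset pset_set0 => u e /andP[u0 _]; split => //= ux.
  by have := le_lt_trans (le_trans u0 ux) x0; rewrite ltxx.
have [x1|x1] := leP 1 x.
  by apply: eq_pset pset_setT => u e /andP[_ u1]; split => //= _; exact: le_trans u1 x1.
have p1 := pset_rectangle0 (FT h0).
have [x0'|x0'] := ltP 0 x; last first.
  apply: eq_pset p1 => u e /andP[u0 _] /=; split => [[-> _]//|ux].
  by split => //; apply/eqP; rewrite eq_le u0 (le_trans ux).
apply: eq_pset (psetU p1 (pset_rectangle (lexx 0) x0' (ltW x1) (FT h0))) => u e /andP[u0 _] /=.
rewrite in_itv/=; split => [[[-> _]//|[/andP[_ ->]]//]|ux].
have [u0'|u0'] := leP u 0; last by right; rewrite ux.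
by left; split => //; apply/eqP; rewrite eq_le u0' u0.
Qed.

Lemma predictable_det (f : R -> R) : meas f -> predictable F (fun u _ => f u).
Proof. by move=> mf; apply/predictableP; exact: mcomp mf meas_time. Qed.

Lemma predictable_step s t (X : E -> R) : 0 <= s -> s < t -> t <= 1 ->
  measurable_wrt (F s) X -> predictable F (fun u e => pred_indic (s < u <= t) * X e).
Proof.
move=> s0 st t1 mX.
suff h B : measurable B -> pset [set p | B (pred_indic (s < p.1 <= t) * X p.2)] by [].
move=> mB; have [B0|B0] := pselect (B (0 : R)); last first.
  apply: eq_pset (pset_rectangle s0 st t1 (mX _ mB)) => u e _ /=.
  rewrite in_itv/=; case: (_ < u <= _); rewrite ?mul1r ?mul0r; split => //; first by case.
  by case.
have := pset_rectangle s0 st t1 (mX _ (measurableC mB)).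
move=> /(fun h => let: And3 _ hC _ := sigma_algebra_pset in hC _ h).
apply: eq_pset => u e _ /=; rewrite in_itv/=.
case: (_ < u <= _); rewrite ?mul1r ?mul0r; split => //.
  by move=> [_ h]; apply: contrapT => nB; apply: h; split.
- by move=> BX; split => // -[].
- by move=> _; split => // -[].
Qed.

Lemma sub_left_limit t : 0 <= t <= 1 -> left_limit F t `<=` F t.
Proof.
move=> /andP[t0 t1]; rewrite /left_limit; case: eqP => [->//|_].
apply: smallest_sub; first by apply: Fs; rewrite t0.
by move=> A [s /andP[s0 st]]; apply: Fmono => //; exact: ltW.
Qed.

Lemma sigma_algebra_left_limit t : 0 <= t <= 1 -> sigma_algebra setT (left_limit F t).
Proof.
by move=> t01; rewrite /left_limit; case: eqP => [t0|_]; [exact: Fs|exact: smallest_sigma_algebra].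
Qed.

(** For a rectangle ]a, c] x A the section at s is A only if a < s, and then A belongs to F_{s-}.
    The residual property conditions on F_{s-}, so membership in F_s would be too weak. *)
Lemma pset_section Q s : 0 <= s <= 1 -> pset Q -> left_limit F s [set e | Q (s, e)].
Proof.
move=> s01; have Ds e : D (s, e) by split => //=; rewrite in_itv.
suff : <<s D, predictable_rectangle F >> `<=` [set Q | left_limit F s [set e | Q (s, e)]].
  move=> h /h /=; congr (left_limit _ _ _); apply/seteqP; split => e; [by case|by split].
have [S0 SC SU] := sigma_algebra_left_limit s01.
apply: smallest_sub; first split => //.
- move=> A /SC /=; rewrite setTD; congr (left_limit _ _ _).
  by apply/seteqP; split => e /=; [split|case].
- by move=> A SA /=; have := SU _ SA; congr (left_limit _ _ _).
have ST : left_limit F s setT by rewrite -[setT](setD0); exact: SC.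
move=> Q' /= [[A FA ->]|[a [c [A [a0 ac c1 FA ->]]]]] /=.
  have [s0|s0] := eqVneq s 0; last first.
    rewrite (_ : [set e | _] = set0)//; apply/seteqP; split => e //= -[/eqP].
    by rewrite (negbTE s0).
  rewrite (_ : [set e | _] = A) ?s0 ?/left_limit ?eqxx//.
  by apply/seteqP; split => e //= [].
rewrite in_itv/=; have [/andP[as_ sc]|ns] := boolP (a < s <= c); last first.
  by rewrite (_ : [set e | _] = set0)//; apply/seteqP; split => e //= -[].
rewrite (_ : [set e | _] = A); last by apply/seteqP; split => e //= [].
rewrite /left_limit gt_eqF ?(le_lt_trans a0)//.
by apply: sub_sigma_algebra; exists a => //=; rewrite a0.
Qed.

Lemma predictable_left_limit H s : 0 <= s <= 1 -> predictable F H ->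
  measurable_wrt (left_limit F s) (H s).
Proof. by move=> s01 pH B mB; exact: (pset_section s01 (pH B mB)). Qed.

(** Progressive measurability: it allows a predictable process to be evaluated at a random jump time
    without losing F_t-measurability. *)
Lemma pset_progressive Q t : 0 <= t <= 1 -> pset Q ->
  measurable ([set p | 0 <= p.1 <= t /\ Q p] : set (R * sigmaT (F t))).
Proof.
move=> t01 pQ; have /andP[t0 t1] := t01.
have FtE : (measurable : set_system (sigmaT (F t))) = F t.
  exact: (sigma_algebra_id (Fs t01)).
suff : <<s D, predictable_rectangle F >> `<=`
    [set Q | measurable ([set p | 0 <= p.1 <= t /\ Q p] : set (R * sigmaT (F t)))].
  move=> /(_ _ pQ); congr measurable; apply/seteqP; split => -[u e] /= [u0t]; last by split => //; split => //; split => //=; rewrite in_itv/=; case/andP: u0t => -> /le_trans->.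
  by case.
have mt : measurable ([set p | 0 <= p.1 <= t] : set (R * sigmaT (F t))).
  rewrite (_ : [set p | _] = `[0, t]%classic `*` setT); first exact: measurableX.
  by apply/seteqP; split => -[u e] /=; rewrite in_itv/=; [split|case].
apply: smallest_sub; first split => //.
- rewrite /= (_ : [set p | _] = set0)//; by apply/seteqP; split => -[u e] //= [].
- move=> A mA /=; have := measurableD mt mA; congr measurable.
  apply/seteqP; split => -[u e] /= [u0t].
    move=> nA; split => //; split; last by move=> Ap; apply: nA.
    by split => //=; rewrite in_itv/=; case/andP: u0t => -> /le_trans->.
  by move=> [_ nA]; split => // -[].
- move=> A mA /=; have := @bigcupT_measurable _ (R * sigmaT (F t))%type (fun i => [set p | 0 <= p.1 <= t /\ A i p]) mA; congr measurable.
  apply/seteqP; split => -[u e] /=; first by move=> [i _ [? ?]]; split => //; exists i.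
  by move=> [u0t [i _ Ai]]; exists i.
move=> Q' /= [[A FA ->]|[a [c [A [a0 ac c1 FA ->]]]]] /=.
  rewrite (_ : [set p | _] = [set 0] `*` A); last first.
    apply/seteqP; split => -[u e] /=; first by case.
    by move=> [-> Ae]; rewrite lexx t0.
  by apply: measurableX => //; rewrite FtE; exact: Fmono FA.
have [ta|at_] := leP t a.
  rewrite (_ : [set p | _] = set0)//; apply/seteqP; split => -[u e] //= [/andP[_ ut]].
  by rewrite in_itv/= => -[/andP[au _] _]; have := lt_le_trans au (le_trans ut ta); rewrite ltxx.
rewrite (_ : [set p | _] = `]a, Num.min c t]%classic `*` A); last first.
  apply/seteqP; split => -[u e] /=; rewrite !in_itv/= le_min.
    by move=> [/andP[_ ->] [/andP[-> ->] Ae]].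
  by move=> [/andP[au /andP[-> ->]] Ae]; rewrite au (le_trans a0 (ltW au)).
by apply: measurableX => //; rewrite FtE; apply: Fmono FA => //; exact: ltW.
Qed.

Lemma predictable_progressive H t : 0 <= t <= 1 -> predictable F H ->
  meas (fun p : R * sigmaT (F t) => pred_indic (0 <= p.1 <= t) * H p.1 p.2).
Proof.
move=> t01 pH _ B mB; rewrite setTI.
have h C : measurable C -> measurable ([set p | 0 <= p.1 <= t /\ C (H p.1 p.2)] : set (R * sigmaT (F t))).
  by move=> mC; exact: (pset_progressive t01 (pH C mC)).
have [B0|B0] := pselect (B 0).
  rewrite -[X in measurable X]setCK; apply: measurableC.
  have := h _ (measurableC mB); congr measurable; apply/seteqP; split => -[u e] /=.
    by move=> [->]; rewrite mul1r.
  by case: (0 <= u <= t); rewrite ?mul1r ?mul0r// => nB; split.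
have := h _ mB; congr measurable; apply/seteqP; split => -[u e] /=.
  by move=> [->]; rewrite mul1r.
by case: (0 <= u <= t); rewrite ?mul1r ?mul0r// => nB; split.
Qed.

(** The process is a pointwise limit of step processes that hold, on each cell of a grid of mesh
    1/(n+1), the value at the left end of the cell; such a value is known when the cell begins. *)
Lemma predictable_left_continuous (W : R -> E -> R) : adapted F W ->
  (forall e t, 0 < t <= 1 -> W s e @[s --> t^'-] --> W t e) -> predictable F W.
Proof.
(* The ceiling minus one, and not the floor: the grid point must lie strictly before s even when s
   is itself a grid point. *)
move=> aW lW; pose g n (s : R) := (Num.ceil (s * n.+1%:R) - 1)%:~R / n.+1%:R : R.
pose Wn n s e := if s <= 0 then W 0 e else W (g n s) e.
have pWn n : predictable F (Wn n).
  suff h B : measurable B -> pset [set p | B (Wn n p.1 p.2)] by [].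
  move=> mB; have kE (k : nat) : (k.+1%:Z - 1 = k%:Z)%R by rewrite -addn1 PoszD addrK.
  have := psetU (pset_rectangle0 (aW _ h0 _ mB)) (_ : pset (\bigcup_(k in [set k | (k < n.+1)%N])
    (`](k%:R / n.+1%:R)%R, (k.+1%:R / n.+1%:R)%R]%classic `*` (W (k%:R / n.+1%:R) @^-1` B)))).
  have n0 : 0 < n.+1%:R :> R by rewrite ltr0Sn.
  have hu : pset (\bigcup_(k in [set k | (k < n.+1)%N])
    (`](k%:R / n.+1%:R)%R, (k.+1%:R / n.+1%:R)%R]%classic `*` (W (k%:R / n.+1%:R) @^-1` B))).
    rewrite -psetE; apply: bigcup_measurable => k /= kn; rewrite psetE; apply: pset_rectangle.
    - exact: divr_ge0.
    - by rewrite ltr_pM2r ?invr_gt0// ltr_nat.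
    - by rewrite ler_pdivrMr// mul1r ler_nat.
    - by apply: aW => //; rewrite divr_ge0//= ler_pdivrMr// mul1r ler_nat ltnW.
  move=> /(_ hu); apply: eq_pset => u e /andP[u0 u1] /=.
  rewrite /Wn; move: u0; rewrite le_eqVlt => /orP[/eqP <-|u0].
    rewrite lexx; split; last by move=> ?; left.
    move=> [[]//|[k /= kn [+ _]]]; rewrite in_itv/= ltNge => /andP[/negP[]].
    by rewrite divr_ge0.
  rewrite leNgt u0 /=; split.
    move=> [[u0' _]|[k /= kn]]; first by rewrite u0' ltxx in u0.
    rewrite in_itv/= => -[/andP[ku uk] BW]; rewrite /g (@ceil_def _ _ k.+1)// kE//.
    by rewrite -ltr_pdivrMr// ku/= -ler_pdivlMr.
  move=> BW; right.
  have c0 : (0 < Num.ceil (u * n.+1%:R))%R by rewrite ceil_gt0 mulr_gt0.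
  have [k ck] : exists k : nat, Num.ceil (u * n.+1%:R) = k.+1%:Z.
    by case: (Num.ceil _) c0 => [[|k]|k]// _; exists k.
  have /andP[c1 c2] := real_ceil_itv (num_real (u * n.+1%:R)).
  move: BW c1 c2; rewrite /g ck kE => BW c1 c2.
  exists k => /=; last split => //.
    rewrite -(ltr_nat R) -(@ltr_pM2r _ n.+1%:R^-1) ?invr_gt0// mulfV ?gt_eqF//.
    by apply: lt_le_trans u1; rewrite ltr_pdivrMr.
  by rewrite in_itv/= ltr_pdivrMr// c1/= ler_pdivlMr.
(* Convergence is known on [0, 1] only, and [pset] ignores all other times, so both sides are set to
   0 there before the limit is taken. *)
pose V n u e := pred_indic (0 <= u <= 1) * Wn n u e.
pose W' u e := pred_indic (0 <= u <= 1) * W u e.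
have m01 : meas (fun u : R => pred_indic (0 <= u <= 1) : R).
  by apply: mb2r; apply: measurable_and; apply: mfun_ler.
have pW' : predictable F W'.
  apply/predictableP.
  apply: (@measurable_fun_cvg _ pT _ _ (fun n p => V n p.1 p.2)) => [n|[u e] _ /=].
    apply: mfunM; last exact/predictableP.
    by have /predictableP := predictable_det m01.
  rewrite /V /W'; case: (boolP (0 <= u <= 1)) => [/andP[u0 u1]|_]; last first.
    by under eq_fun do rewrite mul0r; rewrite mul0r; exact: cvg_cst.
  under eq_fun do rewrite mul1r; rewrite mul1r /Wn.
  have [u0'|u0'] := leP u 0.
    by rewrite (_ : u = 0); [exact: cvg_cst|apply/eqP; rewrite eq_le u0 u0'].
  have u01 : 0 < u <= 1 by rewrite u0'.
  have /cvg_at_leftP/(_ (fun n => g n u)) := lW e u u01; apply.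
  have gb n : u - n.+1%:R^-1 <= g n u < u.
    have n0 : 0 < n.+1%:R :> R by rewrite ltr0Sn.
    have /andP[c1 c2] := real_ceil_itv (num_real (u * n.+1%:R)).
    rewrite /g ltr_pdivrMr// c1 andbT ler_pdivlMr// mulrBl mulVf ?gt_eqF// intrD.
    by rewrite lerD2r.
  split => [n|]; first by case/andP: (gb n).
  apply: (@squeeze_cvgr _ _ _ _ (fun n => u - n.+1%:R^-1) (fun=> u)).
  - by apply: nearW => n; case/andP: (gb n) => -> /ltW.
  - rewrite -[X in _ --> X]subr0; apply: cvgB; first exact: cvg_cst.
    exact: cvg_harmonic.
  - exact: cvg_cst.
suff h B : measurable B -> pset [set p | B (W p.1 p.2)] by [].
move=> mB; apply: eq_pset (pW' B mB) => u e u01 /=.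
by rewrite /W' u01 mul1r.
Qed.

End predictable.

(** * Sums over jumps and their measurability *)

Section jumps.
Context {R : realType} {d} {E : measurableType d} (F : R -> set_system E).
Context (N : E -> cumulative R R).
Implicit Types (H K : R -> E -> R).

(** The Stieltjes integral of H against dN over ]0, 1], by [Rintegral_stieltjes]. *)
Definition jsum H e : R := \sum_(i < njump (N e)) H (jtime (N e) i) e.

Definition tint H e : R := \int[@leb01 R]_s H s e.

(** [predictable] says nothing about times outside [0, 1]. The value 0 there makes the process
    jointly measurable on all of [R * E], see [meas_pred]. *)
Definition pred H := predictable F H /\ forall s e, ~~ (0 <= s <= 1) -> H s e = 0.

Hypothesis fF : filtration F.
Hypothesis pN : forall e, counting_path (N e).
Hypothesis aN : adapted F (fun t e => N e t).

Let Fs := fil_sigma fF.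

Let FE t : 0 <= t <= 1 -> (measurable : set_system (sigmaT (F t))) = F t.
Proof. by move=> t01; exact: (sigma_algebra_id (Fs t01)). Qed.

Lemma meas_wrt_sub S (X : E -> R) : S `<=` measurable ->
  measurable_wrt S X -> meas X.
Proof. by move=> Sm mX _ B mB; rewrite setTI; exact/Sm/mX. Qed.

Lemma adapted_jtime_le t i : 0 <= t <= 1 -> F t [set e | jtime (N e) i <= t].
Proof.
move=> t01; rewrite (_ : [set e | _] = (fun e => N e t) @^-1` `[i.+1%:R, +oo[).
  exact: aN.
by apply/seteqP; split => e /=; rewrite in_itv/= andbT jtime_le.
Qed.

Lemma jtime_gt1 e i : 1 < jtime (N e) i -> jtime (N e) i = 2.
Proof. by rewrite ltNge jtime_le1// /jtime => /negbTE ->. Qed.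

(** After t the jump time is replaced by 2, which is F_t-measurable and lies outside [0, t], where
    [predictable_progressive] masks the process to 0. *)
Lemma adapted_jtime t i : 0 <= t <= 1 ->
  meas (fun e : sigmaT (F t) => if jtime (N e) i <= t then jtime (N e) i else 2).
Proof.
move=> t01; have /andP[t0 t1] := t01.
apply: meas_ray => x; have [x2|x2] := leP 2 x.
  rewrite (_ : [set w | _] = setT); first exact: measurableT.
  apply/seteqP; split => // e _ /=; case: ifP => // et.
  by apply: le_trans x2; rewrite (le_trans et)// (le_trans t1)// ler1n.
have [x0|x0] := ltP x 0.
  rewrite (_ : [set w | _] = set0); first exact: measurable0.
  rewrite -subset0 => e /=; case: ifP => et; rewrite leNgt.
    by rewrite (lt_trans x0)// jtime_gt0.
  by rewrite x2.
rewrite FE//; have mF : 0 <= Num.min x t <= 1 by rewrite le_min x0 t0/= ge_min t1 orbT.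
have /andP[m0 m1] := mF.
have [_ _ /(_ _ t m0)] := fF; rewrite ge_min lexx orbT => /(_ isT t1).
move=> /(_ _ (adapted_jtime_le i mF)); congr (F t).
apply/seteqP; split => e /=; rewrite le_min; first by move=> /andP[? ->].
case: ifP => h1 h2; first by rewrite h2.
by have := le_lt_trans h2 x2; rewrite ltxx.
Qed.

Lemma adapted_jump t i H : 0 <= t <= 1 -> predictable F H ->
  meas (fun e : sigmaT (F t) =>
    (jtime (N e) i <= t)%R%:R * H (jtime (N e) i) e).
Proof.
move=> t01 pH; have := mcomp (predictable_progressive fF t01 pH)
  (mpair (adapted_jtime i t01) (@measurable_id _ (sigmaT (F t)) setT)).
congr measurable_fun; apply/funext => e /=; have /andP[t0 t1] := t01.
case: ifP => et; first by rewrite et ltW ?jtime_gt0.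
have -> : (2 <= t) = false by apply/negbTE; rewrite -ltNge (le_lt_trans t1)// ltr1n.
by rewrite andbF !mul0r.
Qed.

Lemma sum_jumps_cvg e (f : nat -> R) : (forall i, (njump (N e) <= i)%N -> f i = 0) ->
  (fun n => \sum_(i < n) f i) @ \oo --> \sum_(i < njump (N e)) f i.
Proof.
move=> f0; apply: cvg_near_cst; exists (njump (N e)) => // n /= le.
rewrite -(subnKC le) big_split_ord/= [X in _ + X]big1 ?addr0// => i _.
by rewrite f0// leq_addr.
Qed.

(** The number of terms is random, so the sum is reached as the limit of sums over the first n
    indices; indices beyond the last jump contribute 0 because their jump time is 2. *)
Lemma adapted_jsum t H : 0 <= t <= 1 -> predictable F H ->
  meas (jsum (fun s e => (s <= t)%R%:R * H s e) : sigmaT (F t) -> R).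
Proof.
move=> t01 pH.
apply: (@measurable_fun_cvg _ (sigmaT (F t)) R setT (fun n e => \sum_(i < n) (jtime (N e) i <= t)%R%:R * H (jtime (N e) i) e)).
  by move=> n; apply: measurable_sum => i; exact: adapted_jump.
move=> e _; apply: (@sum_jumps_cvg e (fun i => (jtime (N e) i <= t)%R%:R * H (jtime (N e) i) e)) => i ni.
rewrite (_ : _ <= t = false) ?mul0r//; apply/negbTE; rewrite -ltNge.
by case/andP: t01 => _ t1; rewrite (le_lt_trans t1)// ltNge jtime_le1// -leqNgt.
Qed.

Lemma meas_adapted t (X : E -> R) : 0 <= t <= 1 -> meas (X : sigmaT (F t) -> R) -> meas X.
Proof.
move=> t01 /(meas_wrtP X (Fs t01)); apply: meas_wrt_sub.
by case: fF => _ h _; exact: h.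
Qed.

Let h1 : 0 <= (1 : R) <= 1. Proof. by rewrite lexx ler01. Qed.

Lemma eq_jsum H K e : (forall s, 0 < s <= 1 -> H s e = K s e) -> jsum H e = jsum K e.
Proof.
by move=> HK; apply: eq_bigr => i _; apply: HK; rewrite jtime_gt0//= jtime_le1.
Qed.

Lemma meas_jsum H : predictable F H -> meas (jsum H).
Proof.
move=> pH; have := meas_adapted h1 (adapted_jsum h1 pH).
congr measurable_fun; apply/funext => e; apply: eq_jsum => s /andP[_ ->].
by rewrite mul1r.
Qed.

Lemma adapted_tint t K : 0 <= t <= 1 -> predictable F K ->
  meas (tint (fun s e => (0 <= s <= t)%R%:R * K s e) : sigmaT (F t) -> R).
Proof.
move=> t01 pK; have h := mcomp (predictable_progressive fF t01 pK)
  (@measurable_swap _ _ (sigmaT (F t)) R).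
exact: (meas_Ex leb01 h).
Qed.

Lemma meas_pred K : pred K -> meas (fun p : R * E => K p.1 p.2).
Proof.
move=> [pK K0]; apply: (@measurability _ _ _ _ _ _ measurable) => //.
  by rewrite sigma_algebra_id//; exact: sigma_algebra_measurable.
move=> _ [B mB <-]; rewrite setTI.
have m01 : measurable (`[0, 1]%classic `*` setT : set (R * E)) by apply: measurableX.
have h C : measurable C -> measurable [set p : R * E | 0 <= p.1 <= 1 /\ C (K p.1 p.2)].
  move=> mC; have [_ Fm _] := fF.
  have := pset_progressive fF h1 (pK C mC).
  suff : (@measurable _ (R * sigmaT (F 1))%type) `<=` (@measurable _ (R * E)%type) by apply.
  apply: smallest_sub; first exact: sigma_algebra_measurable.
  move=> A [[B' mB' <-]|[B' mB' <-]]; rewrite setTI.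
    by rewrite -[_ @^-1` _]setTI; exact: (@measurable_fst _ _ R E).
  rewrite -[_ @^-1` _]setTI; apply: (@measurable_snd _ _ R E) => //.
  by apply: (Fm 1) => //; rewrite -(FE h1).
have [B0|B0] := pselect (B 0).
  rewrite -[X in measurable X]setCK; apply: measurableC.
  have := h _ (measurableC mB); congr measurable; apply/seteqP; split => -[u e] /=; first by case.
  by move=> nB; split => //; apply: contrapT => /negP/K0 H0; apply: nB; rewrite H0.
have := h _ mB; congr measurable; apply/seteqP; split => -[u e] /=; first by case.
by move=> nB; split => //; apply: contrapT => /negP/K0 H0; apply: B0; rewrite -(H0 e).
Qed.

End jumps.

(** * Limit theorems and the functional monotone class theorem *)

Lemma cvg_bigsum {R : realType} (I : Type) (r : seq I) (f : nat -> I -> R) (g : I -> R) :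
  (forall i, f n i @[n --> \oo] --> g i) ->
  \sum_(i <- r) f n i @[n --> \oo] --> \sum_(i <- r) g i.
Proof.
move=> fg; elim: r => [|i r IH].
  by under eq_fun do rewrite big_nil; rewrite big_nil; exact: cvg_cst.
by under eq_fun do rewrite big_cons; rewrite big_cons; exact: cvgD.
Qed.

Section almost_everywhere.
Context {d} {T : measurableType d} {R : realType} (P : probability T R).
Implicit Types (X Y : T -> R).

Lemma Ex_ae X Y : integ P X -> meas Y -> {ae P, forall w, X w = Y w} ->
  integ P Y /\ \int[P]_w X w = \int[P]_w Y w.
Proof.
move=> iX mY XY; have mX := integ_meas iX.
have E1 : (\int[P]_w (X w)%:E)%E = (\int[P]_w (Y w)%:E)%E.
  apply: ae_eq_integral => //; [exact/mEFinP|exact/mEFinP|].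
  by apply: filterS XY => w /= -> _.
split; last by rewrite /Rintegral E1.
apply/integrableP; split; first exact/mEFinP.
have /integrableP[_] := iX; congr (_ < _)%E; apply: ge0_ae_eq_integral => //.
- by apply: mcomp => //; exact/mEFinP.
- by apply: mcomp => //; exact/mEFinP.
- by apply: filterS XY => w /= -> _.
Qed.

Lemma Ex_cvg (X : nat -> T -> R) Y (Z : T -> R) : (forall n, meas (X n)) -> integ P Y ->
  (forall n w, `|X n w| <= Y w) -> (forall w, X n w @[n --> \oo] --> Z w) ->
  \int[P]_w X n w @[n --> \oo] --> \int[P]_w Z w.
Proof. by move=> mX iY XY XZ; exact: (Ex_dct mX iY XY XZ).2. Qed.

Lemma integ_indicM A X : measurable A -> integ P X -> integ P (fun w => \1_A w * X w).
Proof.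
move=> mA; apply: (@integMb _ _ _ P \1_A X 1); first exact: measurable_indic.
by move=> w; rewrite indicE; case: (w \in A); rewrite ?normr1 ?normr0.
Qed.

Lemma integ_monotone (X : nat -> T -> R) Y (c : R) :
  (forall n, integ P (X n)) -> (forall n w, 0 <= X n w) ->
  (forall w, {homo X^~ w : n m / (n <= m)%N >-> n <= m}) ->
  (forall w, X n w @[n --> \oo] --> Y w) ->
  (forall n, \int[P]_w X n w <= c) -> integ P Y.
Proof.
move=> iX X0 Xnd XY Xc; have mX n := integ_meas (iX n).
have mY : meas Y by apply: (measurable_fun_cvg mX) => w _; exact: XY.
have Y0 w : 0 <= Y w.
  by rewrite -(cvg_lim _ (XY w))//; apply: limr_ge; [apply/cvg_ex; eexists; exact: XY|exact: nearW].
apply/integrableP; split; first exact/mEFinP.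
apply: (@le_lt_trans _ _ c%:E); last exact: ltry.
under eq_integral do rewrite gee0_abs ?lee_fin//.
have cv : (\int[P]_w (X n w)%:E)%E @[n --> \oo] --> (\int[P]_w (Y w)%:E)%E.
  have -> : (fun w => (Y w)%:E) = fun w => limn (fun n => (X n w)%:E).
    apply/funext => w; apply/esym/cvg_lim => //.
    by apply: cvg_EFin; [exact: nearW|exact: XY].
  apply: (@cvg_monotone_convergence _ _ _ P setT measurableT (fun n w => (X n w)%:E)) => //.
  - by move=> n; exact/mEFinP.
  - by move=> n w _; rewrite lee_fin.
  - by move=> w _ n m nm; rewrite lee_fin; exact: Xnd.
rewrite -(cvg_lim _ cv)//; apply: lime_le; first by apply/cvg_ex; eexists; exact: cv.
by apply: nearW => n; rewrite -EFin_Ex// lee_fin.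
Qed.

End almost_everywhere.

Lemma meas_leset {d} {T : measurableType d} {R : realType} (f g : T -> R) :
  meas f -> meas g -> measurable [set x | f x <= g x].
Proof.
by move=> mf mg; have := mfun_ler mf mg measurableT (_ : measurable [set true]); rewrite setTI; apply.
Qed.

Lemma sum_floor {R : realType} (n : nat) (y : R) : 0 <= y <= n%:R ->
  y - 1 <= \sum_(k < n) (k.+1%:R <= y)%R%:R <= y.
Proof.
move=> /andP[y0 yn]; have /andP[t1 t2] := truncn_itv y0.
have tn : (Num.truncn y <= n)%N by rewrite -(ler_nat R) (le_trans t1).
have -> : \sum_(k < n) (k.+1%:R <= y)%R%:R = (Num.truncn y)%:R :> R.
  rewrite -natr_sum; congr _%:R; rewrite -(subnKC tn) big_split_ord/=.
  rewrite [X in (X + _)%N](eq_bigr (fun=> 1%N)) => [|i _].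
    rewrite sum1_card card_ord big1 ?addn0// => i _.
    by apply/eqP; rewrite eqb0 -ltNge (lt_le_trans t2)// ler_nat ltnS leq_addr.
  by apply/eqP; rewrite eqb1 (le_trans _ t1)// ler_nat ltn_ord.
by rewrite t1 andbT lerBlDr natr1 ltW.
Qed.

(** A function g with values in [0, 1] is the uniform limit of the layer sums (n+1)^-1 sum_k
    1{(k+1)/(n+1) <= g}, which are built from indicators alone; a bounded f is an affine image of
    such a g. *)
Lemma bounded_measurable_ind {d} {T : measurableType d} {R : realType}
    (L : (T -> R) -> Prop) :
  (forall A, measurable A -> L \1_A) ->
  (forall f g, L f -> L g -> L (fun x => f x + g x)) ->
  (forall (c : R) f, L f -> L (fun x => c * f x)) ->
  (forall (f_ : nat -> T -> R) (f : T -> R) (c : R), (forall n, meas (f_ n)) ->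
    (bdd f_ c) -> (forall x, f_ n x @[n --> \oo] --> f x) ->
    (forall n, L (f_ n)) -> L f) ->
  forall (f : T -> R) (c : R), meas f -> (forall x, `|f x| <= c) -> L f.
Proof.
move=> L1 LD LZ Llim.
have unit (g : T -> R) : meas g -> (forall x, 0 <= g x <= 1) -> L g.
  move=> mg g01.
  pose A n k := [set x | k.+1%:R / n.+1%:R <= g x].
  have mA n k : measurable (A n k).
    exact: meas_leset (mcst _) mg.
  pose s n m x : R := \sum_(k < m) (\1_(A n k) x).
  have Ls n m : L (s n m).
    elim: m => [|m IH].
      have -> : s n 0%N = \1_set0 by apply/funext => x; rewrite /s big_ord0 indic0.
      exact: L1.
    have -> : s n m.+1 = fun x => s n m x + \1_(A n m) x by apply/funext => x; rewrite /s big_ord_recr.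
    by apply: LD => //; exact: L1.
  have ms n m : meas (s n m).
    by apply: measurable_sum => k; exact: measurable_indic.
  have sb n x : `|g x - n.+1%:R^-1 * s n n.+1 x| <= n.+1%:R^-1.
    have n0 : 0 < n.+1%:R :> R by rewrite ltr0Sn.
    have := @sum_floor R n.+1 (g x * n.+1%:R).
    rewrite mulr_ge0 ?ler_piMl ?(andP (g01 x)).1 ?(andP (g01 x)).2//= => /(_ isT).
    rewrite (_ : \sum_(k < _) _ = s n n.+1 x); last first.
      apply: eq_bigr => k _; rewrite indicE; congr (nat_of_bool _)%:R.
      by rewrite mem_setE -ler_pdivrMr.
    move: (s n n.+1 x) => y /andP[y1 y2].
    have a : n.+1%:R^-1 * y <= g x by rewrite ler_pdivrMl// mulrC.
    have b : g x - n.+1%:R^-1 <= n.+1%:R^-1 * y.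
      by rewrite ler_pdivlMl// mulrBr mulfV ?gt_eqF// mulrC.
    have v0 : 0 <= n.+1%:R^-1 :> R by rewrite invr_ge0.
    by rewrite ler_norml; move: a b v0; move: (_^-1 * y) => z; move: (_^-1) => v a b v0; apply/andP; split; lra.
  apply: (Llim (fun n x => n.+1%:R^-1 * s n n.+1 x) g 2) => //.
  - by move=> n; apply: mfunM.
  - move=> n x; have := sb n x; have /andP[g0 g1] := g01 x.
    have v0 : 0 <= n.+1%:R^-1 :> R by rewrite invr_ge0.
    have : n.+1%:R^-1 <= 1 :> R by rewrite invf_le1 ?ltr0Sn// ler1n.
    move: v0; move: (_^-1 * s _ _ _) => y; move: (_^-1) => v v0; rewrite !ler_norml => v1 /andP[a b]; apply/andP; split; lra.
  - move=> x; apply/cvgrPdist_le => e e0; near=> n.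
    apply: (le_trans (sb n x)); near: n.
    have /cvgr0Pnorm_le/(_ e e0) := @cvg_harmonic R.
    by apply: filterS => n; rewrite ger0_norm// invr_ge0.
  - by move=> n; exact: LZ.
move=> f c mf fc; pose C := Num.max c 1.
have C0 : 0 < C by rewrite lt_max ltr01 orbT.
have fC x : `|f x| <= C by rewrite le_max fc.
pose g x := (f x + C) / (2 * C).
have -> : f = fun x => (2 * C) * g x + (- C) * \1_setT x.
  have C0' : C != 0 by rewrite gt_eqF.
  by apply/funext => x; rewrite indicE in_setT mulr1 /g; field.
apply: LD; apply: LZ; last exact: L1.
apply: unit; first by apply: mfunM => //; apply: mfunD.
move=> x; have := fC x; rewrite ler_norml /g => /andP[f1 f2].
rewrite divr_ge0 ?ler_pdivrMr ?mulr_gt0//=; lra.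
Unshelve. all: by end_near. Qed.

Lemma norm_b2r_le1 {R : realType} (p : bool) : `|p%:R : R| <= 1.
Proof. by case: p; rewrite ?normr1 ?normr0. Qed.

Lemma Rintegral_leb01_at {R : realType} (a : R) (f : R -> R) :
  (forall s, s != a -> f s = 0) -> \int[@leb01 R]_s f s = 0.
Proof.
move=> f0; have -> : f = fun s => f a * \1_[set a] s.
  apply/funext => s; rewrite indicE in_set1; case: eqVneq => [->|/f0 ->]; first by rewrite mulr1.
  by rewrite mulr0.
have m0 : measurable ([set a] : set R) by exact: measurable_set1.
rewrite ExZ ?Ex_indic//; last exact: integ_indic.
have /null_content_dominatesP/(_ _ m0) := dominates_uniform_prob (@ltr01 R).
by move=> /(_ (lebesgue_measure_set1 a)) h; transitivity (f a * fine 0%E); [congr (_ * fine _)|rewrite mulr0].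
Qed.

Section predictable_operations.
Context {R : realType} {d} {E : measurableType d} (F : R -> set_system E).
Hypothesis fF : filtration F.
Implicit Types H K : R -> E -> R.

Lemma predictableM H K : predictable F H -> predictable F K -> predictable F (fun u e => H u e * K u e).
Proof. by move=> /predictableP hH /predictableP hK; apply/predictableP; exact: mfunM. Qed.

Lemma predictableB H K : predictable F H -> predictable F K -> predictable F (fun u e => H u e - K u e).
Proof. by move=> /predictableP hH /predictableP hK; apply/predictableP; exact: mfunB. Qed.

Lemma predictable_comp (f : R -> R) H : meas f -> predictable F H -> predictable F (fun u e => f (H u e)).
Proof. by move=> mf /predictableP pH; apply/predictableP; exact: mcomp mf pH. Qed.

Lemma predictable_time (p : R -> bool) : meas p -> predictable F (fun u _ => (p u)%:R : R).
Proof. by move=> mp; apply: predictable_det => //; exact: mb2r. Qed.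

Lemma predM H K : predictable F H -> pred F K -> pred F (fun u e => H u e * K u e).
Proof.
move=> pH [pK K0]; split; first exact: predictableM.
by move=> u e /K0 ->; rewrite mulr0.
Qed.

Lemma predD H K : pred F H -> pred F K -> pred F (fun u e => H u e + K u e).
Proof.
move=> [/predictableP pH H0] [/predictableP pK K0]; split; first by apply/predictableP; exact: mfunD.
by move=> u e u01; rewrite H0// K0// addr0.
Qed.

Lemma predZ a H : pred F H -> pred F (fun u e => a * H u e).
Proof. by apply: predM; exact: predictable_det. Qed.

Lemma pred_mask H : predictable F H -> pred F (fun u e => (0 <= u <= 1)%R%:R * H u e).
Proof.
move=> pH; split; last by move=> u e /negbTE ->; rewrite mul0r.
by apply: predictableM => //; apply: predictable_time; apply: measurable_and; apply: mfun_ler.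
Qed.

Lemma pred_comp (f : R -> R) H : meas f -> f 0 = 0 -> pred F H -> pred F (fun u e => f (H u e)).
Proof. by move=> mf f0 [pH H0]; split; [exact: predictable_comp|move=> u e /H0 ->]. Qed.

Lemma meas_pred1 H e : pred F H -> meas (H ^~ e).
Proof. by move=> pH; exact: mcomp (meas_pred fF pH) (measurable_pair2 e). Qed.

Lemma meas_tint H : pred F H -> meas (tint H).
Proof.
move=> pH; apply: (meas_Ex leb01 (F := fun p => H p.2 p.1)).
exact: mcomp (meas_pred fF pH) (@measurable_swap _ _ E R).
Qed.

Lemma tint_le H (c : R) e : pred F H -> (forall u, `|H u e| <= c) -> `|tint H e| <= c.
Proof. by move=> pH Hc; apply: abs_Ex_le => //; exact: meas_pred1. Qed.

Lemma integ_pred H (c : R) e : pred F H -> (forall u, `|H u e| <= c) -> integ leb01 (H ^~ e).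
Proof. by move=> pH Hc; apply: (integ_bnd leb01 _ Hc); exact: meas_pred1. Qed.

Lemma integ_tint {P : probability E R} H (c : R) : pred F H -> (bdd H c) ->
  integ P (tint H).
Proof.
by move=> pH Hc; apply: (integ_bnd P (c := c)) => [|e]; [exact: meas_tint|exact: tint_le].
Qed.

End predictable_operations.

(** * The compensator identity for bounded predictable integrands *)

Section compensator.
Context {R : realType} {d} {E : measurableType d} (P : probability E R).
Context (F : R -> set_system E) (N : E -> cumulative R R).
Context (l b : R -> E -> R) (C : R).
Implicit Types (H K : R -> E -> R).
Notation jsum := (jsum N).
Notation pred := (pred F).

Hypothesis fF : filtration F.
Hypothesis pN : forall e, counting_path (N e).
Hypothesis aN : adapted F (fun t e => N e t).
Hypothesis pb : pred b.
Hypothesis bC : forall s e, `|b s e| <= C.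
(** [b] stands for a bounded version of the intensity [l]. Only their time integrals have to agree,
    since nothing else of [l] enters [compensated N l]. *)
Hypothesis bl : {ae P, forall e t, 0 <= t <= 1 ->
  \int[lebesgue_measure]_(s in `[0, t]) l s e = tint (fun s e => (0 <= s <= t)%R%:R * b s e) e}.

Let Fs := fil_sigma fF.

Let Fm := fil_sub fF.

(** The indicator is left-continuous in u, so adaptedness suffices, and {sigma < t} is a countable
    union of events {sigma <= t'} with t' < t. *)
Lemma predictable_stopping sigma : stopping_time F sigma ->
  predictable F (fun u e => (u <= sigma e)%R%:R : R).
Proof.
move=> [s0 sF]; apply: predictable_left_continuous => //.
  move=> t t01; apply/(meas_wrtP _ (Fs t01)); apply: mb2r.
  apply: (measurable_fun_bool true); rewrite setTI.
  rewrite (sigmaT_id (Fs t01)).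
  have [F0 FC FU] := Fs t01.
  have [t0|t0] := leP t 0.
    rewrite (_ : _ @^-1` _ = setT); first by rewrite -[setT](setD0); exact: FC.
    by apply/seteqP; split => e //= _; rewrite (le_trans t0 (s0 e)).
  rewrite (_ : _ @^-1` _ = setT `\` \bigcup_n [set e | sigma e <= t - t / n.+1%:R]).
    apply: FC; apply: FU => n.
    have tn : 0 <= t - t / n.+1%:R <= 1.
      rewrite subr_ge0 ler_pdivrMr ?ltr0Sn// ler_peMr ?ler1n ?(ltW t0)//= lerBlDr.
      by case/andP: t01 => _ t1; rewrite (le_trans t1)// lerDl divr_ge0// ltW.
    have [_ _ /(_ _ t (andP tn).1)] := fF; apply; last exact: sF.
      by rewrite lerBlDr lerDl divr_ge0// ltW.
    by case/andP: t01.
  apply/seteqP; split => e /=.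
    move=> te; split => // -[n _ /=]; apply/negP; rewrite -ltNge (lt_le_trans _ te)//.
    by rewrite ltrBlDr ltrDl divr_gt0.
  move=> [_ ns]; rewrite leNgt; apply/negP => st; apply: ns.
  have e0 : 0 < (t - sigma e) / t by rewrite divr_gt0// subr_gt0.
  have /cvgr0Pnorm_le/(_ _ e0)[n _ /(_ n (leqnn n))] := @cvg_harmonic R.
  rewrite /= ger0_norm ?invr_ge0// => h; exists n => //=.
  by rewrite lerBrDr -lerBrDl; rewrite ler_pdivlMr// mulrC in h.
move=> e t /andP[t0 t1]; have [ts|st] := leP t (sigma e).
  apply: cvg_near_cst; near=> s; congr (nat_of_bool _)%:R; apply: (le_trans _ ts).
  by apply: ltW; near: s; exact: nbhs_left_lt.
apply: cvg_near_cst; near=> s; congr (nat_of_bool _)%:R; apply/negbTE; rewrite -ltNge.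
by near: s; exact: nbhs_left_gt.
Unshelve. all: by end_near. Qed.

Section localized.
Variable sigma : E -> R.
Hypothesis sst : stopping_time F sigma.
Hypothesis smart : martingale P F (fun t e => compensated N l (Order.min t (sigma e)) e - compensated N l 0 e).

Let S (u : R) e : R := (u <= sigma e)%R%:R.
Let pS : predictable F S := predictable_stopping sst.

(** [X] and [Z] are N and its compensator stopped at [sigma]; [martE] identifies their difference
    with the stopped martingale. *)
Let X t := jsum (fun u e => (u <= t)%R%:R * S u e).
Let Z t e := tint (fun u e => (0 <= u <= t)%R%:R * (S u e * b u e)) e.

Let C0 : 0 <= C.
Proof. by have := le_trans (normr_ge0 _) (bC 0 point). Qed.

Let mX t : 0 <= t <= 1 -> meas (X t).
Proof.
move=> t01; apply: (meas_jsum fF pN aN); apply: predictableM => //.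
by apply: predictable_time => //; exact: mfun_ler.
Qed.

Let predSb t : pred (fun u e => (0 <= u <= t)%R%:R * (S u e * b u e)).
Proof.
split; last by move=> u e u01; rewrite (pb.2 _ _ u01) !mulr0.
apply: predictableM; last by apply: predictableM => //; case: pb.
by apply: predictable_det => //; apply: mb2r; apply: measurable_and; apply: mfun_ler.
Qed.

Let S_le1 (t : bool) u e : `|t%:R * S u e| <= 1.
Proof. by rewrite /S; case: t; case: (u <= sigma e); rewrite ?mulr0 ?mul0r ?mulr1 ?normr1 ?normr0. Qed.

Let iZ t : integ P (Z t).
Proof.
apply: (integ_tint fF (c := C) (predSb t)) => u e.
by rewrite mulrA normrM -[leRHS]mul1r ler_pM.
Qed.

Let martE t : 0 <= t <= 1 ->
  {ae P, forall e, X t e - Z t e = compensated N l (Order.min t (sigma e)) e - compensated N l 0 e}.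
Proof.
move=> /andP[t0 t1]; apply: filterS bl => e ble; have s0 := sst.1 e.
have m01 : 0 <= Order.min t (sigma e) <= 1 by rewrite le_min t0 s0/= ge_min t1.
rewrite /compensated !ble ?lexx ?ler01//.
have [-> _ _] := pN e; rewrite [X in _ - (_ - X)](Rintegral_leb01_at (a := 0)); last first.
  move=> s /eqP s0'; rewrite (_ : (0 <= s <= 0) = false) ?mul0r//.
  by apply/negbTE/negP => /andP[a b']; apply: s0'; apply/eqP; rewrite eq_le a b'.
rewrite subr0 subr0; congr (_ - _).
  rewrite (counting_path_sum (pN e) m01); apply: eq_bigr => i _.
  by rewrite /S le_min; case: (_ <= t); rewrite ?mul1r ?mul0r.
apply: eq_Ex => u; rewrite /S le_min.
by case: (0 <= u); case: (u <= t); case: (u <= sigma e); rewrite /= ?mul1r ?mul0r.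
Qed.

(** The stopped martingale is integrable by definition and [Z] is bounded, hence the stopped count
    is integrable. Its value at time 1 dominates all jump sums below, through [QX1]. *)
Let iX t : 0 <= t <= 1 -> integ P (X t).
Proof.
move=> t01; have /andP[t0 t1] := t01.
have [iW _ _ _] := smart t0 (lexx t) t1.
have := Ex_ae (integD iW (iZ t)) (mX t01) _.
case=> //; apply: filterS (martE t01) => e /= <-; by rewrite subrK.
Qed.

Let rect_eq s t A : 0 <= s -> s < t -> t <= 1 -> F s A ->
  \int[P]_e (\1_A e * (X t e - X s e)) = \int[P]_e (\1_A e * (Z t e - Z s e)).
Proof.
move=> s0 st t1 FA; have t0 := le_trans s0 (ltW st); have s1 := le_trans (ltW st) t1.
have s01 : 0 <= s <= 1 by rewrite s0. have t01 : 0 <= t <= 1 by rewrite t0.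
have mA : measurable A by exact: Fm FA.
have [iWt iWs _ /(_ A FA) eqW] := smart s0 (ltW st) t1.
have i1 Y : integ P Y -> integ P (fun e => \1_A e * Y e).
  exact: integ_indicM.
have E1 Y : (\int[P]_(e in A) (Y e)%:E)%E = (\int[P]_e (\1_A e * Y e)%:E)%E.
  rewrite integral_mkcond; apply: eq_integral => e _; rewrite patchE indicE.
  by case: (e \in A); rewrite ?mul1r ?mul0r.
have {eqW} : \int[P]_e (\1_A e * (X s e - Z s e)) = \int[P]_e (\1_A e * (X t e - Z t e)).
  rewrite !E1 in eqW; move: (congr1 fine eqW).
  have ae t' : 0 <= t' <= 1 -> integ P (fun e => compensated N l (Order.min t' (sigma e)) e - compensated N l 0 e) -> 
      fine (\int[P]_e (\1_A e * (compensated N l (Order.min t' (sigma e)) e - compensated N l 0 e))%:E)%E =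
      \int[P]_e (\1_A e * (X t' e - Z t' e)).
    move=> t'01 iW; apply: (Ex_ae (i1 _ iW) _ _).2.
      by apply: integ_meas (i1 _ (integB (iX t'01) (iZ t'))).
    by apply: filterS (martE t'01) => e ->.
  move=> h; exact: etrans (esym (ae s s01 iWs)) (etrans h (ae t t01 iWt)).
have dist Y Y' : integ P Y -> integ P Y' ->
    \int[P]_e (\1_A e * (Y e - Y' e)) = \int[P]_e (\1_A e * Y e) - \int[P]_e (\1_A e * Y' e).
  move=> iY iY'; rewrite -ExB; [by apply: eq_Ex => e; rewrite mulrBr|exact: i1|exact: i1].
have [xs xt zs zt] := And4 (iX s01) (iX t01) (iZ s) (iZ t).
rewrite (dist _ _ xs zs) (dist _ _ xt zt) (dist _ _ xt xs) (dist _ _ zt zs).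
by move: (\int[_]__ _) (\int[_]__ _) (\int[_]__ _) (\int[_]__ _) => a1 a2 a3 a4; lra.
Qed.

Let D : set (R * E) := `[0, 1]%classic `*` [set: E].

Let X1 := X 1.
Let h1 : 0 <= (1 : R) <= 1. Proof. by rewrite lexx ler01. Qed.
Let iX1 : integ P X1 := iX h1.

Let pQ Q : pset F Q -> predictable F (fun u e => \1_Q (u, e) : R).
Proof.
move=> pQ; apply/predictableP.
have := @measurable_indic _ (sigmaT (pset F)) R setT Q; rewrite psetE => /(_ pQ).
by congr measurable_fun; apply/funext => -[].
Qed.

Let ind_le1 Q (p : R * E) : `|\1_Q p : R| <= 1.
Proof. by rewrite indicE; case: (p \in Q); rewrite ?normr1 ?normr0. Qed.

Let QX1 (f : R -> E -> R) (c : R) e : (forall u, `|f u e| <= c) ->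
  `|jsum (fun u e => f u e * S u e) e| <= c * X1 e.
Proof.
move=> fc; rewrite /X1 /X /Submission.jsum mulr_sumr; apply: (le_trans (ler_norm_sum _ _ _)).
apply: ler_sum => i _; rewrite jtime_le1// ltn_ord mul1r normrM.
by rewrite ler_pM// ger0_norm// /S.
Qed.

Let iJ (f : R -> E -> R) (c : R) : predictable F f -> (bdd f c) ->
  integ P (jsum (fun u e => f u e * S u e)).
Proof.
move=> pf fc; apply: (@integ_le _ _ _ P _ (fun e => c * X1 e)).
- refine (meas_jsum fF pN aN (predictableM pf pS)).
- exact: integZ.
- by move=> e; apply: QX1 => u; exact: fc.
Qed.

Let predfSb f : predictable F f -> pred (fun u e => f u e * (S u e * b u e)).
Proof.
move=> pf; split; last by move=> u e u01; rewrite (pb.2 _ _ u01) !mulr0.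
by apply: predictableM pf (predictableM pS pb.1).
Qed.

Let fSb_le f (c : R) : (bdd f c) -> forall u e, `|f u e * (S u e * b u e)| <= c * C.
Proof.
move=> fc u e; rewrite normrM ler_pM// normrM -[leRHS]mul1r ler_pM//.
by have := S_le1 true u e; rewrite mul1r.
Qed.

Let iT (f : R -> E -> R) (c : R) : predictable F f -> (bdd f c) ->
  integ P (tint (fun u e => f u e * (S u e * b u e))).
Proof. by move=> pf fc; exact: (integ_tint fF (predfSb pf) (fSb_le fc)). Qed.

Let good f := \int[P]_e jsum (fun u e => f u e * S u e) e =
  \int[P]_e tint (fun u e => f u e * (S u e * b u e)) e.

Let goodD f g (c c' : R) : predictable F f -> predictable F g ->
  (bdd f c) -> (bdd g c') ->
  good f -> good g -> good (fun u e => f u e + g u e).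
Proof.
move=> pf pg fc gc; rewrite /good => gf gg.
transitivity (\int[P]_e (jsum (fun u e => f u e * S u e) e + jsum (fun u e => g u e * S u e) e)).
  by apply: eq_Ex => e; rewrite -big_split/=; apply: eq_bigr => i _; rewrite mulrDl.
rewrite (ExD (iJ pf fc) (iJ pg gc)) gf gg -(ExD (iT pf fc) (iT pg gc)).
apply: eq_Ex => e; rewrite -ExD.
- by apply: eq_Ex => u; rewrite mulrDl.
- by apply: (integ_bnd leb01 (meas_pred1 fF e (predfSb pf))) => u; exact: fSb_le.
- by apply: (integ_bnd leb01 (meas_pred1 fF e (predfSb pg))) => u; exact: fSb_le.
Qed.

Let goodZ f (a c : R) : predictable F f -> (bdd f c) ->
  good f -> good (fun u e => a * f u e).
Proof.
move=> pf fc; rewrite /good => gf.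
transitivity (\int[P]_e (a * jsum (fun u e => f u e * S u e) e)).
  by apply: eq_Ex => e; rewrite mulr_sumr; apply: eq_bigr => i _; rewrite mulrA.
rewrite (ExZ _ (iJ pf fc)) gf -(ExZ _ (iT pf fc)).
apply: eq_Ex => e; rewrite -ExZ; first by apply: eq_Ex => u; rewrite mulrA.
by apply: (integ_bnd leb01 (meas_pred1 fF e (predfSb pf))) => u; exact: fSb_le.
Qed.

Let goodL (f_ : nat -> R -> E -> R) f (c : R) : (forall n, predictable F (f_ n)) ->
  (forall n u e, `|f_ n u e| <= c) -> (forall u e, 0 <= u <= 1 -> f_ n u e @[n --> \oo] --> f u e) ->
  (forall n, good (f_ n)) -> good f.
Proof.
move=> pf fc ff gf.
have c1 : \int[P]_e jsum (fun u e => f_ n u e * S u e) e @[n --> \oo] -->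
    \int[P]_e jsum (fun u e => f u e * S u e) e.
  apply: (Ex_cvg (Y := fun e => c * X1 e)) => [n|||].
  - exact: integ_meas (iJ (pf n) (fc n)).
  - exact: integZ.
  - by move=> n e; apply: QX1 => u; exact: fc.
  - move=> e; apply: cvg_bigsum => i; apply: cvgM; last exact: cvg_cst.
    by apply: ff; rewrite ltW ?jtime_gt0//= jtime_le1.
have c2 : \int[P]_e tint (fun u e => f_ n u e * (S u e * b u e)) e @[n --> \oo] -->
    \int[P]_e tint (fun u e => f u e * (S u e * b u e)) e.
  have c0 : 0 <= c by have := le_trans (normr_ge0 _) (fc 0%N 0 point).
  apply: (Ex_cvg (Y := fun e => c * C)) => [n|||].
  - exact: integ_meas (iT (pf n) (fc n)).
  - exact: integ_cst.
  - by move=> n e; apply: (tint_le fF (predfSb (pf n))) => u; exact: fSb_le (fc n) _ _.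
  - move=> e; apply: (Ex_cvg (P := leb01) (Y := fun u => c * C)) => [n|||].
    + exact: (meas_pred1 fF e (predfSb (pf n))).
    + exact: integ_cst.
    + by move=> n u; exact: fSb_le.
    + move=> u; have [u01|/pb.2 b0] := boolP (0 <= u <= 1).
        by apply: cvgM; [exact: ff|exact: cvg_cst].
      by rewrite b0 !mulr0; under eq_fun do rewrite !mulr0; exact: cvg_cst.
rewrite /good; move: c1; under eq_cvg do rewrite gf; move=> c1.
exact: (cvg_unique _ c1 c2).
Qed.

Let goodE f g : (forall u e, 0 <= u <= 1 -> f u e = g u e) -> good f -> good g.
Proof.
move=> fg; rewrite /good => gf.
transitivity (\int[P]_e jsum (fun u e => f u e * S u e) e).
  apply: eq_Ex => e; apply: (eq_jsum pN) => u /andP[u0 u1].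
  by rewrite fg// (ltW u0).
rewrite gf; apply: eq_Ex => e; apply: eq_Ex => u.
by have [/fg ->//|/pb.2 b0] := boolP (0 <= u <= 1); rewrite b0 !mulr0.
Qed.

Let FI t A A' : 0 <= t <= 1 -> F t A -> F t A' -> F t (A `&` A').
Proof.
move=> /Fs sF; rewrite -(sigmaT_id sF).
exact: measurableI.
Qed.

Let rect0 : predictable_rectangle F set0.
Proof. by left; exists set0; [case: (Fs (_ : 0 <= 0 <= 1)); rewrite ?lexx ?ler01|rewrite setX0]. Qed.

Let rectI : setI_closed (predictable_rectangle F).
Proof.
have Fmo u v A : 0 <= u -> u <= v -> v <= 1 -> F u A -> F v A.
  by move=> u0 uv v1; case: fF => _ _ h; exact: h.
move=> _ _ [[A FA ->]|[s [t [A [s0 st t1 FA ->]]]]] [[A' FA' ->]|[s' [t' [A' [s0' st' t1' FA' ->]]]]].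
- left; exists (A `&` A'); first by apply: FI => //; rewrite lexx ler01.
  by apply/seteqP; split => -[u e] /=; [move=> [[-> ?] [_ ?]]|move=> [-> []]].
- rewrite (_ : _ `&` _ = set0)// -subset0 => -[u e] [[/= -> _]] [/=].
  by rewrite in_itv/= ltNge s0'.
- rewrite (_ : _ `&` _ = set0)// -subset0 => -[u e] [[/= + _]] [/= u0].
  by rewrite u0 in_itv/= ltNge s0.
have [lt|ge] := ltP (Num.max s s') (Num.min t t'); last first.
  rewrite (_ : _ `&` _ = set0)// -subset0 => -[u e] [[/= + _]] [/=].
  rewrite !in_itv/= => /andP[a1 a2] /andP[a3 a4].
  have := lt_le_trans (_ : Num.max s s' < u) (_ : u <= Num.min t t').
  by rewrite gt_max le_min a1 a2 a3 a4 ltNge ge => /(_ isT isT).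
right; exists (Num.max s s'), (Num.min t t'), (A `&` A'); split => //.
- by rewrite le_max s0.
- by rewrite ge_min t1.
- have m1 : Num.max s s' <= 1 by rewrite ge_max (le_trans (ltW st) t1) (le_trans (ltW st') t1').
  apply: FI; first by rewrite le_max s0 m1.
    by apply: Fmo FA => //; rewrite le_max lexx.
  by apply: Fmo FA' => //; rewrite le_max lexx orbT.
apply/seteqP; split => -[u e] /=; rewrite !in_itv/= gt_max le_min.
  by move=> [[/andP[-> ->] ?] [/andP[-> ->] ?]].
by move=> [/andP[/andP[-> ->] /andP[-> ->]] []].
Qed.

Let goodR Q : predictable_rectangle F Q -> good (fun u e => \1_Q (u, e)).
Proof.
move=> [[A FA ->]|[s [t [A [s0 st t1 FA ->]]]]]; rewrite /good.
  transitivity (0 : R).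
    rewrite -[RHS](Ex_cst P); apply: eq_Ex => e; rewrite /Submission.jsum big1// => i _.
    rewrite indicE (_ : _ \in _ = false) ?mul0r//; apply/negbTE/negP => /set_mem[/= h _].
    by have := jtime_gt0 (pN e) i; rewrite h ltxx.
  rewrite -[LHS](Ex_cst P); apply: eq_Ex => e; apply/esym/(Rintegral_leb01_at (a := 0)) => u /eqP u0.
  by rewrite indicE (_ : _ \in _ = false) ?mul0r//; apply/negbTE/negP => /set_mem[/= h _].
have ineq u e : \1_(`]s, t]%classic `*` A) (u, e) = (u <= t)%R%:R * \1_A e - (u <= s)%R%:R * \1_A e :> R.
  rewrite -mulrBl !indicE in_setX mem_setE /= in_itv/=.
  have [us|su] := leP u s; last by rewrite subr0; case: (u <= t); rewrite ?mul1r ?mul0r.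
  by rewrite (le_trans us (ltW st)) subrr mul0r.
transitivity (\int[P]_e (\1_A e * (X t e - X s e))).
  apply: eq_Ex => e; rewrite /X /Submission.jsum -sumrB mulr_sumr; apply: eq_bigr => i _.
  by rewrite ineq; ring.
rewrite (rect_eq s0 st t1 FA); apply: eq_Ex => e.
have pa t' : 0 <= t' <= 1 -> integ leb01 (fun u => (0 <= u <= t')%R%:R * (S u e * b u e)).
  move=> t01; apply: (integ_bnd leb01 (meas_pred1 fF e (predSb t')) (c := C)) => u.
  by rewrite mulrA normrM -[leRHS]mul1r ler_pM.
have pat : integ leb01 (fun u => (0 <= u <= t)%R%:R * (S u e * b u e)).
  by apply: pa; rewrite (le_trans s0 (ltW st)).
have pas : integ leb01 (fun u => (0 <= u <= s)%R%:R * (S u e * b u e)).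
  by apply: pa; rewrite s0 (le_trans (ltW st)).
rewrite /Z -(ExB pat pas) -(ExZ _ (integB pat pas)); apply: eq_Ex => u.
rewrite ineq; have [u0|u0] := leP 0 u; first by rewrite /=; ring.
by rewrite (pb.2 u e) ?leNgt ?u0// !mulr0 subrr mulr0.
Qed.

(** For a rectangle ]s, t] x A with A in F_s this is the martingale property of the stopped process
    tested on A ([rect_eq]). Rectangles are stable under intersection, so a lambda-system argument
    reaches every predictable set, and [bounded_measurable_ind] every bounded predictable f. *)
Lemma localized_compensator f (c : R) : predictable F f -> (bdd f c) ->
  [/\ integ P (jsum (fun u e => f u e * S u e)),
      integ P (tint (fun u e => f u e * (S u e * b u e)))
    & \int[P]_e jsum (fun u e => f u e * S u e) e = \int[P]_e tint (fun u e => f u e * (S u e * b u e)) e].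
Proof.
move=> pf fc; split; [exact: iJ fc|exact: iT fc|].
have rectD Q : predictable_rectangle F Q -> Q `<=` D.
  case=> [[A FA ->]|[s [t [A [s0 st t1 FA ->]]]]] -[u e] [/=].
    by move=> -> _; split => //=; rewrite in_itv/= lexx ler01.
  rewrite in_itv/= => /andP[su ut] _; split => //=.
  by rewrite in_itv/= (le_trans s0 (ltW su)) (le_trans ut).
have ind1 Q u e := ind_le1 Q (u, e).
have goodQ Q : pset F Q -> good (fun u e => \1_Q (u, e)).
  move=> pQ'; pose G := [set Q | [/\ Q `<=` D, pset F Q & good (fun u e => \1_Q (u, e))]].
  have sG : <<s D, predictable_rectangle F >> `<=` G.
    apply: (lambda_system_subset rectI).
    - split.
      + by move=> A [].
      + split => //.
          have h : pset F setT by exact: pset_setT.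
          by apply: eq_pset h => // u e u01; split => // _; split => //=; rewrite in_itv.
        have [_ _ FT] := Fs h1.
        have r01 : predictable_rectangle F (`]0, 1]%classic `*` setT).
          right; exists 0, 1, setT; split => //; case: (Fs (_ : 0 <= 0 <= 1)); rewrite ?lexx ?ler01//.
          by move=> z0 /(_ _ z0); rewrite setD0.
        have r00 : predictable_rectangle F ([set 0] `*` setT).
          left; exists setT => //; case: (Fs (_ : 0 <= 0 <= 1)); rewrite ?lexx ?ler01//.
          by move=> z0 /(_ _ z0); rewrite setD0.
        have psr Q' : predictable_rectangle F Q' -> pset F Q'.
          move=> [[A FA ->]|[s [t [A [s0 st t1 FA ->]]]]]; [exact: pset_rectangle0|exact: pset_rectangle].
        apply: goodE (goodD (pQ (psr _ r00)) (pQ (psr _ r01)) (ind1 _) (ind1 _) (goodR r00) (goodR r01)) => u e u01.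
        rewrite !indicE !in_setX !in_setT !andbT !mem_setE /= !in_itv/= u01.
        case/andP: u01 => u0 u1; rewrite u1 andbT; move: u0; rewrite le_eqVlt => /predU1P[<-|u0].
          by rewrite ltxx addr0; congr (nat_of_bool _)%:R; apply/mem_set.
        by rewrite u0 (_ : _ \in _ = false) ?add0r//; apply/negbTE/negP => /set_mem/= h; rewrite h ltxx in u0.
      + move=> A B BA [AD pA gA] [BD pB gB]; split.
        * by move=> p [/AD].
        * by move: pA pB; rewrite -psetE; exact: measurableD.
        have nB : predictable F (fun u e => -1 * \1_B (u, e)).
          by apply: predictableM (pQ pB); apply: predictable_det.
        apply: goodE (goodD (pQ pA) nB (ind1 _) (c' := 1) _ gA (goodZ (-1) (pQ pB) (ind1 _) gB)) => u e.
          rewrite !indicE in_setD; case: (boolP ((u, e) \in B)) => [/[dup] /set_mem/BA/mem_set -> _|_]; last by rewrite mulr0 addr0 andbT.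
          by move=> _; rewrite andbF mulN1r subrr.
        by rewrite mulN1r normrN.
      + move=> A ndA GA; split.
        * by move=> p [n _]; case: (GA n) => + _ _; exact.
        * by rewrite -psetE; apply: bigcupT_measurable => n; rewrite psetE; case: (GA n).
        apply: (goodL (f_ := fun n u e => \1_(A n) (u, e)) (c := 1)).
        * by move=> n; apply: pQ; case: (GA n).
        * by move=> n u e; exact: ind1.
        * move=> u e _; apply: cvg_near_cst.
          have [[n _ An]|nA] := pselect ((\bigcup_n A n) (u, e)).
            exists n => // k /= nk; rewrite !indicE !mem_set//; first by exists n.
            by have /subsetPset := ndA _ _ nk; apply.
          apply: nearW => k; rewrite !indicE !memNset// => Ak; apply: nA; by exists k.
        * by move=> n; case: (GA n).
    - move=> Q' rQ'; split; [exact: rectD| |exact: goodR].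
      case: rQ' => [[A FA ->]|[s [t [A [s0 st t1 FA ->]]]]]; [exact: pset_rectangle0|exact: pset_rectangle].
    - by move=> Q' sQ'; apply: (@smallest_sub _ _ _ [set X | X `<=` D] _ _ _ sQ'); [split => [|A AD|A AD] /=; [exact: sub0set|exact: subDsetl|by apply: bigcup_sub => k _; exact: AD]|exact: rectD].
  have [_ _] := sG _ pQ'; apply: goodE => u e u01.
  by rewrite !indicE in_setI (_ : (u, e) \in D)//; apply/mem_set; split => //=; rewrite in_itv.
have pm (g : R * E -> R) : meas (g : sigmaT (pset F) -> R) -> predictable F (fun u e => g (u, e)).
  by move=> mg; apply/predictableP; move: mg; congr measurable_fun; apply/funext => -[].
pose L (g : R * E -> R) := [/\ meas (g : sigmaT (pset F) -> R),
  exists k : R, forall u e, `|g (u, e)| <= k & good (fun u e => g (u, e))].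
suff : L (fun p => f p.1 p.2) by case.
apply: (@bounded_measurable_ind _ (sigmaT (pset F)) R L _ _ _ _ _ c).
- move=> A mA; split; [exact: measurable_indic|by exists 1|].
  by apply: goodQ; rewrite -psetE.
- move=> g h [mg [k gk] gg] [mh [k' hk] gh]; split; first exact: mfunD.
    by exists (k + k') => u e; rewrite (le_trans (ler_normD _ _))// lerD.
  exact: goodD (pm _ mg) (pm _ mh) gk hk gg gh.
- move=> a g [mg [k gk] gg]; split; first exact: mfunM.
    by exists (`|a| * k) => u e; rewrite normrM ler_wpM2l.
  exact: goodZ (pm _ mg) gk gg.
- move=> g_ g k mg gk gg Lg; split.
  + by apply: (measurable_fun_cvg mg) => p _; exact: gg.
  + exists k => u e; have cv : `|g_ n (u, e)| @[n --> \oo] --> `|g (u, e)| by apply: cvg_norm; exact: gg.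
    apply: (cvg_ler cv) => n; exact: gk.
  + apply: (goodL (f_ := fun n u e => g_ n (u, e)) (c := k)) => //.
    * by move=> n; exact: pm.
    * by move=> n; case: (Lg n).
- exact/predictableP.
- by move=> p; exact: fc.
Qed.

End localized.

Hypothesis lmart : local_martingale P F (compensated N l).

(** With H = 1 the stopped counts have expectation at most C for every localizing time, so N_1 is
    integrable by monotone convergence. N_1 then dominates the stopped sums of a general H, and
    dominated convergence removes the localization. *)
Theorem compensator_formula H (c : R) : pred H -> (bdd H c) ->
  integ P (fun e => (njump (N e))%:R) /\
  \int[P]_e jsum H e = \int[P]_e tint (fun u e => H u e * b u e) e.
Proof.
have [tau [tst tnd [Z [mZ PZ0 tZ]] tmart]] := lmart.
pose S n u e : R := (u <= tau n e)%R%:R.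
(* On the null set [Z], where the localizing times may fail to reach 1, the stopped quantities are
   replaced by the unstopped ones: convergence then holds at every point, and no expectation
   changes. *)
pose X' n f e := if e \in Z then jsum f e else jsum (fun u e => f u e * S n u e) e.
pose T' n f e := if e \in Z then tint (fun u e => f u e * b u e) e else tint (fun u e => f u e * (S n u e * b u e)) e.
have C0 : 0 <= C by have := le_trans (normr_ge0 _) (bC 0 point).
have tau1 e : ~ Z e -> \forall n \near \oo, 1 <= tau n e.
  by move=> nZ; apply: contrapT => h; apply: nZ; apply: tZ.
have aeZ (A B : E -> R) : {ae P, forall e, A e = if e \in Z then B e else A e}.
  exists Z; split => // e /=; apply: contra_notP => nZ; by rewrite memNset.
have mif (A B : E -> R) : meas A -> meas B -> meas (fun e => if e \in Z then A e else B e).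
  move=> mA mB; apply: measurable_fun_ifT => //.
  by apply: (measurable_fun_bool true); rewrite setTI; rewrite (_ : _ @^-1` _ = Z)//; apply/seteqP; split => e /=; [exact: set_mem|exact: mem_set].
have pone : predictable F (fun _ _ => 1 : R) by exact: predictable_det.
have cv1 f e : X' n f e @[n --> \oo] --> jsum f e.
  apply: cvg_near_cst; rewrite /X'; have [eZ|/negP nZ] := boolP (e \in Z).
    exact: nearW.
  have := tau1 e (fun h => nZ (mem_set h)); apply: filterS => n n1; rewrite ?(negbTE (introN idP nZ)).
  by apply: (eq_jsum pN) => s /andP[_ s1]; rewrite /S (le_trans s1 n1) mulr1.
have cv2 f e : T' n f e @[n --> \oo] --> tint (fun u e => f u e * b u e) e.
  apply: cvg_near_cst; rewrite /T'; have [eZ|/negP nZ] := boolP (e \in Z).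
    exact: nearW.
  have := tau1 e (fun h => nZ (mem_set h)); apply: filterS => n n1; rewrite ?(negbTE (introN idP nZ)).
  apply: eq_Ex => u; have [/andP[_ u1]|/pb.2 b0] := boolP (0 <= u <= 1).
    by rewrite /S (le_trans u1 n1) mul1r.
  by rewrite b0 !mulr0.
have mjs f : predictable F f -> meas (jsum f) by move=> pf; exact: (meas_jsum fF pN aN).
have EX n f (k : R) : predictable F f -> (bdd f k) ->
    [/\ integ P (X' n f), integ P (T' n f) & \int[P]_e X' n f e = \int[P]_e T' n f e].
  move=> pf fk; have [i1 i2 e1] := localized_compensator (tst n) (tmart n) pf fk.
  have m1 : meas (X' n f) by apply: mif; [exact: mjs|exact: integ_meas i1].
  have mT : meas (tint (fun u e => f u e * b u e)).
    apply: (meas_Ex leb01 (F := fun p => f p.2 p.1 * b p.2 p.1)).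
    have pfb : pred (fun u e => f u e * b u e).
      split; last by move=> u e u01; rewrite (pb.2 _ _ u01) mulr0.
      by apply/predictableP; apply: mfunM; apply/predictableP => //; case: pb.
    exact: mcomp (meas_pred fF pfb) (@measurable_swap _ _ E R).
  have m2 : meas (T' n f) by apply: mif => //; exact: integ_meas i2.
  have [j1 E1] := Ex_ae i1 m1 (aeZ _ (jsum f)).
  have [j2 E2] := Ex_ae i2 m2 (aeZ _ (tint (fun u e => f u e * b u e))).
  by split => //; rewrite -E1 e1 E2.
have one1 (u : R) (e : E) : `|1 : R| <= 1 by rewrite normr1.
have jle f (k : R) e : (bdd f k) -> `|jsum f e| <= k * (njump (N e))%:R.
  move=> fk; apply: (le_trans (ler_norm_sum _ _ _)).
  rewrite -[X in k * X%:R](card_ord (njump (N e))) mulr_natr -sumr_const.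
  by apply: ler_sum => i _.
have S01 n u e : `|S n u e| <= 1 by rewrite /S; case: (u <= _); rewrite ?normr1 ?normr0.
have X'le n f (k : R) e : (bdd f k) -> `|X' n f e| <= k * (njump (N e))%:R.
  move=> fk; rewrite /X'; case: ifP => _; apply: jle => // u e'.
  by rewrite normrM -[leRHS]mulr1 ler_pM.
have tle (f : R -> E -> R) (k : R) e : (bdd f k) -> meas (f ^~ e) -> `|tint f e| <= k.
  by move=> fk mf; apply: abs_Ex_le.
have mpred f e : predictable F f -> meas (fun u => f u e * b u e).
  move=> pf; have pfb : pred (fun u e => f u e * b u e).
    split; last by move=> u e' u01; rewrite (pb.2 _ _ u01) mulr0.
    by apply/predictableP; apply: mfunM; apply/predictableP => //; case: pb.
  exact: mcomp (meas_pred fF pfb) (measurable_pair2 e).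
have T'le n f (k : R) e : predictable F f -> (bdd f k) -> `|T' n f e| <= k * C.
  move=> pf fk; rewrite /T'; case: ifP => _; apply: tle.
  - by move=> u e'; rewrite normrM ler_pM.
  - exact: mpred.
  - move=> u e'; rewrite normrM ler_pM// normrM -[leRHS]mul1r ler_pM//.
  - under eq_fun do rewrite mulrA.
    apply: (mpred (fun u e => f u e * S n u e)); apply/predictableP; apply: mfunM; apply/predictableP => //.
    exact: predictable_stopping (tst n).
have j1 e : jsum (fun _ _ => 1) e = (njump (N e))%:R.
  by rewrite /Submission.jsum sumr_const card_ord.
have iN : integ P (fun e => (njump (N e))%:R).
  apply: (@integ_monotone _ _ _ P (fun n => X' n (fun _ _ => 1)) _ C).
  - by move=> n; case: (EX n _ 1 pone one1).
  - move=> n e; rewrite /X'; case: ifP => _; apply: sumr_ge0 => i _ //.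
    by rewrite mul1r.
  - move=> e n k nk; rewrite /X'; case: ifP => // _; apply: ler_sum => i _.
    rewrite !mul1r /S; have le1 := tnd e n k nk.
    have [le2|_] := leP (jtime (N e) i) (tau n e); last exact: ler0n.
    by rewrite (le_trans le2 le1).
  - by move=> e; rewrite -j1; exact: cv1.
  - move=> n; have [i1 i2 ->] := EX n _ 1 pone one1.
    apply: Ex_le_cst => // e; apply: (le_trans (ler_norm _)).
    by have := T'le n _ 1 e pone one1; rewrite mul1r.
move=> [pH H0] Hc; split => //.
have c1 : \int[P]_e X' n H e @[n --> \oo] --> \int[P]_e jsum H e.
  apply: (Ex_cvg (Y := fun e => c * (njump (N e))%:R)) => [n|||//].
  - by case: (EX n _ _ pH Hc) => /integ_meas.
  - exact: integZ.
  - by move=> n e; exact: X'le.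
have c2 : \int[P]_e X' n H e @[n --> \oo] --> \int[P]_e tint (fun u e => H u e * b u e) e.
  have e12 n : \int[P]_e X' n H e = \int[P]_e T' n H e by case: (EX n _ _ pH Hc).
  under eq_cvg do rewrite e12.
  apply: (Ex_cvg (Y := fun e => c * C)) => [n|||//].
  - by case: (EX n _ _ pH Hc) => _ /integ_meas.
  - exact: integ_cst.
  - by move=> n e; exact: T'le.
exact: (cvg_unique _ c1 c2).
Qed.

End compensator.

(** * Moments of the jump count and the isometry of compensated integrals *)

Lemma integ_b2rM {d} {T : measurableType d} {R : realType} (P : probability T R)
    (p : T -> bool) (X : T -> R) : meas p -> integ P X -> integ P (fun w => (p w)%:R * X w).
Proof.
move=> mp; apply: (@integMb _ _ _ P (fun w => (p w)%:R) X 1); first exact: mb2r.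
by move=> w; exact: norm_b2r_le1.
Qed.

(** The interface between the martingale assumption and the rest of the proof: [cs_formula] is the
    only link between N and the bounded intensity [b]. *)
Record counting_setup {R : realType} {d} {E : measurableType d} (P : probability E R)
    (F : R -> set_system E) (N : E -> cumulative R R) (b : R -> E -> R) (C : R) : Prop := {
  cs_fil : filtration F;
  cs_path : forall e, counting_path (N e);
  cs_adapted : adapted F (fun t e => N e t);
  cs_pred : pred F b;
  cs_bound : forall s e, `|b s e| <= C;
  cs_formula : forall H (c : R), pred F H -> (bdd H c) ->
    integ P (fun e => (njump (N e))%:R) /\
    \int[P]_e jsum N H e = \int[P]_e tint (fun u e => H u e * b u e) e }.

(** A bound for E (N_1 + 1)^p. The factor p 2^(p-1) is the one of [moment_step], and C times the
    previous value bounds the expectation of int (N_{s-} + 1)^(p-1) dN_s. *)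
Fixpoint moment_bound {R : realType} (C : R) (p : nat) : R :=
  if p is q.+1 then 1 + p%:R * 2 ^+ q * (C * moment_bound C q) else 1.

Section counting.
Context {R : realType} {d} {E : measurableType d} (P : probability E R).
Context (F : R -> set_system E) (N : E -> cumulative R R) (b : R -> E -> R) (C : R).
Hypothesis cs : counting_setup P F N b C.
Implicit Types H K : R -> E -> R.
Notation jsum := (jsum N).
Notation pred := (pred F).
Notation nj e := ((njump (N e))%:R : R).

Let fF := cs_fil cs.
Let pN := cs_path cs.
Let aN := cs_adapted cs.
Let pb := cs_pred cs.
Let bC := cs_bound cs.

Let Fs := fil_sigma fF.

Lemma cs_ge0 : 0 <= C.
Proof. by have := le_trans (normr_ge0 _) (bC 0 point). Qed.

Lemma jsum_le H (c : R) e : (forall u, `|H u e| <= c) -> `|jsum H e| <= c * nj e.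
Proof.
move=> Hc; apply: (le_trans (ler_norm_sum _ _ _)).
rewrite -[X in c * X%:R](card_ord (njump (N e))) mulr_natr -sumr_const.
by apply: ler_sum => i _.
Qed.

Lemma jsumD H K e : jsum (fun u e => H u e + K u e) e = jsum H e + jsum K e.
Proof. exact: big_split. Qed.

Lemma jsumZ a H e : jsum (fun u e => a * H u e) e = a * jsum H e.
Proof. by rewrite /Submission.jsum mulr_sumr. Qed.

Lemma jsumMl (X : E -> R) H e : jsum (fun u e => X e * H u e) e = X e * jsum H e.
Proof. by rewrite /Submission.jsum mulr_sumr. Qed.

Lemma meas_jsum_pred H : pred H -> meas (jsum H).
Proof. by case=> pH _; exact: (meas_jsum fF pN aN pH). Qed.

Lemma integ_njump : integ P (fun e => nj e).
Proof.
have p0 : pred (fun _ _ => 0) by split => //; exact: predictable_det.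
by have [] := cs_formula cs p0 (c := 0) (fun _ _ => _); rewrite ?normr0.
Qed.

Let preb H : pred H -> pred (fun u e => H u e * b u e).
Proof. by move=> [pH _]; exact: predM. Qed.

(** The integral of H dN over the times strictly before u. Leaving out a jump at u itself makes it
    left-continuous, hence predictable. *)
Definition jbefore H u e := jsum (fun v e => (v < u)%R%:R * H v e) e.

Lemma predictable_jbefore H : predictable F H -> predictable F (jbefore H).
Proof.
move=> pH; apply: predictable_left_continuous => //.
  move=> t t01; apply/(meas_wrtP _ (Fs t01)).
  have pt : predictable F (fun v e => (v < t)%R%:R * H v e).
    by apply: predictableM => //; apply: predictable_time => //; exact: mfun_ltr.
  have := adapted_jsum fF pN aN t01 pt; congr measurable_fun; apply/funext => e.
  by apply: eq_bigr => i _; case: ltP => [/ltW ->|]; rewrite ?mul1r// ?mul0r mulr0.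
move=> e t /andP[t0 t1]; apply/cvg_at_leftP => u [ut ucv].
apply: cvg_bigsum => i; apply: cvgM; last exact: cvg_cst.
apply: cvg_near_cst; have [it|ti] := ltP (jtime (N e) i) t.
  by near=> n; rewrite (_ : _ < _ = true)//; near: n; exact: (cvgr_gt t ucv).
by apply: nearW => n; rewrite ltNge (le_trans (ltW (ut n)) ti).
Unshelve. all: by end_near. Qed.

Lemma jbefore_jtime e i : (i < njump (N e))%N -> jbefore (fun _ _ => 1) (jtime (N e) i) e = i%:R.
Proof.
move=> iN; rewrite /jbefore /Submission.jsum -(subnKC (ltnW iN)) big_split_ord/=.
rewrite [X in X + _](eq_bigr (fun=> 1)) => [|k _]; last by rewrite mulr1 jtime_lt.
rewrite sumr_const card_ord big1 ?addr0// => k _; rewrite mulr1.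
have [->|ne] := eqVneq (k : nat) 0%N; first by rewrite addn0 ltxx.
have ik : (i < i + k)%N by rewrite -addn1 leq_add2l lt0n.
have kN : (i + k < njump (N e))%N by rewrite -ltn_subRL.
by rewrite ltNge ltW// jtime_lt.
Qed.

Lemma jbefore1_bound u e : 0 <= jbefore (fun _ _ => 1) u e <= nj e.
Proof.
rewrite sumr_ge0 /=; last by move=> i _; rewrite mulr1.
rewrite /jbefore /Submission.jsum -[X in _ <= X%:R](card_ord (njump (N e))) -sumr_const.
by apply: ler_sum => i _; rewrite mulr1 lern1; case: (_ < _).
Qed.

(** Telescoping, with (n+2)^(p+1) - (n+1)^(p+1) <= (p+1) (n+2)^p <= (p+1) 2^p (n+1)^p. *)
Let moment_step (n p : nat) :
  n.+1%:R ^+ p.+1 <= 1 + p.+1%:R * 2 ^+ p * \sum_(i < n) i.+1%:R ^+ p :> R.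
Proof.
elim: n => [|n IH]; first by rewrite big_ord0 mulr0 addr0 expr1n.
rewrite big_ord_recr/= mulrDr addrA.
have : n.+2%:R ^+ p.+1 - n.+1%:R ^+ p.+1 <= p.+1%:R * 2 ^+ p * n.+1%:R ^+ p :> R; last first.
  by rewrite lerBlDr => /le_trans; apply; rewrite [leLHS]addrC lerD2r.
rewrite subrXX -natrB// subSnn mul1r.
apply: (@le_trans _ _ (\sum_(i < p.+1) n.+2%:R ^+ p)).
  apply: ler_sum => i _; rewrite -[in leRHS](subnK (_ : i <= p)%N) ?exprD; last by rewrite -ltnS.
  by rewrite /= ler_wpM2l ?exprn_ge0// lerXn2r ?nnegrE// ler_nat.
rewrite sumr_const card_ord -[leLHS]mulr_natl -mulrA ler_wpM2l// -exprMn lerXn2r ?nnegrE ?mulr_ge0//.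
by rewrite -natrM ler_nat mul2n -addnn addSn addnS !ltnS leq_addr.
Qed.

(** At the jump of index i, counted from 0, one has N_{s-} + 1 = i + 1. The sum in [moment_step] is
    therefore int (N_{s-} + 1)^p dN_s, whose expectation is at most C E (N_1 + 1)^p. *)
Lemma njump_moment p : integ P (fun e => (nj e + 1) ^+ p) /\
  \int[P]_e (nj e + 1) ^+ p <= moment_bound C p.
Proof.
elim: p => [|p [iIH IH]]; first by split; [exact: integ_cst|rewrite (eq_Ex _ (Y := fun=> 1)) ?Ex_cst].
pose g u e := jbefore (fun _ _ => 1) u e + 1.
(* The compensator identity asks for bounded integrands, hence the cap at k; it is removed as k
   grows. *)
pose K k u e := (0 <= u <= 1)%R%:R * Num.min ((g u e) ^+ p) k%:R.
have g1 u e : 1 <= g u e by rewrite lerDr; case/andP: (jbefore1_bound u e).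
have gn u e : g u e <= nj e + 1 by rewrite lerD2r; case/andP: (jbefore1_bound u e).
have K0 k u e : 0 <= K k u e.
  by rewrite mulr_ge0// le_min ler0n andbT exprn_ge0// (le_trans ler01).
have Kk k u e : `|K k u e| <= k%:R.
  rewrite ger0_norm//; rewrite /K; case: (0 <= u <= 1); rewrite ?mul1r ?mul0r//.
  by rewrite ge_min lexx orbT.
have Kg k u e : K k u e <= (nj e + 1) ^+ p.
  rewrite /K; case: (0 <= u <= 1); rewrite ?mul1r ?mul0r ?exprn_ge0 ?addr_ge0//.
  rewrite ge_min lerXn2r ?nnegrE ?addr_ge0//.
  by case/andP: (jbefore1_bound u e).
have pK k : pred (K k).
  apply: pred_mask => //; have pg : predictable F g.
    apply: (predictable_comp (f := fun y => y + 1)); first exact: mfunD.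
    by apply: predictable_jbefore; exact: predictable_det.
  apply: (predictable_comp (f := fun y => Num.min (y ^+ p) k%:R)) pg.
  by apply: measurable_minr => //; exact: mfunX.
pose X k e := jsum (K k) e.
pose Y e : R := \sum_(i < njump (N e)) i.+1%:R ^+ p.
have iX k : integ P (X k).
  apply: (@integ_le _ _ _ P _ (fun e => k%:R * nj e)); first exact: meas_jsum_pred.
    exact/integZ/integ_njump.
  by move=> e; exact: jsum_le.
have XY e : X k e @[k --> \oo] --> Y e.
  apply: cvg_bigsum => i; apply: cvg_near_cst.
  exists (Num.truncn ((i.+1%:R : R) ^+ p)).+1 => // k /= ki; rewrite /K.
  rewrite (ltW (jtime_gt0 (pN e) i)) (jtime_le1 (pN e)) ltn_ord mul1r /g jbefore_jtime// natr1.
  by apply/min_idPl/ltW; apply: lt_le_trans (truncnS_gt _) _; rewrite ler_nat.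
have Xb k : \int[P]_e X k e <= C * moment_bound C p.
  rewrite (cs_formula cs (pK k) (Kk k)).2; apply: (@le_trans _ _ (\int[P]_e (C * (nj e + 1) ^+ p))).
    apply: le_Ex; last 2 first.
    - exact: integZ.
    - move=> e; apply: (le_trans (ler_norm _)); apply: tint_le (preb (pK k)) _ => // u.
      by rewrite normrM mulrC ler_pM// ger0_norm.
    apply: (@integ_bnd _ _ _ P _ (k%:R * C)); first exact: meas_tint (preb (pK k)).
    by move=> e; apply: tint_le (preb (pK k)) _ => // u; rewrite normrM ler_pM.
  by rewrite ExZ// ler_wpM2l// cs_ge0.
have iY : integ P Y.
  apply: (@integ_monotone _ _ _ P X Y (C * moment_bound C p)) => //.
  - by move=> k e; apply: sumr_ge0 => i _.
  - move=> e k l kl; apply: ler_sum => i _; apply: ler_wpM2l => //.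
    by rewrite le_min ge_min lexx/= ge_min ler_nat kl orbT.
have EY : \int[P]_e Y e <= C * moment_bound C p.
  have cv : \int[P]_e X k e @[k --> \oo] --> \int[P]_e Y e.
    apply: (Ex_cvg (Y := Y)) => // [k|k e]; first exact: integ_meas.
    rewrite ger0_norm ?sumr_ge0//; apply: ler_sum => i _; rewrite /K /g jbefore_jtime//.
    by case: (0 <= _ <= 1); rewrite ?mul1r ?mul0r ?exprn_ge0// ge_min natr1 lexx.
  rewrite -(cvg_lim _ cv)//; apply: limr_le; first by apply/cvg_ex; eexists; exact: cv.
  exact: nearW.
pose W e := 1 + p.+1%:R * 2 ^+ p * Y e.
have iW : integ P W by apply: integD (integ_cst _ _) (integZ _ iY).
have le e : (nj e + 1) ^+ p.+1 <= W e by rewrite natr1; exact: moment_step.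
have ipow : integ P (fun e => (nj e + 1) ^+ p.+1).
  apply: integ_le iW _ => [|e]; last by rewrite ger0_norm// exprn_ge0// addr_ge0.
  by apply: mfunX; apply: mfunD => //; exact: integ_meas integ_njump.
split => //; apply: (le_trans (le_Ex ipow iW le)).
rewrite /W ExD ?ExZ ?Ex_cst//=; [|exact: integ_cst|exact: integZ].
by rewrite lerD2l ler_wpM2l// mulr_ge0// exprn_ge0.
Qed.

(** The stochastic integral int_0^1 H dM for M = N - int b ds. *)
Definition mint H e : R := jsum H e - tint (fun u e => H u e * b u e) e.

Lemma mint_le H (c : R) e : pred H -> (forall u, `|H u e| <= c) -> `|mint H e| <= c * (nj e + C).
Proof.
move=> pH Hc; rewrite mulrDr; apply: (le_trans (ler_normB _ _)); apply: lerD; first exact: jsum_le.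
by apply: tint_le (preb pH) _ => // u; rewrite normrM ler_pM.
Qed.

Lemma meas_mint H : pred H -> meas (mint H).
Proof.
move=> pH; apply: mfunB; first exact: meas_jsum_pred.
exact: meas_tint (preb pH).
Qed.

Lemma integ_mint H (c : R) : pred H -> (bdd H c) -> integ P (mint H).
Proof.
move=> pH Hc; apply: (@integ_le _ _ _ P _ (fun e => c * (nj e + C))); first exact: meas_mint.
  by apply: integZ; apply: integD (integ_njump) (integ_cst _ _).
by move=> e; apply: mint_le.
Qed.

Lemma mintD H K (c c' : R) e : pred H -> pred K -> (forall u, `|H u e| <= c) -> (forall u, `|K u e| <= c') ->
  mint (fun u e => H u e + K u e) e = mint H e + mint K e.
Proof.
move=> pH pK Hc Kc; rewrite /mint jsumD.
have -> : tint (fun u e => (H u e + K u e) * b u e) e =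
    tint (fun u e => H u e * b u e) e + tint (fun u e => K u e * b u e) e.
  rewrite /tint -ExD.
  - by apply: eq_Ex => u; rewrite mulrDl.
  - by apply: (integ_pred (c := c * C) fF (preb pH)) => u; rewrite normrM ler_pM.
  - by apply: (integ_pred (c := c' * C) fF (preb pK)) => u; rewrite normrM ler_pM.
by rewrite opprD addrACA.
Qed.

Lemma mintZ a H (c : R) e : pred H -> (forall u, `|H u e| <= c) ->
  mint (fun u e => a * H u e) e = a * mint H e.
Proof.
move=> pH Hc; rewrite /mint jsumZ mulrBr; congr (_ - _).
rewrite /tint -ExZ; first by apply: eq_Ex => u; rewrite mulrA.
by apply: (integ_pred (c := c * C) fF (preb pH)) => u; rewrite normrM ler_pM.
Qed.

(** Centring when the integrand only has a random bound Y, as happens for [mbefore H u e * H u e]: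
    the integrand is truncated at level n, and Y (N_1 + C) dominates the resulting integrals. *)
Lemma expectation_mint K (Y : E -> R) : pred K -> (forall u e, `|K u e| <= Y e) ->
  integ P Y -> integ P (fun e => Y e * nj e) ->
  integ P (mint K) /\ \int[P]_e mint K e = 0.
Proof.
move=> pK KY iY iYn.
have Y0 e : 0 <= Y e by have := le_trans (normr_ge0 _) (KY 0 e).
pose t n (y : R) := Num.max (- n%:R) (Num.min y n%:R).
have t1 n y : `|t n y| <= n%:R.
  rewrite /t ler_norml le_max lexx/= ge_max ge_min lexx orbT andbT.
  by apply: (le_trans (y := 0)) => //; rewrite oppr_le0.
have t2 n y : `|t n y| <= `|y|.
  rewrite /t; have n0 : 0 <= n%:R :> R by [].
  have a1 : - `|y| <= y by rewrite lerNl -normrN ler_norm.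
  have a2 : - `|y| <= n%:R by rewrite (le_trans _ n0)// oppr_le0.
  have a3 : - n%:R <= `|y| by rewrite (le_trans (y := 0))// oppr_le0.
  by rewrite ler_norml le_max le_min ge_max ge_min ler_norm a1 a2 a3 orbT.
have t3 y : t n y @[n --> \oo] --> y.
  apply: cvg_near_cst; exists (Num.truncn `|y|).+1 => // n /= ln; rewrite /t.
  have : `|y| <= n%:R by apply/ltW/(lt_le_trans (truncnS_gt _)); rewrite ler_nat.
  by rewrite ler_norml => /andP[a b']; rewrite (min_idPl b') (max_idPr a).
have mt n : meas (t n) by apply: measurable_maxr => //; exact: measurable_minr.
have t0 n : t n 0 = 0.
  by have := t2 n 0; rewrite normr0 normr_le0 => /eqP.
have pt n : pred (fun u e => t n (K u e)) by apply: pred_comp.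
have tY n u e : `|t n (K u e)| <= Y e by exact: le_trans (t2 _ _) (KY _ _).
have iM : integ P (fun e => Y e * (nj e + C)).
  have := integD iYn (integZ C iY); congr integrable; apply/funext => e /=.
  by rewrite mulrDr [C * _]mulrC.
have cv e : mint (fun u e => t n (K u e)) e @[n --> \oo] --> mint K e.
  apply: cvgB; first by apply: cvg_bigsum => i; exact: t3.
  apply: (Ex_cvg (P := leb01) (Y := fun=> Y e * C)).
  - by move=> n; exact: (meas_pred1 fF e (preb (pt n))).
  - exact: integ_cst.
  - by move=> n u; rewrite normrM ler_pM.
  - by move=> u; apply: cvgM; [exact: t3|exact: cvg_cst].
have [i1 c1] := Ex_dct (fun n => meas_mint (pt n)) iM (fun n e => mint_le (pt n) (fun u => tY n u e)) cv.
split => //; have z n : \int[P]_e mint (fun u e => t n (K u e)) e = 0.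
  have tn u e : `|t n (K u e)| <= n%:R by exact: t1.
  rewrite /mint ExB; first by rewrite (cs_formula cs (pt n) tn).2 subrr.
    apply: (@integ_le _ _ _ P _ (fun e => n%:R * nj e)); first exact: meas_jsum_pred.
      exact/integZ/integ_njump.
    by move=> e; exact: jsum_le.
  apply: (@integ_bnd _ _ _ P _ (n%:R * C)); first exact: meas_tint (preb (pt n)).
  by move=> e; apply: tint_le (preb (pt n)) _ => // u; rewrite normrM ler_pM.
move: c1; under eq_cvg do rewrite z; move=> c1.
exact: (cvg_unique _ c1 (cvg_cst 0)).
Qed.

(* Integration by parts: [Z_1^2 = \int H^2 dN + 2 \int Z_{s-} dZ_s] for [Z = mint H]. *)
Definition mbefore H u e := jbefore H u e - tint (fun v e => (v <= u)%R%:R * (H v e * b v e)) e.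

(** The square is its diagonal plus twice the pairs ordered by jump time; for distinct indices
    exactly one order holds because jump times are distinct. *)
Let jtime_diag e (a : nat -> R) : let n := njump (N e) in
  (\sum_(i < n) a i) ^+ 2 = \sum_(i < n) a i ^+ 2 +
   2 * \sum_(i < n) (a i * \sum_(j < n) (jtime (N e) j < jtime (N e) i)%R%:R * a j).
Proof.
move=> n; set tau := jtime (N e).
have tri (i j : 'I_n) : 1 = (i == j)%:R + (tau j < tau i)%R%:R + (tau i < tau j)%R%:R :> R.
  case: (eqVneq i j) => [->|ne]; first by rewrite ltxx !addr0.
  have [ij|ij] : (i < j)%N \/ (j < i)%N.
    by apply/orP; move: ne; rewrite -(inj_eq val_inj) /= neq_ltn.
  - have h := jtime_lt (pN e) ij (ltn_ord j).
    by rewrite h ltNge ltW// add0r add0r.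
  - have h := jtime_lt (pN e) ij (ltn_ord i).
    by rewrite h ltNge (ltW h) add0r addr0.
have dbl : \sum_(i < n) (a i * \sum_(j < n) (tau j < tau i)%R%:R * a j) =
    \sum_(i < n) \sum_(j < n) (tau i < tau j)%R%:R * (a i * a j).
  rewrite exchange_big/=; apply: eq_bigr => i _; rewrite mulr_sumr.
  by apply: eq_bigr => j _; rewrite mulrCA [a i * _]mulrC.
rewrite mulr2n mulrDl mul1r {2}dbl expr2 mulr_suml.
rewrite addrA -big_split -big_split/=; apply: eq_bigr => i _.
rewrite !mulr_sumr (bigD1 i)//= [X in _ + X + _](bigD1 i)//= [X in _ = _ + X](bigD1 i)//=.
rewrite ltxx !mul0r mulr0 !add0r -expr2 -addrA; congr (_ + _).
rewrite -big_split/=; apply: eq_bigr => j ji.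
have := tri i j; rewrite eq_sym (negbTE ji) add0r => h.
by rewrite -[LHS]mul1r {1}h; ring.
Qed.

(** The integral over the unit square is twice the one over {v <= u}: Fubini exchanges the two
    triangles, and the diagonal is a null set. *)
Let tint_square (f : R -> R) (c : R) : meas f -> (forall u, `|f u| <= c) ->
  2 * \int[leb01]_u (f u * \int[leb01]_v ((v <= u)%R%:R * f v)) = (\int[@leb01 R]_u f u) ^+ 2.
Proof.
move=> mf fc; pose I := \int[@leb01 R]_u f u; rewrite -/I.
have mle : meas (fun p : R * R => (p.2 <= p.1)%R%:R * (f p.1 * f p.2)).
  apply: mfunM.
    by apply: mb2r; apply: mfun_ler.
  by apply: mfunM; exact: mcomp.
have c0 : 0 <= c by exact: le_trans (fc 0).
have bnd (p : bool) u v : `|p%:R * (f u * f v)| <= c * c.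
  by rewrite normrM -[leRHS]mul1r ler_pM// ?norm_b2r_le1// normrM ler_pM.
have [i1 i2 sw] := fubini_bnd leb01 leb01 mle (fun u v => bnd (v <= u) u v).
have if_ : integ leb01 f by exact: (integ_bnd leb01 mf fc).
have ile u : integ leb01 (fun v => (v <= u)%R%:R * f v).
  by apply: integ_b2rM if_; exact: mfun_ler.
have E1 : \int[leb01]_u (f u * \int[leb01]_v ((v <= u)%R%:R * f v)) =
    \int[leb01]_u \int[leb01]_v ((v <= u)%R%:R * (f u * f v)).
  by apply: eq_Ex => u; rewrite -ExZ//; apply: eq_Ex => v; ring.
have E2 : \int[leb01]_u (f u * \int[leb01]_v ((v <= u)%R%:R * f v)) =
    \int[leb01]_v (f v * (I - \int[leb01]_u ((u <= v)%R%:R * f u))).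
  rewrite E1 sw; apply: eq_Ex => v.
  have ige : integ leb01 (fun u => (v <= u)%R%:R * f u).
    by apply: integ_b2rM if_; exact: mfun_ler.
  have -> : I - \int[leb01]_u ((u <= v)%R%:R * f u) = \int[leb01]_u ((v <= u)%R%:R * f u).
    apply/eqP; rewrite -subr_eq0 /I -(ExB if_ (ile v)) -(ExB (integB if_ (ile v)) ige).
    rewrite (Rintegral_leb01_at (a := v))// => u uv.
    by case: (ltgtP u v) uv => // _ _; rewrite ?mul1r ?mul0r ?subr0 ?subrr.
  by rewrite -(ExZ _ ige); apply: eq_Ex => u /=; ring.
have iF : integ leb01 (fun u => f u * \int[leb01]_v ((v <= u)%R%:R * f v)).
  by move: i1; congr integrable; apply/funext => u /=; congr EFin; rewrite -ExZ//; apply: eq_Ex => v; ring.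
have : \int[leb01]_v (f v * (I - \int[leb01]_u ((u <= v)%R%:R * f u))) =
    I * I - \int[leb01]_u (f u * \int[leb01]_v ((v <= u)%R%:R * f v)).
  transitivity (\int[leb01]_v (I * f v - f v * \int[leb01]_u ((u <= v)%R%:R * f u))).
    by apply: eq_Ex => v; rewrite mulrBr [f v * I]mulrC.
  by rewrite (ExB (integZ I if_) iF) (ExZ I if_).
rewrite -E2 => /eqP; rewrite eq_sym subr_eq => /eqP h.
by rewrite expr2 h -mulr2n mulr_natl.
Qed.

Lemma predictable_mbefore H (c : R) : pred H -> (bdd H c) ->
  predictable F (mbefore H).
Proof.
move=> pH Hc; have pHb := preb pH.
have Hbc u e : `|H u e * b u e| <= c * C by rewrite normrM ler_pM.
have pT : predictable F (fun u e => tint (fun v e => (v <= u)%R%:R * (H v e * b v e)) e).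
  apply: predictable_left_continuous => //.
    move=> t t01; apply/(meas_wrtP _ (Fs t01)).
    have := adapted_tint fF t01 pHb.1; congr measurable_fun; apply/funext => e.
    apply: eq_Ex => v; have [v0|v0] := leP 0 v; first by [].
    by rewrite pHb.2 ?mulr0// negb_and -ltNge v0.
  move=> e t /andP[t0 t1]; apply/cvg_at_leftP => u [ut ucv].
  have -> : tint (fun v e => (v <= t)%R%:R * (H v e * b v e)) e =
      tint (fun v e => (v < t)%R%:R * (H v e * b v e)) e.
    apply/eqP; rewrite -subr_eq0 /tint -ExB.
    - rewrite (Rintegral_leb01_at (a := t))// => v vt.
      by case: ltgtP vt => // _ _; rewrite ?subrr.
    - apply: integ_b2rM; first exact: mfun_ler.
      exact: (integ_pred fF pHb (fun v => Hbc v e)).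
    - apply: integ_b2rM; first exact: mfun_ltr.
      exact: (integ_pred fF pHb (fun v => Hbc v e)).
  apply: (Ex_cvg (P := leb01) (Y := fun=> c * C)).
  - move=> n; apply: mfunM; last exact: (meas_pred1 fF e pHb).
    by apply: mb2r; exact: mfun_ler.
  - exact: integ_cst.
  - by move=> n v; rewrite normrM -[leRHS]mul1r ler_pM// ?norm_b2r_le1.
  - move=> v; apply: cvgM; last exact: cvg_cst.
    apply: cvg_near_cst; have [vt|tv] := ltP v t.
      by near=> n; rewrite (_ : _ <= _ = true)//; apply: ltW; near: n; exact: (cvgr_gt t ucv).
    by apply: nearW => n; rewrite leNgt (lt_le_trans (ut n) tv).
exact: predictableB (predictable_jbefore pH.1) pT.
Unshelve. all: by end_near. Qed.

Lemma mbefore_le H (c : R) u e : pred H -> (bdd H c) ->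
  `|mbefore H u e| <= c * (nj e + C).
Proof.
move=> pH Hc; rewrite mulrDr; apply: (le_trans (ler_normB _ _)); apply: lerD.
  by apply: jsum_le => v; rewrite normrM -[leRHS]mul1r ler_pM// ?norm_b2r_le1.
have pHb := preb pH.
have pK : pred (fun v e => (v <= u)%R%:R * (H v e * b v e)).
  by apply: predM => //; apply: predictable_time => //; exact: mfun_ler.
by apply: tint_le pK _ => // v; rewrite normrM -[leRHS]mul1r ler_pM// ?norm_b2r_le1// normrM ler_pM.
Qed.

(** With S the jump sum and I the time integral, (S - I)^2 is expanded: S^2 is split by
    [jtime_diag], I^2 by [tint_square], and S I by whether the jump comes before or after the
    integration time. The pieces regroup into the integral of Z_{s-} against dZ_s. *)
Lemma mint_square H (c : R) e : pred H -> (bdd H c) ->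
  mint H e ^+ 2 = jsum (fun u e => H u e ^+ 2) e + 2 * mint (fun u e => mbefore H u e * H u e) e.
Proof.
move=> pH Hc; have pHb := preb pH.
have Hbc u : `|H u e * b u e| <= c * C by rewrite normrM ler_pM.
pose f u := H u e * b u e; pose G u := \int[leb01]_v ((v <= u)%R%:R * f v).
pose I := \int[leb01]_u f u; pose n := njump (N e); pose a i := H (jtime (N e) i) e.
have mf : meas f := meas_pred1 fF e pHb.
have if_ : integ leb01 f := integ_pred fF pHb Hbc.
have ile (p : R -> bool) : meas p -> integ leb01 (fun v => (p v)%:R * f v).
  by move=> mp; exact: integ_b2rM.
have Gb u : `|G u| <= c * C.
  apply: abs_Ex_le; first by apply: integ_meas (ile _ _); exact: mfun_ler.
  by move=> v; rewrite normrM -[leRHS]mul1r ler_pM// ?norm_b2r_le1//; exact: Hbc.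
have mG : meas G.
  apply: (meas_Ex leb01 (F := fun p => (p.2 <= p.1)%R%:R * f p.2)).
  apply: mfunM; last exact: mcomp.
  by apply: mb2r; apply: mfun_ler.
have ifG : integ leb01 (fun u => f u * G u).
  exact: (@integMb _ _ _ leb01 f G (c * C) mf Hbc (integ_bnd leb01 mG Gb)).
(* The compensator half of the last integral: a jump at tau_j acts at the times u > tau_j, which
   leaves I minus the integral up to tau_j. *)
have E1 : tint (fun u e => mbefore H u e * H u e * b u e) e =
    \sum_(j < n) (a j * (I - G (jtime (N e) j))) - \int[leb01]_u (f u * G u).
  have -> : \sum_(j < n) (a j * (I - G (jtime (N e) j))) =
      \int[leb01]_u \sum_(j < n) (a j * ((jtime (N e) j < u)%R%:R * f u)).
    rewrite Ex_sum => [|j]; last by apply/integZ/ile; exact: mfun_ltr.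
    apply: eq_bigr => j _; rewrite ExZ; last by apply: ile; exact: mfun_ltr.
    congr (_ * _); rewrite /I /G -ExB//; last by apply: ile; exact: mfun_ler.
    by apply: eq_Ex => u; rewrite ltNge; case: (u <= _); rewrite /= ?mul1r ?mul0r ?subrr ?subr0.
  rewrite -ExB//; last by apply: integ_sum => j; apply/integZ/ile; exact: mfun_ltr.
  apply: eq_Ex => u; rewrite /mbefore -/(G u) -mulrA -/(f u) mulrBl [G u * _]mulrC; congr (_ - _).
  by rewrite /jbefore /Submission.jsum mulr_suml; apply: eq_bigr => j _; rewrite -mulrA mulrCA.
rewrite /mint E1 /Submission.jsum -/n.
have -> : \sum_(i < n) mbefore H (jtime (N e) i) e * H (jtime (N e) i) e =
    \sum_(i < n) (a i * \sum_(j < n) (jtime (N e) j < jtime (N e) i)%R%:R * a j) - \sum_(i < n) a i * G (jtime (N e) i).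
  by rewrite -sumrB; apply: eq_bigr => i _; rewrite -mulrBr mulrC.
have -> : tint (fun u e => H u e * b u e) e = I by [].
have D := jtime_diag e a; have T := tint_square mf Hbc.
have -> : \sum_(j < n) (a j * (I - G (jtime (N e) j))) = (\sum_(i < n) a i) * I - \sum_(i < n) a i * G (jtime (N e) i).
  by rewrite mulr_suml -sumrB; apply: eq_bigr => i _; rewrite mulrBr.
move: D T; rewrite -/I /= -/n.
have -> : \sum_(i < n) H (jtime (N e) i) e = \sum_(i < n) a i by [].
have -> : \sum_(i < n) H (jtime (N e) i) e ^+ 2 = \sum_(i < n) a i ^+ 2 by [].
rewrite sqrrB => ->; rewrite -/(G _) => <-.
move: (\sum_(i < n) a i) (\sum_(i < n) (a i * \sum_(j < n) _)) (\sum_(i < n) a i ^+ 2) (\sum_(i < n) (a i * G _)) => s1 s2 s3 s4.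
by rewrite /G; ring.
Qed.

Lemma integ_mom (p q : nat) : integ P (fun e => (nj e) ^+ p * (nj e + 1) ^+ q).
Proof.
apply: integ_le (njump_moment (p + q)).1 _ => [|e].
  by apply: mfunM; apply: mfunX => //; [|apply: mfunD => //]; exact: integ_meas integ_njump.
rewrite ger0_norm; last by rewrite mulr_ge0 ?exprn_ge0// addr_ge0.
rewrite exprD ler_wpM2r ?exprn_ge0 ?addr_ge0// lerXn2r ?nnegrE ?addr_ge0//.
by rewrite lerDl.
Qed.

(** The martingale term of [mint_square] has mean 0. Its integrand is bounded only by c^2 (N_1 + C),
    so the second moment of N_1 enters. *)
Lemma mint_isometry H (c : R) : pred H -> (bdd H c) ->
  integ P (fun e => mint H e ^+ 2) /\
  \int[P]_e (mint H e ^+ 2) = \int[P]_e jsum (fun u e => H u e ^+ 2) e.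
Proof.
move=> pH Hc; have c0 : 0 <= c by have := le_trans (normr_ge0 _) (Hc 0 point).
pose K u e := mbefore H u e * H u e.
have pK : pred K by apply: predM => //; exact: predictable_mbefore Hc.
pose Y e := c * (nj e + C) * c.
have KY u e : `|K u e| <= Y e by rewrite normrM ler_pM//; exact: mbefore_le.
have iY : integ P Y.
  have := integZ (c * c) (integD integ_njump (integ_cst P C)).
  by congr integrable; apply/funext => e /=; rewrite /Y mulrAC.
have iYn : integ P (fun e => Y e * nj e).
  have := integD (integZ (c * c) (integ_mom 2 0)) (integZ (c * c * C) integ_njump).
  by congr integrable; apply/funext => e /=; rewrite /Y expr0 mulr1; congr EFin; ring.
have [iM EM] := expectation_mint pK KY iY iYn.
have H2 u e : `|H u e ^+ 2| <= c ^+ 2 by rewrite normrX lerXn2r ?nnegrE.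
have iJ : integ P (jsum (fun u e => H u e ^+ 2)).
  apply: (@integ_le _ _ _ P _ (fun e => c ^+ 2 * nj e)).
  - apply: meas_jsum_pred; apply: (pred_comp (f := fun y => y ^+ 2)) => //; last by rewrite expr0n.
  - exact/integZ/integ_njump.
  - by move=> e; apply: jsum_le.
have sq : (fun e => mint H e ^+ 2) = fun e => jsum (fun u e => H u e ^+ 2) e + 2 * mint K e.
  by apply/funext => e; exact: mint_square Hc.
rewrite sq; split; first exact: integD iJ (integZ 2 iM).
by rewrite (ExD iJ (integZ 2 iM)) (ExZ 2 iM) EM mulr0 addr0.
Qed.

End counting.

(** * Independence: decoupling and generated sigma-algebras *)

Section decoupling.
Context {d d1 d2} {T : measurableType d} {T1 : measurableType d1} {T2 : measurableType d2}.
Context {R : realType} (P : probability T R) (U : T -> T1) (V : T -> T2).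
Hypotheses (mU : meas U) (mV : meas V).
Hypothesis indUV : forall A B, measurable A -> measurable B ->
  P (U @^-1` A `&` V @^-1` B) = (P (U @^-1` A) * P (V @^-1` B))%E.

Let U' : {mfun T >-> T1} := mfun_Sub (mem_set mU).
Let V' : {mfun T >-> T2} := mfun_Sub (mem_set mV).
Let mW : meas (fun w => (U w, V w)). Proof. exact: mpair. Qed.
Let W' : {mfun T >-> (T1 * T2)%type} := mfun_Sub (mem_set mW).

Let joint X : measurable X -> (distribution P U' \x distribution P V')%E X = distribution P W' X.
Proof.
apply: product_measure_unique => A B mA mB.
by rewrite /= /distribution /pushforward /= -indUV.
Qed.

Lemma ge0_decouple (F : T1 * T2 -> \bar R) : meas F -> (forall p, (0 <= F p)%E) ->
  (\int[P]_w F (U w, V w) = \int[P]_w \int[P]_w' F (U w, V w'))%E.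
Proof.
move=> mF F0.
transitivity (\int[distribution P W']_p F p)%E.
  by rewrite ge0_integral_distribution.
transitivity (\int[distribution P U' \x distribution P V']_p F p)%E.
  by apply: eq_measure_integral => A mA _; exact/esym/joint.
rewrite fubini_tonelli1// /fubini_F ge0_integral_distribution//.
- apply: eq_integral => w _ /=; rewrite ge0_integral_distribution//.
  exact: mcomp mF (measurable_pair1 _).
- exact: measurable_fun_fubini_tonelli_F.
- by move=> x; apply: integral_ge0.
Qed.

Lemma decouple (F : T1 * T2 -> R) : meas F ->
  (forall w, integ P (fun w' => F (U w, V w'))) ->
  (\int[P]_w \int[P]_w' `|F (U w, V w')|%:E < +oo)%E ->
  [/\ integ P (fun w => F (U w, V w)), integ P (fun w => \int[P]_w' F (U w, V w'))
    & \int[P]_w F (U w, V w) = \int[P]_w \int[P]_w' F (U w, V w')].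
Proof.
move=> mF iF Ffin; have mEF : meas (EFin \o F) by exact/mEFinP.
have iW : integ P (fun w => F (U w, V w)).
  apply/integrableP; split; first exact/mEFinP/(mcomp mF mW).
  rewrite (ge0_decouple (F := fun p => `|(F p)%:E|%E))//; last exact: mcomp.
have iJ : (distribution P U' \x distribution P V')%E.-integrable setT (EFin \o F).
  apply/integrableP; split => //.
  rewrite (_ : (\int[_]_x _)%E = (\int[distribution P W']_x `|(EFin \o F) x|)%E).
    rewrite ge0_integral_distribution//=.
    - by have /integrableP[] := iW.
    - by apply/mEFinP; exact: mcomp.
  by apply: eq_measure_integral => A mA _; exact: joint.
have e1 w : fubini_F (distribution P V') (EFin \o F) (U w) = (\int[P]_w' F (U w, V w'))%:E.
  rewrite /fubini_F EFin_Ex//.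
  rewrite [LHS](integral_pushforward mV)//.
    exact: mcomp mEF (measurable_pair1 _).
  exact: iF.
have i1 := integrable_fubini_F iJ.
have i2 : integ P (fun w => \int[P]_w' F (U w, V w')).
  have [m1 f1] := integrableP _ _ _ i1.
  have e2 : (fun w => (\int[P]_w' F (U w, V w'))%:E) = fubini_F (distribution P V') (EFin \o F) \o U.
    by apply/funext => w; rewrite /= e1.
  apply/integrableP; split.
    by rewrite [X in measurable_fun _ X]e2; exact: mcomp m1 mU.
  move: f1; rewrite ge0_integral_distribution//=; last exact: mcomp.
  by under eq_integral do rewrite e1.
split => //; apply: EFin_inj; rewrite !EFin_Ex//.
transitivity (\int[distribution P W']_p (F p)%:E)%E.
  rewrite [RHS](integral_pushforward mW)//.
transitivity (\int[distribution P U' \x distribution P V']_p (F p)%:E)%E.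
  by apply: eq_measure_integral => A mA _; exact/esym/joint.
rewrite -(integral12_prod_meas1 iJ).
rewrite [LHS](integral_pushforward mU)//; first by apply: eq_integral => w _; exact: e1.
  exact: measurable_int i1.
by apply: (eq_integrable _ _ _ _ i2) => // w _; rewrite /= e1.
Qed.

End decoupling.

Section dynkin.
Context {d} {T : measurableType d} {R : realType} (P : probability T R).

Let EInd A (Z : T -> R) : (\int[P]_(e in A) (Z e)%:E)%E = (\int[P]_e (\1_A e * Z e)%:E)%E.
Proof.
rewrite integral_mkcond; apply: eq_integral => e _; rewrite patchE indicE.
by case: (e \in A); rewrite ?mul1r ?mul0r.
Qed.

Lemma Ex_dynkin (G : set_system T) (Z1 Z2 : T -> R) : integ P Z1 -> integ P Z2 ->
  G `<=` measurable -> setI_closed G -> \int[P]_e Z1 e = \int[P]_e Z2 e ->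
  (forall A, G A -> \int[P]_e (\1_A e * Z1 e) = \int[P]_e (\1_A e * Z2 e)) ->
  forall A, <<s G >> A -> \int[P]_e (\1_A e * Z1 e) = \int[P]_e (\1_A e * Z2 e).
Proof.
move=> i1 i2 Gm GI ET EG A.
pose L := [set A | measurable A /\ (\int[P]_(e in A) (Z1 e)%:E = \int[P]_(e in A) (Z2 e)%:E)%E].
have sub B i : measurable B -> P.-integrable B (EFin \o (if i then Z1 else Z2)).
  by move=> mB; apply: (integrableS measurableT mB) => //; case: i.
have LE B : measurable B -> \int[P]_e (\1_B e * Z1 e) = \int[P]_e (\1_B e * Z2 e) -> L B.
  move=> mB EB; split => //; have j1 := integ_indicM mB i1; have j2 := integ_indicM mB i2.
  by rewrite EInd [RHS]EInd -(EFin_Ex j1) -(EFin_Ex j2) EB.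
have DL : dynkin L.
  split.
  - by split => //; rewrite -!EFin_Ex// ET.
  - move=> B [mB EB]; split; first exact: measurableC.
    have split12 i : (\int[P]_(e in ~` B) ((if i then Z1 else Z2) e)%:E =
        \int[P]_e ((if i then Z1 else Z2) e)%:E - \int[P]_(e in B) ((if i then Z1 else Z2) e)%:E)%E.
      have mC := measurableC mB.
      rewrite -(setvU B) integral_setU_EFin//; last by apply/disj_setPS; rewrite setICl.
        rewrite addeK//; exact: (integrable_fin_num mB (sub B i mB)).
      by have m1 := integ_meas i1; have m2 := integ_meas i2; rewrite setvU; case: i.
    have := split12 true; have := split12 false; rewrite /= => -> ->.
    by rewrite -!EFin_Ex// ET EB.
  - move=> F tF LF; split; first by apply: bigcup_measurable => n _; case: (LF n).
    have mF n : measurable (F n) by case: (LF n).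
    rewrite !integral_bigcup//; last 2 first.
    + by apply: (sub _ false); apply: bigcup_measurable.
    + by apply: (sub _ true); apply: bigcup_measurable.
    by apply: eq_eseriesr => n _; case: (LF n).
have GL : G `<=` L by move=> B GB; apply: LE; [exact: Gm|exact: EG].
rewrite -setI_closed_g_dynkin_g_sigma_algebra// => /(smallest_sub DL GL)[mA].
by rewrite EInd [RHS]EInd -(EFin_Ex (integ_indicM mA i1)) -(EFin_Ex (integ_indicM mA i2)) => -[].
Qed.

End dynkin.

Section sig.
Context {d d'} {T : measurableType d} {E : measurableType d'} {R : realType}.
Context (P : probability T R) {I : eqType} (Y : I -> T -> E).
Hypotheses (mY : forall i, meas (Y i)) (indY : mutually_independent P Y).

Definition gen (A : set I) : set_system T :=
  [set X | exists2 i, A i & exists2 B, measurable B & X = Y i @^-1` B].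

(** Finite cylinders over the coordinates in [A] with bases in [S]. Taking [S] to be all measurable
    sets serves the independence of groups of observations; taking it to be F_t gives the joint
    filtration of the sample. *)
Definition cyl (A : set I) (S : set_system E) : set_system T :=
  [set X | exists (s : seq I) (B : I -> set E), [/\ [set` s] `<=` A, forall i, S (B i)
    & X = \bigcap_(i in [set` s]) (Y i @^-1` B i)]].

Let mgen A : gen A `<=` measurable.
Proof. by move=> X [i _ [B mB ->]]; rewrite -[_ @^-1` _]setTI; exact: mY. Qed.

Lemma cyl_measurable A S : S `<=` measurable -> cyl A S `<=` measurable.
Proof.
move=> Sm X [s [B [_ SB ->]]]; apply: fin_bigcap_measurable => // i _.
by rewrite -[_ @^-1` _]setTI; apply: mY => //; exact: Sm.
Qed.

Lemma cyl_setI A S : setI_closed S -> S setT -> setI_closed (cyl A S).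
Proof.
move=> SI ST X X' [s [B [sA SB ->]]] [s' [B' [sA' SB' ->]]].
exists (s ++ s'), (fun i => (if i \in s then B i else setT) `&` (if i \in s' then B' i else setT)).
split => [i /=|i|].
- by rewrite mem_cat => /orP[/sA|/sA'].
- by apply: SI; case: ifP.
- apply/seteqP; split => [w [h h'] i _|w h].
    by split; case: ifP => // si; [exact: h|exact: h'].
  split => i /= si; have := h i; rewrite /= mem_cat si ?orbT => /(_ isT)[] //.
Qed.

Lemma cyl_indep A A' X X' : A `&` A' = set0 -> cyl A measurable X -> cyl A' measurable X' ->
  P (X `&` X') = (P X * P X')%E.
Proof.
move=> AA' [s [B [sA mB ->]]] [s' [B' [sA' mB' ->]]].
have eqS (s1 : seq I) (B1 : I -> set E) : (forall i, measurable (B1 i)) ->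
    P (\bigcap_(i in [set` s1]) (Y i @^-1` B1 i)) = (\prod_(i <- undup s1) P (Y i @^-1` B1 i))%E.
  move=> mB1; rewrite -indY ?undup_uniq//; congr (P _); apply: eq_bigcapl.
  by split => i /=; rewrite mem_undup.
pose B2 i := if i \in s then B i else B' i.
have dis i : i \in s' -> i \notin s.
  by move=> /sA' A'i; apply/negP => /sA Ai; have : (A `&` A') i by []; rewrite AA'.
have -> : \bigcap_(i in [set` s]) (Y i @^-1` B i) `&` \bigcap_(i in [set` s']) (Y i @^-1` B' i) =
    \bigcap_(i in [set` undup s ++ undup s']) (Y i @^-1` B2 i).
  apply/seteqP; split => [w [h h'] i /=|w h].
    rewrite mem_cat !mem_undup /B2; case: (boolP (i \in s)) => [si _|_ /= si]; [exact: h|exact: h'].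
  split => i /= si; have := h i; rewrite /= mem_cat !mem_undup si ?orbT => /(_ isT); rewrite /B2.
    by rewrite si.
  by rewrite (negbTE (dis i si)).
rewrite indY.
- rewrite big_cat/= !eqS//; congr (_ * _)%E; apply: eq_big_seq => i; rewrite mem_undup /B2 => si.
    by rewrite si.
  by rewrite (negbTE (dis i si)).
- rewrite cat_uniq !undup_uniq /= andbT; apply/hasPn => i; rewrite !mem_undup; exact: dis.
- by move=> i; rewrite /B2; case: ifP.
Qed.

Let gen_cyl A X : <<s gen A >> X -> <<s cyl A measurable >> X.
Proof.
apply: sub_sigma_algebra2 => {}X [i Ai [B mB ->]].
exists [:: i], (fun=> B); split => //= [j|]; first by rewrite /= inE => /eqP ->.
by apply/seteqP; split => [w h j|w /(_ i)]; rewrite /= inE ?eqxx//; [move=> /eqP ->|apply].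
Qed.

(** Two passes of [Ex_dynkin] extend first one event, then the other, from cylinders to the
    generated sigma-algebra. For this, independence is written as the equality over X1 of the
    integrals of [\1_X2] and of the constant P(X2). *)
Lemma gen_indep A A' X X' : A `&` A' = set0 -> <<s gen A >> X -> <<s gen A' >> X' ->
  P (X `&` X') = (P X * P X')%E.
Proof.
move=> AA' /gen_cyl gX /gen_cyl gX'.
have sm B X1 : <<s cyl B measurable >> X1 -> measurable X1.
  by apply: smallest_sub; [exact: sigma_algebra_measurable|exact: cyl_measurable].
have cI B : setI_closed (cyl B measurable) by apply: cyl_setI => // ? ?; exact: measurableI.
have toE X1 X2 : measurable X1 -> measurable X2 ->
    (\int[P]_e (\1_X1 e * \1_X2 e) = \int[P]_e (\1_X1 e * fine (P X2))) <->
    P (X1 `&` X2) = (P X1 * P X2)%E.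
  move=> m1 m2; have -> : \int[P]_e (\1_X1 e * \1_X2 e) = fine (P (X1 `&` X2)).
    by rewrite -Ex_indic; [apply: eq_Ex => e; rewrite indicI|exact: measurableI].
  have -> : \int[P]_e (\1_X1 e * fine (P X2)) = fine (P X1) * fine (P X2).
    by under eq_Ex do rewrite mulrC; rewrite ExZ ?Ex_indic 1?mulrC//; exact: integ_indic.
  split=> [h|->]; last by rewrite fineM//; exact: fin_num_measure.
  by rewrite -[LHS]fineK ?h ?fin_num_measure//; [rewrite EFinM !fineK ?fin_num_measure|exact: measurableI].
have half B1 X1 X2 : (forall X1', cyl B1 measurable X1' -> P (X1' `&` X2) = (P X1' * P X2)%E) ->
    measurable X2 -> <<s cyl B1 measurable >> X1 -> P (X1 `&` X2) = (P X1 * P X2)%E.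
  move=> h m2 g1; apply/toE => //; first exact: sm g1.
  apply: (Ex_dynkin (G := cyl B1 measurable)) => //.
  - exact: integ_indic.
  - exact: integ_cst.
  - exact: cyl_measurable.
  - by rewrite Ex_indic// Ex_cst.
  - by move=> X3 c3; apply/toE => //; [exact: (cyl_measurable _ c3)|exact: h].
apply: (half A) => //; last exact: sm gX'.
move=> X1 c1; rewrite setIC muleC; apply: (half A') => //; last exact: (cyl_measurable _ c1).
by move=> X2 c2; rewrite setIC muleC; exact: (cyl_indep AA').
Qed.

(** A type of its own, so that depending only on the observations in [A] becomes measurability from
    [sig A]. *)
Definition sig A := sigmaT (gen A).

Lemma meas_sig A i : A i -> meas (Y i : sig A -> E).
Proof.
by move=> Ai _ B mB; rewrite setTI; apply: sub_sigma_algebra; exists i => //; exists B.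
Qed.

Lemma sig_meas {d2} {T2 : measurableType d2} A (U : T -> T2) :
  meas (U : sig A -> T2) -> meas U.
Proof.
move=> mU _ B mB; have := mU measurableT B mB; apply: smallest_sub => //.
exact: sigma_algebra_measurable.
Qed.

Lemma sig_indep {d1 d2} {T1 : measurableType d1} {T2 : measurableType d2} A A'
    (U : T -> T1) (V : T -> T2) : A `&` A' = set0 ->
  meas (U : sig A -> T1) -> meas (V : sig A' -> T2) ->
  forall B B', measurable B -> measurable B' ->
  P (U @^-1` B `&` V @^-1` B') = (P (U @^-1` B) * P (V @^-1` B'))%E.
Proof.
move=> AA' mU mV B B' mB mB'; apply: (gen_indep AA').
  by have := mU measurableT B mB; rewrite setTI.
by have := mV measurableT B' mB'; rewrite setTI.
Qed.

End sig.

Section law.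
Context {d d'} {T : measurableType d} {E : measurableType d'} {R : realType}.
Context (Q : probability T R) (P : probability E R) (Y : T -> E).
Hypotheses (mY : meas Y) (lawY : forall A, measurable A -> Q (Y @^-1` A) = P A).

Let Y' : {mfun T >-> E} := mfun_Sub (mem_set mY).

Lemma ge0_Ex_law (f : E -> \bar R) : meas f -> (forall e, (0 <= f e)%E) ->
  (\int[Q]_w f (Y w) = \int[P]_e f e)%E.
Proof.
move=> mf f0; transitivity (\int[distribution Q Y']_e f e)%E.
  by rewrite ge0_integral_distribution.
by apply: eq_measure_integral => A mA _; exact: lawY.
Qed.

Lemma Ex_law (f : E -> R) : integ P f ->
  integ Q (f \o Y) /\ \int[Q]_w f (Y w) = \int[P]_e f e.
Proof.
move=> iP; have [mf ff] := integrableP _ _ _ iP.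
have iQ : integ Q (f \o Y).
  apply/integrableP; split; first exact: (mcomp mf mY).
  by rewrite (@ge0_Ex_law (fun e => `|(EFin \o f) e|%E))//; exact: mcomp.
split => //; rewrite /Rintegral; congr fine.
transitivity (\int[distribution Q Y']_e (f e)%:E)%E.
  by rewrite [RHS](integral_pushforward mY).
by apply: eq_measure_integral => A mA _; exact: lawY.
Qed.

End law.

(** * Second and fourth moments of independent sums *)

Section independent_sums.
Context {d d'} {T : measurableType d} {E : measurableType d'} {R : realType}.
Context (P : probability T R) {I : eqType} (Y : I -> T -> E).
Hypotheses (mY : forall i, meas (Y i)) (indY : mutually_independent P Y).
Local Notation sig := (sig Y).

Lemma decouple_dom {d1 d2} {T1 : measurableType d1} {T2 : measurableType d2} A A'
    (U : T -> T1) (V : T -> T2) (F : T1 * T2 -> R) (D : T -> R) :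
  A `&` A' = set0 ->
  meas (U : sig A -> T1) -> meas (V : sig A' -> T2) ->
  meas F -> (forall w w', `|F (U w, V w')| <= D w') -> integ P D ->
  [/\ integ P (fun w => F (U w, V w)), integ P (fun w => \int[P]_w' F (U w, V w'))
    & \int[P]_w F (U w, V w) = \int[P]_w \int[P]_w' F (U w, V w')].
Proof.
move=> AA' mU mV mF FD iD.
have mU' := sig_meas mY mU; have mV' := sig_meas mY mV.
have iF w : integ P (fun w' => F (U w, V w')).
  apply: integ_le iD _ => //; exact: mcomp (mcomp mF (measurable_pair1 _)) mV'.
apply: decouple => //; first exact: (sig_indep mY indY AA').
apply: (@le_lt_trans _ _ (\int[P]_w (\int[P]_w' D w')%:E)%E); last first.
  by rewrite integral_cst//= (probability_setT P) mule1 ltry.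
apply: ge0_le_integral => //.
- by move=> w _; apply: integral_ge0 => w' _; rewrite lee_fin.
- apply: (@mcomp _ _ _ _ _ _ (fun u => \int[P]_w' `|F (u, V w')|%:E)%E) => //.
  apply: (@measurable_fun_fubini_tonelli_F _ _ _ _ _ P (fun p => `|F (p.1, V p.2)|%:E)) => //.
  apply/mEFinP; apply: mcomp => //; apply: mcomp => //.
  by apply: mpair => //; exact: mcomp.
- move=> w _; rewrite EFin_Ex//; apply: ge0_le_integral => //.
  + by apply/mEFinP; apply: mcomp => //; exact: integ_meas (iF w).
  + exact/mEFinP/(integ_meas iD).
  + by move=> w' _; rewrite lee_fin.
Qed.

Lemma indep_mul A A' (U V : T -> R) : A `&` A' = set0 ->
  meas (U : sig A -> R) -> meas (V : sig A' -> R) ->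
  integ P U -> integ P V ->
  integ P (fun w => U w * V w) /\ \int[P]_w (U w * V w) = (\int[P]_w U w) * (\int[P]_w V w).
Proof.
move=> AA' mU mV iU iV.
have [] := @decouple _ _ _ _ _ _ _ P U V (sig_meas mY mU) (sig_meas mY mV)
  (sig_indep mY indY AA' mU mV) (fun p => p.1 * p.2).
- by apply: mfunM.
- by move=> w; exact: integZ.
- have e w : (\int[P]_w' `|(U w * V w')|%:E = (\int[P]_w' `|V w'| * `|U w|)%:E)%E.
    rewrite mulrC -(ExZ _ (integ_abs iV)) (EFin_Ex (integZ _ (integ_abs iV))).
    by apply: eq_integral => w' _; rewrite normrM.
  under eq_integral do rewrite e.
  by rewrite -(EFin_Ex (integZ _ (integ_abs iU))) ltry.
- move=> h _ ->; split => //; under eq_Ex do rewrite /= ExZ// mulrC.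
  by rewrite ExZ// mulrC.
Qed.

Let Lp (X : T -> R) := meas X /\ integ P (fun w => X w ^+ 4).

Lemma Lp_add (X Z : T -> R) : Lp X -> Lp Z -> Lp (fun w => X w + Z w).
Proof.
move=> [mX iX] [mZ iZ]; split; first exact: mfunD.
apply: (integ_le _ (integZ 8 (integD iX iZ))) => [|w].
  by apply: mfunX; exact: mfunD.
rewrite ger0_norm ?exprn_even_ge0//; move: (X w) (Z w) => x z.
(* A sum-of-squares certificate: 8 x^4 + 8 z^4 - (x + z)^4 = 6 ((x + z)(x - z))^2 + (x - z)^4. *)
have := addr_ge0 (mulr_ge0 (ler0n R 6) (sqr_ge0 ((x + z) * (x - z)))) (sqr_ge0 ((x - z) ^+ 2)).
by move=> h; rewrite -subr_ge0; apply: (le_trans h); apply: eq_ler; ring.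
Qed.

Lemma Lp_mono (X Z : T -> R) (p q : nat) : (p + q <= 4)%N -> Lp X -> Lp Z ->
  integ P (fun w => X w ^+ p * Z w ^+ q).
Proof.
move=> pq [mX iX] [mZ iZ].
apply: (integ_le _ (integD (integ_cst P 1) (integD iX iZ))) => [|w].
  by apply: mfunM; exact: mfunX.
have p4 (x : R) (k : nat) : `|x| ^+ 4 = x ^+ 4 by rewrite -normrX ger0_norm// exprn_even_ge0.
rewrite normrM !normrX -(p4 (X w) 0%N) -(p4 (Z w) 0%N).
set m := Num.max 1 (Num.max `|X w| `|Z w|).
have m1 : 1 <= m by rewrite le_max lexx.
have le1 : `|X w| <= m by rewrite !le_max lexx orbT.
have le2 : `|Z w| <= m by rewrite !le_max lexx !orbT.
apply: (@le_trans _ _ (m ^+ (p + q))).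
  by rewrite exprD ler_pM ?exprn_ge0// lerXn2r ?nnegrE// (le_trans ler01).
apply: (@le_trans _ _ (m ^+ 4)); first exact: ler_weXn2l.
have x4 := exprn_ge0 4 (normr_ge0 (X w)); have z4 := exprn_ge0 4 (normr_ge0 (Z w)).
by rewrite /m /Num.max; case: ifP => _; [case: ifP => _|]; rewrite ?expr1n; lra.
Qed.

(** When X is added to the sum S, independence kills every mixed term with a single factor X or a
    single factor S, and 6 E X^2 E S^2 is the cross term of 3 (E X^2 + E S^2)^2. *)
Lemma fourth_moment (X : I -> T -> R) (s : seq I) : uniq s ->
  (forall i, meas (X i : sig [set i] -> R)) ->
  (forall i, integ P (fun w => X i w ^+ 4)) -> (forall i, \int[P]_w X i w = 0) ->
  [/\ Lp (fun w => \sum_(i <- s) X i w),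
    \int[P]_w ((\sum_(i <- s) X i w) ^+ 2) = \sum_(i <- s) \int[P]_w (X i w ^+ 2)
  & \int[P]_w ((\sum_(i <- s) X i w) ^+ 4) <=
    3 * (\sum_(i <- s) \int[P]_w (X i w ^+ 2)) ^+ 2 + \sum_(i <- s) \int[P]_w (X i w ^+ 4)].
Proof.
move=> us mX iX EX.
have LX i : Lp (X i) by split => //; exact: sig_meas (mX i).
have mono i : integ P (X i) by have := Lp_mono (p := 1) (q := 0) isT (LX i) (LX i); under eq_fun do rewrite expr1 expr0 mulr1.
elim: s us => [_|i s IH /= /andP[si us]].
  split.
  - split; under eq_fun do rewrite big_nil; first exact: mcst.
    by rewrite expr0n; exact: integ_cst.
  - by under eq_Ex do rewrite big_nil expr0n; rewrite Ex_cst big_nil.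
  - by under eq_Ex do rewrite big_nil expr0n; rewrite Ex_cst !big_nil expr0n mulr0 addr0.
have [LS E2 E4] := IH us; pose S w := \sum_(j <- s) X j w.
have mS : meas (S : sig [set j | j \in s] -> R).
  rewrite (_ : S = fun w => \sum_(j <- s) (if j \in s then X j w else 0)); last first.
    by apply/funext => w; apply: eq_big_seq => j ->.
  apply: (@measurable_sum _ (sig [set j | j \in s]) R setT _ s (fun j w => if j \in s then X j w else 0)) => j.
  case js: (j \in s); last exact: mcst.
  move=> mT B mB; have := mX j measurableT B mB; rewrite !setTI.
  apply: sub_sigma_algebra2 => A [k /= -> [C mC ->]]; exists j => //; by exists C.
have dis : [set i] `&` [set j | j \in s] = set0.
  by apply/seteqP; split => // j [/= -> h]; rewrite h in si.
have prod p q : (p + q <= 4)%N -> \int[P]_w (X i w ^+ p * S w ^+ q) =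
    (\int[P]_w X i w ^+ p) * (\int[P]_w S w ^+ q).
  move=> pq.
  have iXp : integ P (fun w => X i w ^+ p).
    have := @Lp_mono (X i) (X i) p 0 _ (LX i) (LX i); under eq_fun do rewrite expr0 mulr1.
    by rewrite addn0; apply; apply: leq_trans pq; exact: leq_addr.
  have iSq : integ P (fun w => S w ^+ q).
    have := @Lp_mono S S q 0 _ LS LS; under eq_fun do rewrite expr0 mulr1.
    by rewrite addn0; apply; apply: leq_trans pq; exact: leq_addl.
  by apply: (indep_mul dis _ _ iXp iSq).2; exact: mfunX.
have LD := Lp_add (LX i) LS.
have i2 p q := @Lp_mono (X i) S p q.
have ex p q (pq : (p + q <= 4)%N) c := integZ c (i2 p q pq (LX i) LS).
have E1 : \int[P]_w (X i w ^+ 1) = 0 by under eq_Ex do rewrite expr1.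
have E0 : \int[P]_w (S w ^+ 0) = 1 by under eq_Ex do rewrite expr0; exact: Ex_cst.
have E0' : \int[P]_w (X i w ^+ 0) = 1 by under eq_Ex do rewrite expr0; exact: Ex_cst.
split.
- by rewrite (_ : (fun w => _) = fun w => X i w + S w)//; apply/funext => w; rewrite big_cons.
- rewrite big_cons -E2 -/S.
  transitivity (\int[P]_w (1 * (X i w ^+ 2 * S w ^+ 0) + (2 * (X i w ^+ 1 * S w ^+ 1) + 1 * (X i w ^+ 0 * S w ^+ 2)))).
    by apply: eq_Ex => w; rewrite big_cons -/(S w); ring.
  rewrite (ExD (ex 2%N 0%N isT _) (integD (ex 1%N 1%N isT _) (ex 0%N 2%N isT _))).
  rewrite (ExD (ex 1%N 1%N isT _) (ex 0%N 2%N isT _)) !(ExZ _ (i2 _ _ _ (LX i) LS))// !prod// E1 ?E0 ?E0'.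
  by rewrite /S; ring.
- have -> : \int[P]_w ((\sum_(j <- i :: s) X j w) ^+ 4) = \int[P]_w (1 * (X i w ^+ 4 * S w ^+ 0) + (4 * (X i w ^+ 3 * S w ^+ 1) + (6 * (X i w ^+ 2 * S w ^+ 2) + (4 * (X i w ^+ 1 * S w ^+ 3) + 1 * (X i w ^+ 0 * S w ^+ 4))))).
    by apply: eq_Ex => w; rewrite big_cons -/(S w); ring.
  rewrite (ExD (ex 4%N 0%N isT _) (integD (ex 3%N 1%N isT _) (integD (ex 2%N 2%N isT _) (integD (ex 1%N 3%N isT _) (ex 0%N 4%N isT _))))).
  rewrite (ExD (ex 3%N 1%N isT _) (integD (ex 2%N 2%N isT _) (integD (ex 1%N 3%N isT _) (ex 0%N 4%N isT _)))).
  rewrite (ExD (ex 2%N 2%N isT _) (integD (ex 1%N 3%N isT _) (ex 0%N 4%N isT _))).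
  rewrite (ExD (ex 1%N 3%N isT _) (ex 0%N 4%N isT _)).
  rewrite !(ExZ _ (i2 _ _ _ (LX i) LS))// !prod// E1 ?E0 ?E0' !big_cons.
  have -> : \int[P]_w (S w ^+ 1) = 0.
    under eq_Ex do rewrite expr1; rewrite Ex_sum//; exact: big1.
  move: E4 E2; rewrite -/S => E4 ->; nra.
Qed.

End independent_sums.

(** * Doob's maximal inequality, in discrete time and on dyadic grids *)

Section doob.
Context {d} {T : measurableType d} {R : realType} (P : probability T R).
Context (S : nat -> set_system T) (Z : nat -> T -> R) (n : nat).
Local Notation fT i := (sigmaT (S i)).
Hypotheses (Sm : forall i, <<s S i >> `<=` measurable) (Sh : forall i, <<s S i >> `<=` <<s S i.+1 >>).
Hypotheses (mZ : forall i, (i <= n)%N -> meas (Z i : fT i -> R)).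
Hypotheses (iZ : forall i, (i <= n)%N -> integ P (Z i)).
Hypothesis EZ : forall i B, (i <= n)%N -> <<s S i >> B ->
  \int[P]_w (\1_B w * Z i w) = \int[P]_w (\1_B w * Z n w).

(** First-passage decomposition: the event that |Z| first exceeds c at index k splits by the sign of
    [Z k] and lies in the sigma-algebra of index k, so that [EZ] exchanges [Z k] for [Z n] on it. *)
Lemma doob (c : R) : 0 < c -> let A := [set w | exists2 i, (i <= n)%N & c < `|Z i w|] in
  measurable A /\ c * fine (P A) <= \int[P]_w (\1_A w * `|Z n w|).
Proof.
move=> c0 A; pose M k := [set w | exists2 i, (i < k)%N & c < `|Z i w|].
suff h : forall k, (k <= n)%N -> <<s S k >> (M k.+1) /\ c * fine (P (M k.+1)) <= \int[P]_w (\1_(M k.+1) w * `|Z n w|).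
  have [gM le] := h n (leqnn _).
  have -> : A = M n.+1 by apply/seteqP; split => w /= [i ni ?]; exists i.
  by split => //; exact: Sm gM.
have iN := integ_abs (iZ (leqnn n)).
pose Bp k := ~` M k `&` [set w | c < Z k w]; pose Bn k := ~` M k `&` [set w | Z k w < - c].
have step k : (k <= n)%N -> <<s S k >> (M k) ->
    c * fine (P (M k)) <= \int[P]_w (\1_(M k) w * `|Z n w|) ->
    <<s S k >> (M k.+1) /\ c * fine (P (M k.+1)) <= \int[P]_w (\1_(M k.+1) w * `|Z n w|).
  move=> kn gM le.
  have mM : measurable (M k : set (fT k)) := gM.
  have mp : measurable ([set w | c < Z k w] : set (fT k)).
    by have := mZ kn measurableT (measurable_itv `]c, +oo[); rewrite setTI; congr measurable; apply/seteqP; split => w /=; rewrite in_itv /= andbT.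
  have mn : measurable ([set w | Z k w < - c] : set (fT k)).
    by have := mZ kn measurableT (measurable_itv `]-oo, - c[); rewrite setTI; congr measurable; apply/seteqP; split => w /=; rewrite in_itv.
  have mBp : measurable (Bp k : set (fT k)) by apply: measurableI => //; exact: measurableC.
  have mBn : measurable (Bn k : set (fT k)) by apply: measurableI => //; exact: measurableC.
  have MS : M k.+1 = M k `|` (Bp k `|` Bn k).
    apply/seteqP; split => w.
      move=> [i]; rewrite ltnS leq_eqVlt => /orP[/eqP ->|ik ci]; last by left; exists i.
      move=> ck; case: (pselect (M k w)) => Mk; first by left.
      by right; move: ck; rewrite ltNge ler_norml negb_and -!ltNge => /orP[ck|ck]; [right|left]; split.
    move=> [[i ik ci]|[[_ /= ck]|[_ /= ck]]]; first by exists i => //; exact: ltnW.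
    + by exists k => //; exact: lt_le_trans ck (ler_norm _).
    + by exists k => //; rewrite -normrN; apply: lt_le_trans (ler_norm _); rewrite ltrNr.
  have gM' : <<s S k >> (M k.+1) by rewrite MS; exact: (measurableU _ _ mM (measurableU _ _ mBp mBn)).
  split => //.
  have ind w : \1_(M k.+1) w = \1_(M k) w + (\1_(Bp k) w + \1_(Bn k) w) :> R.
    rewrite MS !indicE !in_setU !in_setI !in_setC; case: (w \in M k) => /=; first by rewrite !addr0.
    case: (boolP (w \in [set w | c < Z k w])) => /= [/set_mem/= h|_]; last by rewrite !add0r.
    by rewrite memNset ?addr0 ?add0r//= => h'; lra.
  have one (B : set T) (sg : R) : measurable (B : set (fT k)) -> `|sg| = 1 -> (forall w, B w -> c <= sg * Z k w) ->
      c * fine (P B) <= \int[P]_w (\1_B w * `|Z n w|).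
    move=> mB s1 Bc; have mB' : measurable B := Sm mB.
    have i1 := integ_indicM mB' (iZ kn); have i2 := integ_indicM mB' (iZ (leqnn n)).
    apply: (@le_trans _ _ (\int[P]_w (sg * (\1_B w * Z n w)))).
      rewrite (ExZ _ i2) -(EZ kn mB) -(ExZ _ i1) -Ex_indic// -(ExZ _ (integ_indic P mB')).
      apply: le_Ex => [||w]; [exact/integZ/integ_indic|exact: integZ|].
      rewrite indicE; case: (boolP (w \in B)) => [/set_mem/Bc|_]; first by rewrite mulr1 mul1r.
      by rewrite mul0r !mulr0.
    apply: le_Ex => [||w]; [exact: integZ|exact: integ_indicM|].
    rewrite mulrCA; apply: ler_wpM2l => //.
    by rewrite (le_trans (ler_norm _))// normrM s1 mul1r.
  have j (B : set T) (mB : measurable (B : set (fT k))) := integ_indicM (Sm mB) iN.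
  rewrite -(Ex_indic P (Sm gM')).
  under eq_Ex do rewrite ind; under [leRHS]eq_Ex do rewrite ind !mulrDl.
  have ii (B : set T) (mB : measurable (B : set (fT k))) := integ_indic P (Sm mB).
  rewrite (ExD (ii _ mM) (integD (ii _ mBp) (ii _ mBn))) (ExD (ii _ mBp) (ii _ mBn)).
  rewrite (ExD (j _ mM) (integD (j _ mBp) (j _ mBn))) (ExD (j _ mBp) (j _ mBn)).
  rewrite !Ex_indic; [|exact: Sm mBn|exact: Sm mBp|exact: Sm mM].
  have b1 := one _ 1 mBp (normr1 _); have b2 := one _ (-1) mBn (normrN1 _).
  rewrite !mulrDr lerD// lerD//; [apply: b1|apply: b2] => w [_ /=]; rewrite ?mul1r ?mulN1r.
    exact: ltW.
  by rewrite -lerNr => /ltW; rewrite lerNr.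
elim=> [|k IH] kn.
  have M0 : M 0%N = set0 by apply/seteqP; split => // w [].
  apply: step => //; rewrite M0; first exact: (@measurable0 _ (fT 0%N)).
  by rewrite measure0 mulr0; apply: ge0_Ex => w; rewrite mulr_ge0// indicE.
have [gM le] := IH (ltnW kn); apply: step => //; exact: Sh gM.
Qed.

(** Young's inequality p c^(p-1) |z| <= z^p + (p-1) c^p, integrated over the exceedance event A and
    combined with c P(A) <= E(1_A |Z_n|), gives p c^p P(A) <= E Z_n^p + (p-1) c^p P(A). *)
Lemma doob_pow (p : nat) (c : R) : p = 2 \/ p = 4 -> 0 < c -> integ P (fun w => Z n w ^+ p) ->
  c ^+ p * fine (P [set w | exists2 i, (i <= n)%N & c < `|Z i w|]) <= \int[P]_w (Z n w ^+ p).
Proof.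
move=> p24 c0 ip; have [mA le] := doob c0; move: mA le; set A := [set w | _] => mA le.
have iA := integ_indic P mA; have iN := integ_abs (iZ (leqnn n)).
have young (z : R) : 0 <= z ^+ p /\ p%:R * c ^+ p.-1 * `|z| <= z ^+ p + (p%:R - 1) * c ^+ p.
  have zc := mulr_ge0 (normr_ge0 z) (ltW c0); have c2 := sqr_ge0 c; have z2 := sqr_ge0 `|z|.
  have zc2 := sqr_ge0 (`|z| - c).
  case: p24 => -> /=.
    by rewrite -(real_normK (num_real z)); split=> //; rewrite expr1; lra.
  rewrite (_ : z ^+ 4 = `|z| ^+ 4); last by rewrite -normrX ger0_norm// exprn_even_ge0.
  split; first exact: exprn_ge0.
  (* Young's inequality for p = 4 by factoring: z^4 + 3 c^4 - 4 c^3 z = (z - c)^2 (z^2 + 2 c z + 3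
     c^2). *)
  have : 0 <= (`|z| - c) ^+ 2 * (`|z| ^+ 2 + 2 * (`|z| * c) + 3 * c ^+ 2) by rewrite mulr_ge0//; lra.
  by rewrite (_ : _ * _ = `|z| ^+ 4 + 3 * c ^+ 4 - 4 * c ^+ 3 * `|z|); [lra|ring].
have : \int[P]_w (p%:R * c ^+ p.-1 * (\1_A w * `|Z n w|)) <= \int[P]_w (Z n w ^+ p + (p%:R - 1) * c ^+ p * \1_A w).
  apply: le_Ex; [exact/integZ/integ_indicM|by apply: integD => //; exact: integZ|move=> w].
  have [y0 y] := young (Z n w); rewrite indicE.
  by case: (_ \in _); rewrite ?mul1r ?mulr1 ?mul0r ?mulr0 ?addr0.
rewrite (ExZ _ (integ_indicM mA iN)) (ExD ip (integZ _ iA)) (ExZ _ iA) (Ex_indic P mA).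
have q0 : 0 <= p%:R * c ^+ p.-1 by rewrite mulr_ge0 ?exprn_ge0// ltW.
have cp : c ^+ p.-1 * c = c ^+ p by rewrite -exprSr prednK//; case: p24 => ->.
have := ler_wpM2l q0 le; rewrite (_ : _ * (c * _) = p%:R * c ^+ p * fine (P A)); first lra.
by rewrite -cp; ring.
Qed.

End doob.

Section dyadic_suprema.
Context {R : realType}.

(** The cap makes every index a time in [0, 1], so families indexed by all naturals are
    available. *)
Definition dyadic (m i : nat) : R := Num.min 1 (i%:R / 2 ^+ m).

Lemma dyadic01 m i : 0 <= dyadic m i <= 1.
Proof. by rewrite /dyadic le_min ler01 ge_min lexx divr_ge0// exprn_ge0. Qed.

Lemma dyadic_le m i j : (i <= j)%N -> dyadic m i <= dyadic m j.
Proof.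
move=> ij; rewrite /dyadic le_min !ge_min lexx/=; apply/orP; right.
by rewrite ler_pM2r ?invr_gt0 ?exprn_gt0// ler_nat.
Qed.

Lemma dyadic_last m : dyadic m (2 ^ m) = 1.
Proof. by rewrite /dyadic natrX divff ?minxx// expf_neq0. Qed.

Lemma dyadicS m i : dyadic m.+1 (2 * i) = dyadic m i.
Proof.
rewrite /dyadic natrM exprS; congr Num.min; field; exact/expf_neq0.
Qed.

Lemma exists_dyadic (f : R -> R) (c t : R) : (forall t, 0 <= t < 1 -> f s @[s --> t^'+] --> f t) ->
  0 <= t <= 1 -> c < `|f t| -> exists m i, (i <= 2 ^ m)%N /\ c < `|f (dyadic m i)|.
Proof.
move=> rc /andP[t0 t1] ct; have [t1'|tn1] := eqVneq t 1.
  rewrite t1' in ct.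
  by exists 0%N, 1%N; rewrite expn0 (_ : dyadic 0 1 = 1)// -[RHS](dyadic_last 0).
have {}t1 : t < 1 by rewrite lt_neqAle tn1.
have cv : `|f s| @[s --> t^'+] --> `|f t| by apply: cvg_norm; apply: rc; rewrite t0.
have /cvgr_gt/(_ _ ct) := cv.
move=> [e /= e0 he].
pose m := (Num.truncn (e^-1)).+1.
have em : (2 ^+ m)^-1 < e.
  rewrite -[ltRHS]invrK ltf_pV2 ?posrE ?invr_gt0 ?exprn_gt0//.
  apply: (@lt_trans _ _ m%:R); first by rewrite truncnS_gt.
  by rewrite -natrX ltr_nat ltn_expl.
have p0 : (0 : R) < 2 ^+ m by rewrite exprn_gt0.
(* The dyadic point of index k + 1 lies strictly after t and at distance at most 2^-m, so right
   continuity at t applies to it. *)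
pose k := Num.truncn (t * 2 ^+ m).
have /andP[k1 k2] : k%:R <= t * 2 ^+ m < k.+1%:R by apply: truncn_itv; rewrite mulr_ge0// ltW.
have k3 : (k.+1 <= 2 ^ m)%N.
  by rewrite -(ltr_nat R) natrX; apply: le_lt_trans k1 _; rewrite -[ltRHS]mul1r ltr_pM2r.
have dE : dyadic m k.+1 = k.+1%:R / 2 ^+ m.
  by rewrite /dyadic min_r// ler_pdivrMr// mul1r -natrX ler_nat.
exists m, k.+1; split => //; apply: he.
  rewrite /= dE ltr_norml; apply/andP; split.
    have : k.+1%:R / 2 ^+ m <= t + (2 ^+ m)^-1.
      by rewrite ler_pdivrMr// mulrDl mulVf ?gt_eqF// -natr1 lerD2r.
    by move: em; lra.
  have : t < k.+1%:R / 2 ^+ m by rewrite ltr_pdivlMr.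
  by lra.
by rewrite dE ltr_pdivlMr.
Qed.

Context {d} {T : measurableType d} (P : probability T R) (X : R -> T -> R).
Hypothesis mX : forall t, 0 <= t <= 1 -> meas (X t).
Hypothesis rcX : forall w t, 0 <= t < 1 -> X s w @[s --> t^'+] --> X t w.

Let dya c m := [set w | exists2 i, (i <= 2 ^ m)%N & c < `|X (dyadic m i) w|].
Let full c := [set w | exists2 t, 0 <= t <= 1 & c < `|X t w|].

Lemma meas_exceeds c t : 0 <= t <= 1 -> measurable [set w | c < `|X t w|].
Proof.
move=> /mX mXt; have := mfun_ltr (mcst c) (mcomp (@normr_measurable R setT) mXt) measurableT (_ : measurable [set true]).
by rewrite setTI; apply.
Qed.

Lemma meas_exceeds_fin (N : nat) (t : nat -> R) c : (forall i, 0 <= t i <= 1) ->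
  measurable [set w | exists2 i, (i <= N)%N & c < `|X (t i) w|].
Proof.
move=> t01; rewrite (_ : [set w | _] = \bigcup_(i in [set i | (i <= N)%N]) [set w | c < `|X (t i) w|]).
  by apply: bigcup_measurable => i _; exact: meas_exceeds.
by apply/seteqP; split => w [i]; exists i.
Qed.

Lemma dyadic_supE c : full c = \bigcup_m dya c m.
Proof.
apply/seteqP; split => [w [t t01 ct]|w [m _ [i im ci]]].
  by have [m [i [im ci]]] := exists_dyadic (f := X^~ w) (@rcX w) t01 ct; exists m => //; exists i.
by exists (dyadic m i) => //; exact: dyadic01.
Qed.

Lemma meas_dyadic_sup c : measurable (full c).
Proof.
rewrite dyadic_supE; apply: bigcup_measurable => m _.
by apply: meas_exceeds_fin => i; exact: dyadic01.
Qed.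

(** A strict exceedance by a right-continuous path is visible on some dyadic grid, and the grids are
    nested; the probability over [0, 1] is thus an increasing limit of grid probabilities. *)
Lemma dyadic_sup_le c M : (forall m, fine (P (dya c m)) <= M) -> fine (P (full c)) <= M.
Proof.
move=> PM; have md m : measurable (dya c m) by apply: meas_exceeds_fin => i; exact: dyadic01.
have : P \o dya c @ \oo --> P (\bigcup_m dya c m).
  apply: nondecreasing_cvg_mu => //; first exact: bigcup_measurable.
  move=> m k mk; apply/subsetPset; rewrite -(subnK mk); elim: (k - m)%N => [|l IH]; first exact: subset_refl.
  apply: (subset_trans IH) => w [i im ci]; rewrite addSn; exists (2 * i)%N; last by rewrite dyadicS.
  by rewrite expnS leq_mul2l.
rewrite -dyadic_supE => cv; rewrite -lee_fin fineK ?fin_num_measure//; last exact: meas_dyadic_sup.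
rewrite -(cvg_lim _ cv)//; apply: lime_le; first by apply/cvg_ex; eexists; exact: cv.
by apply: nearW => m /=; rewrite -[P _]fineK ?lee_fin// fin_num_measure.
Qed.

End dyadic_suprema.

(** * The martingale of a whole fold and its maximal inequality *)

Section fold_martingale.
Context {d d'} {T : measurableType d} {E : measurableType d'} {R : realType}.
Context (Q : probability T R) (P : probability E R) {I : eqType} (Y : I -> T -> E).
Hypotheses (mY : forall i, meas (Y i)) (indY : mutually_independent Q Y).
Hypothesis lawY : has_law Q P Y.
Context (F : R -> set_system E) (N : E -> cumulative R R) (b : R -> E -> R) (C : R).
Hypothesis CS : counting_setup P F N b C.
Local Notation mint := (mint N b).
Local Notation pred := (pred F).
Implicit Types H : R -> E -> R.

Let fF := cs_fil CS.
Let Fm := fil_sub fF.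
Let Fs := fil_sigma fF.

(** The stochastic integral up to time t, as the terminal value for the integrand cut off after t:
    all facts about [mint] then apply at each t. *)
Definition mart H t e := mint (fun u e => (u <= t)%R%:R * H u e) e.

Lemma pred_upto H t : pred H -> pred (fun u e => (u <= t)%R%:R * H u e).
Proof. by apply: predM; apply: predictable_time => //; exact: mfun_ler. Qed.

Lemma pred_after H t : pred H -> pred (fun u e => (t < u)%R%:R * H u e).
Proof. by apply: predM; apply: predictable_time => //; exact: mfun_ltr. Qed.

Lemma maskM_le (p : bool) (x c : R) : `|x| <= c -> `|p%:R * x| <= c.
Proof. by move=> xc; rewrite normrM -[c]mul1r ler_pM// norm_b2r_le1. Qed.

Lemma mart1 H e : pred H -> mart H 1 e = mint H e.
Proof.
move=> [_ H0]; rewrite /mart; congr (mint _ e); apply/funext => u; apply/funext => e'.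
by case: leP => u1; rewrite ?mul1r// mul0r H0// negb_and -!ltNge u1 orbT.
Qed.

Lemma mint_indic A H (c : R) e : pred H -> (bdd H c) ->
  mint (fun u e => \1_A e * H u e) e = \1_A e * mint H e.
Proof.
move=> pH Hc; rewrite /Submission.mint jsumMl mulrBr; congr (_ - _).
rewrite /tint -ExZ; first by apply: eq_Ex => u; rewrite mulrA.
by apply: (integ_pred fF (c := c * C) (H := fun u e => H u e * b u e)) => [|u]; [exact: predM pH.1 (cs_pred CS)|rewrite normrM ler_pM// (cs_bound CS)].
Qed.

(** For A in F_s the process 1_A 1{s < u} H is again predictable, so its integral is centred; this
    is the martingale property of [mart H]. *)
Lemma mint_future H (c s : R) A : pred H -> (bdd H c) -> 0 <= s <= 1 -> F s A ->
  \int[P]_e (\1_A e * mint (fun u e => (s < u)%R%:R * H u e) e) = 0.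
Proof.
move=> pH Hc s01 FA; have p1 := pred_after s pH.
have b1 u e : `|(s < u)%R%:R * H u e| <= c by exact: maskM_le.
have bK u e : `|\1_A e * ((s < u)%R%:R * H u e)| <= c by rewrite indicE; exact: maskM_le.
have pK : pred (fun u e => \1_A e * ((s < u)%R%:R * H u e)).
  split; last by move=> u e /(pH.2 u e) ->; rewrite !mulr0.
  (* [predictable_step] asks for s < 1; when s = 1 the integrand vanishes identically. *)
  have [s1|s1] := ltP s 1.
    rewrite (_ : (fun u e => _) = fun u e => ((s < u <= 1)%R%:R * \1_A e) * H u e).
      apply: predictableM => //; last exact: pH.1.
      apply: predictable_step => //; [by case/andP: s01|].
      apply/(meas_wrtP _ (Fs s01)); apply: measurable_indic; exact: sub_sigma_algebra.
    apply/funext => u; apply/funext => e; case: ltP => /= su; last by rewrite !(mul0r, mulr0).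
    by case: leP => u1; rewrite ?mul1r// (pH.2 u e) ?mulr0// negb_and -!ltNge u1 orbT.
  rewrite (_ : (fun u e => _) = fun _ _ => 0); first exact: predictable_det.
  apply/funext => u; apply/funext => e; case: ltP => su; last by rewrite mul0r mulr0.
  by rewrite (pH.2 u e) ?mulr0// negb_and -!ltNge (le_lt_trans s1 su) orbT.
have := (expectation_mint CS pK bK (integ_cst P c) (integZ c (integ_njump CS))).2.
by under eq_Ex do rewrite (mint_indic _ _ p1 b1).
Qed.

Lemma martB H (c s t : R) e : pred H -> (bdd H c) -> s <= t ->
  mart H t e - mart H s e = mint (fun u e => (s < u)%R%:R * ((u <= t)%R%:R * H u e)) e.
Proof.
move=> pH Hc st; rewrite /mart.
have h : (fun u e => (u <= t)%R%:R * H u e) =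
    fun u e => (u <= s)%R%:R * H u e + (s < u)%R%:R * ((u <= t)%R%:R * H u e).
  apply/funext => u; apply/funext => e'; have [us|us] := leP u s.
    by rewrite (le_trans us st) mul0r addr0.
  by rewrite mul0r add0r mul1r.
rewrite h (mintD CS (c := c) (c' := c)) //; [by rewrite addrC addKr|exact: pred_upto| |move=> u; exact: maskM_le|].
  exact/pred_after/pred_upto.
by move=> u; do 2 apply: maskM_le.
Qed.

Lemma adapted_mart H (c t : R) : pred H -> (bdd H c) -> 0 <= t <= 1 ->
  meas (mart H t : sigmaT (F t) -> R).
Proof.
move=> pH Hc t01; rewrite /mart /Submission.mint; apply: mfunB.
  exact: (adapted_jsum fF (cs_path CS) (cs_adapted CS) t01 pH.1).
have := adapted_tint fF t01 (predictableM pH.1 (cs_pred CS).1); congr measurable_fun.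
apply/funext => e; apply: eq_Ex => u; case: (leP 0 u) => u0; first by rewrite mulrA.
by rewrite (pH.2 u e) ?mul0r ?mulr0 ?mul0r// negb_and -ltNge u0.
Qed.

Lemma meas_mart H (c t : R) : pred H -> (bdd H c) -> 0 <= t <= 1 -> meas (mart H t).
Proof. by move=> pH Hc t01; apply: (meas_mint (H := fun u e => (u <= t)%R%:R * H u e) CS); exact: pred_upto. Qed.

(** The closed inequality v <= u is right-continuous in u; the cut-off in [mart] is chosen
    accordingly. *)
Lemma cvg_indic_right (u : nat -> R) (p v : R) : (forall n, p < u n) -> u n @[n --> \oo] --> p ->
  (fun n => (v <= u n)%R%:R : R) @ \oo --> ((v <= p)%R%:R : R).
Proof.
move=> pu up; apply: cvg_near_cst; have [vp|vp] := leP v p.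
  by apply: nearW => n; rewrite (le_trans vp) ?ltW.
have /cvgr_lt/(_ _ vp) := up; apply: filterS => n /=; rewrite ltNge => /negbTE ->; exact: erefl.
Qed.

Lemma mart_rc H (c : R) e t : pred H -> (bdd H c) ->
  mart H s e @[s --> t^'+] --> mart H t e.
Proof.
move=> pH Hc; apply/cvg_at_rightP => u [pu up]; rewrite /mart /Submission.mint; apply: cvgB.
  by apply: cvg_bigsum => i; apply: cvgMl; exact: cvg_indic_right.
have mHb : meas (fun v => H v e * b v e).
  by apply: mfunM; apply: (meas_pred1 fF); [exact: pH|exact: (cs_pred CS)].
apply: (Ex_cvg (Y := fun=> c * C)) => [n||n v|v].
- have := mfunM (mb2r (R := R) (mfun_ler (@measurable_id _ R setT) (mcst (u n)))) mHb.
  by congr measurable_fun; apply/funext => v; rewrite /= mulrA.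
- exact: integ_cst.
- by rewrite -mulrA; apply: maskM_le; rewrite normrM ler_pM// (cs_bound CS).
- by apply: cvgMl; apply: cvgMl; exact: cvg_indic_right.
Qed.

Context (r : seq I) (ur : uniq r).
Definition fold_sum H t w := \sum_(j <- r) mart H t (Y j w).

(** Generates the joint filtration at time t of all observations. *)
Let cylF t := cyl Y setT (F t).
Let FI t : 0 <= t <= 1 -> setI_closed (F t).
Proof.
by move=> t01 A B; rewrite -(sigmaT_id (Fs t01)); exact: measurableI.
Qed.
Let FT t : 0 <= t <= 1 -> F t setT.
Proof.
move=> t01; have [F0 FC _] := Fs t01; have := FC _ F0; by rewrite setD0.
Qed.

Let iM H (c t : R) i : pred H -> (bdd H c) -> integ Q (fun w => mart H t (Y i w)).
Proof.
move=> pH Hc; apply: (Ex_law (mY i) (lawY i) _).1.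
apply: (integ_mint (H := fun u e => (u <= t)%R%:R * H u e) (c := c) CS); first exact: pred_upto.
by move=> u e; exact: maskM_le.
Qed.

Let indicM (A B : set T) w : \1_(A `&` B) w = \1_A w * \1_B w :> R. Proof. by rewrite indicI. Qed.

(** On a cylinder the base of observation j is split off; the remaining bases are independent of it,
    and [mint_future] kills the factor of observation j. [Ex_dynkin] then passes to the generated
    sigma-algebra. *)
Lemma fold_future H (c s : R) B : pred H -> (bdd H c) -> 0 <= s <= 1 ->
  <<s cylF s >> B -> \int[Q]_w (\1_B w * fold_sum (fun u e => (s < u)%R%:R * H u e) 1 w) = 0.
Proof.
move=> pH Hc s01 sB; set K := (fun u e => (s < u)%R%:R * H u e).
have pK : pred K by exact: pred_after.
have Kc u e : `|K u e| <= c by exact: maskM_le.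
have iK i : integ Q (fun w => mart K 1 (Y i w)) by exact: (iM _ _ pK Kc).
have iS : integ Q (fold_sum K 1) by exact: integ_sum.
have one A j : cylF s A -> \int[Q]_w (\1_A w * mart K 1 (Y j w)) = 0.
  move=> [q [D [_ FD ->]]].
  pose q' := [seq i <- q | i != j]; pose A' := \bigcap_(i in [set` q']) (Y i @^-1` D i).
  pose Dj := if j \in q then D j else setT.
  have FDj : F s Dj by rewrite /Dj; case: ifP => _; [exact: FD|exact: FT].
  have -> : \bigcap_(i in [set` q]) (Y i @^-1` D i) = A' `&` Y j @^-1` Dj.
    apply/seteqP; split => [w h|w [h h'] i /= iq].
      split; last by rewrite /Dj /preimage /=; case: ifP => // jq; exact: h.
      by move=> i /=; rewrite mem_filter => /andP[_]; exact: h.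
    have [ij|ij] := eqVneq i j; last by apply: h; rewrite /= mem_filter ij.
    by move: h'; rewrite /Dj -ij iq.
  under eq_Ex do rewrite indicM -mulrA.
  have mA' : measurable A' by apply: fin_bigcap_measurable => // i _; rewrite -[_ @^-1` _]setTI; apply: mY => //; exact: (Fm s01).
  have mDj := Fm s01 FDj.
  have iV : integ P (fun e => \1_Dj e * mart K 1 e).
    apply: integ_indicM => //; apply: (integ_mint (H := fun u e => (u <= 1)%R%:R * K u e) (c := c) CS); first exact: pred_upto.
    by move=> u e; exact: maskM_le.
  have [iV' EV'] := Ex_law (mY j) (lawY j) iV.
  have dis : [set i | i != j] `&` [set j] = set0.
    by apply/seteqP; split => // i [/= /eqP].
  have mj : meas (Y j : sig Y [set j] -> E) by exact: meas_sig.
  have [] := @indep_mul _ _ _ _ _ Q _ Y mY indY _ _ (\1_A') (fun w => \1_Dj (Y j w) * mart K 1 (Y j w)) dis.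
  - apply: measurable_indic; apply: (@fin_bigcap_measurable _ (sig Y [set i | i != j])) => // i /=.
    rewrite mem_filter => /andP[ij _]; rewrite -[_ @^-1` _]setTI; apply: (meas_sig (A := [set i | i != j])) => //.
    exact: (Fm s01).
  - exact: (mcomp (integ_meas iV) mj).
  - exact: integ_indic.
  - exact: iV'.
  move=> _; rewrite (_ : (fun w => _) = fun w => \1_A' w * (\1_(Y j @^-1` Dj) w * mart K 1 (Y j w))); last by apply/funext => w; rewrite !indicE.
  move=> ->.
  rewrite (_ : \int[Q]_w (_ * _) = \int[P]_e (\1_Dj e * mart K 1 e))//.
  rewrite [X in _ * X](_ : _ = 0) ?mulr0//.
  by under eq_Ex do rewrite mart1//; exact: mint_future pH Hc s01 FDj.
have : \int[Q]_w (\1_B w * fold_sum K 1 w) = \int[Q]_w (\1_B w * 0).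
  apply: (Ex_dynkin (G := cylF s)) => //.
  - exact: integ_cst.
  - by apply: cyl_measurable => //; exact: Fm.
  - by apply: cyl_setI; [exact: FI|exact: FT].
  - rewrite Ex_cst Ex_sum// big1// => j _.
    have := one setT j; under eq_Ex do rewrite indicT mul1r; apply.
    exists [::], (fun=> setT); split => // [i|]; first exact: FT.
    by apply/seteqP; split => // w _ i.
  - move=> A cA; under [RHS]eq_Ex do rewrite mulr0; rewrite Ex_cst.
    have mA : measurable A by apply: cyl_measurable cA => //; exact: Fm.
    under eq_Ex do rewrite mulr_sumr.
    by rewrite Ex_sum => [|j]; [apply: big1 => j _; exact: one|exact: integ_indicM].
by under [RHS]eq_Ex do rewrite mulr0; rewrite Ex_cst.
Qed.

Let Sm t : 0 <= t <= 1 -> <<s cylF t >> `<=` measurable.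
Proof.
move=> t01; apply: smallest_sub; first exact: sigma_algebra_measurable.
by apply: cyl_measurable => //; exact: Fm.
Qed.

(** By [fold_future] the fold sum is a martingale for the joint filtration along every dyadic grid.
    The bound of [doob_pow] does not depend on the grid, so [dyadic_sup_le] carries it to all
    times. *)
Lemma fold_doob H (c x : R) (p : nat) : pred H -> (bdd H c) -> 0 < x ->
  p = 2 \/ p = 4 -> integ Q (fun w => (\sum_(j <- r) mint H (Y j w)) ^+ p) ->
  let A := [set w | exists2 t, 0 <= t <= 1 & x < `|fold_sum H t w|] in
  measurable A /\ x ^+ p * fine (Q A) <= \int[Q]_w ((\sum_(j <- r) mint H (Y j w)) ^+ p).
Proof.
move=> pH Hc x0 p24 ip A.
have mX t : 0 <= t <= 1 -> meas (fold_sum H t).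
  by move=> t01; apply: measurable_sum => j; apply: mcomp (mY j); exact: meas_mart Hc t01.
have rX w t : 0 <= t < 1 -> fold_sum H s w @[s --> t^'+] --> fold_sum H t w.
  move=> _; apply/cvg_at_rightP => u pu; apply: cvg_bigsum => j.
  by have /cvg_at_rightP := mart_rc (e := Y j w) (t := t) pH Hc; apply.
have mA := meas_dyadic_sup mX rX x; split => //.
rewrite mulrC -ler_pdivlMr ?exprn_gt0//; apply: (@dyadic_sup_le _ _ _ Q _ mX rX x) => m.
rewrite ler_pdivlMr ?exprn_gt0// mulrC.
pose tm := @dyadic R m; pose S i := cylF (tm i); have tm01 i : 0 <= tm i <= 1 := @dyadic01 R m i.
pose Z i := fold_sum H (tm i).
have ZN w : Z (2 ^ m)%N w = \sum_(j <- r) mint H (Y j w).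
  by rewrite /Z /tm dyadic_last; apply: eq_bigr => j _; exact: mart1.
have SS i : <<s S i >> `<=` measurable by exact: Sm.
have mono s t : 0 <= s -> s <= t -> t <= 1 -> F s `<=` F t by have [_ _ h] := fF; exact: h.
have Sh i : <<s S i >> `<=` <<s S i.+1 >>.
  apply: sub_sigma_algebra2 => B [q [D [qs FD ->]]]; exists q, D; split => // k.
  apply: (mono (tm i)) (FD k); first by case/andP: (tm01 i).
  - exact: dyadic_le.
  - by case/andP: (tm01 i.+1).
have mZ i : (i <= 2 ^ m)%N -> meas (Z i : sigmaT (S i) -> R).
  move=> _; apply: (@measurable_sum _ (sigmaT (S i)) R setT _ r (fun j w => mart H (tm i) (Y j w))) => j.
  have am := adapted_mart pH Hc (tm01 i).
  suff mj : meas (Y j : sigmaT (S i) -> sigmaT (F (tm i))).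
    exact: (mcomp am mj).
  move=> _ B; rewrite /measurable/= sigma_algebra_id; last exact: Fs.
  move=> FB; rewrite setTI; apply: sub_sigma_algebra; exists [:: j], (fun=> B); split => //.
  by apply/seteqP; split => [w h k|w /(_ j)]; rewrite /= inE ?eqxx//; [move=> /eqP ->|apply].
have iZ i : (i <= 2 ^ m)%N -> integ Q (Z i) by move=> _; apply: integ_sum => j; exact: iM Hc.
have EZ i B : (i <= 2 ^ m)%N -> <<s S i >> B ->
    \int[Q]_w (\1_B w * Z i w) = \int[Q]_w (\1_B w * Z (2 ^ m)%N w).
  move=> im sB; have mB := SS i _ sB.
  have j1 := integ_indicM mB (iZ _ im); have j2 := integ_indicM mB (iZ _ (leqnn _)).
  apply/eqP; rewrite eq_sym -subr_eq0 -(ExB j2 j1); apply/eqP.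
  rewrite -[RHS](fold_future pH Hc (tm01 i) sB); apply: eq_Ex => w.
  rewrite -mulrBr; congr (_ * _); rewrite /Z /fold_sum -sumrB; apply: eq_bigr => j _.
  rewrite (martB _ pH Hc); last by apply: dyadic_le.
  rewrite /tm dyadic_last -[RHS]/(mint _ _); congr (mint _ _); apply/funext => u; apply/funext => e.
  by rewrite mulrCA.
have eE q : (fun w => (\sum_(j <- r) mint H (Y j w)) ^+ q) = fun w => Z (2 ^ m)%N w ^+ q.
  by apply/funext => w; rewrite ZN.
move: ip; rewrite eE => ip.
exact: (doob_pow SS Sh mZ iZ EZ p24 x0 ip).
Qed.

End fold_martingale.

Lemma norm_leD {R : realType} (a b A B : R) : `|a| <= A -> `|b| <= B -> `|a + b| <= A + B.
Proof. by move=> aA bB; apply: le_trans (ler_normD _ _) _; exact: lerD. Qed.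

Lemma norm_leM {R : realType} (a b A B : R) : `|a| <= A -> `|b| <= B -> `|a * b| <= A * B.
Proof. by move=> aA bB; rewrite normrM ler_pM. Qed.

(** * Smoothed indicators with third order expansions, and one exchange step *)

Section smooth_step.
Context {R : realType}.
Implicit Types s u v : R.

Let pp (s : R) := Num.max 0 s.

(** The distribution function of a sum of three independent uniform variables on [0, 1]: a C^2
    piecewise cubic that rises from 0 to 1 on [0, 3]. Explicit pieces let every bound be checked by
    arithmetic. *)
Definition step s : R :=
  (pp s ^+ 3 - 3 * pp (s - 1) ^+ 3 + 3 * pp (s - 2) ^+ 3 - pp (s - 3) ^+ 3) / 6.

Let pp0 s : s <= 0 -> pp s = 0. Proof. exact: max_l. Qed.
Let ppid s : 0 <= s -> pp s = s. Proof. exact: max_r. Qed.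

Let step_cases s : s <= 0 \/ exists u, 0 <= u /\
  [\/ s = u /\ u <= 1, s = 1 + u /\ u <= 1, s = 2 + u /\ u <= 1 | s = 3 + u].
Proof.
have [s0|s0] := leP s 0; [by left|right].
have [s1|s1] := leP s 1; first by exists s; split; [exact: ltW|apply: Or41].
have [s2|s2] := leP s 2.
  by exists (s - 1); split; [lra|apply: Or42; split; lra].
have [s3|s3] := leP s 3.
  by exists (s - 2); split; [lra|apply: Or43; split; lra].
by exists (s - 3); split; [lra|apply: Or44; lra].
Qed.

Let pps s : (s <= 0 /\ [/\ pp s = 0, pp (s - 1) = 0, pp (s - 2) = 0 & pp (s - 3) = 0]) \/
  exists u, 0 <= u /\
  [\/ u <= 1 /\ [/\ s = u, pp s = u, pp (s - 1) = 0, pp (s - 2) = 0 & pp (s - 3) = 0],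
      u <= 1 /\ [/\ s = 1 + u, pp s = 1 + u, pp (s - 1) = u, pp (s - 2) = 0 & pp (s - 3) = 0],
      u <= 1 /\ [/\ s = 2 + u, pp s = 2 + u, pp (s - 1) = 1 + u, pp (s - 2) = u & pp (s - 3) = 0]
    | [/\ s = 3 + u, pp s = 3 + u, pp (s - 1) = 2 + u, pp (s - 2) = 1 + u & pp (s - 3) = u]].
Proof.
case: (step_cases s) => [s0|[u [u0 h]]]; [left|right].
  by split => //; split; apply: pp0; lra.
exists u; split => //; case: h => [[-> u1]|[-> u1]|[-> u1]|->]; [apply: Or41|apply: Or42|apply: Or43|apply: Or44];
  rewrite ?u1; do ?split => //; try (by apply: pp0; lra); rewrite ppid; lra.
Qed.

Lemma step_le0 s : s <= 0 -> step s = 0.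
Proof.
move=> s0; rewrite /step !pp0; [ring|lra|lra|lra|lra].
Qed.

Lemma step_ge3 s : 3 <= s -> step s = 1.
Proof.
move=> s3; have p a : a <= 3 -> pp (s - a) = s - a by move=> a3; apply: ppid; lra.
by rewrite /step ppid ?p; [field|lra|lra|lra|lra].
Qed.

Lemma step01 s : 0 <= step s <= 1.
Proof.
rewrite /step; case: (pps s) => [[_ [-> -> -> ->]]|[u [u0]]]; first by apply/andP; split; lra.
have u2 : 0 <= u * u by rewrite mulr_ge0.
have u3 : 0 <= u * u * u by rewrite !mulr_ge0.
case=> [[u1 [_ -> -> -> ->]]|[u1 [_ -> -> -> ->]]|[u1 [_ -> -> -> ->]]|[_ -> -> -> ->]]; try (by apply/andP; split; lra).
- have : u ^+ 3 <= 1 by rewrite exprn_ile1.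
  by move=> h; apply/andP; split; lra.
- have h1 : u * u <= u by nra.
  have h2 : u * u * u <= u * u by nra.
  have h3 : 0 <= (u - 1) * (u - 1) * (u + 2) by rewrite mulr_ge0 ?addr_ge0// -expr2 sqr_ge0.
  by apply/andP; split; lra.
- have h1 : 0 <= (1 - u) ^+ 3 by rewrite exprn_ge0//; lra.
  have h2 : (1 - u) ^+ 3 <= 1 by rewrite exprn_ile1//; lra.
  by apply/andP; split; lra.
Qed.

Let cub_jet s v :
  `|pp (s + v) ^+ 3 - pp s ^+ 3 - 3 * pp s ^+ 2 * v - 3 * pp s * v ^+ 2| <= `|v| ^+ 3.
Proof.
have [s0|s0] := leP 0 s; have [sv0|sv0] := leP 0 (s + v).
- by rewrite !ppid// -normrX le_eqVlt; apply/orP; left; apply/eqP; congr `|_|; ring.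
- rewrite (pp0 (ltW sv0)) ppid//.
  have v0 : v < 0 by lra.
  have h : `|- (s + v)| ^+ 3 <= `|v| ^+ 3.
    by rewrite lerXn2r ?nnegrE// (ltr0_norm v0) gtr0_norm; lra.
  rewrite gtr0_norm in h; last by lra.
  rewrite (ltr0_norm v0) in h *.
  have h0 : 0 <= (- (s + v)) ^+ 3 by rewrite exprn_ge0//; lra.
  have e : 0 ^+ 3 - s ^+ 3 - 3 * s ^+ 2 * v - 3 * s * v ^+ 2 = (- (s + v)) ^+ 3 - (- v) ^+ 3 by ring.
  by rewrite e ler_norml; apply/andP; split; lra.
- rewrite (pp0 (ltW s0)) ppid//.
  rewrite (_ : _ - _ = (s + v) ^+ 3); last by ring.
  have v0 : 0 <= v by lra.
  by rewrite normrX lerXn2r ?nnegrE// !ger0_norm//; lra.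
- rewrite (pp0 (ltW s0)) (pp0 (ltW sv0)).
  by rewrite (_ : _ - _ = 0) ?normr0 ?exprn_ge0//; ring.
Qed.

(** The witnesses are the first derivative and half of the second. Each truncated cube has remainder
    at most |v|^3 ([cub_jet]), and the weights 1, 3, 3, 1 over 6 add up to 8/6, which is below 2. *)
Lemma step_jet s : exists a q : R, [/\ `|a| <= 1, `|q| <= 1 &
  forall v, `|step (s + v) - step s - a * v - q * v ^+ 2| <= 2 * `|v| ^+ 3].
Proof.
exists ((pp s ^+ 2 - 3 * pp (s - 1) ^+ 2 + 3 * pp (s - 2) ^+ 2 - pp (s - 3) ^+ 2) / 2),
  ((pp s - 3 * pp (s - 1) + 3 * pp (s - 2) - pp (s - 3)) / 2); split.
- case: (pps s) => [[_ [-> -> -> ->]]|[u [u0]]]; first by rewrite ler_norml; apply/andP; split; lra.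
  have u2 : 0 <= u * u by rewrite mulr_ge0.
  case=> [[u1 [_ -> -> -> ->]]|[u1 [_ -> -> -> ->]]|[u1 [_ -> -> -> ->]]|[_ -> -> -> ->]];
    rewrite ler_norml; apply/andP; split; nra.
- case: (pps s) => [[_ [-> -> -> ->]]|[u [u0]]]; first by rewrite ler_norml; apply/andP; split; lra.
  case=> [[u1 [_ -> -> -> ->]]|[u1 [_ -> -> -> ->]]|[u1 [_ -> -> -> ->]]|[_ -> -> -> ->]];
    rewrite ler_norml; apply/andP; split; lra.
- move=> v; rewrite /step.
  have j0 := cub_jet s v; have j1 := cub_jet (s - 1) v; have j2 := cub_jet (s - 2) v; have j3 := cub_jet (s - 3) v.
  rewrite !(addrAC s v).
  move: j0 j1 j2 j3; rewrite !ler_norml => /andP[? ?] /andP[? ?] /andP[? ?] /andP[? ?].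
  by apply/andP; split; lra.
Qed.

Lemma meas_step : meas step.
Proof.
have mp c : meas (fun s : R => pp (s - c) ^+ 3).
  apply: mfunX; apply: measurable_maxr => //.
  by apply: mfunB.
rewrite /step; apply: mfunM => //.
apply: mfunB; last exact: mp.
apply: mfunD; last by apply: mfunM => //; exact: mp.
apply: mfunB; last by apply: mfunM => //; exact: mp.
by apply: mfunX; exact: measurable_maxr.
Qed.

End smooth_step.

Section jets.
Context {R : realType} (k : nat).
Local Notation vec := ('I_k -> R).
Implicit Types (y u : vec) (f g : vec -> R).

Definition norm1 u : R := \sum_l `|u l|.

Definition linear_form (L : vec -> R) := exists c : vec, forall u, L u = \sum_l c l * u l.
Definition quadratic_form (Q : vec -> R) :=
  exists c : 'I_k -> vec, forall u, Q u = \sum_l \sum_l' c l l' * (u l * u l').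

(* A second order expansion of f at every point, without derivatives. *)
Definition has_jet (M : R) f := forall y, `|f y| <= 1 /\
  exists L Q, [/\ linear_form L, quadratic_form Q,
    forall u, `|L u| <= M * norm1 u, forall u, `|Q u| <= M * norm1 u ^+ 2
  & forall u, `|f (fun l => y l + u l) - f y - L u - Q u| <= M * norm1 u ^+ 3].

Lemma norm1_ge0 u : 0 <= norm1 u. Proof. exact: sumr_ge0. Qed.

Lemma le_norm1 u l : `|u l| <= norm1 u.
Proof. by rewrite /norm1 (bigD1 l)//= lerDl sumr_ge0. Qed.

Lemma linear_formZ a L : linear_form L -> linear_form (fun u => a * L u).
Proof.
move=> [c Lc]; exists (fun l => a * c l) => u; rewrite Lc mulr_sumr.
by apply: eq_bigr => l _; rewrite mulrA.
Qed.

Lemma linear_formD L L' : linear_form L -> linear_form L' -> linear_form (fun u => L u + L' u).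
Proof.
move=> [c Lc] [c' Lc']; exists (fun l => c l + c' l) => u; rewrite Lc Lc' -big_split/=.
by apply: eq_bigr => l _; rewrite mulrDl.
Qed.

Lemma quadratic_formZ a L : quadratic_form L -> quadratic_form (fun u => a * L u).
Proof.
move=> [c Lc]; exists (fun l l' => a * c l l') => u; rewrite Lc mulr_sumr.
by apply: eq_bigr => l _; rewrite mulr_sumr; apply: eq_bigr => l' _; rewrite mulrA.
Qed.

Lemma quadratic_formD L L' : quadratic_form L -> quadratic_form L' ->
  quadratic_form (fun u => L u + L' u).
Proof.
move=> [c Lc] [c' Lc']; exists (fun l l' => c l l' + c' l l') => u; rewrite Lc Lc' -big_split/=.
by apply: eq_bigr => l _; rewrite -big_split/=; apply: eq_bigr => l' _; rewrite mulrDl.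
Qed.

Lemma linear_formM L L' : linear_form L -> linear_form L' -> quadratic_form (fun u => L u * L' u).
Proof.
move=> [c Lc] [c' Lc']; exists (fun l l' => c l * c' l') => u; rewrite Lc Lc' mulr_suml.
by apply: eq_bigr => l _; rewrite mulr_sumr; apply: eq_bigr => l' _; ring.
Qed.

Lemma has_jet_cst : has_jet 1 (fun _ => 1).
Proof.
move=> y; split; first by rewrite normr1.
exists (fun _ => 0), (fun _ => 0); split => [| |u|u|u].
- by exists (fun _ => 0) => u; rewrite big1// => l _; rewrite mul0r.
- by exists (fun _ _ => 0) => u; rewrite big1// => l _; rewrite big1// => l' _; rewrite mul0r.
- by rewrite normr0 mul1r norm1_ge0.
- by rewrite normr0 mul1r exprn_ge0// norm1_ge0.
- by rewrite !subr0 subrr normr0 mul1r exprn_ge0// norm1_ge0.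
Qed.

(** For displacements of norm at most 1 the product of the two expansions is multiplied out; for
    larger ones each term is bounded by itself, since lower powers of the norm are then below the
    third. The factor 20 leaves room in both cases. *)
Lemma has_jetM M f g : 1 <= M -> has_jet M f -> has_jet M g -> has_jet (20 * M ^+ 2) (fun y => f y * g y).
Proof.
move=> M1 jf jg y; have [f1 [Lf [Qf [lf qf bLf bQf rf]]]] := jf y; have [g1 [Lg [Qg [lg qg bLg bQg rg]]]] := jg y.
have M0 : 0 <= M by lra.
have MM : M <= M ^+ 2 by rewrite expr2 ler_peMl.
have norm_le1 (a b : R) : `|a| <= 1 -> `|b| <= 1 -> `|a * b| <= 1.
  by move=> a1 b1; rewrite normrM -[1]mulr1 ler_pM.
split; first exact: norm_le1.
exists (fun u => f y * Lg u + g y * Lf u), (fun u => f y * Qg u + g y * Qf u + Lf u * Lg u).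
have sc (a z B : R) : `|a| <= 1 -> `|z| <= B -> `|a * z| <= B.
  by move=> a1 zB; rewrite normrM -[B]mul1r ler_pM.
split => [| |u|u|u].
- by apply: linear_formD; exact: linear_formZ.
- by apply: quadratic_formD; [apply: quadratic_formD; exact: quadratic_formZ|exact: linear_formM].
- apply: (le_trans (ler_normD _ _)); apply: (@le_trans _ _ (M * norm1 u + M * norm1 u)).
    by apply: lerD; apply: sc.
  by have := norm1_ge0 u; nra.
- have n0 := norm1_ge0 u; have nn := exprn_ge0 2 n0.
  apply: (le_trans (ler_normD _ _)).
  apply: (@le_trans _ _ (M * norm1 u ^+ 2 + M * norm1 u ^+ 2 + (M * norm1 u) * (M * norm1 u))).
    apply: lerD; last exact: norm_leM.
    by apply: norm_leD; apply: sc.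
  by nra.
- set yu := fun l => y l + u l; have n0 := norm1_ge0 u; set s := norm1 u in n0 *.
  have := rf u; have := rg u; have := bLf u; have := bQf u; have := bLg u; have := bQg u.
  have fu1 := (jf yu).1; have gu1 := (jg yu).1; rewrite -/yu -/s.
  move: (f yu) (g yu) fu1 gu1 (f y) (g y) f1 g1 (Lf u) (Lg u) (Qf u) (Qg u).
  move=> fu gu fu1 gu1 f0 g0 f1 g1 lf' lg' qf' qg' hqg hlg hqf hlf hrg hrf.
  have s2 := exprn_ge0 2 n0; have s3 := exprn_ge0 3 n0.
  have [sl|sl] := leP s 1.
    have -> : fu * gu - f0 * g0 - (f0 * lg' + g0 * lf') - (f0 * qg' + g0 * qf' + lf' * lg') =
      fu * (gu - g0 - lg' - qg') + g0 * (fu - f0 - lf' - qf') + (fu - f0 - lf' - qf') * (lg' + qg') + (lf' * qg' + qf' * lg' + qf' * qg') by ring.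
    apply: (@le_trans _ _ (M * s ^+ 3 + M * s ^+ 3 + (M * s ^+ 3) * (M * s + M * s ^+ 2) + (M * s * (M * s ^+ 2) + M * s ^+ 2 * (M * s) + M * s ^+ 2 * (M * s ^+ 2)))).
      by repeat first [exact: sc|assumption|apply: norm_leD|apply: norm_leM].
    have e1 : s ^+ 2 <= s by rewrite expr2; nra.
    have k1 : M * s ^+ 3 <= M ^+ 2 * s ^+ 3 by rewrite ler_wpM2r.
    have k2 : s ^+ 3 * s <= s ^+ 3 by rewrite ler_piMr.
    have k3 : s ^+ 3 * s ^+ 2 <= s ^+ 3 by rewrite ler_piMr// (le_trans e1).
    have M20 : 0 <= M ^+ 2 by rewrite sqr_ge0.
    have := ler_wpM2l M20 k2; have := ler_wpM2l M20 k3.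
    have q0 : 0 <= M ^+ 2 * s ^+ 3 by rewrite mulr_ge0.
    by lra.
  have l3 : s <= s ^+ 3 by rewrite -[X in X <= _]expr1 ler_weXn2l// ltW.
  have l23 : s ^+ 2 <= s ^+ 3 by rewrite ler_weXn2l// ltW.
  have l03 : 1 <= s ^+ 3 by rewrite exprn_ege1// ltW.
  apply: (@le_trans _ _ (1 + 1 + (M * s + M * s) + (M * s ^+ 2 + M * s ^+ 2 + M * s * (M * s)))).
    repeat (apply: norm_leD; rewrite ?normrN);
      by first [exact: norm_le1|exact: sc|exact: norm_leM].
  have M21 : 1 <= M ^+ 2 by rewrite exprn_ege1.
  have k1 : M * s <= M ^+ 2 * s ^+ 3 by rewrite ler_pM.
  have k2 : M * s ^+ 2 <= M ^+ 2 * s ^+ 3 by rewrite ler_pM.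
  have k3 : M ^+ 2 * s ^+ 2 <= M ^+ 2 * s ^+ 3 by rewrite ler_wpM2l// sqr_ge0.
  have k4 : 1 <= M ^+ 2 * s ^+ 3 by rewrite -[1]mulr1 ler_pM.
  by lra.
Qed.

Lemma has_jet_ridge (a b B : R) (l : 'I_k) : `|b| <= B -> 1 <= B ->
  has_jet (2 * B ^+ 3) (fun y => step (a + b * y l)).
Proof.
move=> bB B1 y; split; first by rewrite ler_norml; have /andP[] := step01 (a + b * y l); lra.
have [c [q [c1 q1 r]]] := step_jet (a + b * y l).
have B0 : 0 <= B by lra.
have B13 : B <= B ^+ 3 by rewrite -[X in X <= _]expr1 ler_weXn2l.
have B23 : B ^+ 2 <= B ^+ 3 by rewrite ler_weXn2l.
exists (fun u => c * b * u l), (fun u => q * b ^+ 2 * (u l * u l)); split => [| |u|u|u].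
- exists (fun i => c * b * (i == l)%:R) => u; rewrite (bigD1 l)//= eqxx mulr1 big1 ?addr0// => i /negbTE ->.
  by rewrite mulr0 mul0r.
- exists (fun i j => q * b ^+ 2 * ((i == l) && (j == l))%:R) => u.
  rewrite (bigD1 l)//= (bigD1 l)//= !eqxx mulr1 !big1 ?addr0// => i /negbTE il; last by rewrite il andbF mulr0 mul0r.
  by rewrite big1// => j _; rewrite il mulr0 mul0r.
- apply: (@le_trans _ _ (1 * B * norm1 u)).
    by repeat first [assumption|exact: le_norm1|apply: norm_leM].
  by have := norm1_ge0 u; nra.
- rewrite expr2; apply: (@le_trans _ _ (1 * (B * B) * (norm1 u * norm1 u))).
    by repeat first [assumption|exact: le_norm1|apply: norm_leM].
  by rewrite -!expr2; have := sqr_ge0 (norm1 u); nra.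
- have -> : a + b * (y l + u l) = a + b * y l + b * u l by ring.
  have -> : q * b ^+ 2 * (u l * u l) = q * (b * u l) ^+ 2 by ring.
  rewrite -(mulrA c); apply: (le_trans (r _)).
  have h : `|b * u l| <= B * norm1 u by apply: norm_leM => //; exact: le_norm1.
  by rewrite -(mulrA 2) -exprMn ler_pM2l// lerXn2r ?nnegrE ?mulr_ge0 ?norm1_ge0.
Qed.

(** A smoothed indicator of {max |y_l| < c}: it is 1 when all |y_l| are at most c - 3 eta and 0 when
    one of them reaches c. The width 3 eta comes from the interval [0, 3] on which [step] rises. *)
Definition bump (c eta : R) y : R :=
  \prod_l (step (c / eta + (- eta^-1) * y l) * step (c / eta + eta^-1 * y l)).

Lemma has_jet_mono M M' f : M <= M' -> has_jet M f -> has_jet M' f.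
Proof.
move=> MM jf y; have [f1 [L [Q [lL qQ bL bQ r]]]] := jf y; split => //.
have h p u : M * norm1 u ^+ p <= M' * norm1 u ^+ p by rewrite ler_wpM2r// exprn_ge0// norm1_ge0.
exists L, Q; split => // u; [exact: le_trans (bL u) (h 1%N u)|exact: le_trans (bQ u) (h _ u)|exact: le_trans (r u) (h _ u)].
Qed.

Lemma has_jet_prod (s : seq 'I_k) (M : R) : 1 <= M -> exists M', 1 <= M' /\
  forall g : 'I_k -> vec -> R, (forall l, has_jet M (g l)) ->
    has_jet M' (fun y => \prod_(l <- s) g l y).
Proof.
move=> M1; elim: s => [|l s [M' [M'1 IH]]].
  exists 1; split => // g _; rewrite (_ : (fun y => _) = fun=> 1); first exact: has_jet_cst.
  by apply/funext => y; rewrite big_nil.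
pose M2 := Num.max M M'; have M21 : 1 <= M2 by rewrite le_max M1.
exists (20 * M2 ^+ 2); split => [|g jg].
  by have : 1 <= M2 ^+ 2 := exprn_ege1 2 M21; lra.
rewrite (_ : (fun y => _) = fun y => g l y * \prod_(l <- s) g l y); last first.
  by apply/funext => y; rewrite big_cons.
apply: has_jetM => //; first by apply: has_jet_mono (jg l); rewrite le_max lexx.
by apply: has_jet_mono (IH g jg); rewrite le_max lexx orbT.
Qed.

(** The same M serves every level c, because c enters each factor as a shift only and the slopes are
    plus or minus 1/eta. *)
Lemma has_jet_bump (eta : R) : 0 < eta -> exists M : R, 1 <= M /\ forall c, has_jet M (bump c eta).
Proof.
move=> eta0; pose B := Num.max 1 eta^-1.
have B1 : 1 <= B by rewrite le_max lexx.
have bB : `|eta^-1| <= B by rewrite gtr0_norm ?invr_gt0// le_max lexx orbT.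
have bB' : `|- eta^-1| <= B by rewrite normrN.
have B3 : 1 <= 2 * B ^+ 3 by have : 1 <= B ^+ 3 := exprn_ege1 3 B1; lra.
have M1 : 1 <= 20 * (2 * B ^+ 3) ^+ 2 by have : 1 <= (2 * B ^+ 3) ^+ 2 := exprn_ege1 2 B3; lra.
have [M' [M'1 h]] := has_jet_prod (index_enum 'I_k) M1.
exists M'; split => // c; apply: h => l.
by apply: has_jetM => //; exact: has_jet_ridge.
Qed.

Lemma bump01 c eta y : 0 <= bump c eta y <= 1.
Proof.
have h (l : 'I_k) : 0 <= step (c / eta + (- eta^-1) * y l) * step (c / eta + eta^-1 * y l) <= 1.
  have /andP[a0 a1] := step01 (c / eta + (- eta^-1) * y l).
  have /andP[b0 b1] := step01 (c / eta + eta^-1 * y l).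
  by rewrite mulr_ge0//= -[leRHS]mulr1 ler_pM.
rewrite /bump; apply: (@big_ind _ (fun z => 0 <= z <= 1)) => [|x z /andP[x0 x1] /andP[z0 z1]|l _]; [by rewrite ler01 lexx| |exact: h].
by rewrite mulr_ge0//= -[leRHS]mulr1 ler_pM.
Qed.

Lemma bump_eq1 c eta y : 0 < eta -> (forall l, `|y l| <= c - 3 * eta) -> bump c eta y = 1.
Proof.
move=> e0 yc; rewrite /bump big1// => l _.
have e : eta / eta = 1 by rewrite divff// gt_eqF.
have h (a : R) : a <= c - 3 * eta -> 3 <= c / eta - eta^-1 * a.
  by move=> ac; rewrite -(ler_pM2r e0) mulrBl mulrAC -mulrA e mulr1 mulrAC mulVf ?gt_eqF// mul1r; lra.
have /andP[y1 y2] : - (c - 3 * eta) <= y l <= c - 3 * eta by rewrite -ler_norml.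
rewrite mulNr step_ge3 ?h// step_ge3 ?mulr1//.
by have := h (- y l); rewrite mulrN opprK; apply; lra.
Qed.

Lemma bump_eq0 c eta y : 0 < eta -> (exists l, c <= `|y l|) -> bump c eta y = 0.
Proof.
move=> e0 [l cl]; rewrite /bump (bigD1 l)//=.
have h (a : R) : c <= a -> c / eta - eta^-1 * a <= 0.
  by move=> ca; rewrite mulrC -mulrBr pmulr_rle0 ?invr_gt0//; lra.
move: cl; rewrite ler_normr => /orP[cl|cl].
  by rewrite mulNr (step_le0 (h _ cl)) !mul0r.
by rewrite [X in _ * X * _](step_le0 _) ?mulr0 ?mul0r//; have := h _ cl; rewrite mulrN opprK.
Qed.

Lemma meas_bump {d} {T : measurableType d} c eta (X : 'I_k -> T -> R) :
  (forall l, meas (X l)) -> meas (fun w => bump c eta (fun l => X l w)).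
Proof.
move=> mX; apply: measurable_prod => l _; apply: mfunM;
  apply: (mcomp meas_step); apply: mfunD => //; exact: mfunM.
Qed.

End jets.

Section one_step.
Context {R : realType} {k : nat}.
Context {d d'} {E : measurableType d} {T : measurableType d'} (P : probability E R) (Q : probability T R).
Context (X : 'I_k -> E -> R) (Z : 'I_k -> T -> R) (a b : R).

Record third_moments {d0} {S : measurableType d0} (PS : probability S R) (Y : 'I_k -> S -> R) (a : R) := {
  tm_meas : forall l, meas (Y l);
  tm_int : forall l, integ PS (Y l);
  tm_mean : forall l, \int[PS]_w Y l w = 0;
  tm_int2 : forall l l', integ PS (fun w => Y l w * Y l' w);
  tm_int3 : integ PS (fun w => norm1 (fun l => Y l w) ^+ 3);
  tm_third : \int[PS]_w (norm1 (fun l => Y l w) ^+ 3) <= a }.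

Hypotheses (tX : third_moments P X a) (tZ : third_moments Q Z b).
Hypothesis cov : forall l l', \int[P]_e (X l e * X l' e) = \int[Q]_w (Z l w * Z l' w).

(** One side of the exchange: in E f(y + Y) the linear term is centred, the quadratic term sees only
    the covariances of Y, and the remainder costs M times the third moment. Equal covariances then
    cancel in [lindeberg_step]. *)
Let half {d0} {S : measurableType d0} (PS : probability S R) (Y : 'I_k -> S -> R) (c M f0 : R)
    (f : ('I_k -> R) -> R) (y : 'I_k -> R) (L Qf : ('I_k -> R) -> R) (q : 'I_k -> 'I_k -> R) :
  third_moments PS Y c -> 0 <= M -> linear_form L -> (forall u, Qf u = \sum_l \sum_l' q l l' * (u l * u l')) ->
  (forall y, `|f y| <= 1) -> meas (fun w => f (fun l => y l + Y l w)) ->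
  (forall u, `|f (fun l => y l + u l) - f0 - L u - Qf u| <= M * norm1 u ^+ 3) ->
  `|\int[PS]_w f (fun l => y l + Y l w) - (f0 + \sum_l \sum_l' q l l' * \int[PS]_w (Y l w * Y l' w))| <= M * c.
Proof.
move=> tY M0 [cL LE] QE f1 mf r.
have i1 := integ_bnd PS mf (fun w => f1 _).
have i2 : integ PS (fun w => L (Y ^~ w)).
  by rewrite (_ : (fun w => _) = fun w => \sum_l cL l * Y l w);
    [apply: integ_sum => l; exact/integZ/(tm_int tY)|apply/funext => w; rewrite LE].
have E2 : \int[PS]_w L (Y ^~ w) = 0.
  under eq_Ex do rewrite LE.
  rewrite Ex_sum => [|l]; last exact/integZ/(tm_int tY).
  by apply: big1 => l _; rewrite (ExZ _ (tm_int tY l)) (tm_mean tY) mulr0.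
have i3' l : integ PS (fun w => \sum_l' q l l' * (Y l w * Y l' w)).
  by apply: integ_sum => l'; exact/integZ/(tm_int2 tY).
have i3 : integ PS (fun w => Qf (Y ^~ w)).
  by rewrite (_ : (fun w => _) = fun w => \sum_l \sum_l' q l l' * (Y l w * Y l' w));
    [exact: integ_sum|apply/funext => w; rewrite QE].
have E3 : \int[PS]_w Qf (Y ^~ w) = \sum_l \sum_l' q l l' * \int[PS]_w (Y l w * Y l' w).
  under eq_Ex do rewrite QE.
  rewrite Ex_sum//; apply: eq_bigr => l _; rewrite Ex_sum => [|l']; last exact/integZ/(tm_int2 tY).
  by apply: eq_bigr => l' _; rewrite (ExZ _ (tm_int2 tY l l')).
have ic := integ_cst PS f0.
pose rem w := f (fun l => y l + Y l w) - f0 - L (Y ^~ w) - Qf (Y ^~ w).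
have irem : integ PS rem := integB (integB (integB i1 ic) i2) i3.
have <- : \int[PS]_w rem w = \int[PS]_w f (fun l => y l + Y l w) - (f0 + \sum_l \sum_l' q l l' * \int[PS]_w (Y l w * Y l' w)).
  by rewrite (ExB (integB (integB i1 ic) i2) i3) (ExB (integB i1 ic) i2) (ExB i1 ic) Ex_cst E2 E3; ring.
apply: (le_trans (abs_Ex irem)); apply: (@le_trans _ _ (\int[PS]_w (M * norm1 (Y ^~ w) ^+ 3))).
  by apply: le_Ex => [||w]; [exact: integ_abs|exact/integZ/(tm_int3 tY)|exact: r].
by rewrite (ExZ _ (tm_int3 tY)) ler_wpM2l// (tm_third tY).
Qed.

Lemma lindeberg_step (M : R) f y : 0 <= M -> has_jet M f ->
  meas (fun e => f (fun l => y l + X l e)) -> meas (fun w => f (fun l => y l + Z l w)) ->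
  `|\int[P]_e f (fun l => y l + X l e) - \int[Q]_w f (fun l => y l + Z l w)| <= M * (a + b).
Proof.
move=> M0 jf mX mZ; have [_ [L [Qf [lL [q qQ] _ _ r]]]] := jf y.
have f1 z : `|f z| <= 1 by case: (jf z).
have := half tX M0 lL qQ f1 mX r; have := half tZ M0 lL qQ f1 mZ r.
have -> : \sum_l \sum_l' q l l' * \int[P]_w (X l w * X l' w) = \sum_l \sum_l' q l l' * \int[Q]_w (Z l w * Z l' w).
  by apply: eq_bigr => l _; apply: eq_bigr => l' _; rewrite cov.
rewrite !ler_norml => /andP[? ?] /andP[? ?]; apply/andP; split; lra.
Qed.

End one_step.

(** * Gaussian laws: density bound and moments *)

Section density.
Context {R : realType} (nu : probability (measurableTypeR R) R) (g : R -> R).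
Hypotheses (mg : meas g) (g0 : forall x, 0 <= g x).
Hypothesis nuE : forall A, measurable A -> nu A = (\int[lebesgue_measure]_(x in A) (g x)%:E)%E.

Let mEg : meas (EFin \o g). Proof. exact/mEFinP. Qed.

Let density_indic A : measurable A ->
  (\int[nu]_x (\1_A x)%:E = \int[lebesgue_measure]_x ((\1_A x)%:E * (g x)%:E))%E.
Proof.
move=> mA; rewrite integral_indic// setIT; transitivity (\int[lebesgue_measure]_(x in A) (g x)%:E)%E; first exact: nuE.
rewrite integral_mkcond.
apply: eq_integral => x _; rewrite patchE indicE.
by case: ifP => _; rewrite ?mul1e ?mul0e.
Qed.

Import HBNNSimple.

Let density_nnsfun (f : {nnsfun measurableTypeR R >-> R}) :
  (\int[nu]_x (f x)%:E = \int[lebesgue_measure]_x ((f x)%:E * (g x)%:E))%E.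
Proof.
under [LHS]eq_integral do rewrite fimfunE -fsumEFin//.
rewrite [LHS]ge0_integral_fsum//; last 2 first.
- by move=> r; exact/mEFinP/mcomp.
- by move=> n x _; rewrite EFinM nnfun_muleindic_ge0.
under [RHS]eq_integral.
  move=> x xD; rewrite muleC fimfunE -fsumEFin// ge0_mule_fsumr; last first.
    by move=> r; rewrite EFinM nnfun_muleindic_ge0.
  over.
rewrite [RHS]ge0_integral_fsum//; last 2 first.
- by move=> r; apply: emeasurable_funM; [exact: mEg|exact/mEFinP/mcomp].
- by move=> n x _; rewrite EFinM mule_ge0 ?lee_fin// -lee_fin EFinM nnfun_muleindic_ge0.
apply: eq_fsbigr => r _; rewrite integralZl_indic_nnsfun//= density_indic//.
have [r0|r0] := leP 0 r; last first.
  rewrite preimage_nnfun0//; under eq_integral do rewrite indic0 mul0e.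
  rewrite integral0 mule0; under eq_integral do rewrite indic0 mulr0 mule0.
  by rewrite integral0.
rewrite -ge0_integralZl//.
- by apply: eq_integral => x _; rewrite -!EFinM; congr _%:E; ring.
- by apply: emeasurable_funM => //; exact/mEFinP.
- by move=> x _; rewrite -EFinM lee_fin mulr_ge0.
Qed.

Lemma ge0_integral_density (f : measurableTypeR R -> R) : meas f -> (forall x, 0 <= f x) ->
  (\int[nu]_x (f x)%:E = \int[lebesgue_measure]_x (f x * g x)%:E)%E.
Proof.
move=> mf f0; have mEf : meas (EFin \o f) by exact/mEFinP.
have Ef0 x : (0 <= (EFin \o f) x)%E by rewrite lee_fin.
pose f_ := nnsfun_approx measurableT mEf.
have cv x : (f_ n x)%:E @[n --> \oo] --> (f x)%:E by apply: cvg_nnsfun_approx.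
have nd x : nondecreasing_seq (fun n => f_ n x).
  by move=> n m nm; exact/lefP/nd_nnsfun_approx.
have -> : (\int[nu]_x (f x)%:E)%E = limn (fun n => \int[nu]_x (f_ n x)%:E)%E.
  rewrite -monotone_convergence//=.
  - by apply: eq_integral => x _; apply/esym/cvg_lim => //; exact: cv.
  - by move=> n; exact/mEFinP/measurable_funTS.
  - by move=> n x _; rewrite lee_fin.
  - by move=> x _ n m nm; rewrite lee_fin nd.
have -> : (\int[lebesgue_measure]_x (f x * g x)%:E)%E =
    limn (fun n => \int[lebesgue_measure]_x ((f_ n x)%:E * (g x)%:E))%E.
  rewrite -monotone_convergence//=.
  - apply: eq_integral => x _; apply/esym/cvg_lim => //.
    by rewrite EFinM; apply: cvgeZr => //; exact: cv.
  - by move=> n; apply: emeasurable_funM; [exact/mEFinP/measurable_funTS|exact: mEg].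
  - by move=> n x _; rewrite mule_ge0 ?lee_fin.
  - by move=> x _ n m nm; rewrite -!EFinM lee_fin ler_wpM2r// nd.
by apply: congr_lim; apply/funext => n; exact: density_nnsfun.
Qed.

End density.

Section normal.
Context {R : realType} (s : R).
Hypothesis s0 : 0 < s.

Let sn0 : s != 0. Proof. exact: lt0r_neq0. Qed.

(** Completing the square: exp(l x) times the N(0, s^2) density is exp(l^2 s^2 / 2) times the N(l
    s^2, s^2) density. *)
Lemma normal_mgf (l : R) :
  integ (normal_prob 0 s) (fun x => expR (l * x)) /\
  \int[normal_prob 0 s]_x expR (l * x) = expR (l ^+ 2 * s ^+ 2 / 2).
Proof.
have me : meas (fun x : R => expR (l * x)) by apply: mcomp => //; exact: mfunM.
have E : (\int[normal_prob 0 s]_x (expR (l * x))%:E = (expR (l ^+ 2 * s ^+ 2 / 2))%:E)%E.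
  rewrite (@ge0_integral_density R (normal_prob 0 s) (normal_pdf 0 s) (measurable_normal_pdf 0 s)
    (normal_pdf_ge0 0 s) (fun A _ => erefl) _ me (fun x => expR_ge0 _)).
  transitivity ((expR (l ^+ 2 * s ^+ 2 / 2))%:E * \int[lebesgue_measure]_x (normal_pdf (l * s ^+ 2) s x)%:E)%E; last first.
    by rewrite integral_normal_pdf mule1.
  transitivity (\int[lebesgue_measure]_x ((expR (l ^+ 2 * s ^+ 2 / 2))%:E * (normal_pdf (l * s ^+ 2) s x)%:E))%E; last first.
    apply: ge0_integralZl => //.
    - by apply/mEFinP; exact: measurable_normal_pdf.
    - by move=> x _; rewrite lee_fin normal_pdf_ge0.
  apply: eq_integral => x _; rewrite -EFinM; congr _%:E; rewrite !normal_pdfE// /normal_fun.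
  rewrite mulrCA [RHS]mulrCA; congr (_ * _); rewrite -!expRD; congr expR.
  by rewrite -[X in _ / X]mulr_natr -[X in _ = _ + _ / X]mulr_natr; field.
split; last by rewrite /Rintegral E.
apply/integrableP; split; first exact/mEFinP.
under eq_integral do rewrite gee0_abs ?lee_fin ?expR_ge0//.
by rewrite E ltry.
Qed.

Lemma normal_itv_le (a c : R) : a <= c ->
  (normal_prob 0 s `[a, c]%classic <= (normal_peak s * (c - a))%:E)%E.
Proof.
move=> ac; rewrite /normal_prob.
apply: (@le_trans _ _ (\int[lebesgue_measure]_(x in `[a, c]%classic) (normal_peak s)%:E)%E).
  apply: ge0_le_integral => //.
  - by move=> x _; rewrite lee_fin normal_pdf_ge0.
  - by apply/mEFinP/measurable_funTS; exact: measurable_normal_pdf.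
  - by move=> x _; rewrite lee_fin normal_pdf_ub.
rewrite integral_cst//= lebesgue_measure_itv/= lte_fin.
case: ltP => h; first by rewrite -EFinD -EFinM.
by rewrite mule0 lee_fin mulr_ge0 ?normal_peak_ge0// subr_ge0.
Qed.

End normal.

Section gaussian_moments.
Context {d} {T : measurableType d} {R : realType} (P : probability T R).
Context (X : T -> R) (v : R).
Hypotheses (mX : meas X) (v0 : 0 < v).
Hypothesis mgf : forall l : R, integ P (fun w => expR (l * X w)) /\
  \int[P]_w expR (l * X w) = expR (l ^+ 2 * v / 2).

(** From 1 + y <= exp y <= 1 / (1 - y) the quotient lies between a and a / (1 - a h). *)
Let expR_slope (a : R) (h : nat -> R) : (forall n, 0 < h n) -> h n @[n --> \oo] --> 0 ->
  (expR (a * h n) - 1) / h n @[n --> \oo] --> a.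
Proof.
move=> h0 hc; apply: (@squeeze_cvgr _ _ _ _ (fun=> a) (fun n => a / (1 - a * h n))); last 2 first.
- exact: cvg_cst.
- rewrite -[X in _ --> X](_ : a / (1 - a * 0) = _); last by rewrite mulr0 subr0 divr1.
  apply: cvgM; first exact: cvg_cst.
  apply: cvgV; first by rewrite mulr0 subr0 oner_neq0.
  by apply: cvgB; [exact: cvg_cst|apply: cvgMr; exact: hc].
have cah : a * h n @[n --> \oo] --> 0 by rewrite -(mulr0 a); exact: cvgMr.
have /cvgr_lt/(_ 1 ltr01) := cah; apply: filterS => n ah1.
rewrite ler_pdivlMr// ler_pdivrMr//.
have e1 := expR_ge1Dx (a * h n).
have e2 : expR (a * h n) <= (1 - a * h n)^-1.
  have := expR_ge1Dx (- (a * h n)); rewrite expRN => e.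
  by rewrite -[leLHS]invrK lef_pV2 ?posrE ?invr_gt0 ?expR_gt0//; lra.
apply/andP; split; first by lra.
apply: (@le_trans _ _ ((1 - a * h n)^-1 - 1)); first by lra.
apply: eq_ler; field; lra.
Qed.

Let hh (n : nat) : R := n.+1%:R^-1.
Let hh0 n : 0 < hh n. Proof. by rewrite invr_gt0. Qed.
Let hhc : hh n @[n --> \oo] --> 0. Proof. exact: cvg_harmonic. Qed.
Let hh1 n : hh n <= 1. Proof. by rewrite invf_le1// ler1n. Qed.

Let sinh_bound (y : R) : `|expR y - expR (- y)| <= 2 * `|y| * expR `|y|.
Proof.
wlog y0 : y / 0 <= y.
  move=> h; have [/h//|/ltW yn] := leP 0 y.
  by rewrite distrC -(normrN y); have hn := h (- y); rewrite opprK in hn; apply: hn; lra.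
rewrite (ger0_norm y0) ger0_norm; last by rewrite subr_ge0 ler_expR; lra.
have e : expR (- y) = expR y * expR (- (2 * y)) by rewrite -expRD; congr expR; ring.
have e2 := expR_ge1Dx (- (2 * y)); have e3 := expR_gt0 y.
by rewrite e; nra.
Qed.

(** The symmetric difference quotient at 0 of l -> exp(l x) with step [hh n]. It tends to x and is
    dominated by exponentials, and its moments are read off the moment generating function;
    dominated convergence gives the mean and the variance. *)
Let D n (x : R) : R := (expR (x * hh n) - expR (- (x * hh n))) / (2 * hh n).

Let D_cvg x : D n x @[n --> \oo] --> x.
Proof.
have -> : D^~ x = fun n => ((expR (x * hh n) - 1) / hh n - (expR ((- x) * hh n) - 1) / hh n) / 2.
  by apply/funext => n; rewrite /D mulNr; field; rewrite gt_eqF.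
rewrite -[X in _ --> X](_ : (x - - x) / 2 = x); last by field.
apply: cvgMl; apply: cvgB; exact: expR_slope.
Qed.

Let expR_norm (y : R) : expR `|y| <= expR y + expR (- y).
Proof.
by have := expR_ge0 y; have := expR_ge0 (- y); case: (ler0P y) => _; lra.
Qed.

Let D_le n x : `|D n x| <= expR (2 * x) + expR ((- 2) * x).
Proof.
have h0 := hh0 n; have x0 := normr_ge0 x.
apply: (@le_trans _ _ (`|x| * expR `|x|)).
  rewrite /D normrM normfV (gtr0_norm (mulr_gt0 _ h0))// ler_pdivrMr ?mulr_gt0//.
  apply: (le_trans (sinh_bound _)); rewrite normrM (gtr0_norm h0).
  have : expR (`|x| * hh n) <= expR `|x| by rewrite ler_expR ler_piMr// hh1.
  have : 0 <= `|x| * hh n by rewrite mulr_ge0// ltW.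
  by move: (expR _) => E1 p E2; nra.
apply: (@le_trans _ _ (expR `|2 * x|)).
  rewrite normrM (ger0_norm (ler0n _ _)) mulr_natl expRD ler_wpM2r ?expR_ge0//.
  by have := expR_ge1Dx `|x|; lra.
by apply: (le_trans (expR_norm _)); rewrite mulNr.
Qed.

Let D2_le n x : `|D n x ^+ 2| <= 2 * (expR (4 * x) + expR ((- 4) * x)).
Proof.
rewrite normrX; apply: (@le_trans _ _ ((expR (2 * x) + expR ((- 2) * x)) ^+ 2)).
  by rewrite lerXn2r ?nnegrE ?addr_ge0 ?expR_ge0// D_le.
have -> : expR (4 * x) = expR (2 * x) ^+ 2 by rewrite expr2 -expRD; congr expR; ring.
have -> : expR (- 4 * x) = expR (- 2 * x) ^+ 2 by rewrite expr2 -expRD; congr expR; ring.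
by have := sqr_ge0 (expR (2 * x) - expR (- 2 * x)); lra.
Qed.

Let mDX n : meas (fun w => D n (X w)).
Proof.
rewrite /D; apply: mfunM => //; apply: mfunB; apply: mcomp => //.
  exact: mfunM.
by apply: mcomp => //; exact: mfunM.
Qed.

Lemma gaussian_mean : integ P X /\ \int[P]_w X w = 0.
Proof.
have iY : integ P (fun w => expR (2 * X w) + expR ((- 2) * X w)) := integD (mgf 2).1 (mgf (- 2)).1.
have [iX cv] := Ex_dct mDX iY (fun n w => D_le n (X w)) (fun w => @D_cvg (X w)).
split => //; rewrite -(cvg_lim _ cv)//; apply: cvg_lim => //; apply: cvg_near_cst; apply: nearW => n.
have e w : D n (X w) = (2 * hh n)^-1 * (expR (hh n * X w) - expR ((- hh n) * X w)).
  by rewrite /D mulrC (mulrC (X w)) mulNr.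
rewrite (eq_Ex _ e) (ExZ _ (integB (mgf _).1 (mgf _).1)) (ExB (mgf _).1 (mgf _).1) !(mgf _).2.
by rewrite sqrrN subrr mulr0.
Qed.

Lemma gaussian_variance : integ P (fun w => X w ^+ 2) /\ \int[P]_w (X w ^+ 2) = v.
Proof.
have iY : integ P (fun w => 2 * (expR (4 * X w) + expR ((- 4) * X w))) := integZ 2 (integD (mgf 4).1 (mgf (- 4)).1).
have mD2 n : meas (fun w => D n (X w) ^+ 2) by exact: mfunX.
have c2 w : D n (X w) ^+ 2 @[n --> \oo] --> X w ^+ 2.
  by under eq_cvg do rewrite expr2; rewrite expr2; apply: cvgM; exact: D_cvg.
have [iX cv] := Ex_dct mD2 iY (fun n w => D2_le n (X w)) c2.
split => //; rewrite -(cvg_lim _ cv)//; apply: cvg_lim => //.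
have e n w : D n (X w) ^+ 2 = (2 * hh n)^-1 ^+ 2 * ((expR (2 * hh n * X w) + expR ((- (2 * hh n)) * X w)) - 2).
  rewrite /D exprMn mulrC; congr (_ * _).
  have -> : expR (2 * hh n * X w) = expR (X w * hh n) ^+ 2 by rewrite expr2 -expRD; congr expR; ring.
  have -> : expR (- (2 * hh n) * X w) = expR (- (X w * hh n)) ^+ 2 by rewrite expr2 -expRD; congr expR; ring.
  have : expR (X w * hh n) * expR (- (X w * hh n)) = 1 by rewrite -expRD subrr expR0.
  move: (expR _) (expR _) => E1 E2 h.
  by transitivity (E1 ^+ 2 + E2 ^+ 2 - 2 * (E1 * E2)); [ring|rewrite (mulrC E1) h; ring].
have E n : \int[P]_w (D n (X w) ^+ 2) = (expR ((2 * v) * (hh n ^+ 2)) - 1) / (hh n ^+ 2) / 2.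
  rewrite (eq_Ex _ (e n)) (ExZ _ (integB (integD (mgf _).1 (mgf _).1) (integ_cst P 2))).
  rewrite (ExB (integD (mgf _).1 (mgf _).1) (integ_cst P 2)) (ExD (mgf _).1 (mgf _).1) !(mgf _).2 Ex_cst.
  rewrite sqrrN (_ : (2 * hh n) ^+ 2 * v / 2 = 2 * v * hh n ^+ 2); last by field.
  by field; rewrite gt_eqF.
rewrite (funext E) -[X in _ --> X](_ : (2 * v) / 2 = v); last by field.
apply: cvgMl; apply: expR_slope => [n|]; first by rewrite exprn_gt0.
by rewrite -[0 in X in _ --> X](mulr0 0); under eq_cvg do rewrite expr2; exact: cvgM.
Qed.

(** With y = X / sqrt v, the bound 1 + |y|/4 <= exp(|y|/4) gives y^4 <= 4^4 exp |y|, and exp y,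
    exp(-y) both have expectation exp(1/2). Only the order v^2 matters later. *)
Lemma gaussian_fourth : integ P (fun w => X w ^+ 4) /\
  \int[P]_w (X w ^+ 4) <= (2 * 4 ^+ 4) * expR (2^-1) * v ^+ 2.
Proof.
pose s := Num.sqrt v; have s0 : 0 < s by rewrite sqrtr_gt0.
have s2 : s ^+ 2 = v by rewrite sqr_sqrtr// ltW.
pose Y w := 4 ^+ 4 * v ^+ 2 * (expR (s^-1 * X w) + expR ((- s^-1) * X w)).
have iY : integ P Y := integZ _ (integD (mgf _).1 (mgf _).1).
have XY w : `|X w ^+ 4| <= Y w.
  rewrite normrX /Y mulNr; set y := s^-1 * X w.
  have -> : X w = s * y by rewrite /y mulrA divff ?mul1r// gt_eqF.
  have -> : v ^+ 2 = s ^+ 4 by rewrite -s2; ring.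
  rewrite normrM (gtr0_norm s0) exprMn; set e2 := expR y + _.
  have -> : 4 ^+ 4 * s ^+ 4 * e2 = s ^+ 4 * (4 ^+ 4 * e2) by ring.
  apply: (ler_wpM2l (exprn_ge0 4 (ltW s0))).
  apply: (@le_trans _ _ (4 ^+ 4 * expR `|y|)); last by apply: ler_wpM2l => //; exact: expR_norm.
  have -> : expR `|y| = expR (`|y| / 4) ^+ 4 by rewrite -expRM_natl; congr expR; field.
  by rewrite -exprMn lerXn2r ?nnegrE ?mulr_ge0 ?expR_ge0//; have := expR_ge1Dx (`|y| / 4); lra.
have i4 : integ P (fun w => X w ^+ 4) by apply: integ_le iY _ => //; exact: mfunX.
split => //; apply: (@le_trans _ _ (\int[P]_w Y w)).
  by apply: le_Ex => // w; exact: le_trans (ler_norm _) (XY w).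
rewrite (ExZ _ (integD (mgf _).1 (mgf _).1)) (ExD (mgf _).1 (mgf _).1) !(mgf _).2.
rewrite sqrrN exprVn s2 mulVf ?gt_eqF// mul1r le_eqVlt; apply/orP; left; apply/eqP; ring.
Qed.

End gaussian_moments.

Section probability_bounds.
Context {d} {T : measurableType d} {R : realType} (P : probability T R).
Implicit Types A B : set T.

Lemma pr_le A B : measurable A -> measurable B -> A `<=` B -> fine (P A) <= fine (P B).
Proof.
by move=> mA mB AB; rewrite fine_le ?fin_num_measure// le_measure ?inE.
Qed.

Lemma pr_U A B : measurable A -> measurable B -> fine (P (A `|` B)) <= fine (P A) + fine (P B).
Proof.
move=> mA mB; rewrite -fineD ?fin_num_measure// fine_le ?fin_num_measure//.
- exact: measurableU.
- by rewrite fin_numD !fin_num_measure.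
- exact: measureU2.
Qed.

Lemma pr_ge0 A : 0 <= fine (P A). Proof. exact: fine_ge0. Qed.

Lemma pr_le_U A B C : measurable A -> measurable B -> measurable C -> A `<=` B `|` C ->
  fine (P A) <= fine (P B) + fine (P C).
Proof.
by move=> mA mB mC h; apply: le_trans (pr_U mB mC); apply: pr_le => //; exact: measurableU.
Qed.

End probability_bounds.

Section decouple_id.
Context {d d'} {T : measurableType d} {E : measurableType d'} {R : realType}.
Context (P : probability T R) {I : eqType} (Y : I -> T -> E).
Hypotheses (mY : forall i, meas (Y i)) (indY : mutually_independent P Y).

(** Both maps are the identity, read in two different sigma-algebras on the same space, so two
    groups of variables can be separated without listing them. *)
Lemma decouple_id A A' (F : T * T -> R) (c : R) : A `&` A' = set0 ->
  meas (F : sig Y A * sig Y A' -> R) -> (forall p, `|F p| <= c) ->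
  [/\ integ P (fun w => F (w, w)), integ P (fun w => \int[P]_w' F (w, w'))
    & \int[P]_w F (w, w) = \int[P]_w \int[P]_w' F (w, w')].
Proof.
move=> AA' mF Fc.
have mid B : meas (id : sig Y B -> sig Y B) by exact: measurable_id.
exact: (@decouple_dom _ _ T E R P I Y mY indY _ _ (sig Y A) (sig Y A') A A' id id F (fun=> c) AA'
  (mid A) (mid A') mF (fun w w' => Fc (w, w')) (integ_cst P c)).
Qed.

End decouple_id.

Lemma meas_bigmax {d} {T : measurableType d} {R : realType} (I : Type) (r : seq I) (p : I -> bool)
    (X : I -> T -> R) : (forall i, p i -> meas (X i)) -> meas (fun w => \big[Num.max/0]_(i <- r | p i) X i w).
Proof.
move=> mX; elim: r => [|i r IH]; first by under eq_fun do rewrite big_nil; exact: mcst.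
under eq_fun do rewrite big_cons.
by case: (boolP (p i)) => pi //; apply: measurable_maxr => //; exact: mX.
Qed.

(** * The supremum of |B|: grid approximation and absence of atoms *)

Section brownian.
Context {d} {T : measurableType d} {R : realType} (P : probability T R) (B : R -> T -> R).
Hypothesis hB : standard_brownian_motion P B.

Let mB t : 0 <= t <= 1 -> meas (B t). Proof. by case: hB => h _ _ _; exact: h. Qed.
Let B0 w : B 0 w = 0. Proof. by case: hB => _ h _ _; case: (h w). Qed.
Let cB w : {within `[0, 1]%classic, continuous (B^~ w)}. Proof. by case: hB => _ h _ _; case: (h w). Qed.

Lemma meas_increment s t : 0 <= s <= 1 -> 0 <= t <= 1 -> meas (fun w => B t w - B s w).
Proof. by move=> s01 t01; apply: mfunB; exact: mB. Qed.

Lemma brownian_mgf s t l : 0 <= s -> s < t -> t <= 1 ->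
  integ P (fun w => expR (l * (B t w - B s w))) /\
  \int[P]_w expR (l * (B t w - B s w)) = expR (l ^+ 2 * (t - s) / 2).
Proof.
move=> s0 st t1; have st0 : 0 < t - s by rewrite subr_gt0.
have sq : 0 < Num.sqrt (t - s) by rewrite sqrtr_gt0.
have mX : meas (fun w => B t w - B s w).
  by apply: meas_increment; apply/andP; split; lra.
have [i E] := normal_mgf sq l.
have law A : measurable A -> P ((fun w => B t w - B s w) @^-1` A) = (normal_prob 0 (Num.sqrt (t - s)) : probability (measurableTypeR R) R) A.
  by case: hB => _ _ h _; exact: h.
have [i2 E2] := @Ex_law _ _ T (measurableTypeR R) R P (normal_prob 0 (Num.sqrt (t - s))) _ mX law (fun x => expR (l * x)) i.
by split; rewrite ?E2 ?E ?sqr_sqrtr// ltW.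
Qed.

Lemma increment_itv_le s t a c : 0 <= s -> s < t -> t <= 1 -> a <= c ->
  fine (P [set w | a <= B t w - B s w <= c]) <= normal_peak (Num.sqrt (t - s)) * (c - a).
Proof.
move=> s0 st t1 ac; have st0 : 0 < t - s by rewrite subr_gt0.
have sq : 0 < Num.sqrt (t - s) by rewrite sqrtr_gt0.
have := normal_itv_le sq ac; case: hB => _ _ h _; rewrite -(h s t)//.
rewrite (_ : _ @^-1` _ = [set w | a <= B t w - B s w <= c]); last first.
  by apply/seteqP; split => w; rewrite /= in_itv.
move=> le; rewrite -lee_fin fineK// fin_num_measure//.
rewrite (_ : [set w | _] = (fun w => B t w - B s w) @^-1` `[a, c]%classic); last first.
  by apply/seteqP; split => w; rewrite /= in_itv.
rewrite -[_ @^-1` _]setTI; apply: meas_increment => //; apply/andP; split; lra.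
Qed.

Lemma brownian_rc w t : 0 <= t < 1 -> B s w @[s --> t^'+] --> B t w.
Proof.
move=> /andP[t0 t1]; have := cB (w := w) ; move=> /(continuous_within_itvP _ ltr01)[ci c0 _].
have [t0'|t0'] := eqVneq t 0; first by rewrite t0'.
apply: cvg_at_right_filter; apply: ci.
by rewrite in_itv/= t1 lt_neqAle eq_sym t0' t0.
Qed.

Definition bsup w := sup [set `|B t w| | t in `[0, 1]%classic].

Let bsup_has_sup w : has_sup [set `|B t w| | t in `[0, 1]%classic].
Proof.
split; first by exists `|B 0 w|, 0 => //; rewrite /= in_itv/= lexx ler01.
have cn : {within `[0, 1]%classic, continuous (fun t => `|B t w|)}.
  by move=> t; apply: continuous_comp; [exact: cB|exact: norm_continuous].
have [c _ h] := EVT_max ler01 cn; exists `|B c w| => _ [t t01 <-]; exact: h.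
Qed.

Lemma bsup_leP w x : reflect (forall t, 0 <= t <= 1 -> `|B t w| <= x) (bsup w <= x).
Proof.
have hs := bsup_has_sup w.
apply: (iffP idP) => [le t t01|h].
  by apply: le_trans le; apply: sup_upper_bound => //; exists t => //; rewrite /= in_itv.
by apply: ge_sup; [case: hs|move=> _ [t + <-]; rewrite /= in_itv/=; exact: h].
Qed.

Lemma bsup_gtP w x : x < bsup w <-> exists2 t, 0 <= t <= 1 & x < `|B t w|.
Proof.
rewrite ltNge; split => [/negP h|[t t01 xt]].
  apply: contrapT => nh; apply: h; apply/bsup_leP => t t01; rewrite leNgt.
  by apply/negP => xt; apply: nh; exists t.
by apply/negP => /bsup_leP/(_ _ t01); rewrite leNgt xt.
Qed.

Lemma meas_bsup : meas bsup.
Proof.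
apply: meas_ray => x.
rewrite (_ : [set w | _] = ~` [set w | exists2 t, 0 <= t <= 1 & x < `|B t w|]).
  by apply: measurableC; apply: meas_dyadic_sup => // w t; exact: brownian_rc.
apply/seteqP; split => w /=; first by move=> le /bsup_gtP; rewrite ltNge le.
by move=> /bsup_gtP nh; rewrite leNgt; apply/negP.
Qed.

Definition grid_gt m x := [set w | exists2 i, (i <= 2 ^ m)%N & x < `|B (dyadic m i) w|].

Lemma meas_grid m x : measurable (grid_gt m x).
Proof. by apply: meas_exceeds_fin => // i; exact: dyadic01. Qed.

Lemma bsup_gtE x : [set w | x < bsup w] = \bigcup_m grid_gt m x.
Proof.
rewrite -(dyadic_supE brownian_rc); apply/seteqP; split => w /=; [exact: (bsup_gtP w x).1|exact: (bsup_gtP w x).2].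
Qed.

Lemma grid_subset m n x : (m <= n)%N -> grid_gt m x `<=` grid_gt n x.
Proof.
move=> mn; rewrite -(subnK mn); elim: (n - m)%N => [|l IH] //.
apply: (subset_trans IH) => w [i im ci]; rewrite addSn; exists (2 * i)%N; last by rewrite dyadicS.
by rewrite expnS leq_mul2l.
Qed.

Lemma grid_cvg x : fine (P (grid_gt m x)) @[m --> \oo] --> fine (P [set w | x < bsup w]).
Proof.
have mU : measurable (\bigcup_m grid_gt m x) by apply: bigcup_measurable => m _; exact: meas_grid.
rewrite bsup_gtE; apply: fine_cvg; rewrite fineK ?fin_num_measure//.
apply: nondecreasing_cvg_mu => //; first by move=> m; exact: meas_grid.
by move=> m n mn; apply/subsetPset; exact: grid_subset.
Qed.

Let inc m (i : 'I_(2 ^ m)) w := B (dyadic m i.+1) w - B (dyadic m i) w.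

Let inc_indep m : mutually_independent P (@inc m).
Proof.
case: hB => _ _ _ h; apply: (h (2 ^ m)%N (dyadic m)); [by case/andP: (@dyadic01 R m 0)|by case/andP: (@dyadic01 R m (2 ^ m))|].
by move=> i j; exact: dyadic_le.
Qed.

Let minc m i : meas (@inc m i). Proof. by apply: meas_increment; exact: dyadic01. Qed.

Let inc_sum m (l l' : nat) w : (l <= l')%N -> (l' <= 2 ^ m)%N ->
  B (dyadic m l') w - B (dyadic m l) w = \sum_(i < 2 ^ m | (l <= i < l')%N) inc i w.
Proof.
move=> ll' l'm.
transitivity (\sum_(l <= i < l') (B (dyadic m i.+1) w - B (dyadic m i) w)).
  by rewrite telescope_sumr.
rewrite (big_nat_widen _ _ (2 ^ m))// big_geq_mkord; apply: eq_bigl => i.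
by rewrite andbC.
Qed.

Definition early q c := [set w | exists2 t, 0 <= t <= 1 & t <= (2 ^+ q)^-1 /\ c < `|B t w|].

Lemma meas_early q c : measurable (early q c).
Proof.
pose eps := (2 ^+ q)^-1 : R.
have q0 : 0 < eps by rewrite invr_gt0 exprn_gt0.
have q1 : eps <= 1 by rewrite invf_le1 ?exprn_gt0// exprn_ege1// ler1n.
(* Time is rescaled by 2^-q because [meas_dyadic_sup] speaks of the whole interval [0, 1]. *)
rewrite (_ : early q c = [set w | exists2 t, 0 <= t <= 1 & c < `|B (eps * t) w|]).
  apply: (meas_dyadic_sup (X := fun t => B (eps * t))) => [t /andP[t0 t1]|w t /andP[t0 t1]].
    by apply: mB; rewrite mulr_ge0 ?(ltW q0)//= mulr_ile1// ltW.
  apply/cvg_at_rightP => u [pu up].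
  have et1 : 0 <= eps * t < 1 by rewrite mulr_ge0 ?(ltW q0)//=; nra.
  have /cvg_at_rightP/(_ (fun n => eps * u n)) := brownian_rc (w := w) et1; apply.
  by split => [n|]; [rewrite ltr_pM2l|exact: cvgMr].
apply/seteqP; split => w [t /andP[t0 t1]].
  move=> [te xt]; exists (t / eps); last by rewrite mulrC divfK// gt_eqF.
  by rewrite divr_ge0 ?(ltW q0)//= ler_pdivrMr ?mul1r.
move=> xt; exists (eps * t); first by rewrite mulr_ge0 ?(ltW q0)//= mulr_ile1// ltW.
by split => //; rewrite ler_piMr// ltW.
Qed.

(** The events decrease in q, and continuity at 0 together with B_0 = 0 leaves nothing in their
    intersection. *)
Lemma early_cvg (c e : R) : 0 < c -> 0 < e -> exists q, fine (P (early q c)) <= e.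
Proof.
move=> c0 e0.
have i0 : \bigcap_q early q c = set0.
  apply/seteqP; split => // w h.
  have := cB (w := w); move=> /(continuous_within_itvP _ ltr01)[_ + _]; rewrite B0 => /cvgr_norm_lt.
  rewrite normr0 => /(_ _ c0)[dl /= dl0 hd].
  have [q qd] : exists q, (2 ^+ q)^-1 < dl.
    exists (Num.truncn dl^-1).+1; rewrite -[ltRHS]invrK ltf_pV2 ?posrE ?invr_gt0 ?exprn_gt0//.
    apply: (@lt_trans _ _ (Num.truncn dl^-1).+1%:R); first by rewrite truncnS_gt.
    by rewrite -natrX ltr_nat ltn_expl.
  have [t /andP[t0 t1] [tq ct]] := h q I.
  have [t00|t00] := eqVneq t 0; first by move: ct; rewrite t00 B0 normr0; lra.
  have tp : 0 < t by rewrite lt_neqAle eq_sym t00.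
  have := hd t; rewrite /= sub0r normrN (gtr0_norm tp) => /(_ (le_lt_trans tq qd) tp).
  by lra.
have : fine (P (early q c)) @[q --> \oo] --> 0.
  rewrite -[X in _ --> X](_ : fine (P (\bigcap_q early q c)) = 0); last by rewrite i0 measure0.
  apply: fine_cvg; rewrite fineK ?fin_num_measure//; last by rewrite i0.
  apply: nonincreasing_cvg_mu.
  - by rewrite (le_lt_trans (probability_le1 _ _)) ?ltry//; exact: meas_early.
  - by move=> q; exact: meas_early.
  - by rewrite i0.
  - move=> q q' qq'; apply/subsetPset => w [t t01 [tq ct]]; exists t => //; split => //.
    apply: (le_trans tq); rewrite lef_pV2 ?posrE ?exprn_gt0//; apply: ler_weXn2l => //.
    by rewrite ler1n.
move=> /cvgr_lt/(_ _ e0)[q _ hq]; exists q; apply: ltW; exact: hq (leqnn q).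
Qed.

(* The maximum over the grid after time 2^-q is |B(2^-q)| shifted by an
   independent amount, and B(2^-q) has a bounded density. *)
Lemma grid_small q m (x dl : R) : (q <= m)%N -> 0 <= dl ->
  fine (P (grid_gt m (x - dl) `\` grid_gt m x)) <=
  fine (P (early q (x - dl))) +
  2 * (normal_peak (Num.sqrt ((2 ^+ q)^-1)) * dl).
Proof.
move=> qm d0; pose l1 := (2 ^ (m - q))%N; pose D := @dyadic R m.
have q0 : 0 < (2 ^+ q)^-1 :> R by rewrite invr_gt0 exprn_gt0.
have q1 : (2 ^+ q)^-1 <= 1 :> R by rewrite invf_le1 ?exprn_gt0// exprn_ege1// ler1n.
have l1m : (l1 <= 2 ^ m)%N by rewrite leq_exp2l// leq_subr.
have Dl1 : D l1 = (2 ^+ q)^-1.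
  have e : (2 ^+ m : R) = 2 ^+ (m - q) * 2 ^+ q by rewrite -exprD subnK.
  have e1 : l1%:R / 2 ^+ m = (2 ^+ q)^-1 :> R.
    by rewrite natrX e invfM mulrA divff ?mul1r// expf_neq0.
  by rewrite /D /dyadic e1 min_r.
pose eps := (2 ^+ q)^-1 : R; pose pk := normal_peak (Num.sqrt eps).
(* [sg] is the sign of the exceedance. Measuring from the value at time 2^-q makes [U] a function of
   the later increments alone; the default 0 of the maximum is also its term at index [l1]. *)
pose U (sg : R) w := \big[Num.max/0]_(i < (2 ^ m).+1 | (l1 <= i)%N) (sg * (B (D i) w - B (D l1) w)).
pose Z (sg : R) w := sg * B (D l1) w.
pose Ev sg := [set w | x - dl < Z sg w + U sg w <= x].
pose A1 := early q (x - dl).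
have B1 w : B (D l1) w = B (D l1) w - B (D 0%N) w.
  by rewrite [D 0%N](_ : _ = 0) ?B0 ?subr0// /D /dyadic mul0r min_r.
pose SA := [set i : 'I_(2 ^ m) | (l1 <= i)%N]; pose SB := [set i : 'I_(2 ^ m) | (i < l1)%N].
have AB : SA `&` SB = set0 by apply/seteqP; split => // i []; rewrite /SA /SB /= => a; rewrite ltnNge a.
have msum (S : set 'I_(2 ^ m)) (p : 'I_(2 ^ m) -> bool) : (forall i, p i -> S i) ->
    meas ((fun w => \sum_(i < 2 ^ m | p i) inc i w) : sig (@inc m) S -> R).
  move=> pS; under eq_fun do rewrite big_mkcond; apply: (@measurable_sum _ (sig (@inc m) S)) => i.
  case pi : (p i); last exact: mcst.
  by apply: (meas_sig (Y := @inc m) (A := S)); exact: pS.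
have mZ sg : meas (Z sg : sig (@inc m) SB -> R).
  rewrite (_ : Z sg = fun w => sg * \sum_(i < 2 ^ m | (0 <= i < l1)%N) inc i w).
    by apply: mfunM => //; apply: msum => i; rewrite leq0n.
  apply/funext => w; rewrite /Z B1 (@inc_sum m 0 l1)//.
have mU sg : meas (U sg : sig (@inc m) SA -> R).
  apply: (@meas_bigmax _ (sig (@inc m) SA)) => i li; apply: mfunM => //.
  under eq_fun do rewrite (@inc_sum m l1 i _ li (ltn_ord i)).
  by apply: msum => j /andP[].
have mB1 : meas (B (D l1)) by apply: mB; exact: dyadic01.
have mZ' sg : meas (Z sg) by exact: mfunM.
have mU' sg : meas (U sg).
  by apply: meas_bigmax => i li; apply: mfunM => //; apply: mfunB => //; apply: mB; exact: dyadic01.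
pose s01 (sg : R) := sg = 1 \/ sg = - 1.
have mEv sg : measurable (Ev sg).
  have ms := mfunD (mZ' sg) (mU' sg).
  have := ms measurableT _ (measurable_itv `]x - dl, x]); rewrite setTI.
  by congr measurable; apply/seteqP; split => w; rewrite /= in_itv.
have PEv sg : s01 sg -> fine (P (Ev sg)) <= pk * dl.
  move=> sg1; pose F (p : T * T) : R := (x - dl < Z sg p.2 + U sg p.1)%R%:R * (Z sg p.2 + U sg p.1 <= x)%R%:R.
  have msum2 : meas ((fun p => Z sg p.2 + U sg p.1) : sig (@inc m) SA * sig (@inc m) SB -> R).
    by apply: mfunD; [exact: mcomp (mZ sg) _|exact: mcomp (mU sg) _].
  have mF : meas (F : sig (@inc m) SA * sig (@inc m) SB -> R).
    apply: mfunM; apply: mb2r.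
      by apply: mfun_ltr => //; exact: mcst.
    by apply: mfun_ler => //; exact: mcst.
  have F1 p : `|F p| <= 1 by rewrite -[leRHS]mulr1; exact: norm_leM (norm_b2r_le1 _) (norm_b2r_le1 _).
  have [i1 i2 e] := decouple_id (minc (m := m)) (@inc_indep m) AB mF F1.
  rewrite -Ex_indic// (_ : \int[P]_w (\1_(Ev sg) w) = \int[P]_w F (w, w)); last first.
    apply: eq_Ex => w; rewrite indicE /F /=; case: (boolP (w \in Ev sg)) => [/set_mem/= /andP[-> ->]|]; first by rewrite mulr1.
    by rewrite notin_setE /Ev /=; case: (x - dl < _); case: (_ <= x); rewrite ?mul0r ?mulr0//= => -[].
  rewrite e; apply: Ex_le_cst => // w.
  have mG c1 c2 : measurable [set w' | c1 <= B (D l1) w' <= c2].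
    have := mB1 measurableT _ (measurable_itv `[c1, c2]); rewrite setTI.
    by congr measurable; apply/seteqP; split => w'; rewrite /= in_itv.
  have b c1 c2 : c1 <= c2 -> fine (P [set w' | c1 <= B (D l1) w' <= c2]) <= pk * (c2 - c1).
    move=> c12; have := @increment_itv_le 0 eps c1 c2 (lexx _) q0 q1 c12; rewrite subr0 /pk Dl1.
    suff -> : [set w' | c1 <= B (2 ^- q) w' <= c2] = [set w' | c1 <= B eps w' - B 0 w' <= c2] by [].
    by apply/seteqP; split => w'; rewrite /= B0 subr0.
  (* With the later increments frozen at [w], the event confines B(2^-q) to an interval of length
     [dl]. *)
  have [c1 [c2 [c12 h]]] : exists c1 c2, c2 - c1 = dl /\
      forall w', x - dl < Z sg w' + U sg w <= x -> c1 <= B (D l1) w' <= c2.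
    case: sg1 => ->; [exists (x - dl - U 1 w), (x - U 1 w)|exists (U (- 1) w - x), (U (- 1) w - x + dl)];
      (split; first ring); move=> w' /andP[]; rewrite /Z => ? ?; apply/andP; split; lra.
  rewrite -c12; apply: le_trans (b _ _ _); last by lra.
  rewrite -Ex_indic//; apply: le_Ex => [||w'].
  - apply: (integ_bnd P (c := 1)) => [|w']; last exact: (F1 (w, w')).
    have mZw : meas (fun w' => Z sg w' + U sg w) by apply: mfunD => //; exact: mcst.
    rewrite /F /=; apply: mfunM; apply: mb2r.
      by apply: mfun_ltr => //; exact: mcst.
    by apply: mfun_ler => //; exact: mcst.
  - exact: integ_indic.
  rewrite indicE /F /=; have [h1|h1] := ltP (x - dl); last by rewrite mul0r.
  have [h2|h2] := leP (Z sg w' + U sg w) x; last by rewrite mulr0.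
  by rewrite mem_set ?mul1r//=; apply: h; rewrite h1 h2.
(* If x - dl is exceeded on the grid but x is not, then either the exceedance occurs by time 2^-q,
   or the later grid maximum of B or of -B lies in ]x - dl, x]. *)
have sub : grid_gt m (x - dl) `\` grid_gt m x `<=` A1 `|` (Ev 1 `|` Ev (- 1)).
  move=> w [[i im xi] nx].
  have Bx j : (j <= 2 ^ m)%N -> `|B (D j) w| <= x.
    by move=> jm; rewrite leNgt; apply/negP => xj; apply: nx; exists j.
  have [il|il] := leqP i l1.
    left; exists (D i); first exact: dyadic01.
    by split => //; rewrite /eps -Dl1; exact: dyadic_le.
  have key sg : s01 sg -> x - dl < sg * B (D i) w -> Ev sg w.
    move=> sg1 xs; have sB j : (j <= 2 ^ m)%N -> sg * B (D j) w <= x.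
      move=> /Bx; rewrite ler_norml => /andP[? ?]; case: sg1 => ->; lra.
    have im' : (i < (2 ^ m).+1)%N by rewrite ltnS.
    rewrite /Ev /=; apply/andP; split.
      apply: (lt_le_trans xs); rewrite /Z -lerBlDl -mulrBr /U.
      rewrite (bigD1 (Ordinal im'))/=; last exact: ltnW.
      by rewrite le_max lexx.
    rewrite -lerBrDl /U; apply/bigmax_leP; split => [|j lj]; first by rewrite subr_ge0; exact: sB.
    by have := sB j (ltn_ord j); rewrite /Z; lra.
  move: xi; rewrite ltr_normr => /orP[xi|xi].
    by right; left; apply: key; [left|rewrite mul1r].
  by right; right; apply: key; [right|rewrite mulN1r].
have mA1 : measurable A1 by exact: meas_early.
have mE := measurableU _ _ (mEv 1) (mEv (- 1)).
have mg := measurableD (meas_grid m (x - dl)) (meas_grid m x).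
apply: le_trans (pr_le_U P mg mA1 mE sub) _; rewrite lerD2l.
apply: (le_trans (pr_U _ (mEv 1) (mEv (- 1)))).
by rewrite mulr_natl mulr2n lerD// PEv//; [left|right].
Qed.

(** First q makes an exceedance of x/2 before 2^-q unlikely, then [dl] is taken small for the
    density bound of B(2^-q). The estimate of [grid_small] does not depend on the grid, so it
    survives the limit in m. *)
Lemma bsup_no_atom (x eps : R) : 0 < x -> 0 < eps -> exists2 dl, 0 < dl &
  fine (P [set w | x - dl < bsup w <= x]) <= eps.
Proof.
move=> x0 e0.
have [q Pq] := early_cvg (divr_gt0 x0 (ltr0Sn R 1)) (divr_gt0 e0 (ltr0Sn R 1)).
pose pk := normal_peak (Num.sqrt ((2 ^+ q)^-1)) : R; have pk0 : 0 <= pk by exact: normal_peak_ge0.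
(* The first bound keeps x - dl above x/2, the second makes 2 pk dl at most eps/2. *)
pose dl := Num.min (x / 2) (eps / (4 * (pk + 1))).
have d0 : 0 < dl by rewrite lt_min !divr_gt0// mulr_gt0//; lra.
have d1 : dl <= x / 2 by rewrite ge_min lexx.
have d2 : dl <= eps / (4 * (pk + 1)) by rewrite ge_min lexx orbT.
have pkd : pk * dl <= eps / 4.
  apply: (le_trans (ler_wpM2l pk0 d2)).
  have -> : pk * (eps / (4 * (pk + 1))) = eps / 4 * (pk / (pk + 1)) by field; lra.
  by rewrite ler_piMr ?ler_pdivrMr; lra.
exists dl => //.
have step m : (q <= m)%N -> fine (P (grid_gt m (x - dl))) - fine (P (grid_gt m x)) <= eps.
  move=> qm; have mg1 := meas_grid m (x - dl); have mg2 := meas_grid m x.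
  have g := grid_small x qm (ltW d0).
  have e1 : fine (P (early q (x - dl))) <= fine (P (early q (x / 2))).
    apply: pr_le; [exact: meas_early|exact: meas_early|].
    by move=> w [t t01 [tq xt]]; exists t => //; split => //; lra.
  have : fine (P (grid_gt m (x - dl))) <=
      fine (P (grid_gt m (x - dl) `\` grid_gt m x)) + fine (P (grid_gt m x)).
    apply: pr_le_U => //; first exact: measurableD.
    by move=> w h; case: (pselect (grid_gt m x w)) => h'; [right|left].
  by rewrite -/pk in g; lra.
have mb c : measurable [set w | c < bsup w].
  by rewrite bsup_gtE; apply: bigcup_measurable => m _; exact: meas_grid.
have -> : [set w | x - dl < bsup w <= x] = [set w | x - dl < bsup w] `\` [set w | x < bsup w].
  apply/seteqP; split => w /=; first by move=> /andP[h1 h2]; split => //; rewrite ltNge h2.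
  by move=> [h1 /negP]; rewrite -leNgt h1 => ->.
have -> : fine (P ([set w | x - dl < bsup w] `\` [set w | x < bsup w])) =
    fine (P [set w | x - dl < bsup w]) - fine (P [set w | x < bsup w]).
  rewrite measureD//; last by rewrite (le_lt_trans (probability_le1 _ _)) ?ltry.
  rewrite setIidr => [|w /=]; last by move=> xb; apply: lt_trans xb; lra.
  by rewrite fineB ?fin_num_measure.
have cv : (fun m => fine (P (grid_gt m (x - dl))) - fine (P (grid_gt m x))) @ \oo -->
    fine (P [set w | x - dl < bsup w]) - fine (P [set w | x < bsup w]) by apply: cvgB; exact: grid_cvg.
rewrite -(cvg_lim _ cv)//; apply: limr_le; first by apply/cvg_ex; eexists; exact: cv.
by exists q => // m /= qm; exact: step.
Qed.

Lemma bsup_gt0 : fine (P [set w | bsup w <= 0]) = 0.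
Proof.
have m1 : measurable [set w | bsup w <= 0] by apply: meas_leset => //; exact: meas_bsup.
apply/eqP; rewrite eq_le pr_ge0 andbT; apply/ler_addgt0Pl => e e0; rewrite addr0.
pose pk := normal_peak (Num.sqrt (1 - 0)) : R; have pk0 : 0 <= pk by exact: normal_peak_ge0.
pose c := e / (2 * (pk + 1)).
have c0 : 0 < c by rewrite divr_gt0// mulr_gt0//; lra.
have := @increment_itv_le 0 1 (- c) c (lexx _) ltr01 (lexx _); rewrite -/pk => h.
apply: le_trans (pr_le _ m1 _ _) (le_trans (h _) _).
- have := meas_increment (s := 0) (t := 1) _ _ measurableT (measurable_itv `[- c, c]); rewrite !lexx ler01 setTI => /(_ isT isT).
  by congr measurable; apply/seteqP; split => w; rewrite /= in_itv.
- move=> w /= /bsup_leP/(_ 1); rewrite ler01 lexx => /(_ isT); rewrite normr_le0 => /eqP ->.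
  by rewrite B0 subr0; apply/andP; split; lra.
- by lra.
rewrite opprK /c; have -> : pk * (e / (2 * (pk + 1)) + e / (2 * (pk + 1))) = e * (pk / (pk + 1)).
  by field; rewrite gt_eqF//; lra.
by rewrite ler_piMr ?(ltW e0)// ler_pdivrMr; lra.
Qed.

End brownian.

(** * Third moments from second and fourth moments *)

Lemma normM_le_sqr {R : realType} (x y : R) : `|x * y| <= x ^+ 2 + y ^+ 2.
Proof.
have := sqr_ge0 (x - y); have := sqr_ge0 (x + y); have := sqr_ge0 x; have := sqr_ge0 y.
by rewrite sqrrB sqrrD ler_norml => *; apply/andP; split; lra.
Qed.

Lemma sumr_cst {R : realType} (k : nat) (c : R) : \sum_(i < k) c = k%:R * c.
Proof. by rewrite sumr_const card_ord mulr_natl. Qed.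

Lemma sum_sqr_le {R : realType} (k : nat) (x : 'I_k -> R) :
  (\sum_l x l) ^+ 2 <= k%:R * \sum_l x l ^+ 2.
Proof.
rewrite expr2 mulr_suml; under eq_bigr do rewrite mulr_sumr.
apply: (@le_trans _ _ (\sum_l \sum_l' (2^-1 * x l ^+ 2 + 2^-1 * x l' ^+ 2))).
  apply: ler_sum => a _; apply: ler_sum => b _; have := sqr_ge0 (x a - x b).
  by rewrite sqrrB; lra.
under eq_bigr do rewrite big_split/= sumr_cst -mulr_sumr.
rewrite big_split/= sumr_cst -!mulr_sumr.
by set s := \sum_(i < k) _; apply: eq_ler; field.
Qed.

Lemma norm1_sqr {R : realType} (k : nat) (u : 'I_k -> R) : norm1 u ^+ 2 <= k%:R * \sum_l u l ^+ 2.
Proof.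
apply: (le_trans (sum_sqr_le _)); apply: ler_wpM2l => //.
by apply: ler_sum => l _; rewrite real_normK ?num_real.
Qed.

Lemma norm1_fourth {R : realType} (k : nat) (u : 'I_k -> R) :
  norm1 u ^+ 4 <= k%:R ^+ 3 * \sum_l u l ^+ 4.
Proof.
rewrite (exprM _ 2 2); apply: (@le_trans _ _ ((k%:R * \sum_l u l ^+ 2) ^+ 2)).
  rewrite lerXn2r ?nnegrE ?norm1_sqr ?sqr_ge0//.
  by rewrite mulr_ge0// sumr_ge0// => l _; exact: sqr_ge0.
rewrite exprMn [k%:R ^+ 3]exprSr -mulrA ler_wpM2l ?sqr_ge0//.
apply: (le_trans (sum_sqr_le _)); apply: ler_wpM2l => //.
by apply: ler_sum => l _; rewrite -exprM.
Qed.

Section moments.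
Context {d} {S : measurableType d} {R : realType} (P : probability S R) {k : nat}.
Context (Y : 'I_k -> S -> R).
Hypotheses (mY : forall l, meas (Y l)) (i4 : forall l, integ P (fun w => Y l w ^+ 4)).

Let lem (p : nat) (x : R) : (p <= 4)%N -> `|x| ^+ p <= 1 + x ^+ 4.
Proof.
move=> p4; have -> : x ^+ 4 = `|x| ^+ 4 by rewrite -normrX ger0_norm// exprn_even_ge0.
have [x1|x1] := leP `|x| 1.
  by apply: (@le_trans _ _ 1); rewrite ?exprn_ile1// lerDl exprn_ge0.
by apply: (@le_trans _ _ (`|x| ^+ 4)); rewrite ?lerDr// ler_weXn2l// ltW.
Qed.

Lemma integ_of4 l (p : nat) : (p <= 4)%N -> integ P (fun w => Y l w ^+ p).
Proof.
move=> p4; apply: (integ_le _ (integD (integ_cst P 1) (i4 l))) => [|w]; first exact: mfunX.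
by rewrite normrX lem.
Qed.

(** Interpolation |x|^3 <= s x^2 + x^4 / s. When the second and fourth moments have orders s^2 and
    s^4, both terms have order s^3. *)
Lemma third_moments_of4 (v kap s : R) : 0 < s -> (forall l, \int[P]_w Y l w = 0) ->
  (forall l, \int[P]_w (Y l w ^+ 2) <= v * s ^+ 2) ->
  (forall l, \int[P]_w (Y l w ^+ 4) <= kap * s ^+ 4) ->
  third_moments P Y (s ^+ 3 * (k%:R ^+ 2 * v + k%:R ^+ 4 * kap)).
Proof.
move=> s0 E1 E2 E4.
have i2 := fun l => integ_of4 l (isT : (2 <= 4)%N).
have mn : meas (fun w => norm1 (fun l => Y l w)).
  by apply: measurable_sum => l; exact: mcomp.
pose D w := s * (k%:R * \sum_l Y l w ^+ 2) + s^-1 * (k%:R ^+ 3 * \sum_l Y l w ^+ 4).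
have iD : integ P D.
  by apply: integD; apply: integZ; apply: integZ; apply: integ_sum => l; [exact: i2|exact: i4].
have le3 w : norm1 (fun l => Y l w) ^+ 3 <= D w.
  have n2 := norm1_sqr (Y ^~ w); have n4 := norm1_fourth (Y ^~ w); have n0 := norm1_ge0 (Y ^~ w).
  have si : 0 < s^-1 by rewrite invr_gt0.
  have a1 := ler_wpM2l (ltW s0) n2; have a2 := ler_wpM2l (ltW si) n4.
  apply: le_trans (lerD a1 a2); move: (norm1 _) n0 => x x0.
  (* Half of this nonnegative quantity is s x^2 + x^4 / s - x^3. *)
  have h : 0 <= s^-1 * (x ^+ 2 * (x - s) ^+ 2 + x ^+ 4 + s ^+ 2 * x ^+ 2).
    have q1 := mulr_ge0 (sqr_ge0 x) (sqr_ge0 (x - s)); have q2 := exprn_ge0 4 x0.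
    by have q3 := mulr_ge0 (sqr_ge0 s) (sqr_ge0 x); rewrite mulr_ge0 ?(ltW si)//; lra.
  have e : s^-1 * s = 1 by rewrite mulVf// gt_eqF.
  have h2 : s^-1 * (x ^+ 2 * (x - s) ^+ 2 + x ^+ 4 + s ^+ 2 * x ^+ 2) =
    2 * (s^-1 * x ^+ 4 + (s^-1 * s) * s * x ^+ 2 - (s^-1 * s) * x ^+ 3) by ring.
  by rewrite h2 e mul1r in h; lra.
have i3 : integ P (fun w => norm1 (fun l => Y l w) ^+ 3).
  apply: integ_le iD _ => [|w]; first exact: mfunX.
  by rewrite ger0_norm ?exprn_ge0 ?norm1_ge0.
split => //.
- by move=> l; have := integ_of4 l (isT : (1 <= 4)%N); under eq_fun do rewrite expr1.
- move=> l l'; apply: (integ_le _ (integD (i2 l) (i2 l'))) => [|w]; first exact: mfunM.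
  exact: normM_le_sqr.
- apply: (@le_trans _ _ (\int[P]_w D w)); first exact: le_Ex.
  have iS2 := integ_sum (index_enum 'I_k) xpredT i2; have iS4 := integ_sum (index_enum 'I_k) xpredT i4.
  rewrite (ExD (integZ _ (integZ _ iS2)) (integZ _ (integZ _ iS4))).
  rewrite (ExZ _ (integZ _ iS2)) (ExZ _ iS2) (ExZ _ (integZ _ iS4)) (ExZ _ iS4) (Ex_sum _ _ i2) (Ex_sum _ _ i4).
  apply: (@le_trans _ _ (s * (k%:R * \sum_(l < k) v * s ^+ 2) + s^-1 * (k%:R ^+ 3 * \sum_(l < k) kap * s ^+ 4))).
    apply: lerD; apply: ler_wpM2l; rewrite ?invr_ge0 ?(ltW s0)//; apply: ler_wpM2l; rewrite ?exprn_ge0//; exact: ler_sum.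
  rewrite !sumr_cst le_eqVlt; apply/orP; left; apply/eqP.
  have e : s^-1 * s = 1 by rewrite mulVf// gt_eqF.
  move: (k%:R : R) (s^-1) e => K t e.
  transitivity (s ^+ 3 * (K ^+ 2 * v) + (t * s) * (s ^+ 3 * (K ^+ 4 * kap))); [ring|rewrite e; ring].
Qed.

End moments.

(** * Brownian motion cut into exchangeable Gaussian blocks *)

Section brownian_blocks.
Context {d} {T : measurableType d} {R : realType} (P : probability T R) (B : R -> T -> R).
Hypothesis hB : standard_brownian_motion P B.
Context (k n : nat) (v : R).
Hypotheses (k0 : (0 < k)%N) (n0 : (0 < n)%N) (v0 : 0 <= v).

Definition btime (i : nat) : R := Num.min 1 (i%:R / (k * n)%:R).
Definition block_inc (i : nat) w := B (btime i.+1) w - B (btime i) w.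
(** The k n increments of a fine grid are dealt out to n blocks: block j takes the increment of rank
    j in each of the k cells of mesh 1/k and sums over the first l + 1 cells. The blocks are
    independent, have the covariance of one rescaled observation, and add up to sqrt v times B on
    the coarse grid. *)
Definition gauss_block (j : nat) (l : 'I_k) w := Num.sqrt v * \sum_(i < k | (i <= l)%N) block_inc (i * n + j) w.

Let kn0 : 0 < (k * n)%:R :> R. Proof. by rewrite ltr0n muln_gt0 k0. Qed.

Lemma btime01 i : 0 <= btime i <= 1.
Proof. by rewrite /btime le_min ler01 divr_ge0//= ge_min lexx. Qed.

Lemma btime_le : {homo btime : i j / (i <= j)%N >-> i <= j}.
Proof.
move=> i j ij; rewrite /btime le_min !ge_min lexx/=; apply/orP; right.
by rewrite ler_pM2r ?invr_gt0// ler_nat.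
Qed.

Lemma btimeE i : (i <= k * n)%N -> btime i = i%:R / (k * n)%:R.
Proof. by move=> ik; rewrite /btime min_r// ler_pdivrMr// mul1r ler_nat. Qed.

Let inc (i : 'I_(k * n)) := block_inc i.

Lemma meas_block_inc i : meas (block_inc i).
Proof. by apply: (meas_increment hB); exact: btime01. Qed.

Let inc_indep : mutually_independent P inc.
Proof.
case: hB => _ _ _ h; apply: (h (k * n)%N btime) => //.
- by case/andP: (btime01 0).
- by case/andP: (btime01 (k * n)).
- exact: btime_le.
Qed.

Let mgf_inc i : (i < k * n)%N -> forall l : R, integ P (fun w => expR (l * block_inc i w)) /\
  \int[P]_w expR (l * block_inc i w) = expR (l ^+ 2 * (k * n)%:R^-1 / 2).
Proof.
move=> ik l.
have st : btime i.+1 - btime i = (k * n)%:R^-1.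
  by rewrite (btimeE ik) (btimeE (ltnW ik)) -mulrBl -natr1 addrAC subrr add0r mul1r.
rewrite -st; apply: (brownian_mgf hB).
- by case/andP: (btime01 i).
- by rewrite -subr_gt0 st invr_gt0.
- by case/andP: (btime01 i.+1).
Qed.

Let vi0 : 0 < (k * n)%:R^-1 :> R. Proof. by rewrite invr_gt0. Qed.

Let idx (i : 'I_k) (j : nat) : (j < n)%N -> (i * n + j < k * n)%N.
Proof. by move=> jn; rewrite (leq_trans (_ : _ < i.+1 * n)%N) ?leq_mul2r ?ltn_ord ?orbT// mulSn addnC ltn_add2r. Qed.

Let i4 i : (i < k * n)%N -> integ P (fun w => block_inc i w ^+ 4).
Proof. by move=> ik; exact: (gaussian_fourth (meas_block_inc i) vi0 (mgf_inc ik)).1. Qed.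

Lemma block_inc_cov i i' : (i < k * n)%N -> (i' < k * n)%N ->
  integ P (fun w => block_inc i w * block_inc i' w) /\
  \int[P]_w (block_inc i w * block_inc i' w) = (i == i')%:R * (k * n)%:R^-1.
Proof.
move=> ik ik'; have [<-|ne] := eqVneq i i'.
  have [j e] := gaussian_variance (meas_block_inc i) (mgf_inc ik).
  by rewrite mul1r -e; split; [under eq_fun do rewrite -expr2|apply: eq_Ex => w; rewrite expr2].
have [j1 e1] := gaussian_mean (meas_block_inc i) (mgf_inc ik).
have [j2 e2] := gaussian_mean (meas_block_inc i') (mgf_inc ik').
pose o := Ordinal ik; pose o' := Ordinal ik'.
have dis : [set o] `&` [set o'] = set0.
  by apply/seteqP; split => // x [/= -> /(congr1 val)/= e]; rewrite e eqxx in ne.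
have [] := indep_mul (Y := inc) (fun i => meas_block_inc i) inc_indep dis
  (meas_sig (erefl o : [set o] o)) (meas_sig (erefl o' : [set o'] o')) j1 j2.
by rewrite e1 e2 mul0r mul0r.
Qed.

Lemma gauss_blockE j l : gauss_block j l =
  fun w => Num.sqrt v * \sum_(i < k) (if (i <= l)%N then block_inc (i * n + j) w else 0).
Proof. by apply/funext => w; rewrite /gauss_block big_mkcond. Qed.

Lemma gauss_block_moments j : (j < n)%N ->
  [/\ forall l, meas (gauss_block j l),
    third_moments P (gauss_block j) ((Num.sqrt n%:R)^-1 ^+ 3 *
      (k%:R ^+ 2 * v + k%:R ^+ 4 * (v ^+ 2 * (k%:R ^+ 4 * (2 * 4 ^+ 4 * expR (2^-1)))))) &
  forall l l', \int[P]_w (gauss_block j l w * gauss_block j l' w) = v * (minn l.+1 l'.+1)%:R / (k * n)%:R].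
Proof.
move=> jn.
have mg l : meas (gauss_block j l).
  rewrite gauss_blockE; apply: mfunM => //; apply: measurable_sum => i.
  by case: (i <= l)%N => //; exact: meas_block_inc.
pose U w (i : 'I_k) := block_inc (i * n + j) w.
have gU l w : `|\sum_(i < k | (i <= l)%N) U w i| <= norm1 (U w).
  apply: (le_trans (ler_norm_sum _ _ _)); rewrite /norm1 [leRHS](bigID (fun i : 'I_k => (i <= l)%N))/=.
  by rewrite lerDl sumr_ge0.
have iU4 (i : 'I_k) : integ P (fun w => U w i ^+ 4) by exact: i4 (idx i jn).
have g4 l w : gauss_block j l w ^+ 4 <= v ^+ 2 * (k%:R ^+ 3 * \sum_i U w i ^+ 4).
  rewrite /gauss_block exprMn (exprM (Num.sqrt v) 2 2) sqr_sqrtr// ler_wpM2l ?sqr_ge0//.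
  apply: le_trans (norm1_fourth _).
  by rewrite -[leLHS]ger0_norm ?exprn_even_ge0// normrX lerXn2r ?nnegrE ?norm1_ge0// gU.
have iG4 l : integ P (fun w => gauss_block j l w ^+ 4).
  have ib := integZ (v ^+ 2) (integZ (k%:R ^+ 3) (integ_sum (index_enum 'I_k) xpredT iU4)).
  apply: integ_le ib _ => [|w]; first exact: mfunX.
  by rewrite ger0_norm ?exprn_even_ge0.
have cov l l' : \int[P]_w (gauss_block j l w * gauss_block j l' w) = v * (minn l.+1 l'.+1)%:R / (k * n)%:R.
  have ii (a b : 'I_k) := block_inc_cov (idx a jn) (idx b jn).
  transitivity (\int[P]_w (v * \sum_(a < k | (a <= l)%N) \sum_(b < k | (b <= l')%N) (U w a * U w b))).
    apply: eq_Ex => w; rewrite /gauss_block mulrACA -expr2 sqr_sqrtr//; congr (_ * _).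
    by rewrite mulr_suml; apply: eq_bigr => a _; rewrite mulr_sumr.
  have iS (a : 'I_k) : integ P (fun w => \sum_(b < k | (b <= l')%N) (U w a * U w b)).
    by apply: integ_sum => b; exact: (ii a b).1.
  rewrite ExZ; last exact: integ_sum.
  rewrite Ex_sum// -mulrA; congr (_ * _).
  under eq_bigr => a _.
    rewrite Ex_sum; last by move=> b; exact: (ii a b).1.
    under eq_bigr => b _ do rewrite (ii a b).2.
    over.
  have eb (a b : 'I_k) : ((a * n + j)%N == (b * n + j)%N) = (b == a).
    by rewrite eqn_add2r eqn_pmul2r// eq_sym.
  under eq_bigr => a _.
    under eq_bigr => b _ do rewrite eb.
    rewrite -mulr_suml.
    over.
  rewrite -mulr_suml; congr (_ * _).
  (* The covariance counts the cells common to both sums, min(l, l') + 1 of them. *)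
  transitivity (\sum_(a < k | (a <= l)%N && (a <= l')%N) 1 : R).
    rewrite big_mkcondr/=; apply: eq_bigr => a _.
    rewrite -[RHS](_ : \sum_(b < k | (b <= l')%N && (b == a)) 1 = _).
      by rewrite big_mkcondr/=; apply: eq_bigr => b _; case: (b == a).
    case: ifP => al'; first by rewrite (big_pred1 a)// => b /=; case: eqP => [->|]; rewrite ?al' ?andbF.
    by rewrite big1// => b /andP[bl' /eqP ba]; rewrite -ba bl' in al'.
  rewrite sumr_const; congr (_%:R).
  rewrite -[RHS](_ : #|[pred a : 'I_k | (a < minn l.+1 l'.+1)%N]| = _).
    by apply: eq_card => a; rewrite !inE /= leq_min !ltnS.
  rewrite -sum1_card big_mkcond/= -(big_mkord xpredT (fun a => if (a < minn l.+1 l'.+1)%N then 1%N else 0%N)) -big_mkcond/=.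
  have mk : (minn l.+1 l'.+1 <= k)%N by rewrite geq_min ltn_ord.
  by rewrite -(big_nat_widen 0 _ k xpredT (fun=> 1%N) mk) sum_nat_const_nat subn0 muln1.
split => //.
have sn0 : 0 < (Num.sqrt n%:R : R)^-1 by rewrite invr_gt0 sqrtr_gt0 ltr0n.
have sn2 : (Num.sqrt n%:R : R)^-1 ^+ 2 = n%:R^-1 by rewrite exprVn sqr_sqrtr.
apply: third_moments_of4 => // l.
- rewrite /gauss_block ExZ; last first.
    apply: integ_sum => i; exact: (gaussian_mean (meas_block_inc _) (mgf_inc (idx i jn))).1.
  rewrite Ex_sum => [|i]; last exact: (gaussian_mean (meas_block_inc _) (mgf_inc (idx i jn))).1.
  by rewrite big1 ?mulr0// => i _; exact: (gaussian_mean (meas_block_inc _) (mgf_inc (idx i jn))).2.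
- have -> : \int[P]_w (gauss_block j l w ^+ 2) = v * l.+1%:R / (k * n)%:R.
    by rewrite -(minnn l.+1) -cov; apply: eq_Ex => w; rewrite expr2.
  rewrite sn2 -mulrA ler_wpM2l// ler_pdivrMr// natrM mulrA.
  by rewrite mulrAC mulVf ?mul1r ?ler_nat ?pnatr_eq0 -?lt0n// ltn_ord.
- have ib := integ_sum (index_enum 'I_k) xpredT iU4.
  apply: (@le_trans _ _ (\int[P]_w (v ^+ 2 * (k%:R ^+ 3 * \sum_i U w i ^+ 4)))).
    by apply: le_Ex => //; exact/integZ/integZ.
  rewrite (ExZ _ (integZ _ ib)) (ExZ _ ib) (Ex_sum _ _ iU4).
  set Cg := 2 * 4 ^+ 4 * expR (2^-1); have Cg0 : 0 <= Cg by rewrite !mulr_ge0 ?expR_ge0.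
  have -> : v ^+ 2 * (k%:R ^+ 4 * Cg) * (Num.sqrt n%:R)^-1 ^+ 4 =
      v ^+ 2 * (k%:R ^+ 3 * (k%:R * (Cg * ((Num.sqrt n%:R)^-1 ^+ 2) ^+ 2))) by ring.
  rewrite sn2; apply: ler_wpM2l; first exact: sqr_ge0.
  apply: ler_wpM2l; first exact: exprn_ge0.
  rewrite -sumr_cst; apply: ler_sum => i _.
  apply: (le_trans (gaussian_fourth (meas_block_inc _) vi0 (mgf_inc (idx i jn))).2).
  apply: ler_wpM2l => //.
  have h : (k * n)%:R^-1 <= n%:R^-1 :> R.
    by rewrite lef_pV2 ?posrE ?ltr0n//; rewrite ?ler_nat ?leq_pmull// muln_gt0 k0.
  by rewrite lerXn2r ?nnegrE ?invr_ge0.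
Qed.

Lemma gauss_block_sum (l : 'I_k) w :
  \sum_(0 <= j < n) gauss_block j l w = Num.sqrt v * B (l.+1%:R / k%:R) w.
Proof.
rewrite /gauss_block -mulr_sumr; congr (_ * _); rewrite exchange_big/=.
have e0 : btime 0 = 0 by rewrite btimeE// mul0r.
have B0 : B 0 w = 0 by case: hB => _ h _ _; case: (h w).
transitivity (\sum_(i < k | (i <= l)%N) (B (btime (i.+1 * n)) w - B (btime (i * n)) w)).
  apply: eq_bigr => i _; under eq_bigr do rewrite /block_inc -addnS.
  by rewrite (telescope_sumr (fun j => B (btime (i * n + j)) w))// addn0 mulSn addnC.
transitivity (\sum_(0 <= i < l.+1) (B (btime (i.+1 * n)) w - B (btime (i * n)) w)).
  rewrite (big_nat_widen _ _ k)//= big_mkord; apply: eq_bigl => i; by rewrite ltnS.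
rewrite (telescope_sumr (fun i => B (btime (i * n)) w))// mul0n e0 B0 subr0.
rewrite btimeE ?leq_mul2r ?ltn_ord ?orbT//; congr (B _ w).
by rewrite !natrM -mulf_div divff ?mulr1// pnatr_eq0 -lt0n.
Qed.

(** Block j uses the increments whose index is j modulo n, so blocks with different j depend on
    disjoint sets of increments. *)
Lemma gauss_block_sig (A : set nat) j l : A j -> (j < n)%N ->
  meas (gauss_block j l : sig inc [set i | A (i %% n)%N] -> R).
Proof.
move=> Aj jn; rewrite gauss_blockE; apply: mfunM => //.
apply: (@measurable_sum _ (sig inc [set i | A (i %% n)%N])) => i.
case: (i <= l)%N; last exact: mcst.
apply: (@meas_sig _ _ T _ _ inc [set i | A (i %% n)%N] (Ordinal (idx i jn))).
by rewrite /= modnMDl modn_small.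
Qed.

End brownian_blocks.

(** * Lindeberg's exchange on a fixed grid *)

Section grid_clt.
Context {d d'} {T : measurableType d} {E : measurableType d'} {R : realType}.
Context (Q : probability T R) (P : probability E R) (Y : option nat -> T -> E).
Hypotheses (mY : forall i, meas (Y i)) (indY : mutually_independent Q Y).
Hypothesis lawY : has_law Q P Y.
Context {dB} {TB : measurableType dB} (PB : probability TB R) (B : R -> TB -> R).
Hypothesis hB : standard_brownian_motion PB B.
Context (k n : nat) (X : 'I_k -> E -> R) (v kap : R).
Hypotheses (k0 : (0 < k)%N) (n0 : (0 < n)%N) (v0 : 0 <= v).
Hypotheses (mX : forall l, meas (X l)) (iX4 : forall l, integ P (fun e => X l e ^+ 4)).
Hypothesis EX : forall l, \int[P]_e X l e = 0.
Hypothesis covX : forall l l', \int[P]_e (X l e * X l' e) = v * (minn l.+1 l'.+1)%:R / k%:R.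
Hypothesis EX4 : forall l, \int[P]_e (X l e ^+ 4) <= kap.
Context (c eta M : R).
Hypotheses (eta0 : 0 < eta) (M0 : 0 <= M) (jet : @has_jet R k M (bump c eta)).

Let s : R := (Num.sqrt n%:R)^-1.
Let s0 : 0 < s. Proof. by rewrite invr_gt0 sqrtr_gt0 ltr0n. Qed.
Let s2 : s ^+ 2 = n%:R^-1. Proof. by rewrite exprVn sqr_sqrtr. Qed.
Let xi (l : 'I_k) e := s * X l e.
Let f : ('I_k -> R) -> R := bump c eta.
Let cX := k%:R ^+ 2 * v + k%:R ^+ 4 * kap.
Let cG := k%:R ^+ 2 * v + k%:R ^+ 4 * (v ^+ 2 * (k%:R ^+ 4 * (2 * 4 ^+ 4 * expR (2^-1)))).
Let g j := gauss_block B n v j : 'I_k -> TB -> R.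

Let mxi l : meas (xi l). Proof. exact: mfunM. Qed.
Let iX2 l : integ P (fun e => X l e ^+ 2). Proof. exact: integ_of4 mX iX4 l _ _. Qed.
Let iX1 l : integ P (X l). Proof. by have := integ_of4 mX iX4 l (isT : (1 <= 4)%N); under eq_fun do rewrite expr1. Qed.

Let tX : third_moments P xi (s ^+ 3 * cX).
Proof.
have k0' : (0 : R) < k%:R by rewrite ltr0n.
apply: third_moments_of4 => // l.
- by rewrite /xi; under eq_fun do rewrite exprMn; exact: integZ.
- by rewrite /xi (ExZ _ (iX1 l)) EX mulr0.
- have -> : \int[P]_e (xi l e ^+ 2) = s ^+ 2 * \int[P]_e (X l e ^+ 2).
    by rewrite -ExZ//; apply: eq_Ex => e; rewrite /xi exprMn.
  rewrite mulrC ler_wpM2r ?sqr_ge0// (_ : \int[P]_e (X l e ^+ 2) = v * l.+1%:R / k%:R); last first.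
    by rewrite -[in RHS](minnn l.+1) -covX; apply: eq_Ex => e; rewrite expr2.
  by rewrite -mulrA ler_piMr// ler_pdivrMr// mul1r ler_nat ltn_ord.
- have -> : \int[P]_e (xi l e ^+ 4) = s ^+ 4 * \int[P]_e (X l e ^+ 4).
    by rewrite -ExZ//; apply: eq_Ex => e; rewrite /xi exprMn.
  by rewrite mulrC ler_wpM2r ?exprn_even_ge0.
Qed.

Let f1 y : `|f y| <= 1.
Proof. by have /andP[h0 h1] := bump01 c eta y; rewrite /f ger0_norm. Qed.

Let A j (w : T) (l : 'I_k) := \sum_(0 <= i < j) xi l (Y (Some i) w).
Let G j (w' : TB) (l : 'I_k) := \sum_(j <= i < n) g i l w'.
(** The hybrid: observations below j, Gaussian blocks from j on. The two sample spaces are joined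
    only through the double integral. *)
Let a j := \int[Q]_w \int[PB]_w' f (fun l => A j w l + G j w' l).

Let mA (j : nat) l : meas ((fun w => A j w l) : sig Y [set i | exists2 i', (i' < j)%N & i = Some i'] -> R).
Proof.
rewrite (_ : (fun w => A j w l) = fun w => \sum_(0 <= i < j) (if (i < j)%N then xi l (Y (Some i) w) else 0)); last first.
  by apply/funext => w; apply: eq_big_nat => i /andP[_ ->].
apply: (@measurable_sum _ (sig Y [set i | exists2 i', (i' < j)%N & i = Some i']) R setT _ (index_iota 0 j)
  (fun i w => if (i < j)%N then xi l (Y (Some i) w) else 0)) => i.
case ij : (i < j)%N; last exact: mcst.
by apply: mcomp (mxi l) _; apply: meas_sig; exists i.
Qed.

Let inc := (fun i : 'I_(k * n) => block_inc B k n i).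
Let inc_indep : mutually_independent PB inc.
Proof.
case: hB => _ _ _ h; apply: (h (k * n)%N (btime k n)) => //.
- by case/andP: (btime01 (R := R) k n 0).
- by case/andP: (btime01 (R := R) k n (k * n)).
- exact: btime_le.
Qed.
Let minc i : meas (inc i). Proof. exact: (meas_block_inc hB). Qed.

Let mG j l (S : set nat) : (forall i, (j <= i < n)%N -> S i) ->
  meas ((fun w => G j w l) : sig inc [set i | S (i %% n)%N] -> R).
Proof.
move=> jS; rewrite (_ : (fun w => G j w l) = fun w => \sum_(j <= i < n) (if (j <= i < n)%N then g i l w else 0)); last first.
  by apply/funext => w; apply: eq_big_nat => i ->.
apply: (@measurable_sum _ (sig inc [set i | S (i %% n)%N]) R setT _ (index_iota j n)
  (fun i w => if (j <= i < n)%N then g i l w else 0)) => i.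
case ij : (j <= i < n)%N; last exact: mcst.
have /andP[_ lt] := ij; exact: (gauss_block_sig v l (jS i ij) lt).
Qed.

Let step j : (j < n)%N -> `|a j.+1 - a j| <= M * (s ^+ 3 * cX + s ^+ 3 * cG).
Proof.
move=> jn; set bd := M * _.
have mA' l : meas (fun w => A j w l) by exact: (sig_meas mY (@mA j l)).
have mG' l : meas (fun w => G j.+1 w l).
  exact: (sig_meas minc (@mG j.+1 l [set i | (j < i)%N] (fun i h => proj1 (andP h)))).
have [mg tg cov] := gauss_block_moments hB k0 n0 v0 jn.
have AS w l : A j.+1 w l = A j w l + xi l (Y (Some j) w) by rewrite /A big_nat_recr.
have GS w l : G j w l = G j.+1 w l + g j l w by rewrite /G big_ltn// addrC.
have pr1 d0 (S0 : measurableType d0) : meas (fun q : (T * TB) * S0 => q.1.1) by exact: mcomp measurable_fst.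
have pr2 d0 (S0 : measurableType d0) : meas (fun q : (T * TB) * S0 => q.1.2) by exact: mcomp measurable_fst.
(* [Phi] and [Psi] integrate out position j alone, filled by the observation and by the Gaussian
   block respectively; the rest of the hybrid is the same in both. *)
pose Phi w w' := \int[P]_e f (fun l => (A j w l + G j.+1 w' l) + xi l e).
pose Psi w w' := \int[PB]_w'' f (fun l => (A j w l + G j.+1 w' l) + g j l w'').
have mPhi : meas (fun p : T * TB => Phi p.1 p.2).
  apply: (@meas_Ex _ _ (T * TB)%type E R P (fun q => f (fun l => (A j q.1.1 l + G j.+1 q.1.2 l) + xi l q.2))).
  apply: meas_bump => l; apply: mfunD; last exact: mcomp.
  by apply: mfunD; [exact: (mcomp (mA' l) (pr1 _ _))|exact: (mcomp (mG' l) (pr2 _ _))].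
have mPsi : meas (fun p : T * TB => Psi p.1 p.2).
  apply: (@meas_Ex _ _ (T * TB)%type TB R PB (fun q => f (fun l => (A j q.1.1 l + G j.+1 q.1.2 l) + g j l q.2))).
  apply: meas_bump => l; apply: mfunD; last exact: (mcomp (mg l)).
  by apply: mfunD; [exact: (mcomp (mA' l) (pr1 _ _))|exact: (mcomp (mG' l) (pr2 _ _))].
have bE d0 (S0 : measurableType d0) (P0 : probability S0 R) (h : S0 -> 'I_k -> R) :
    (forall l, meas (h ^~ l)) -> `|\int[P0]_w f (h w)| <= 1.
  by move=> mh; apply: abs_Ex_le => [|w]; [exact: meas_bump|exact: f1].
have bPhi w w' : `|Phi w w'| <= 1.
  by apply: bE => l; apply: mfunD; [exact: mcst|exact: mxi].
have bPsi w w' : `|Psi w w'| <= 1.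
  by apply: bE => l; apply: mfunD; [exact: mcst|exact: mg].
have [i1 _ s1] := fubini_bnd Q PB mPhi (fun w w' => bPhi w w').
have [i2 _ s2'] := fubini_bnd Q PB mPsi (fun w w' => bPsi w w').
have aS : a j.+1 = \int[Q]_w \int[PB]_w' Phi w w'.
  have mF : meas (fun p : T * TB => f (fun l => A j.+1 p.1 l + G j.+1 p.2 l)).
    apply: meas_bump => l; apply: mfunD; last exact: (mcomp (mG' l)).
    exact: (mcomp (sig_meas mY (@mA j.+1 l))).
  have [_ _ sw] := fubini_bnd Q PB mF (fun w w' => f1 _).
  (* With the Gaussian part held fixed outside, the inner integral over the sample separates
     observation j from the first j ones. *)
  rewrite /a sw s1; apply: eq_Ex => w' /=.
  have dis : [set i | exists2 i', (i' < j)%N & i = Some i'] `&` [set Some j] = set0.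
    by apply/seteqP; split => // i [[i' i'j ->] /= [ij]]; rewrite ij ltnn in i'j.
  pose F (p : T * T) := f (fun l => A j p.1 l + G j.+1 w' l + xi l (Y (Some j) p.2)).
  have [|_ _ e] := decouple_id (F := F) mY indY dis _ (fun p => f1 _).
    apply: (meas_bump (T := (sig Y _ * sig Y _)%type)) => l; apply: mfunD.
      apply: mfunD; last exact: mcst.
      exact: (mcomp (@mA j l)).
    have mYj : meas (Y (Some j) : sig Y [set Some j] -> E) by exact: meas_sig.
    exact: (mcomp (mcomp (mxi l) mYj) measurable_snd).
  transitivity (\int[Q]_w F (w, w)).
    apply: eq_Ex => w; congr f; apply/funext => l; rewrite AS /=; ring.
  rewrite e; apply: eq_Ex => w; rewrite /F /Phi /=.
  apply: (Ex_law (mY (Some j)) (lawY (Some j)) _).2.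
  apply: (integ_bnd P (c := 1)) => [|e']; last exact: f1.
  by apply: meas_bump => l; apply: mfunD; [exact: mcst|exact: mxi].
have a0 : a j = \int[Q]_w \int[PB]_w' Psi w w'.
  apply: eq_Ex => w.
  pose S1 := [set i : nat | (j < i)%N]; pose S2 := [set j].
  have dis : [set i : 'I_(k * n) | S1 (i %% n)%N] `&` [set i : 'I_(k * n) | S2 (i %% n)%N] = set0.
    by apply/seteqP; split => // i [/= h1 h2]; rewrite /S1 /S2 /= in h1 h2; rewrite h2 ltnn in h1.
  pose F (p : TB * TB) := f (fun l => A j w l + G j.+1 p.1 l + g j l p.2).
  have [|_ _ e] := decouple_id (F := F) minc inc_indep dis _ (fun p => f1 _).
    apply: (meas_bump (T := (sig inc _ * sig inc _)%type)) => l; apply: mfunD.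
      apply: mfunD; first exact: mcst.
      have mG1 : meas ((fun w' => G j.+1 w' l) : sig inc [set i | S1 (i %% n)%N] -> R).
        by apply: mG => i /andP[].
      exact: (mcomp mG1 measurable_fst).
    have mg2 : meas (g j l : sig inc [set i | S2 (i %% n)%N] -> R).
      exact: (gauss_block_sig v l (erefl j : S2 j) jn).
    exact: (mcomp mg2 measurable_snd).
  transitivity (\int[PB]_w' F (w', w')); last exact: e.
  by apply: eq_Ex => w'; congr f; apply/funext => l; rewrite GS /=; ring.
rewrite aS a0 -(ExB i1 i2).
have cv l l' : \int[P]_e (xi l e * xi l' e) = \int[PB]_w (g j l w * g j l' w).
  rewrite cov; have -> : \int[P]_e (xi l e * xi l' e) = s ^+ 2 * \int[P]_e (X l e * X l' e).
    rewrite -ExZ; first by apply: eq_Ex => e; rewrite /xi; ring.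
    apply: (integ_le _ (integD (iX2 l) (iX2 l'))) => [|e]; first exact: mfunM.
    exact: normM_le_sqr.
  by rewrite covX s2 natrM invfM; ring.
have hb w w' : `|Phi w w' - Psi w w'| <= bd.
  have m1 : meas (fun e => f (fun l => (A j w l + G j.+1 w' l) + xi l e)).
    by apply: meas_bump => l; apply: mfunD; [exact: mcst|exact: mxi].
  have m2 : meas (fun w'' => f (fun l => (A j w l + G j.+1 w' l) + g j l w'')).
    by apply: meas_bump => l; apply: mfunD; [exact: mcst|exact: mg].
  exact: (lindeberg_step tX tg cv M0 jet m1 m2).
have bd0 : 0 <= bd by exact: le_trans (normr_ge0 _) (hb point point).
apply: abs_Ex_le => [|w]; first by apply: mfunB; [exact: integ_meas i1|exact: integ_meas i2].
have mP1 : meas (Phi w) by exact: (mcomp mPhi (measurable_pair1 w)).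
have mP2 : meas (Psi w) by exact: (mcomp mPsi (measurable_pair1 w)).
rewrite -(ExB (integ_bnd PB mP1 (bPhi w)) (integ_bnd PB mP2 (bPsi w))).
by apply: abs_Ex_le => [|w']; [exact: mfunB|exact: hb].
Qed.

(** Each of the n exchanges costs a multiple of n^(-3/2), which leaves the factor s = n^(-1/2). *)
Lemma grid_clt :
  `|\int[Q]_w bump c eta (fun l => s * \sum_(0 <= i < n) X l (Y (Some i) w)) -
    \int[PB]_w bump c eta (fun l : 'I_k => Num.sqrt v * B (l.+1%:R / k%:R) w)| <= M * (cX + cG) * s.
Proof.
have an : \int[Q]_w bump c eta (fun l => s * \sum_(0 <= i < n) X l (Y (Some i) w)) = a n.
  apply: eq_Ex => w; rewrite -[LHS](Ex_cst PB); apply: eq_Ex => w'; congr f; apply/funext => l.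
  by rewrite /A /G [X in _ + X]big_geq// addr0 mulr_sumr.
have a0 : \int[PB]_w bump c eta (fun l : 'I_k => Num.sqrt v * B (l.+1%:R / k%:R) w) = a 0%N.
  rewrite -[LHS](Ex_cst Q); apply: eq_Ex => w; apply: eq_Ex => w'; congr f; apply/funext => l.
  by rewrite /A /G big_geq// add0r -(gauss_block_sum hB v k0 n0).
rewrite an a0 -(telescope_sumr a)//; apply: (le_trans (ler_norm_sum _ _ _)).
apply: (@le_trans _ _ (\sum_(0 <= j < n) M * (s ^+ 3 * cX + s ^+ 3 * cG))).
  by rewrite !big_nat; apply: ler_sum => j /andP[_ jn]; exact: step.
rewrite big_mkord sumr_cst.
have e : n%:R * s ^+ 2 = 1 by rewrite s2 divff// pnatr_eq0 -lt0n.
have -> : n%:R * (M * (s ^+ 3 * cX + s ^+ 3 * cG)) = (n%:R * s ^+ 2) * (M * (cX + cG) * s) by ring.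
by rewrite e mul1r.
Qed.

End grid_clt.

(** * Freezing the training data *)

Section joint_measurability.
Context {R : realType} {d} {E : measurableType d} (F : R -> set_system E) (N : E -> cumulative R R).
Hypotheses (fF : filtration F) (pN : forall e, counting_path (N e)) (aN : adapted F (fun t e => N e t)).
Context {dX} {X : measurableType dX} (H : X -> R -> E -> R).
Hypothesis mH : meas (fun p : X * (R * E) => H p.1 p.2.1 p.2.2).

Lemma meas_jtime i : meas (fun e => jtime (N e) i).
Proof.
have h1 : 0 <= (1 : R) <= 1 by rewrite ler01 lexx.
have := meas_adapted fF h1 (adapted_jtime fF pN aN i h1); congr measurable_fun.
by apply/funext => e; have [//|/jtime_gt1 ->] := leP.
Qed.

Lemma meas_tint_joint : meas (fun p : X * E => tint (H p.1) p.2).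
Proof.
apply: (meas_Ex leb01 (F := fun q : (X * E) * R => H q.1.1 q.2 q.1.2)).
apply: (mcomp mH (_ : meas (fun q : (X * E) * R => (q.1.1, (q.2, q.1.2))))).
apply: mpair; first exact: mcomp measurable_fst.
by apply: mpair => //; exact: mcomp measurable_fst.
Qed.

Hypothesis H0 : forall x s e, ~~ (0 <= s <= 1) -> H x s e = 0.

Lemma meas_jsum_joint : meas (fun p : X * E => jsum N (H p.1) p.2).
Proof.
apply: (@measurable_fun_cvg _ _ R setT (fun n (p : X * E) => \sum_(i < n) H p.1 (jtime (N p.2) i) p.2)).
  move=> n; apply: measurable_sum => i.
  apply: (mcomp mH (_ : meas (fun p : X * E => (p.1, (jtime (N p.2) i, p.2))))).
  apply: mpair => //; apply: mpair => //.
  exact: (mcomp (meas_jtime i)).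
move=> p _; apply: (@sum_jumps_cvg _ _ _ N p.2 (fun i => H p.1 (jtime (N p.2) i) p.2)) => i ni.
by rewrite H0// negb_and -!ltNge [X in _ || X]ltNge jtime_le1// -leqNgt ni orbT.
Qed.

End joint_measurability.

Section freeze.
Context {d d'} {T : measurableType d} {E : measurableType d'} {R : realType}.
Context (Q : probability T R) (P : probability E R) (Y : option nat -> T -> E).
Hypotheses (mY : forall i, meas (Y i)) (indY : mutually_independent Q Y).
Hypothesis lawY : has_law Q P Y.
Context {n : nat} (D : {set 'I_n}).

Definition sample_tuple (w : T) : n.-tuple E := [tuple Y (Some (val i)) w | i < n].

Definition heldout : set (option nat) := [set i | i = None \/ exists2 j : 'I_n, j \notin D & i = Some (val j)].

Let train : set (option nat) := [set i | exists2 j : 'I_n, j \in D & i = Some (val j)].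
(** The data with all coordinates outside the training set erased: it depends on the training
    observations only, and a fitted object cannot tell it from the full data. *)
Let dataD (w : T) : n.-tuple E := [tuple if i \in D then Y (Some (val i)) w else point | i < n].

Let mdataD : meas (dataD : sig Y train -> n.-tuple E).
Proof.
apply/measurable_fun_tnthP => i.
rewrite (_ : _ \o _ = fun w => if i \in D then Y (Some (val i)) w else point); last first.
  by apply/funext => w; rewrite /= tnth_mktuple.
case: (boolP (i \in D)) => iD; last exact: mcst.
by apply: meas_sig; exists i.
Qed.

Let dis : train `&` heldout = set0.
Proof.
apply/seteqP; split => // i [[j jD ->] [//|[j' j'D [e]]]].
by rewrite -(val_inj e) jD in j'D.
Qed.

Lemma meas_sample_tuple : meas sample_tuple.
Proof.
apply/measurable_fun_tnthP => i; rewrite (_ : _ \o _ = Y (Some (val i)))//.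
by apply/funext => w; rewrite /= tnth_mktuple.
Qed.

(** Conditioning on the training data, written as a second integral in which [w'] supplies the
    held-out observations while the data stay at [w]. *)
Lemma freeze (Phi : n.-tuple E * T -> R) (Dm : T -> R) :
  (forall x y w, (forall i, i \in D -> tnth x i = tnth y i) -> Phi (x, w) = Phi (y, w)) ->
  meas (Phi : n.-tuple E * sig Y heldout -> R) ->
  (forall x w, `|Phi (x, w)| <= Dm w) -> integ Q Dm ->
  [/\ integ Q (fun w => Phi (sample_tuple w, w)),
      integ Q (fun w => \int[Q]_w' Phi (sample_tuple w, w'))
    & \int[Q]_w Phi (sample_tuple w, w) = \int[Q]_w \int[Q]_w' Phi (sample_tuple w, w')].
Proof.
move=> dep mPhi bPhi iD.
have e w w' : Phi (sample_tuple w, w') = Phi (dataD w, w').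
  by apply: dep => i iD'; rewrite !tnth_mktuple iD'.
have mid : meas (id : sig Y heldout -> sig Y heldout) by exact: measurable_id.
have [i1 i2 e12] := @decouple_dom _ _ T E R Q _ Y mY indY _ _ (n.-tuple E) (sig Y heldout) train heldout dataD id Phi Dm
  dis mdataD mid mPhi (fun w w' => bPhi (dataD w) w') iD.
have eq1 : (fun w => Phi (sample_tuple w, w)) = fun w => Phi (dataD w, w) by apply/funext => w; exact: e.
have eq2 : (fun w => \int[Q]_w' Phi (sample_tuple w, w')) = fun w => \int[Q]_w' Phi (dataD w, w').
  by apply/funext => w; apply: eq_Ex => w'; exact: e.
by rewrite eq1 eq2; split => //; rewrite (funext (fun w => e w w)) e12; apply: eq_Ex => w; rewrite (congr1 (@^~ w) eq2).
Qed.

Lemma meas_heldout_obs i : heldout i -> meas (Y i : sig Y heldout -> E).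
Proof. exact: meas_sig. Qed.

Lemma freeze_one (Phi : n.-tuple E * E -> R) (Dm : E -> R) i : heldout i ->
  (forall x y e, (forall i, i \in D -> tnth x i = tnth y i) -> Phi (x, e) = Phi (y, e)) ->
  meas Phi -> (forall x e, `|Phi (x, e)| <= Dm e) -> integ P Dm ->
  [/\ integ Q (fun w => Phi (sample_tuple w, Y i w)),
      integ Q (fun w => \int[P]_e Phi (sample_tuple w, e))
    & \int[Q]_w Phi (sample_tuple w, Y i w) = \int[Q]_w \int[P]_e Phi (sample_tuple w, e)].
Proof.
move=> hi dep mPhi bPhi iD.
have iP x : integ P (fun e => Phi (x, e)).
  by apply: (integ_le _ iD) => //; exact: (mcomp mPhi (measurable_pair1 x)).
have e x : \int[Q]_w Phi (x, Y i w) = \int[P]_e Phi (x, e) := (Ex_law (mY i) (lawY i) (iP x)).2.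
have [] := @freeze (fun p => Phi (p.1, Y i p.2)) (Dm \o Y i).
- by move=> x y w; exact: dep.
- apply: (@mcomp _ _ _ _ _ _ Phi) => //; apply: mpair; first exact: measurable_fst.
  exact: (mcomp (meas_heldout_obs hi) measurable_snd).
- by move=> x w; exact: bPhi.
- exact: (Ex_law (mY i) (lawY i) iD).1.
move=> i1 i2 e12; split => //=.
  by rewrite (_ : (fun w => _) = fun w => \int[Q]_w' Phi (sample_tuple w, Y i w'))//; apply/funext => w; rewrite e.
by rewrite e12; apply: eq_Ex => w; exact: e.
Qed.

End freeze.

Section iid.
Context {d d'} {T : measurableType d} {E : measurableType d'} {R : realType}.
Context (Q : probability T R) (P : probability E R) {I : eqType} (Y : I -> T -> E).
Hypotheses (mY : forall i, meas (Y i)) (indY : mutually_independent Q Y).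
Hypothesis lawY : has_law Q P Y.

Lemma iid_moments (g : E -> R) (r : seq I) : uniq r -> meas g -> integ P (fun e => g e ^+ 4) ->
  \int[P]_e g e = 0 ->
  [/\ integ Q (fun w => (\sum_(j <- r) g (Y j w)) ^+ 2),
      \int[Q]_w ((\sum_(j <- r) g (Y j w)) ^+ 2) = (size r)%:R * \int[P]_e (g e ^+ 2),
      integ Q (fun w => (\sum_(j <- r) g (Y j w)) ^+ 4)
    & \int[Q]_w ((\sum_(j <- r) g (Y j w)) ^+ 4) <=
      3 * ((size r)%:R * \int[P]_e (g e ^+ 2)) ^+ 2 + (size r)%:R * \int[P]_e (g e ^+ 4)].
Proof.
move=> ur mg i4 E0.
have ip p : (p <= 4)%N -> integ P (fun e => g e ^+ p).
  by move=> p4; exact: (integ_of4 (k := 1) (Y := fun _ => g) (fun _ => mg) (fun _ => i4) ord0 p4).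
have iQ p i (p4 : (p <= 4)%N) := Ex_law (mY i) (lawY i) (ip p p4).
have mX i : meas ((fun w => g (Y i w)) : sig Y [set i] -> R).
  by apply: mcomp mg _; exact: meas_sig.
have i1 : integ P g by have := ip 1%N isT; under eq_fun do rewrite expr1.
have E0Q i : \int[Q]_w g (Y i w) = 0 by rewrite (Ex_law (mY i) (lawY i) i1).2.
have [[mS iS] e2 e4] := fourth_moment mY indY ur mX (fun i => (iQ 4 i isT).1) E0Q.
have sumr_size (c : R) : \sum_(i <- r) c = (size r)%:R * c by rewrite big_const_seq count_predT iter_addr_0 mulr_natl.
have s2 : \sum_(i <- r) \int[Q]_w (g (Y i w) ^+ 2) = (size r)%:R * \int[P]_e (g e ^+ 2).
  by rewrite -sumr_size; apply: eq_bigr => i _; exact: (iQ 2 i isT).2.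
have s4 : \sum_(i <- r) \int[Q]_w (g (Y i w) ^+ 4) = (size r)%:R * \int[P]_e (g e ^+ 4).
  by rewrite -sumr_size; apply: eq_bigr => i _; exact: (iQ 4 i isT).2.
split => //; [|by rewrite e2 s2|by rewrite -s2 -s4].
exact: (integ_of4 (k := 1) (Y := fun _ w => \sum_(j <- r) g (Y j w)) (fun _ => mS) (fun _ => iS) ord0 (isT : (2 <= 4)%N)).
Qed.

End iid.

(** * Error bounds on one fold *)

Section fold.
Context {d d'} {T : measurableType d} {E : measurableType d'} {R : realType}.
Context (Q : probability T R) (P : probability E R) (Y : option nat -> T -> E).
Hypotheses (mY : forall i, meas (Y i)) (indY : mutually_independent Q Y).
Hypothesis lawY : has_law Q P Y.
Context (F : R -> set_system E) (N : E -> cumulative R R) (b : R -> E -> R) (C : R).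
Hypothesis CS : counting_setup P F N b C.
Context {n : nat}.
Local Notation mint := (mint N b).
Local Notation jsum := (jsum N).
Local Notation mart := (mart N b).
Local Notation nj e := ((njump (N e))%:R : R).
Local Notation tup := (n.-tuple E).
Local Notation data := (@sample_tuple _ _ T E Y n).
Local Notation Yj j := (Y (Some (val j))).

(** The class is closed under sums, products, squares, absolute values and cut-offs in time, so each
    remainder on a fold is again of this form and can be integrated with the training data
    frozen. *)
Record frozen (D : {set 'I_n}) (H : tup -> R -> E -> R) (c : R) : Prop := {
  fz_dep : forall x y, (forall i, i \in D -> tnth x i = tnth y i) -> H x = H y;
  fz_meas : meas (fun p : tup * (R * E) => H p.1 p.2.1 p.2.2);
  fz_pred : forall x, pred F (H x);
  fz_bound : forall x s e, `|H x s e| <= c }.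

Let fF := cs_fil CS.
Let C0 : 0 <= C := cs_ge0 CS.

Lemma frozen_cst (D : {set 'I_n}) K c : pred F K -> (bdd K c) -> frozen D (fun _ => K) c.
Proof.
move=> pK bK; split => //; exact: (mcomp (meas_pred fF pK) measurable_snd).
Qed.

Lemma frozenD D H K c c' : frozen D H c -> frozen D K c' ->
  frozen D (fun x s e => H x s e + K x s e) (c + c').
Proof.
move=> h k; split => [x y xy|||x s e].
- by rewrite (fz_dep h xy) (fz_dep k xy).
- exact: mfunD (fz_meas h) (fz_meas k).
- by move=> x; apply: predD (fz_pred h x) (fz_pred k x).
- exact: norm_leD (fz_bound h x s e) (fz_bound k x s e).
Qed.

Lemma frozenM D H K c c' : frozen D H c -> frozen D K c' ->
  frozen D (fun x s e => H x s e * K x s e) (c * c').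
Proof.
move=> h k; split => [x y xy|||x s e].
- by rewrite (fz_dep h xy) (fz_dep k xy).
- exact: mfunM (fz_meas h) (fz_meas k).
- by move=> x; apply: predM (fz_pred k x); exact: (fz_pred h x).1.
- exact: norm_leM (fz_bound h x s e) (fz_bound k x s e).
Qed.

Lemma frozenZ D a H c : frozen D H c -> frozen D (fun x s e => a * H x s e) (`|a| * c).
Proof.
move=> h; split => [x y xy|||x s e].
- by rewrite (fz_dep h xy).
- exact: mfunM (mcst _) (fz_meas h).
- by move=> x; exact: predZ (fz_pred h x).
- exact: norm_leM (lexx _) (fz_bound h x s e).
Qed.

Lemma frozen_abs D H c : frozen D H c -> frozen D (fun x s e => `|H x s e|) c.
Proof.
move=> h; split => [x y xy|||x s e].
- by rewrite (fz_dep h xy).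
- exact: mcomp (fz_meas h).
- by move=> x; apply: (pred_comp (f := fun z => `|z|)) (fz_pred h x); [exact: mcomp|rewrite normr0].
- by rewrite normr_id; exact: fz_bound h x s e.
Qed.

Lemma fz_zero D H c x s e : frozen D H c -> ~~ (0 <= s <= 1) -> H x s e = 0.
Proof. by move=> h; exact: (fz_pred h x).2. Qed.

Lemma meas_upto (t : R) : meas (fun p : tup * (R * E) => (p.2.1 <= t)%R%:R : R).
Proof.
apply: mb2r; apply: mfun_ler; last exact: mcst.
exact: mcomp measurable_fst measurable_snd.
Qed.

Lemma frozen_upto D H c (t : R) : frozen D H c -> frozen D (fun x s e => (s <= t)%R%:R * H x s e) c.
Proof.
move=> h; split => [x y xy|||x s e].
- by rewrite (fz_dep h xy).
- exact: mfunM (meas_upto t) (fz_meas h).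
- by move=> x; exact: (pred_upto CS t (fz_pred h x)).
- exact: maskM_le (fz_bound h x s e).
Qed.

Lemma integ_frozen D H c x e : frozen D H c -> integ leb01 (fun s => H x s e).
Proof. by move=> h; apply: (integ_pred fF (fz_pred h x)) => s; exact: fz_bound h x s e. Qed.

Let fb D : frozen D (fun _ => b) C. Proof. exact: frozen_cst (cs_pred CS) (cs_bound CS). Qed.

Let mtint D H c : frozen D H c -> meas (fun p : tup * E => tint (H p.1) p.2).
Proof. by move=> h; exact: meas_tint_joint (fz_meas h). Qed.

Let mjsum D H c : frozen D H c -> meas (fun p : tup * E => jsum (H p.1) p.2).
Proof.
move=> h; apply: (meas_jsum_joint (cs_fil CS) (cs_path CS) (cs_adapted CS) (fz_meas h)).
by move=> x s e; exact: fz_zero h.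
Qed.

Let mmart D H c t : frozen D H c -> meas (fun p : tup * E => mart (H p.1) t p.2).
Proof.
move=> h; apply: mfunB; first exact: mjsum (frozen_upto t h).
exact: mtint (frozenM (frozen_upto t h) (fb D)).
Qed.

Definition err2 (H K : tup -> R -> E -> R) (x : tup) : R :=
  \int[P]_e tint (fun s e => (H x s e - K x s e) ^+ 2) e.

Lemma frozenB D H K c c' : frozen D H c -> frozen D K c' ->
  frozen D (fun x s e => H x s e - K x s e) (c + c').
Proof.
move=> h k; have := frozenD h (frozenZ (- 1) k); rewrite normrN1 mul1r.
congr (frozen D _ _); apply/funext => x; apply/funext => s; apply/funext => e.
by rewrite mulN1r.
Qed.

Lemma frozen_sqr D H c : frozen D H c -> frozen D (fun x s e => H x s e ^+ 2) (c ^+ 2).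
Proof.
by move=> h; have := frozenM h h; rewrite expr2; congr (frozen D _ _).
Qed.

Let integ_tint D H c x : frozen D H c -> integ P (tint (H x)).
Proof.
by move=> h; exact: (integ_tint fF (fz_pred h x) (fz_bound h x)).
Qed.

Let Ex_tint_le D H c x K c2 : frozen D H c -> frozen D K c2 -> (forall s e, H x s e <= K x s e) ->
  \int[P]_e tint (H x) e <= \int[P]_e tint (K x) e.
Proof.
move=> h k hk; apply: le_Ex => [||e]; [exact: integ_tint h|exact: integ_tint k|].
apply: le_Ex => [||s]; last exact: hk.
  exact: integ_frozen h.
exact: integ_frozen k.
Qed.

Lemma jsum_formula D H c x : frozen D H c ->
  integ P (jsum (H x)) /\ \int[P]_e jsum (H x) e <= C * \int[P]_e tint (fun s e => `|H x s e|) e.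
Proof.
move=> h; have [inj e] := cs_formula CS (fz_pred h x) (fz_bound h x); split.
  apply: (@integ_le _ _ _ P _ (fun e => c * nj e)) ; [exact: (meas_jsum_pred CS (fz_pred h x))|exact: (integZ c inj)|move=> e'].
  by apply: jsum_le => s; exact: fz_bound h x s e'.
rewrite e -ExZ; last exact: integ_tint (frozen_abs h).
apply: le_Ex => [||e']; [exact: integ_tint (frozenM h (fb D))|exact/integZ/(integ_tint _ (frozen_abs h))|].
rewrite /tint -ExZ; last first.
  exact: integ_frozen (frozen_abs h).
apply: le_Ex => [||s].
- exact: integ_frozen (frozenM h (fb D)).
- by apply: integZ; exact: integ_frozen (frozen_abs h).
- apply: (le_trans (ler_norm _)); rewrite normrM mulrC ler_wpM2r//; exact: (cs_bound CS).
Qed.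

Context (D J : {set 'I_n}) (DJ : forall i, i \in J -> i \notin D).
Local Notation hist := (tup * sig Y (heldout D))%type.
Let r : seq (option nat) := [seq Some (val j) | j <- enum J].

Let ur : uniq r.
Proof. by rewrite map_inj_uniq ?enum_uniq// => i j [] /val_inj. Qed.

Let size_r : size r = #|J|. Proof. by rewrite size_map -cardE. Qed.

Let sum_r (f : option nat -> R) : \sum_(j <- r) f j = \sum_(j in J) f (Some (val j)).
Proof. by rewrite big_map big_enum. Qed.

Let heldJ j : j \in J -> heldout D (Some (val j)).
Proof. by move=> jJ; right; exists j => //; exact: DJ. Qed.

(** Given the training data, each held-out observation still has law P; the conditional bound [bd]
    is then integrated over the data. *)
Lemma fold_expectation (Phi : tup * E -> R) (Dm : E -> R) (bd : tup -> R) :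
  (forall x y e, (forall i, i \in D -> tnth x i = tnth y i) -> Phi (x, e) = Phi (y, e)) ->
  meas Phi -> (forall x e, `|Phi (x, e)| <= Dm e) -> integ P Dm ->
  (forall x, \int[P]_e Phi (x, e) <= bd x) -> integ Q (fun w => bd (data w)) ->
  integ Q (fun w => \sum_(j in J) Phi (data w, Yj j w)) /\
  \int[Q]_w (\sum_(j in J) Phi (data w, Yj j w)) <= #|J|%:R * \int[Q]_w bd (data w).
Proof.
move=> dep mPhi bPhi iD le_bd ibd.
have one j : j \in J -> [/\ integ Q (fun w => Phi (data w, Yj j w)),
    integ Q (fun w => \int[P]_e Phi (data w, e)) &
    \int[Q]_w Phi (data w, Yj j w) = \int[Q]_w \int[P]_e Phi (data w, e)].
  by move=> jJ; exact: (freeze_one mY indY lawY (heldJ jJ) dep mPhi bPhi iD).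
pose X j w := if j \in J then Phi (data w, Yj j w) else 0.
have iX j : integ Q (X j).
  rewrite /X; case: (boolP (j \in J)) => jJ; last exact: integ_cst.
  by case: (one j jJ).
have e w : \sum_(j in J) Phi (data w, Yj j w) = \sum_j X j w by rewrite big_mkcond.
rewrite (funext e); split; first exact: integ_sum.
rewrite Ex_sum//; apply: (@le_trans _ _ (\sum_(j in J) \int[Q]_w bd (data w))).
  rewrite [leRHS]big_mkcond/=; apply: ler_sum => j _; rewrite /X.
  case: (boolP (j \in J)) => jJ; last by rewrite Ex_cst.
  by have [_ i ->] := one j jJ; exact: le_Ex.
by rewrite sumr_const mulr_natl.
Qed.

Context (G : R -> E -> R) (c' : R) (Gh lh : tup -> R -> E -> R).
Hypotheses (pG : pred F G) (bG : forall s e, `|G s e| <= c').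
Hypotheses (fGh : frozen D Gh c') (flh : frozen D lh C).
Let c'0 : 0 <= c' := le_trans (normr_ge0 _) (bG 0 point).
Let fG : frozen D (fun _ => G) c'. Proof. exact: frozen_cst. Qed.

Let fdG := frozenB fGh fG.
Let fdl := frozenB (fb D) flh.

Let merr H K c1 c2 : frozen D H c1 -> frozen D K c2 -> meas (err2 H K).
Proof.
move=> h k; apply: (meas_Ex P (F := fun p : tup * E => tint (fun s e => (H p.1 s e - K p.1 s e) ^+ 2) p.2)).
exact: mtint (frozen_sqr (frozenB h k)).
Qed.

Let err_le H K c1 c2 x : frozen D H c1 -> frozen D K c2 -> `|err2 H K x| <= (c1 + c2) ^+ 2.
Proof.
move=> h k; apply: abs_Ex_le => [|e]; first exact: meas_tint (fz_pred (frozen_sqr (frozenB h k)) x).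
by apply: (tint_le fF (fz_pred (frozen_sqr (frozenB h k)) x)) => s; exact: fz_bound (frozen_sqr (frozenB h k)) x s e.
Qed.

Lemma integ_err H K c1 c2 : frozen D H c1 -> frozen D K c2 -> integ Q (fun w => err2 H K (data w)).
Proof.
move=> h k; apply: (integ_bnd Q (c := (c1 + c2) ^+ 2)) => [|w]; last exact: err_le.
exact: (mcomp (merr h k) (meas_sample_tuple (n := n) mY)).
Qed.

Let g2 := \int[Q]_w err2 Gh (fun _ => G) (data w).
Let h2 := \int[Q]_w err2 (fun _ => b) lh (data w).
Let ig2 := integ_err fGh fG.
Let ih2 := integ_err (fb D) flh.

Let product_error (w : T) := \sum_(j in J) tint (fun s e => `|(Gh (data w) s e - G s e) * (b s e - lh (data w) s e)|) (Yj j w).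

(** Cauchy-Schwarz in the form |y z| <= (a y^2 + z^2 / a) / 2. The weight a stays free here and is
    picked by [balanced_error]. *)
Lemma fold_product_error (a : R) : 0 < a -> integ Q product_error /\
  \int[Q]_w product_error w <= #|J|%:R * (2^-1 * (a * g2 + a^-1 * h2)).
Proof.
move=> a0; have fp := frozen_abs (frozenM fdG fdl).
pose bd x := 2^-1 * (a * err2 Gh (fun _ => G) x + a^-1 * err2 (fun _ => b) lh x).
have -> : 2^-1 * (a * g2 + a^-1 * h2) = \int[Q]_w bd (data w).
  by rewrite /bd (ExZ _ (integD (integZ _ ig2) (integZ _ ih2))) (ExD (integZ _ ig2) (integZ _ ih2)) (ExZ _ ig2) (ExZ _ ih2).
apply: (@fold_expectation (fun p => tint (fun s e => `|(Gh p.1 s e - G s e) * (b s e - lh p.1 s e)|) p.2) (fun=> (c' + c') * (C + C)) bd).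
- by move=> x y e xy /=; rewrite (fz_dep fGh xy) (fz_dep flh xy).
- exact: mtint fp.
- by move=> x e; apply: (tint_le fF (fz_pred fp x)) => s; exact: fz_bound fp x s e.
- exact: integ_cst.
- move=> x; pose K y s e := 2^-1 * (a * (Gh y s e - G s e) ^+ 2 + a^-1 * (b s e - lh y s e) ^+ 2).
  have fK := frozenZ 2^-1 (frozenD (frozenZ a (frozen_sqr fdG)) (frozenZ a^-1 (frozen_sqr fdl))).
  apply: (le_trans (@Ex_tint_le D _ _ x _ _ fp fK _)).
    move=> s e; rewrite normrM -(real_normK (num_real (Gh x s e - G s e))) -(real_normK (num_real (b s e - lh x s e))).
    move: `|Gh x s e - G s e| `|b s e - lh x s e| => y z.
    have ai : 0 < a^-1 by rewrite invr_gt0.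
    have e1 : a^-1 * a = 1 by rewrite mulVf// gt_eqF.
    have : 0 <= a^-1 * (a * y - z) ^+ 2 by rewrite mulr_ge0 ?sqr_ge0// ltW.
    have -> : a^-1 * (a * y - z) ^+ 2 = (a^-1 * a) * a * y ^+ 2 + a^-1 * z ^+ 2 - 2 * (a^-1 * a) * (y * z) by ring.
    by rewrite e1; lra.
  have i1 := integ_tint x (frozen_sqr fdG); have i2 := integ_tint x (frozen_sqr fdl).
  apply: eq_ler.
  rewrite /bd /err2 -(ExZ _ i1) -(ExZ _ i2) -(ExD (integZ _ i1) (integZ _ i2)) -(ExZ _ (integD (integZ _ i1) (integZ _ i2))).
  apply: eq_Ex => e.
  have l1 : integ leb01 (fun s => (Gh x s e - G s e) ^+ 2).
    exact: integ_frozen (frozen_sqr fdG).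
  have l2 : integ leb01 (fun s => (b s e - lh x s e) ^+ 2).
    exact: integ_frozen (frozen_sqr fdl).
  by rewrite /tint (ExZ _ (integD (integZ _ l1) (integZ _ l2))) (ExD (integZ _ l1) (integZ _ l2)) (ExZ _ l1) (ExZ _ l2).
- by apply: integZ; apply: integD; apply: integZ.
Qed.

Let variance_error (w : T) := \sum_(j in J) jsum (fun s e => `|Gh (data w) s e ^+ 2 - G s e ^+ 2|) (Yj j w).

(** |Gh^2 - G^2| <= 2 c' |Gh - G| and 2 |y| <= a + y^2 / a reduce the error to a squared one, after
    the compensator identity has replaced dN by at most C ds. *)
Lemma fold_variance_error (a : R) : 0 < a -> integ Q variance_error /\
  \int[Q]_w variance_error w <= #|J|%:R * (C * c' * (a + a^-1 * g2)).
Proof.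
move=> a0; have fp := frozen_abs (frozenB (frozen_sqr fGh) (frozen_sqr fG)).
pose bd x := C * c' * (a + a^-1 * err2 Gh (fun _ => G) x).
have -> : C * c' * (a + a^-1 * g2) = \int[Q]_w bd (data w).
  by rewrite /bd (ExZ _ (integD (integ_cst Q a) (integZ _ ig2))) (ExD (integ_cst Q a) (integZ _ ig2)) (ExZ _ ig2) Ex_cst.
apply: (@fold_expectation (fun p => jsum (fun s e => `|Gh p.1 s e ^+ 2 - G s e ^+ 2|) p.2) (fun e => (c' ^+ 2 + c' ^+ 2) * nj e) bd).
- by move=> x y e xy /=; rewrite (fz_dep fGh xy).
- exact: mjsum fp.
- by move=> x e; apply: jsum_le => s; exact: fz_bound fp x s e.
- exact/integZ/(integ_njump CS).
- move=> x; apply: (le_trans (jsum_formula x fp).2).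
  rewrite /bd -mulrA ler_wpM2l//.
  have i1 := integ_tint x (frozen_sqr fdG).
  apply: (@le_trans _ _ (\int[P]_e (c' * (a + a^-1 * tint (fun s e => (Gh x s e - G s e) ^+ 2) e)))); last first.
    by rewrite (ExZ _ (integD (integ_cst P a) (integZ _ i1))) (ExD (integ_cst P a) (integZ _ i1)) (ExZ _ i1) Ex_cst.
  apply: le_Ex => [||e]; [exact: integ_tint (frozen_abs fp)|by apply/integZ/integD; [exact: integ_cst|exact: integZ]|].
  have l2 : integ leb01 (fun s => (Gh x s e - G s e) ^+ 2).
    exact: integ_frozen (frozen_sqr fdG).
  have -> : c' * (a + a^-1 * tint (fun s e => (Gh x s e - G s e) ^+ 2) e) =
      \int[leb01]_s (c' * (a + a^-1 * (Gh x s e - G s e) ^+ 2)).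
    by rewrite (ExZ _ (integD (integ_cst _ a) (integZ _ l2))) (ExD (integ_cst _ a) (integZ _ l2)) (ExZ _ l2) Ex_cst.
  apply: le_Ex => [||s].
  - exact: integ_frozen (frozen_abs fp).
  - by apply/integZ/integD; [exact: integ_cst|exact: integZ].
  rewrite normr_id subr_sqr normrM.
  have h1 : `|Gh x s e + G s e| <= c' + c' by exact: norm_leD (fz_bound fGh x s e) (bG s e).
  rewrite -(real_normK (num_real (Gh x s e - G s e))); move: `|Gh x s e - G s e| (normr_ge0 (Gh x s e - G s e)) => y y0.
  have ai : 0 < a^-1 by rewrite invr_gt0.
  have e1 : a^-1 * a = 1 by rewrite mulVf// gt_eqF.
  have : 0 <= a^-1 * (y - a) ^+ 2 by rewrite mulr_ge0 ?sqr_ge0// ltW.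
  have -> : a^-1 * (y - a) ^+ 2 = a^-1 * y ^+ 2 + (a^-1 * a) * a - 2 * (a^-1 * a) * y by ring.
  rewrite e1 => q; apply: (@le_trans _ _ (c' * (2 * y))).
    by have := ler_wpM2l y0 h1; lra.
  by rewrite ler_wpM2l//; lra.
- by apply: integZ; apply: integD; [exact: integ_cst|exact: integZ].
Qed.

Let Dl x s e := b s e - lh x s e.

Hypothesis ort : forall x s, \int[P]_e (G s e * Dl x s e) = 0.

Let orthogonal_error (wt : R) (w : T) :=
  \int[leb01]_s ((\sum_(j in J) wt * (G s (Yj j w) * Dl (data w) s (Yj j w))) ^+ 2).

(** At each time s the held-out terms are, given the training data, i.i.d. and centred by [ort], so
    the square of their sum has no cross terms in expectation. The square is integrated over time
    because that controls all partial time integrals at once, see [leb01_sqr]. *)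
Lemma fold_orthogonal_error (wt : R) : integ Q (orthogonal_error wt) /\
  \int[Q]_w orthogonal_error wt w <= wt ^+ 2 * #|J|%:R * c' ^+ 2 * h2.
Proof.
have fGD : frozen D (fun x s e => wt * (G s e * Dl x s e)) (`|wt| * (c' * (C + C))) := frozenZ wt (frozenM fG fdl).
set M := `|wt| * _ in fGD.
pose Phi (p : tup * T) := \int[leb01]_s ((\sum_(j in J) wt * (G s (Yj j p.2) * Dl p.1 s (Yj j p.2))) ^+ 2).
pose S x w' s := \sum_(j in J) wt * (G s (Yj j w') * Dl x s (Yj j w')).
have bS x w' s : `|S x w' s| <= #|J|%:R * M.
  apply: (le_trans (ler_norm_sum _ _ _)); rewrite mulr_natl -sumr_const; apply: ler_sum => j _.
  exact: fz_bound fGD x s _.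
have bS2 x w' s : `|S x w' s ^+ 2| <= (#|J|%:R * M) ^+ 2.
  by rewrite normrX lerXn2r ?nnegrE// (le_trans _ (bS x w' s)).
have mS : meas ((fun q => S q.1.1 q.1.2 q.2 ^+ 2) : hist * R -> R).
  apply: mfunX; rewrite /S; under eq_fun do rewrite big_mkcond.
  apply: (@measurable_sum _ (hist * R)%type R setT) => j.
  case: (boolP (j \in J)) => jJ; last exact: mcst.
  apply: (mcomp (fz_meas fGD) (_ : meas ((fun q => (q.1.1, (q.2, Yj j q.1.2))) : hist * R -> tup * (R * E)))).
  apply: mpair; first exact: mcomp measurable_fst.
  apply: mpair; first exact: measurable_snd.
  have mYj := meas_heldout_obs (Y := Y) (heldJ jJ).
  exact: (mcomp mYj (mcomp measurable_snd measurable_fst)).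
have mSx x : meas (fun q : T * R => S x q.1 q.2 ^+ 2).
  apply: mfunX; rewrite /S; under eq_fun do rewrite big_mkcond.
  apply: measurable_sum => j; case: (boolP (j \in J)) => jJ; last exact: mcst.
  apply: (mcomp (fz_meas fGD) (_ : meas (fun q : T * R => (x, (q.2, Yj j q.1))))).
  apply: mpair; first exact: mcst.
  by apply: mpair; [exact: measurable_snd|exact: (mcomp (mY _) measurable_fst)].
have mPhi : meas (Phi : hist -> R).
  exact: (meas_Ex leb01 (F := (fun q => S q.1.1 q.1.2 q.2 ^+ 2) : hist * R -> R)).
have mS1 x w' : meas (fun s => S x w' s ^+ 2) by exact: (mcomp (mSx x) (measurable_pair1 w')).
have bPhi x w : `|Phi (x, w)| <= (#|J|%:R * M) ^+ 2 by rewrite /Phi; apply: abs_Ex_le => [|s]; [exact: (mS1 x w)|exact: (bS2 x w s)].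
have [|i1 i2 e12] := freeze mY indY _ mPhi bPhi (integ_cst Q _).
  by move=> x y w xy; rewrite /Phi /= /Dl (fz_dep flh xy).
split; first exact: i1.
rewrite [leLHS]e12 -(ExZ _ ih2); apply: le_Ex => // [|w]; first exact: integZ.
set x := data w.
have [j1 j2 ->] := fubini_bnd Q leb01 (mSx x) (bS2 x).
have mGs s : meas (fun e => wt * (G s e * Dl x s e)).
  exact: (mcomp (meas_pred fF (fz_pred fGD x)) (measurable_pair1 s)).
have mDs s : meas (fun e => Dl x s e ^+ 2).
  exact: (mcomp (meas_pred fF (fz_pred (frozen_sqr fdl) x)) (measurable_pair1 s)).
have bDs s e : `|Dl x s e ^+ 2| <= (C + C) ^+ 2 := fz_bound (frozen_sqr fdl) x s e.
have mDj : meas (fun p : E * R => Dl x p.2 p.1 ^+ 2).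
  exact: mcomp (meas_pred fF (fz_pred (frozen_sqr fdl) x)) (@measurable_swap _ _ E R).
have [k1 k2 ke] := fubini_bnd P leb01 mDj (fun e s => bDs s e).
have -> : wt ^+ 2 * #|J|%:R * c' ^+ 2 * err2 (fun _ => b) lh x =
    \int[leb01]_s (wt ^+ 2 * #|J|%:R * c' ^+ 2 * \int[P]_e (Dl x s e ^+ 2)).
  by rewrite (ExZ _ k2); congr (_ * _); exact: ke.
apply: le_Ex => [||s]; [exact: j2|exact: integZ|] => /=.
have iP (p : nat) : integ P (fun e => (wt * (G s e * Dl x s e)) ^+ p).
  apply: (integ_bnd P (c := M ^+ p)) => [|e]; first exact: mfunX.
  by rewrite normrX lerXn2r ?nnegrE ?fz_bound//; [exact: le_trans (normr_ge0 _) (fz_bound fGD x s e)|exact: fz_bound fGD x s e].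
have E0 : \int[P]_e (wt * (G s e * Dl x s e)) = 0.
  rewrite ExZ ?ort ?mulr0//; apply: (integ_bnd P (c := c' * (C + C))) => [|e]; last exact: fz_bound (frozenM fG fdl) x s e.
  exact: (mcomp (meas_pred fF (fz_pred (frozenM fG fdl) x)) (measurable_pair1 s)).
have [_ e2 _ _] := iid_moments mY indY lawY ur (mGs s) (iP 4) E0.
rewrite (_ : \int[Q]_w' (S x w' s ^+ 2) = \int[Q]_w' ((\sum_(j <- r) wt * (G s (Y j w') * Dl x s (Y j w'))) ^+ 2)); last first.
  by apply: eq_Ex => w'; rewrite /S sum_r.
rewrite e2 size_r -(ExZ _ (iP 2)) -(ExZ _ (integ_bnd P (mDs s) (bDs s))).
apply: le_Ex => [||e]; [exact/integZ/iP|exact/integZ/(integ_bnd P (mDs s) (bDs s))|].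
have : G s e ^+ 2 <= c' ^+ 2 by rewrite -(real_normK (num_real _)) lerXn2r ?nnegrE.
have w0 := sqr_ge0 wt; have d0 := sqr_ge0 (Dl x s e).
have q0 : 0 <= wt ^+ 2 * #|J|%:R * (Dl x s e) ^+ 2 by apply: mulr_ge0 d0; exact: mulr_ge0.
by move=> /(ler_wpM2l q0); congr (_ <= _); ring.
Qed.

Lemma mint_fourth H (c : R) : pred F H -> (bdd H c) ->
  integ P (fun e => mint H e ^+ 4) /\
  \int[P]_e (mint H e ^+ 4) <= (c * (1 + C)) ^+ 4 * moment_bound C 4.
Proof.
move=> pH Hc; have c0 : 0 <= c := le_trans (normr_ge0 _) (Hc 0 point).
have [i4 m4] := njump_moment CS 4.
have le4 e : `|mint H e ^+ 4| <= (c * (1 + C)) ^+ 4 * (nj e + 1) ^+ 4.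
  rewrite normrX -exprMn lerXn2r ?nnegrE ?mulr_ge0 ?addr_ge0//.
  apply: (le_trans (mint_le CS pH (Hc ^~ e))); rewrite -mulrA ler_wpM2l//.
  by have := mulr_ge0 C0 (ler0n R (njump (N e))); lra.
have i : integ P (fun e => mint H e ^+ 4).
  apply: (@integ_le _ _ _ P _ (fun e => (c * (1 + C)) ^+ 4 * (nj e + 1) ^+ 4)) => //; last exact: integZ.
  by have mm := meas_mint CS pH; exact: mfunX.
split => //; apply: (@le_trans _ _ (\int[P]_e ((c * (1 + C)) ^+ 4 * (nj e + 1) ^+ 4))).
  by apply: le_Ex => // [|e]; [exact: integZ|exact: le_trans (ler_norm _) (le4 e)].
by rewrite (ExZ _ i4) ler_wpM2l// exprn_ge0// mulr_ge0// addr_ge0.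
Qed.

(** Doob's inequality given the training data. The integrand is wt (Gh - G) + (wt - sn) G: the first
    part is the estimation error, the second the gap between the weight of an observation in its
    fold and its weight in the full sample. *)
Lemma fold_martingale_error (wt sn eta : R) : 0 < eta ->
  let A := [set w | exists2 t, 0 <= t <= 1 &
    eta < `|\sum_(j in J) mart (fun s e => wt * Gh (data w) s e - sn * G s e) t (Yj j w)|] in
  measurable A /\
  eta ^+ 2 * fine (Q A) <= #|J|%:R * C * (2 * wt ^+ 2 * g2 + 2 * (wt - sn) ^+ 2 * c' ^+ 2).
Proof.
move=> e0 A.
have fH := frozenB (frozenZ wt fGh) (frozenZ sn fG); set cH := `|wt| * c' + _ in fH.
pose H x s e := wt * Gh x s e - sn * G s e.
pose X (t : R) (p : tup * T) := \sum_(j in J) mart (H p.1) t (Yj j p.2).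
have XE : X = fun t p => \sum_(j <- r) mart (H p.1) t (Y j p.2) by apply/funext => t; apply/funext => p; rewrite sum_r.
pose AA := [set p | exists2 t, 0 <= t <= 1 & eta < `|X t p|].
have rcX p t : 0 <= t < 1 -> X s p @[s --> t^'+] --> X t p.
  rewrite XE => _; apply/cvg_at_rightP => u pu; apply: cvg_bigsum => j.
  by have /cvg_at_rightP := mart_rc CS (e := Y j p.2) (t := t) (fz_pred fH p.1) (fz_bound fH p.1); apply.
have mAA : measurable (AA : set hist).
  apply: (meas_dyadic_sup (T := hist) (X := X)) => // t _.
  rewrite /X; under eq_fun do rewrite big_mkcond.
  apply: (@measurable_sum _ hist R setT) => j.
  case: (boolP (j \in J)) => jJ; last exact: mcst.
  apply: (mcomp (mmart t fH) (_ : meas ((fun q => (q.1, Yj j q.2)) : hist -> tup * E))).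
  apply: mpair; first exact: measurable_fst.
  have mYj := meas_heldout_obs (Y := Y) (heldJ jJ).
  exact: (mcomp mYj measurable_snd).
have mPhi : meas (\1_AA : hist -> R) by exact: measurable_indic.
have b1 x w : `|\1_AA (x, w)| <= 1 :> R by rewrite indicE; case: (_ \in _); rewrite ?normr1 ?normr0.
have [|i1 i2 e12] := freeze mY indY _ mPhi b1 (integ_cst Q _).
  move=> x y w xy; rewrite !indicE; congr (nat_of_bool _)%:R; apply/idP/idP => /set_mem[t t01 h]; apply/mem_set; exists t => //;
    by move: h; rewrite /X /H /= (fz_dep fGh xy).
(* The set is recovered as the place where its indicator, already known to be measurable, equals
   1. *)
have mA : measurable A.
  have := integ_meas i1 measurableT (measurable_set1 (1 : R)); rewrite setTI.
  congr measurable; apply/seteqP; split => w; rewrite /= indicE.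
    by case: (boolP (_ \in AA)) => [/set_mem[t t01 h] _|_ /esym/eqP]; [exists t|rewrite oner_eq0].
  by move=> [t t01 h]; rewrite mem_set//; exists t.
split => //; rewrite -Ex_indic//.
have -> : \int[Q]_w (\1_A w) = \int[Q]_w (\1_AA (data w, w)).
  by apply: eq_Ex => w; rewrite !indicE; congr (nat_of_bool _)%:R; apply/idP/idP => /set_mem[t t01 h]; apply/mem_set; exists t.
rewrite e12 -(ExZ _ i2).
have ibd : integ Q (fun w => #|J|%:R * C * (2 * wt ^+ 2 * err2 Gh (fun _ => G) (data w) + 2 * (wt - sn) ^+ 2 * c' ^+ 2)).
  by apply/integZ/integD; [exact: integZ|exact: integ_cst].
have -> : #|J|%:R * C * (2 * wt ^+ 2 * g2 + 2 * (wt - sn) ^+ 2 * c' ^+ 2) =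
    \int[Q]_w (#|J|%:R * C * (2 * wt ^+ 2 * err2 Gh (fun _ => G) (data w) + 2 * (wt - sn) ^+ 2 * c' ^+ 2)).
  by rewrite (ExZ _ (integD (integZ _ ig2) (integ_cst Q _))) (ExD (integZ _ ig2) (integ_cst Q _)) (ExZ _ ig2) Ex_cst.
apply: le_Ex => // [|w]; first exact: integZ.
set x := data w; have pH := fz_pred fH x; have bH := fz_bound fH x.
have [i4 _] := mint_fourth pH bH; have [im em] := mint_isometry CS pH bH.
have E0 : \int[P]_e mint (H x) e = 0.
  exact: (expectation_mint CS pH bH (integ_cst P cH) (integZ cH (integ_njump CS))).2.
have [j2 e2 _ _] := iid_moments mY indY lawY ur (meas_mint CS pH) i4 E0.
have [mAx le] := fold_doob (r := r) mY indY lawY CS pH bH e0 (or_introl (erefl 2)) j2.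
have -> : \int[Q]_w' (\1_AA (x, w')) = fine (Q [set w' | exists2 t, 0 <= t <= 1 & eta < `|fold_sum Y N b r (H x) t w'|]).
  rewrite -Ex_indic//; apply: eq_Ex => w'; rewrite !indicE; congr (nat_of_bool _)%:R.
  by apply/idP/idP => /set_mem[t t01 h]; apply/mem_set; exists t => //; move: h; rewrite /fold_sum /X sum_r.
apply: (le_trans le); rewrite e2 size_r em -mulrA ler_wpM2l//.
have fH2 := frozen_sqr fH.
apply: (le_trans (jsum_formula x fH2).2); rewrite ler_wpM2l//.
have i1' := integ_tint x (frozen_sqr fdG).
apply: (@le_trans _ _ (\int[P]_e (2 * wt ^+ 2 * tint (fun s e => (Gh x s e - G s e) ^+ 2) e + 2 * (wt - sn) ^+ 2 * c' ^+ 2))); last first.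
  by rewrite (ExD (integZ _ i1') (integ_cst P _)) (ExZ _ i1') Ex_cst.
apply: le_Ex => [||e]; [exact: integ_tint (frozen_abs fH2)|by apply: integD; [exact: integZ|exact: integ_cst]|].
have l2 : integ leb01 (fun s => (Gh x s e - G s e) ^+ 2).
  exact: integ_frozen (frozen_sqr fdG).
have -> : 2 * wt ^+ 2 * tint (fun s e => (Gh x s e - G s e) ^+ 2) e + 2 * (wt - sn) ^+ 2 * c' ^+ 2 =
    \int[leb01]_s (2 * wt ^+ 2 * (Gh x s e - G s e) ^+ 2 + 2 * (wt - sn) ^+ 2 * c' ^+ 2).
  by rewrite (ExD (integZ _ l2) (integ_cst _ _)) (ExZ _ l2) Ex_cst.
apply: le_Ex => [||s].
- exact: integ_frozen (frozen_abs fH2).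
- by apply: integD; [exact: integZ|exact: integ_cst].
rewrite ger0_norm ?sqr_ge0//.
have Gc : G s e ^+ 2 <= c' ^+ 2 by rewrite -(real_normK (num_real _)) lerXn2r ?nnegrE.
have := ler_wpM2l (sqr_ge0 (wt - sn)) Gc; have := sqr_ge0 (wt * (Gh x s e - G s e) - (wt - sn) * G s e).
by lra.
Qed.

Lemma fold_variance_lln (eta : R) : 0 < eta ->
  let V := \int[P]_e jsum (fun s e => G s e ^+ 2) e in
  let A := [set w | eta < `|\sum_(j in J) (jsum (fun s e => G s e ^+ 2) (Yj j w) - V)|] in
  measurable A /\ eta ^+ 2 * fine (Q A) <= #|J|%:R * (c' ^+ 4 * moment_bound C 2).
Proof.
move=> e0 V A; pose x0 : tup := [tuple point | _ < n].
have f2 := frozen_sqr fG; have [iV _] := jsum_formula x0 f2.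
pose g e := jsum (fun s e => G s e ^+ 2) e - V.
have mj : meas (jsum (fun s e => G s e ^+ 2)) := integ_meas iV.
have mg : meas g by apply: mfunB => //; exact: mcst.
have jle e : `|jsum (fun s e => G s e ^+ 2) e| <= c' ^+ 2 * nj e by apply: jsum_le => s; exact: fz_bound f2 x0 s e.
have [i4n _] := njump_moment CS 4; have [i2n m2n] := njump_moment CS 2.
have c2 := sqr_ge0 c'.
have V0 : `|V| <= c' ^+ 2 * (\int[P]_e nj e).
  rewrite -(ExZ _ (integ_njump CS)); apply: (le_trans (abs_Ex iV)).
  by apply: le_Ex => //; [exact: integ_abs|exact/integZ/(integ_njump CS)].
have i4 : integ P (fun e => g e ^+ 4).
  set c := c' ^+ 2 + `|V|.
  have c0 : 0 <= c by rewrite addr_ge0.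
  apply: (@integ_le _ _ _ P _ (fun e => c ^+ 4 * (nj e + 1) ^+ 4)); [exact: mfunX|exact: integZ|move=> e].
  rewrite normrX -exprMn lerXn2r ?nnegrE ?mulr_ge0 ?addr_ge0//.
  apply: (le_trans (ler_normB _ _)); apply: (le_trans (lerD (jle e) (lexx _))).
  have := mulr_ge0 (normr_ge0 V) (ler0n R (njump (N e))); rewrite /c; lra.
have ip (p : nat) : (p <= 4)%N -> integ P (fun e => jsum (fun s e => G s e ^+ 2) e ^+ p).
  move=> p4; have [ipn _] := njump_moment CS p.
  apply: (@integ_le _ _ _ P _ (fun e => (c' ^+ 2) ^+ p * (nj e + 1) ^+ p)); [exact: mfunX|exact: integZ|move=> e].
  rewrite normrX -exprMn lerXn2r ?nnegrE ?mulr_ge0 ?addr_ge0//.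
  by apply: (le_trans (jle e)); rewrite ler_wpM2l// lerDl.
have E0 : \int[P]_e g e = 0 by rewrite (ExB iV (integ_cst P V)) Ex_cst subrr.
have [j2 e2 _ _] := iid_moments mY indY lawY ur mg i4 E0.
have sE w : \sum_(j <- r) g (Y j w) = \sum_(j in J) g (Yj j w) by rewrite sum_r.
have mS : meas (fun w => \sum_(j in J) g (Yj j w)).
  rewrite (_ : (fun w => _) = fun w => \sum_(j <- r) g (Y j w)); last by apply/funext => w; rewrite sE.
  by apply: measurable_sum => j; exact: (mcomp mg).
have mA : measurable A.
  have := mfun_ltr (mcst eta) (mcomp (@normr_measurable R setT) mS) measurableT (_ : measurable [set true]).
  by rewrite setTI; apply.
split => //.
apply: (le_trans (Ex_markov (X := fun w => (\sum_(j <- r) g (Y j w)) ^+ 2) j2 mA _ _)).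
- by move=> w; exact: sqr_ge0.
- move=> w; rewrite /A /= sE => h; rewrite -(real_normK (num_real (\sum_(j in J) _))).
  by rewrite lerXn2r ?nnegrE ?(ltW e0)// ltW.
rewrite e2 size_r ler_wpM2l//.
have -> : \int[P]_e (g e ^+ 2) = \int[P]_e (jsum (fun s e => G s e ^+ 2) e ^+ 2) - V ^+ 2.
  transitivity (\int[P]_e ((jsum (fun s e => G s e ^+ 2) e ^+ 2 - 2 * V * jsum (fun s e => G s e ^+ 2) e) + V ^+ 2)).
    by apply: eq_Ex => e; rewrite /g; ring.
  rewrite (ExD (integB (ip 2 isT) (integZ _ iV)) (integ_cst P _)) (ExB (ip 2 isT) (integZ _ iV)) (ExZ _ iV) Ex_cst -/V.
  by ring.
have : \int[P]_e (jsum (fun s e => G s e ^+ 2) e ^+ 2) <= \int[P]_e (c' ^+ 4 * (nj e + 1) ^+ 2).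
  apply: le_Ex => [||e]; [exact: ip|exact: integZ|].
  rewrite (exprM c' 2 2) -exprMn -(real_normK (num_real (jsum _ e))) lerXn2r ?nnegrE ?mulr_ge0 ?addr_ge0//.
  by apply: (le_trans (jle e)); rewrite ler_wpM2l// lerDl.
rewrite (ExZ _ i2n) => h; have := ler_wpM2l (exprn_ge0 4 c'0) m2n; have := sqr_ge0 V; lra.
Qed.

End fold.

(** * Truncation, enlargement of the filtration and orthogonality *)

Section truncation.
Context {R : realType}.
Implicit Types c x y : R.

Definition trunc c x := Num.max (- c) (Num.min c x).

Lemma trunc_le c x : 0 <= c -> `|trunc c x| <= c.
Proof.
move=> c0; rewrite /trunc /Num.max /Num.min ler_norml; case: (ltP c x) => cx; case: ltP => h; apply/andP; split; lra.
Qed.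

Lemma trunc_id c x : `|x| <= c -> trunc c x = x.
Proof.
rewrite ler_norml => /andP[h1 h2]; rewrite /trunc min_r// max_r//.
Qed.

Lemma trunc_lip c x y : 0 <= c -> `|trunc c x - trunc c y| <= `|x - y|.
Proof.
move=> c0; rewrite /trunc /Num.max /Num.min; have := ler_norm (x - y); have := ler_norm (- (x - y)); rewrite normrN => h1 h2.
by case: (ltP c x) => cx; case: (ltP c y) => cy; repeat (case: (ltP (- c)) => ?);
  rewrite ler_norml; apply/andP; split; lra.
Qed.

(** Truncation is the projection onto [-c, c]: no other point of the interval is closer to x. *)
Lemma trunc_nearest c x y : `|y| <= c -> (x - trunc c x) ^+ 2 <= (x - y) ^+ 2.
Proof.
rewrite ler_norml => /andP[h1 h2]; rewrite /trunc /Num.max /Num.min.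
case: (ltP c x) => cx; case: ltP => h; rewrite -subr_ge0.
- have -> : (x - y) ^+ 2 - (x - c) ^+ 2 = (c - y) * ((x - y) + (x - c)) by ring.
  by rewrite mulr_ge0; lra.
- suff -> : y = - c by rewrite subrr.
  lra.
- by rewrite subrr expr0n subr0 sqr_ge0.
- have -> : (x - y) ^+ 2 - (x - - c) ^+ 2 = (y + c) * (- (x - y) - (x + c)) by ring.
  by rewrite mulr_ge0; lra.
Qed.

Lemma meas_trunc c : meas (trunc c).
Proof. by apply: measurable_maxr => //; exact: measurable_minr. Qed.

Context {d} {E : measurableType d}.
Implicit Types (F : R -> set_system E) (H : R -> E -> R).

Definition mask H s e := (0 <= s <= 1)%R%:R * H s e.
(** The mask is included because [pred] asks for the value 0 outside [0, 1]. *)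
Definition clip c H := mask (fun s e => trunc c (H s e)).

Lemma clip_le c H s e : 0 <= c -> `|clip c H s e| <= c.
Proof. by move=> c0; apply: maskM_le; exact: trunc_le. Qed.

Lemma clip_id c H s e : 0 <= s <= 1 -> `|H s e| <= c -> clip c H s e = H s e.
Proof. by move=> s01 Hc; rewrite /clip /mask s01 mul1r trunc_id. Qed.

Lemma clip_lip c H K s e : 0 <= c -> (clip c H s e - clip c K s e) ^+ 2 <= (mask H s e - mask K s e) ^+ 2.
Proof.
move=> c0; rewrite /clip /mask; case: (0 <= s <= 1); rewrite ?mul1r ?mul0r//.
by rewrite -(real_normK (num_real (trunc _ _ - _))) -(real_normK (num_real (H _ _ - _))) lerXn2r ?nnegrE// trunc_lip.
Qed.

Lemma predictable_sub F F' H : (forall t, 0 <= t <= 1 -> F t `<=` F' t) ->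
  predictable F H -> predictable F' H.
Proof.
move=> FF' pH D B mB; have := pH B mB; apply: smallest_sub; first exact: smallest_sigma_algebra.
move=> A [[A0 FA ->]|[s [t [A0 [s0 st t1 FA ->]]]]]; apply: sub_sigma_algebra.
  by left; exists A0 => //; apply: FF' FA; rewrite lexx ler01.
by right; exists s, t, A0; split => //; apply: FF' FA; rewrite s0/=; lra.
Qed.

Lemma pred_clip F c H : filtration F -> 0 <= c -> predictable F H -> pred F (clip c H).
Proof.
move=> fF c0 pH; apply: pred_mask => //.
by apply: (predictable_comp (f := trunc c)) => //; exact: meas_trunc.
Qed.

End truncation.

Section enlarged_filtration.
Context {R : realType} {d} {E : measurableType d} (F : R -> set_system E) (W : R -> E -> R).
Hypotheses (fF : filtration F) (mW : forall t, 0 <= t <= 1 -> meas (W t)).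

Lemma sub_enlargement t : 0 <= t <= 1 -> F t `<=` enlargement F W t.
Proof.
move=> /andP[t0 t1] A FA s ts; apply: sub_sigma_algebra; left.
have [_ _ mono] := fF; case: ts => [->|/andP[ts s1]]; first exact: mono FA.
by apply: mono FA => //; exact: ltW.
Qed.

Lemma enlargement_filtration : filtration (enlargement F W).
Proof.
split.
- move=> t t01; split.
  + by move=> s ts; have [h _ _] := smallest_sigma_algebra setT (F s `|` [set A | exists u (B : set R), [/\ 0 <= u <= s, measurable B & A = W u @^-1` B]]).
  + by move=> A hA s ts; have [_ h _] := smallest_sigma_algebra setT (F s `|` [set A | exists u (B : set R), [/\ 0 <= u <= s, measurable B & A = W u @^-1` B]]); apply: h; exact: hA.
  + by move=> A hA s ts; have [_ _ h] := smallest_sigma_algebra setT (F s `|` [set A | exists u (B : set R), [/\ 0 <= u <= s, measurable B & A = W u @^-1` B]]); apply: h => i; exact: hA.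
- move=> t t01 A /(_ 1 (or_introl erefl)); apply: smallest_sub; first exact: sigma_algebra_measurable.
  have h1 : 0 <= (1 : R) <= 1 by rewrite ler01 lexx.
  move=> B [|[u [C [u01 mC ->]]]]; first by have [_ h _] := fF; exact: h.
  by rewrite -[_ @^-1` _]setTI; exact: (mW u01 measurableT).
- move=> s t s0 st t1 A hA u [->|/andP[tu u1]]; apply: hA; first by left.
  by right; rewrite (le_lt_trans st tu) u1.
Qed.

End enlarged_filtration.

Section orthogonality.
Context {R : realType} {d} {E : measurableType d} (P : probability E R).

(** The definition tests the conditional expectation on sets only; the functional monotone class
    theorem extends the test to bounded factors measurable for S. *)
Lemma cond_exp_orthogonal (S : set_system E) (Z D : E -> R) (c : R) : sigma_algebra setT S ->
  S `<=` measurable -> is_cond_exp P S Z (cst 0) -> measurable_wrt S D -> (forall e, `|D e| <= c) ->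
  \int[P]_e (D e * Z e) = 0.
Proof.
move=> sS Sm [iZ _ _ EZ] mD bD.
pose L (f : E -> R) := meas (f : sigmaT S -> R) /\ (exists k : R, forall e, `|f e| <= k) /\ \int[P]_e (f e * Z e) = 0.
have SE : (measurable : set_system (sigmaT S)) = S by rewrite /measurable/= sigma_algebra_id.
have mS (f : E -> R) : meas (f : sigmaT S -> R) -> meas f.
  by move=> mf _ B mB; apply: Sm; rewrite -SE; exact: (mf measurableT B mB).
have iL f k : meas (f : sigmaT S -> R) -> (forall e, `|f e| <= k) -> integ P (fun e => f e * Z e).
  by move=> mf bf; exact: (@integMb _ _ _ P f Z k (mS _ mf) bf iZ).
suff [_ []] : L D by [].
apply: (@bounded_measurable_ind _ (sigmaT S) R L _ _ _ _ _ c) => //.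
- move=> A mA; split; first exact: measurable_indic.
  split; first by exists 1 => e; rewrite indicE; case: (_ \in _); rewrite ?normr1 ?normr0.
  have SA : S A by rewrite -SE.
  have := EZ _ SA; rewrite integral0 => e0.
  transitivity (fine (\int[P]_(e in A) (Z e)%:E)%E); last by rewrite -e0.
  rewrite integral_mkcond; congr fine; apply: eq_integral => e _.
  by rewrite patchE indicE; case: (e \in A); rewrite ?mul1r ?mul0r.
- move=> f g [mf [[k bf] ef]] [mg [[k' bg] eg]]; split; first exact: mfunD.
  split; first by exists (k + k') => e; exact: norm_leD.
  under eq_Ex do rewrite mulrDl; rewrite (ExD (iL _ _ mf bf) (iL _ _ mg bg)) ef eg addr0//.
- move=> a f [mf [[k bf] ef]]; split; first exact: mfunM.
  split; first by exists (`|a| * k) => e; exact: norm_leM.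
  by under eq_Ex do rewrite -mulrA; rewrite (ExZ _ (iL _ _ mf bf)) ef mulr0.
- move=> f_ f k mf bf cf Lf.
  have mfl : meas (f : sigmaT S -> R) by apply: (measurable_fun_cvg mf) => e _; exact: cf.
  split => //; split.
    exists k => e; have cv : `|f_ n e| @[n --> \oo] --> `|f e| by apply: cvg_norm; exact: cf.
    apply: (cvg_ler cv) => n; exact: bf.
  have cv : \int[P]_e (f_ n e * Z e) @[n --> \oo] --> \int[P]_e (f e * Z e).
    apply: (Ex_cvg (Y := fun e => k * `|Z e|)) => [n||n e|e].
    + exact: integ_meas (iL _ _ (mf n) (bf n)).
    + exact/integZ/integ_abs.
    + by rewrite normrM ler_wpM2r.
    + by apply: cvgMl; exact: cf.
  rewrite -(cvg_lim _ cv)//; apply: cvg_lim => //; apply: cvg_near_cst; apply: nearW => n.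
  by have [_ []] := Lf n.
- exact/meas_wrtP.
Qed.

End orthogonality.

Section path_integrals.
Context {R : realType}.

Lemma Rintegral_upto (f : R -> R) (t : R) : 0 <= t <= 1 -> measurable_fun (I01 R) f ->
  \int[lebesgue_measure]_(s in `[0, t]) f s =
  \int[@leb01 R]_s ((s <= t)%R%:R * ((0 <= s <= 1)%R%:R * f s)).
Proof.
move=> /andP[t0 t1] mf.
have mg : meas (fun s : R => (s <= t)%R%:R * ((0 <= s <= 1)%R%:R * f s)).
  apply: mfunM; first by apply: mb2r; apply: mfun_ler => //; exact: mcst.
  have : meas (f \_ `[0, 1]%classic) by apply/(measurable_restrictT f (measurable_itv _)).
  congr measurable_fun; apply/funext => s; rewrite patchE mem_setE in_itv/=.
  by case: (0 <= s <= 1); rewrite ?mul1r ?mul0r.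
rewrite -Rintegral_leb01// /Rintegral; congr fine.
rewrite integral_mkcond [RHS]integral_mkcond; apply: eq_integral => s _.
rewrite !patchE !mem_setE !in_itv/=; case: (leP 0 s) => s0 //=; case: (leP s t) => st.
  by rewrite (le_trans st t1) !mul1r.
by case: ifP; rewrite ?mul0r.
Qed.

End path_integrals.

Lemma ge0_integral_eq0_ae {d} {T : measurableType d} {R : realType}
    (mu : {measure set T -> \bar R}) (f : T -> \bar R) : meas f -> (forall x, (0 <= f x)%E) ->
  (\int[mu]_x f x = 0)%E -> {ae mu, forall x, f x = 0%E}.
Proof.
move=> mf f0 If; have [h _] := @ae_eq_integral_abs _ _ _ mu setT measurableT f mf.
have : ae_eq mu setT f (cst 0%E).
  by apply: h; under eq_integral do rewrite gee0_abs//.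
by apply: filterS => x; exact.
Qed.

Lemma mask_section {R : realType} {d} {E : measurableType d} (W : R -> E -> R) e : meas (fun s => mask W s e) ->
  measurable_fun (I01 R) (fun s => W s e).
Proof.
move=> /(@measurable_funTS _ _ _ _ (I01 R)); apply: eq_measurable_fun => s.
by rewrite inE/= in_itv/= /mask => ->; rewrite mul1r.
Qed.

(** * From the model to truncated processes *)

Section model.
Context {R : realType} (m : lct_model R).
Hypothesis hm : lct_setting m.
Notation P := (obs_law m).
Notation Q := (data_law m).
Notation Y := (sample m).
Notation N := (Nproc m).
Notation F := (big_fil m).
Notation E := (obs_space m).
Let mY := sample_measurable m hm.
Let indY := sample_independent m hm.
Let lawY i A := @sample_law _ _ hm i A.

Lemma big_filtration : filtration F.
Proof. exact: enlargement_filtration (fil_filtration m hm) (X_measurable m hm). Qed.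

Lemma predictable_big H : predictable (fil m) H -> predictable F H.
Proof. by apply: predictable_sub => t; exact: (sub_enlargement (W := Xproc m) (fil_filtration m hm)). Qed.

Let bF := big_filtration.

Lemma predictable_lambda : predictable (fil m) (lambda m).
Proof. by have [] := lambdaP m hm. Qed.

Lemma predictable_residual : predictable F (Gres m).
Proof.
have [cG aG _] := GresP m hm.
by apply: (predictable_left_continuous bF aG) => e t t01; have [h _] := cG e; exact: h.
Qed.

Lemma meas_mask H : predictable F H -> meas (fun p : R * E => mask H p.1 p.2).
Proof. by move=> pH; apply: (meas_pred bF); exact: pred_mask. Qed.

Section estimator.
Context {n : nat} (D : {set 'I_n}) (F' : R -> set_system E).
Hypothesis F'F : forall H, predictable F' H -> predictable F H.
Notation tup := (n.-tuple E).
Context (H : estimator m n).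
Hypothesis fH : fitted_estimator D F' H.

Lemma meas_fitted : meas (fun p : tup * (R * E) => mask (H p.1) p.2.1 p.2.2).
Proof.
case: fH => _ mH _.
have mD : measurable [set p : tup * (R * E) | 0 <= p.2.1 <= 1].
  have -> : [set p : tup * (R * E) | 0 <= p.2.1 <= 1] = (fun p : tup * (R * E) => p.2.1) @^-1` (I01 R).
    by apply/seteqP; split => p /=; rewrite in_itv.
  rewrite -[_ @^-1` _]setTI; apply: (mcomp measurable_fst measurable_snd) => //.
have := (measurable_restrictT (fun p : tup * (R * E) => H p.1 p.2.1 p.2.2) mD).1 mH; congr measurable_fun.
apply/funext => p; rewrite patchE /mask; case: (boolP (0 <= p.2.1 <= 1)) => h.
  by rewrite mem_set// mul1r.
by rewrite memNset ?mul0r//; exact/negP.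
Qed.

Lemma frozen_comp (phi : R -> R) (c : R) : meas phi -> (forall x, `|phi x| <= c) ->
  frozen F D (fun x => mask (fun s e => phi (H x s e))) c.
Proof.
move=> mphi bphi; have [dH _ pH] := fH; split.
- by move=> x y /dH ->.
- have h : meas (fun p : tup * (R * E) => (0 <= p.2.1 <= 1)%R%:R * phi (mask (H p.1) p.2.1 p.2.2)).
    apply: mfunM; last exact: (mcomp mphi meas_fitted).
    apply: mb2r; apply: measurable_and; apply: mfun_ler => //;
      exact: (mcomp measurable_fst measurable_snd).
  move: h; congr measurable_fun; apply/funext => p; rewrite /mask.
  by case: (0 <= p.2.1 <= 1); rewrite ?mul1r ?mul0r.
- move=> x; have h := predictable_comp mphi (F'F (pH x)).
  exact: (pred_mask bF h).
- by move=> x s e; exact: maskM_le.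
Qed.

Lemma frozen_clip (c : R) : 0 <= c -> frozen F D (fun x => clip c (H x)) c.
Proof. by move=> c0; apply: frozen_comp; [exact: meas_trunc | move=> x; exact: trunc_le]. Qed.

Section error.
Variable W : R -> E -> R.
Hypothesis pW : predictable F W.

Let gap (p : (tup * E) * R) := (mask W p.2 p.1.2 - mask (H p.1.1) p.2 p.1.2) ^+ 2.

Let mgap : meas gap.
Proof.
apply: mfunX; apply: mfunB.
  apply: (mcomp (meas_mask pW) (_ : meas (fun p : (tup * E) * R => (p.2, p.1.2)))).
  by apply: mpair => //; exact: (mcomp measurable_snd measurable_fst).
apply: (mcomp meas_fitted (_ : meas (fun p : (tup * E) * R => (p.1.1, (p.2, p.1.2))))).
apply: mpair; first exact: (mcomp measurable_fst measurable_fst).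
by apply: mpair => //; exact: (mcomp measurable_snd measurable_fst).
Qed.

(** Kept extended-valued, since the unclipped error need not be integrable at every point. *)
Let gap2 (p : tup * E) := (\int[@leb01 R]_s (gap (p, s))%:E)%E.

Let mgap2 : meas gap2.
Proof.
have := @measurable_fun_fubini_tonelli_F _ _ (tup * E)%type (measurableTypeR R) R leb01 (fun q => (gap q)%:E).
apply.
- by apply/mEFinP; exact: mgap.
- by move=> q; rewrite lee_fin sqr_ge0.
Qed.

Lemma meas_gap : meas (fun w : data_space m => gap2 (data w, Y None w)).
Proof. by apply: (mcomp mgap2); apply: mpair => //; exact: (meas_sample_tuple mY). Qed.

Lemma L2_error_le (eps : R) : 0 <= eps -> (L2_error W H <= eps%:E)%E ->
  (\int[Q]_w gap2 (data w, Y None w) <= (eps ^+ 2)%:E)%E.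
Proof.
move=> e0 he.
rewrite -lee_sqrt ?lee_fin ?sqr_ge0// [leRHS](_ : _ = eps%:E); last first.
  by rewrite /= sqrtr_sqr ger0_norm.
apply: le_trans he; rewrite /L2_error le_eqVlt; apply/orP; left; apply/eqP; congr sqrte.
apply: eq_integral => w _; rewrite /gap2 -ge0_integral_leb01.
- by apply: eq_integral => s; rewrite inE/= in_itv/= => s01; rewrite /gap /mask/= s01 !mul1r.
- by apply: (mcomp mgap (_ : meas (fun s : R => ((data w, Y None w), s)))); exact: mpair.
- by move=> s; exact: sqr_ge0.
Qed.

(** Clipping is 1-Lipschitz, so it does not increase the error. The additional copy is held out of
    every training set, so [freeze_one] turns the average over it into [err2]. *)
Lemma err2_clip (c eps : R) : 0 <= c -> 0 <= eps -> (L2_error W H <= eps%:E)%E ->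
  \int[Q]_w err2 P (fun _ => clip c W) (fun x => clip c (H x)) (@data _ m n w) <= eps ^+ 2.
Proof.
move=> c0 e0 he.
have fHc := frozen_clip c0; have pW' : pred F (clip c W) by exact: pred_clip.
have fW : frozen F D (fun _ => clip c W) c.
  split => //; last by move=> x s e; exact: clip_le.
  exact: (mcomp (meas_pred bF pW') measurable_snd).
pose Phi (p : tup * E) := tint (fun s e => (clip c W s e - clip c (H p.1) s e) ^+ 2) p.2.
have dPhi x y e : (forall i, i \in D -> tnth x i = tnth y i) -> Phi (x, e) = Phi (y, e).
  by move=> /(fz_dep fHc) h; rewrite /Phi/= h.
have mg : meas (fun q : (tup * E) * R => (clip c W q.2 q.1.2 - clip c (H q.1.1) q.2 q.1.2) ^+ 2).
  have h : meas (fun q : (tup * E) * R => (q.1.1, (q.2, q.1.2))).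
    apply: mpair; first exact: (mcomp measurable_fst measurable_fst).
    by apply: mpair => //; exact: (mcomp measurable_snd measurable_fst).
  apply: mfunX; apply: mfunB; first exact: (mcomp (fz_meas fW) h).
  exact: (mcomp (fz_meas fHc) h).
have mPhi : meas Phi by exact: (meas_Ex leb01 mg).
have bg x e s : `|(clip c W s e - clip c (H x) s e) ^+ 2| <= (c + c) ^+ 2.
  rewrite normrX lerXn2r ?nnegrE ?addr_ge0//; apply: (le_trans (ler_normB _ _)); apply: lerD; exact: clip_le.
have ms x e : meas (fun s : R => (clip c W s e - clip c (H x) s e) ^+ 2).
  by apply: (mcomp mg (_ : meas (fun s : R => ((x, e), s)))); exact: mpair.
have bPhi x e : `|Phi (x, e)| <= (c + c) ^+ 2 by apply: abs_Ex_le => [|s]; [exact: ms | exact: bg].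
have [iPhi _ ePhi] := freeze_one mY indY lawY (or_introl erefl : heldout D None) dPhi mPhi bPhi (integ_cst P ((c + c) ^+ 2)).
suff : \int[Q]_w Phi (data w, Y None w) <= eps ^+ 2 by rewrite ePhi.
rewrite -lee_fin (EFin_Ex iPhi); apply: (le_trans _ (L2_error_le e0 he)).
apply: ge0_le_integral => //.
- by move=> w _; rewrite lee_fin; apply: ge0_Ex => s; exact: sqr_ge0.
- exact: measurable_int iPhi.
- exact: meas_gap.
- move=> w _; rewrite /Phi/= EFin_Ex; last first.
    by apply: integ_bnd; [exact: ms | exact: bg].
  apply: ge0_le_integral => //.
  + by move=> s _; rewrite lee_fin sqr_ge0.
  + by apply/mEFinP; exact: ms.
  + apply/mEFinP.
    by apply: (mcomp mgap (_ : meas (fun s : R => ((data w, Y None w), s)))); exact: mpair.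
  + by move=> s _; rewrite lee_fin; exact: clip_lip.
Qed.

End error.

(** The bound is assumed on the additional copy. Observation i has the same law and is likewise
    independent of the training data, so its expected number of jumps and amount of time with |H|
    above c equal those of the copy, which are 0. *)
Lemma bounded_on_fold (c : R) i : i \notin D ->
  integ P (fun e => (njump (N e))%:R) ->
  {ae Q, forall w t, 0 <= t <= 1 -> `|eval_new H w t| <= c} ->
  {ae Q, forall w, jsum N (mask (fun s e => (c < `|H (data w) s e|)%R%:R : R)) (Y (Some (val i)) w) = 0 /\
     tint (mask (fun s e => (c < `|H (data w) s e|)%R%:R : R)) (Y (Some (val i)) w) = 0}.
Proof.
move=> iD iN ae.
pose bad x := mask (fun s e => (c < `|H x s e|)%R%:R : R).
have fb : frozen F D bad 1.
  apply: (frozen_comp (phi := fun x => (c < `|x|)%R%:R)) => [|x]; last exact: norm_b2r_le1.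
  by apply: mb2r; apply: mfun_ltr => //; exact: measurable_normr.
have bad0 x s e : 0 <= bad x s e by rewrite /bad /mask -natrM ler0n.
have bad1 x s e : bad x s e <= 1 by rewrite -(ger0_norm (bad0 x s e)); exact: (fz_bound fb).
have j0 x e : 0 <= jsum N (bad x) e by apply: sumr_ge0.
have t0 x e : 0 <= tint (bad x) e by apply: ge0_Ex.
pose Z (p : tup * E) := jsum N (bad p.1) p.2 + tint (bad p.1) p.2.
have aN : adapted F (fun t e => N e t).
  by move=> t t01 B mB; apply: (sub_enlargement (W := Xproc m) (fil_filtration m hm)) => //; exact: (N_adapted m hm).
have mZ : meas Z.
  apply: mfunD; last exact: (meas_tint_joint (fz_meas fb)).
  by apply: (meas_jsum_joint bF (N_path m hm) aN (fz_meas fb)) => x s e h; rewrite /bad /mask (negbTE h) mul0r.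
have bZ x e : `|Z (x, e)| <= (njump (N e))%:R + 1.
  rewrite ger0_norm ?addr_ge0//; apply: lerD.
    by apply: (le_trans (ler_sum _ (fun i _ => bad1 x _ e))); rewrite sumr_cst mulr1.
  have : `|tint (bad x) e| <= 1.
    by apply: (tint_le bF (fz_pred fb x)) => u; exact: (fz_bound fb).
  by rewrite ger0_norm.
have dZ x y e : (forall i, i \in D -> tnth x i = tnth y i) -> Z (x, e) = Z (y, e).
  by move=> /(fz_dep fb) h; rewrite /Z/= h.
have iD1 := integD iN (integ_cst P 1).
have [iN1 _ eN] := freeze_one mY indY lawY (or_introl erefl : heldout D None) dZ mZ bZ iD1.
have hi : heldout D (Some (val i)) by right; exists i.
have [iZ _ eZ] := freeze_one mY indY lawY hi dZ mZ bZ iD1.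
have : \int[Q]_w Z (data w, Y (Some (val i)) w) = 0.
  rewrite eZ -eN; rewrite -[RHS](Ex_cst Q 0).
  have h : {ae Q, forall w, (cst 0 : _ -> R) w = Z (data w, Y None w)}.
    move: ae; apply: filterS => w bw.
    have b0 s : bad (data w) s (Y None w) = 0.
      rewrite /bad /mask; case: (boolP (0 <= s <= 1)) => h; rewrite ?mul0r//.
      by rewrite mul1r ltNge bw.
    rewrite /Z/= /jsum /tint big1 ?add0r; last by move=> *; exact: b0.
    by transitivity (\int[@leb01 R]_s (0 : R)); [rewrite Ex_cst | apply: eq_Ex => s; rewrite b0].
  by have [_ <-] := Ex_ae (integ_cst Q 0) (integ_meas iN1) h.
move=> /(Ex_eq0_ae iZ (fun w => addr_ge0 (j0 _ _) (t0 _ _))); apply: filterS => w /eqP.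
by rewrite /Z/= paddr_eq0// => /andP[/eqP -> /eqP ->].
Qed.

End estimator.

(** By [trunc_nearest] the truncation of lambda is at least as close to lambda as any estimate
    bounded by C, and estimates with arbitrarily small L2 error exist. So lambda and its truncation
    agree at almost every time, almost surely. *)
Lemma intensity_clip (C : R) : 0 <= C ->
  (forall eps : R, 0 < eps -> exists n (D : {set 'I_n}) (H : estimator m n),
    [/\ fitted_estimator D (fil m) H,
        {ae Q, forall w t, 0 <= t <= 1 -> `|eval_new H w t| <= C}
      & (L2_error (lambda m) H <= eps%:E)%E]) ->
  {ae P, forall e t, 0 <= t <= 1 ->
    \int[lebesgue_measure]_(s in `[0, t]) lambda m s e =
    tint (fun s e => (0 <= s <= t)%R%:R * clip C (lambda m) s e) e}.
Proof.
move=> C0 app; have pl := predictable_big predictable_lambda.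
have pb : pred F (clip C (lambda m)) by exact: pred_clip.
pose f (p : E * R) := (mask (lambda m) p.2 p.1 - clip C (lambda m) p.2 p.1) ^+ 2.
have mswap : meas (fun p : E * R => (p.2, p.1)) by exact: mpair.
have mf : meas f.
  apply: mfunX; apply: mfunB; first exact: (mcomp (meas_mask pl) mswap).
  exact: (mcomp (meas_pred bF pb) mswap).
have mfe e : meas (fun s : R => f (e, s)) by apply: (mcomp mf); exact: mpair.
have f0 p : (0 <= (f p)%:E)%E by rewrite lee_fin sqr_ge0.
pose g e := (\int[@leb01 R]_s (f (e, s))%:E)%E.
have mg : meas g.
  have := @measurable_fun_fubini_tonelli_F _ _ E (measurableTypeR R) R leb01 (fun q => (f q)%:E).
  by apply => //; exact/mEFinP.
have g0 e : (0 <= g e)%E by apply: integral_ge0 => s _; exact: f0.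
have Ig : (\int[P]_e g e = 0)%E.
  apply/eqP; rewrite eq_le; apply/andP; split; last by apply: integral_ge0 => e _; exact: g0.
  apply/lee_addgt0Pr => eps e0; rewrite add0e -[eps](sqr_sqrtr (ltW e0)).
  have s0 : 0 < Num.sqrt eps by rewrite sqrtr_gt0.
  have [n [D [H [fH bH eH]]]] := app _ s0.
  apply: le_trans (L2_error_le fH pl (ltW s0) eH).
  rewrite -(ge0_Ex_law (mY None) (lawY None) mg g0).
  apply: ae_ge0_le_integral => //.
  - exact: (mcomp mg (mY None)).
  - by move=> w _; apply: integral_ge0 => s _; rewrite lee_fin sqr_ge0.
  - exact: (meas_gap fH pl).
  move: bH; apply: filterS => w bw _; apply: ge0_le_integral => //.
  - by apply/mEFinP; exact: (mfe (Y None w)).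
  - apply/mEFinP; apply: mfunX; apply: mfunB.
      by apply: (mcomp (meas_mask pl) (_ : meas (fun s : R => (s, Y None w)))); exact: mpair.
    by apply: (mcomp (meas_fitted fH) (_ : meas (fun s : R => (data w, (s, Y None w))))); exact: mpair.
  - move=> s _; rewrite lee_fin /f/= /clip /mask; case: (boolP (0 <= s <= 1)) => h; rewrite ?mul0r// !mul1r.
    by apply: trunc_nearest; exact: bw.
have := ge0_integral_eq0_ae mg g0 Ig; apply: filterS => e ge t t01.
have mfe' : meas (EFin \o (fun s : R => f (e, s))) by exact/mEFinP.
have fe := ge0_integral_eq0_ae (mu := leb01) mfe' (fun s => f0 (e, s)) ge.
have ml : measurable_fun (I01 R) (fun s => lambda m s e).
  apply: mask_section; apply: (mcomp (meas_mask pl) (_ : meas (fun s : R => (s, e)))).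
  exact: mpair.
rewrite (Rintegral_upto t01 ml) /tint.
have mupto (u : R -> R) : meas u -> meas (fun s : R => (s <= t)%R%:R * u s).
  by move=> mu; apply: mfunM => //; apply: mb2r; exact: mfun_ler.
have mc : meas (fun s : R => clip C (lambda m) s e) by exact: (meas_pred1 bF e pb).
have mm : meas (fun s : R => mask (lambda m) s e).
  by apply: (mcomp (meas_mask pl) (_ : meas (fun s : R => (s, e)))); exact: mpair.
transitivity (\int[@leb01 R]_s ((s <= t)%R%:R * clip C (lambda m) s e)); last first.
  apply: eq_Ex => s; rewrite /clip /mask; case: (leP 0 s) => //= s0; by rewrite !mul0r mulr0.
have ic : integ (@leb01 R) (fun s => (s <= t)%R%:R * clip C (lambda m) s e).
  by apply: integ_bnd; [exact: mupto | move=> s; apply: maskM_le; exact: clip_le].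
have h : {ae @leb01 R, forall s, (s <= t)%R%:R * clip C (lambda m) s e = (s <= t)%R%:R * mask (lambda m) s e}.
  move: fe; apply: filterS => s /= [] /eqP; rewrite /f/= sqrf_eq0 subr_eq0 => /eqP ->//.
by have [_ ->] := Ex_ae ic (mupto _ mm) h.
Qed.

End model.

Lemma ae_and {d} {T : measurableType d} {R : realType} (P : probability T R) (p q : T -> Prop) :
  {ae P, forall w, p w} -> {ae P, forall w, q w} -> {ae P, forall w, p w /\ q w}.
Proof. by move=> hp hq; apply: filterI. Qed.

Section clipped_integrals.
Context {R : realType} {d} {E : measurableType d} (N : E -> cumulative R R) (e : E).
Hypothesis pN : counting_path (N e).
Implicit Types W G l : R -> E -> R.
Local Notation jsum := (jsum N).
(** If its jump sum is 0, clipping W at c changes nothing at the jumps; if its time integral is 0,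
    clipping changes nothing at almost every time. *)
Local Notation excess c W := (mask (fun s e => (c < `|W s e|)%R%:R : R)).

Lemma jsum_upto_clip W (c t : R) : 0 <= t <= 1 -> jsum (excess c W) e = 0 ->
  measurable_fun (I01 R) (fun s => W s e) ->
  \int[ls_measure (N e)]_(s in `]0, t]) W s e =
  jsum (fun s e => (s <= t)%R%:R * clip c W s e) e.
Proof.
move=> t01 j0 mW; rewrite (Rintegral_stieltjes pN t01 mW); apply: eq_bigr => i _; congr (_ * _).
have t1 : 0 <= jtime (N e) i <= 1 by rewrite ltW ?jtime_gt0//= jtime_le1.
have ge0 (k : 'I_(njump (N e))) : 0 <= excess c W (jtime (N e) k) e by rewrite /mask -natrM ler0n.
have := (psumr_eq0P (fun k _ => ge0 k) j0) i isT; rewrite /mask t1 mul1r.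
by case: ltP => [_ /eqP|h _]; rewrite ?oner_eq0// /clip /mask t1 mul1r trunc_id.
Qed.

Lemma clip_ae W (c : R) : meas (fun s => mask W s e) -> tint (excess c W) e = 0 ->
  {ae @leb01 R, forall s, clip c W s e = mask W s e}.
Proof.
move=> mW t0.
have eE s : excess c W s e = ((0 <= s <= 1) && (c < `|mask W s e|))%:R.
  by rewrite /mask; case: (0 <= s <= 1); rewrite ?mul1r ?mul0r.
have mE : meas (fun s => excess c W s e).
  rewrite (funext eE); apply: mb2r; apply: measurable_and.
    by apply: measurable_and; exact: mfun_ler.
  by apply: mfun_ltr => //; exact: (mcomp (@normr_measurable R setT) mW).
have iE : integ (@leb01 R) (fun s => excess c W s e).
  by apply: integ_bnd => // s; rewrite eE; exact: norm_b2r_le1.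
have g0 s : 0 <= excess c W s e by rewrite eE ler0n.
have := Ex_eq0_ae iE g0 t0; apply: filterS => s; rewrite /clip /mask.
case: (0 <= s <= 1); rewrite ?mul0r// !mul1r; case: ltP => [_ /eqP|h _]; first by rewrite oner_eq0.
by rewrite trunc_id.
Qed.

Lemma integral_dM_clip G l (cG cl t : R) : 0 <= t <= 1 -> 0 <= cG -> 0 <= cl ->
  meas (fun s => mask G s e) -> meas (fun s => mask l s e) ->
  jsum (excess cG G) e = 0 -> tint (excess cG G) e = 0 -> tint (excess cl l) e = 0 ->
  integral_dM (N e) (l^~ e) (G^~ e) t =
  jsum (fun s e => (s <= t)%R%:R * clip cG G s e) e -
  tint (fun s e => (s <= t)%R%:R * (clip cG G s e * clip cl l s e)) e.
Proof.
move=> t01 cG0 cl0 mG ml jG tG tl; rewrite /integral_dM; congr (_ - _).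
  exact: jsum_upto_clip jG (mask_section mG).
have mGl : measurable_fun (I01 R) (fun s => G s e * l s e).
  by apply: mfunM; exact: mask_section.
rewrite (Rintegral_upto t01 mGl) /tint.
have mclip W c : meas (fun s => mask W s e) -> meas (fun s => clip c W s e).
  move=> mW; have h : meas (fun s : R => (0 <= s <= 1)%R%:R * trunc c (mask W s e)).
    apply: mfunM; last exact: (mcomp (meas_trunc c) mW).
    by apply: mb2r; apply: measurable_and; exact: mfun_ler.
  move: h; congr measurable_fun; apply/funext => s; rewrite /clip /mask.
  by case: (0 <= s <= 1); rewrite ?mul1r ?mul0r.
have mu : meas (fun s : R => (s <= t)%R%:R : R) by apply: mb2r; exact: mfun_ler.
have iX : integ (@leb01 R) (fun s => (s <= t)%R%:R * (clip cG G s e * clip cl l s e)).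
  apply: (@integ_bnd _ _ _ _ _ (cG * cl)).
    by apply: mfunM => //; apply: mfunM; exact: mclip.
  by move=> s; apply: maskM_le; apply: norm_leM; exact: clip_le.
have mY : meas (fun s : R => (s <= t)%R%:R * ((0 <= s <= 1)%R%:R * (G s e * l s e))).
  have h : meas (fun s : R => (s <= t)%R%:R * (mask G s e * mask l s e)).
    by apply: mfunM => //; exact: mfunM.
  move: h; congr measurable_fun; apply/funext => s; rewrite /mask.
  by case: (0 <= s <= 1); rewrite ?mul1r ?mul0r.
have aeXY : {ae @leb01 R, forall s, (s <= t)%R%:R * (clip cG G s e * clip cl l s e) =
    (s <= t)%R%:R * ((0 <= s <= 1)%R%:R * (G s e * l s e))}.
  move: (ae_and (clip_ae mG tG) (clip_ae ml tl)); apply: filterS => s [-> ->]; rewrite /mask.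
  by case: (0 <= s <= 1); rewrite ?mul1r ?mul0r.
by have [_ ->] := Ex_ae iX mY aeXY.
Qed.

End clipped_integrals.

(** * Orthogonality and the decomposition of one observation *)

Section model_setup.
Context {R : realType} (m : lct_model R).
Hypothesis hm : lct_setting m.
Notation P := (obs_law m).
Notation Q := (data_law m).
Notation Y := (sample m).
Notation N := (Nproc m).
Notation F := (big_fil m).
Notation E := (obs_space m).
Let mY := sample_measurable m hm.
Let indY := sample_independent m hm.
Let lawY i A := @sample_law _ _ hm i A.
Let bF := big_filtration hm.
Variables (C c' : R).
Hypotheses (C0 : 0 <= C) (c'0 : 0 <= c').
Local Notation b := (clip C (lambda m)).
Local Notation G := (clip c' (Gres m)).
Local Notation jsum := (jsum N).
Local Notation mart := (mart N b).

Let pb_small : pred (fil m) b.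
Proof. by apply: pred_clip (fil_filtration m hm) C0 _; exact: predictable_lambda. Qed.

Let pb : pred F b.
Proof. by apply: pred_clip => //; exact: (predictable_big hm (predictable_lambda hm)). Qed.

Lemma pred_residual : pred F G.
Proof. by apply: pred_clip => //; exact: predictable_residual. Qed.

Lemma model_counting :
  {ae P, forall e t, 0 <= t <= 1 ->
    \int[lebesgue_measure]_(s in `[0, t]) lambda m s e =
    tint (fun s e => (0 <= s <= t)%R%:R * b s e) e} ->
  H0 m -> counting_setup P F N b C.
Proof.
move=> bl h0.
have aN : adapted F (fun t e => N e t).
  by move=> t t01 B mB; apply: (sub_enlargement (W := Xproc m) (fil_filtration m hm)) => //; exact: (N_adapted m hm).
have bC s e : `|b s e| <= C by exact: clip_le.
split => //; first exact: (N_path m hm).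
by move=> H c pH bH; exact: (compensator_formula bF (N_path m hm) aN pb bC bl h0 pH bH).
Qed.

Hypothesis bG : {ae P, forall e, caglad (Gres m ^~ e) /\ forall t, 0 <= t <= 1 -> `|Gres m t e| <= c'}.

(** The intensity and its estimate are predictable for the small filtration, so their difference at
    time s is bounded and F_{s-}-measurable, and G_s integrates to 0 against it. *)
Lemma residual_orthogonal n (D : {set 'I_n}) (H : estimator m n) x s : fitted_estimator D (fil m) H ->
  \int[P]_e (G s e * (b s e - clip C (H x) s e)) = 0.
Proof.
case=> _ _ pH; have [s01|s01] := boolP (0 <= s <= 1); last first.
  by rewrite -[RHS](Ex_cst P 0); apply: eq_Ex => e; rewrite /clip /mask (negbTE s01) !mul0r.
have fF := fil_filtration m hm; have [Fs Fm _] := fF.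
have pc : pred (fil m) (clip C (H x)) by apply: pred_clip.
have mD := predictable_left_limit fF s01 (predictableB pb_small.1 pc.1).
have sS := sigma_algebra_left_limit fF s01.
have Sm : left_limit (fil m) s `<=` measurable by move=> A /(sub_left_limit fF s01); exact: Fm.
have [_ _ /(_ s s01) ce] := GresP m hm.
have bD e : `|b s e - clip C (H x) s e| <= C + C.
  by apply: (le_trans (ler_normB _ _)); apply: lerD; exact: clip_le.
have [iG _ _ _] := ce.
have mDm := meas_wrt_sub Sm mD.
have iX := integMb mDm bD iG.
rewrite -(cond_exp_orthogonal sS Sm ce mD bD).
have mZ : meas (fun e => G s e * (b s e - clip C (H x) s e)).
  apply: mfunM => //.
  by apply: (mcomp (meas_pred bF pred_residual) (_ : meas (fun e : E => (s, e)))); exact: mpair.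
have ae : {ae P, forall e, (b s e - clip C (H x) s e) * Gres m s e = G s e * (b s e - clip C (H x) s e)}.
  by move: bG; apply: filterS => e [_ h]; rewrite mulrC (clip_id s01 (h _ s01)).
by have [_ ->] := Ex_ae iX mZ ae.
Qed.

Lemma model_variance (delta : R) : integ P (jsum (fun s e => G s e ^+ 2)) ->
  (delta%:E <= variance_function m 1)%E -> delta <= \int[P]_e jsum (fun s e => G s e ^+ 2) e.
Proof.
move=> iJ hv; rewrite -lee_fin (EFin_Ex iJ); apply: (le_trans hv); rewrite /variance_function.
have h1 : 0 <= (1 : R) <= 1 by rewrite ler01 lexx.
have mG2 e : measurable_fun (I01 R) (fun s => Gres m s e ^+ 2).
  apply: mfunX; apply: mask_section.
  apply: (mcomp (meas_mask hm (predictable_residual hm)) (_ : meas (fun s : R => (s, e)))).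
  exact: mpair.
under eq_integral do rewrite (ge0_integral_stieltjes (N_path m hm _) h1 (mG2 _) (fun s => sqr_ge0 _)).
rewrite le_eqVlt; apply/orP; left; apply/eqP.
have e1 e : \sum_(i < njump (N e)) (jtime (N e) i <= 1)%R%:R * Gres m (jtime (N e) i) e ^+ 2 =
    jsum (mask (fun s e => Gres m s e ^+ 2)) e.
  apply: eq_bigr => i _; rewrite /mask (jtime_le1 (N_path m hm e)).
  by rewrite (ltW (jtime_gt0 (N_path m hm e) i)).
under eq_integral do rewrite e1.
apply: ae_eq_integral => //.
- apply/mEFinP; apply: (meas_jsum bF (N_path m hm)).
    by move=> t t01 B mB; apply: (sub_enlargement (W := Xproc m) (fil_filtration m hm)) => //; exact: (N_adapted m hm).
  have pr := predictable_residual hm.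
  exact: (pred_mask bF (predictableM pr pr)).1.
- exact: measurable_int iJ.
- move: bG; apply: filterS => e [_ h] _; congr EFin; apply: eq_bigr => i _.
  have t1 : 0 <= jtime (N e) i <= 1.
    by rewrite (ltW (jtime_gt0 (N_path m hm e) i))/= (jtime_le1 (N_path m hm e)).
  by rewrite /mask t1 mul1r clip_id// h.
Qed.

(** The estimated martingale differs from M by the drift (b - lhat) ds, and [bounded_on_fold] makes
    every truncation invisible, at the jumps and at almost all times. *)
Lemma fold_representation n (D : {set 'I_n}) (Gh lh : estimator m n) (j : 'I_n) :
  fitted_estimator D F Gh -> fitted_estimator D (fil m) lh ->
  counting_setup P F N b C -> j \notin D ->
  {ae Q, forall w t, 0 <= t <= 1 -> `|eval_new lh w t| <= C /\ `|eval_new Gh w t| <= c'} ->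
  {ae Q, forall w, let e := Y (Some (val j)) w in
    (forall t, 0 <= t <= 1 -> integral_dM (N e) (eval_obs lh j w) (eval_obs Gh j w) t =
      mart (clip c' (Gh (data w))) t e +
      tint (fun s e => (s <= t)%R%:R * (clip c' (Gh (data w)) s e * (b s e - clip C (lh (data w)) s e))) e) /\
    \int[ls_measure (N e)]_(s in `]0, 1]) (eval_obs Gh j w s ^+ 2) =
      jsum (fun s e => clip c' (Gh (data w)) s e ^+ 2) e}.
Proof.
move=> fG fl CS jD bd; have iN := integ_njump CS.
have bdG : {ae Q, forall w t, 0 <= t <= 1 -> `|eval_new Gh w t| <= c'}.
  by move: bd; apply: filterS => w h t /h [].
have bdl : {ae Q, forall w t, 0 <= t <= 1 -> `|eval_new lh w t| <= C}.
  by move: bd; apply: filterS => w h t /h [].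
have aG := bounded_on_fold hm (fun H p => p) fG jD iN bdG.
have al := bounded_on_fold hm (predictable_big hm) fl jD iN bdl.
move: (ae_and aG al); apply: filterS => w [[jG tG] [_ tl]]; set e := Y _ w.
have pN := N_path m hm e.
have mGe : meas (fun s : R => mask (Gh (data w)) s e).
  by apply: (mcomp (meas_fitted fG) (_ : meas (fun s : R => (data w, (s, e))))); exact: mpair.
have mle : meas (fun s : R => mask (lh (data w)) s e).
  by apply: (mcomp (meas_fitted fl) (_ : meas (fun s : R => (data w, (s, e))))); exact: mpair.
have h1 : 0 <= (1 : R) <= 1 by rewrite ler01 lexx.
have fGc := frozen_clip hm (fun H p => p) fG c'0.
have flc := frozen_clip hm (predictable_big hm) fl C0.
have pGc := fz_pred fGc (data w); have plc := fz_pred flc (data w).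
split => [t t01|].
  rewrite (integral_dM_clip pN t01 c'0 C0 mGe mle jG tG tl) /mart /mint -addrA; congr (_ + _).
  have pu H : pred F H -> pred F (fun s e => (s <= t)%R%:R * H s e) by move=> pH; exact: (pred_upto CS).
  have i1 : integ (@leb01 R) (fun s => (s <= t)%R%:R * (clip c' (Gh (data w)) s e * clip C (lh (data w)) s e)).
    apply: (integ_pred (c := c' * C) bF (pu _ (predM pGc.1 plc))) => s.
    by apply: maskM_le; apply: norm_leM; exact: clip_le.
  have i2 : integ (@leb01 R) (fun s => (s <= t)%R%:R * (clip c' (Gh (data w)) s e * b s e)).
    apply: (integ_pred (c := c' * C) bF (pu _ (predM pGc.1 pb))) => s.
    by apply: maskM_le; apply: norm_leM; exact: clip_le.
  rewrite /tint; under [X in - X + _]eq_Ex do rewrite -mulrA.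
  under [X in _ + X]eq_Ex do rewrite mulrBr mulrBr.
  by rewrite (ExB i2 i1); ring.
have p2 : measurable_fun (I01 R) (fun s => Gh (data w) s e ^+ 2).
  by apply: mfunX; exact: mask_section.
rewrite (Rintegral_stieltjes pN h1 p2); apply: eq_bigr => i _.
have t1 : 0 <= jtime (N e) i <= 1 by rewrite (ltW (jtime_gt0 pN i))/= (jtime_le1 pN).
have /andP[_ t1'] := t1; rewrite t1' mul1r; congr (_ ^+ 2).
have ge0 (k : 'I_(njump (N e))) : 0 <= mask (fun s e => (c' < `|Gh (data w) s e|)%R%:R : R) (jtime (N e) k) e by rewrite /mask -natrM ler0n.
have := (psumr_eq0P (fun k _ => ge0 k) jG) i isT; rewrite /mask t1 mul1r.
by case: ltP => [_ /eqP|h _]; rewrite ?oner_eq0// clip_id.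
Qed.

End model_setup.

Lemma Rintegral_leb01_le {R : realType} (t : R) : 0 <= t <= 1 ->
  \int[@leb01 R]_s ((s <= t)%R%:R * (0 <= s <= 1)%R%:R) = t.
Proof.
move=> t01; transitivity (\int[lebesgue_measure]_(s in `[0, t]) (1 : R)).
  by rewrite (@Rintegral_upto R (fun=> 1) t t01)//; apply: eq_Ex => s; rewrite mulr1.
rewrite Rintegral_cst ?mul1r; last exact: measurable_itv.
rewrite [X in fine X](lebesgue_measure_itv `[0, t]%R)/= lte_fin; case/andP: t01 => t0 _.
case: ltP => [_|h]; first by rewrite -EFinB/= subr0.
by apply/eqP; rewrite eq_le t0 h.
Qed.

Lemma pr_exists_le {d} {T : measurableType d} {R : realType} (Q : probability T R) (k : nat) (O : nat -> set T) (q : R) :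
  (forall l, (l < k)%N -> measurable (O l) /\ fine (Q (O l)) <= q) ->
  measurable [set w | exists2 l, (l < k)%N & O l w] /\
  fine (Q [set w | exists2 l, (l < k)%N & O l w]) <= k%:R * q.
Proof.
elim: k => [|k IH] hO.
  have -> : [set w | exists2 l, (l < 0)%N & O l w] = set0 by apply/seteqP; split => [w []|].
  by rewrite measure0 mul0r; split => //; exact: measurable0.
have [mU qU] := IH (fun l h => hO l (ltnW h)); have [mk qk] := hO k (ltnSn k).
have -> : [set w | exists2 l, (l < k.+1)%N & O l w] = [set w | exists2 l, (l < k)%N & O l w] `|` O k.
  apply/seteqP; split => w /=.
    by move=> [l]; rewrite ltnS leq_eqVlt => /orP[/eqP ->|h] Ow; [right | left; exists l].
  by move=> [[l h Ow]|Ow]; [exists l => //; exact: ltnW | exists k].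
split; first exact: measurableU.
apply: (le_trans (pr_U Q mU mk)).
by rewrite -natr1 mulrDl mul1r; exact: lerD.
Qed.

(** * The score process on a grid of its variance clock *)

Section sup_clt.
Context {d d'} {T : measurableType d} {E : measurableType d'} {R : realType}.
Context (Q : probability T R) (P : probability E R) (Y : option nat -> T -> E).
Hypotheses (mY : forall i, meas (Y i)) (indY : mutually_independent Q Y).
Hypothesis lawY : has_law Q P Y.
Context (F : R -> set_system E) (N : E -> cumulative R R) (b : R -> E -> R) (C : R).
Hypothesis CS : counting_setup P F N b C.
Context (G : R -> E -> R) (c : R).
Hypotheses (pG : pred F G) (bG : forall s e, `|G s e| <= c).
Local Notation mint := (mint N b).
Local Notation jsum := (jsum N).
Local Notation mart := (mart N b).
Let fF := cs_fil CS.
Let pN := cs_path CS.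
Let C0 : 0 <= C := cs_ge0 CS.
Let c0 : 0 <= c := le_trans (normr_ge0 _) (bG 0 point).

(** The variance of the martingale integral of G at time t. Its terminal value is fixed at 1 so that
    the limit is standard Brownian motion. *)
Definition clock t := \int[P]_e jsum (fun u e => (u <= t)%R%:R * G u e ^+ 2) e.

Hypothesis clock1 : clock 1 = 1.

Let pG2 : pred F (fun u e => G u e ^+ 2).
Proof. by apply: (pred_comp (f := fun x => x ^+ 2)) pG; [exact: mfunX | rewrite expr0n]. Qed.

Let bG2 u e : `|G u e ^+ 2| <= c ^+ 2.
Proof. by rewrite normrX lerXn2r ?nnegrE. Qed.

Let ijs H (k : R) : pred F H -> (bdd H k) -> integ P (jsum H).
Proof.
move=> pH bH; apply: (integ_le (meas_jsum fF pN (cs_adapted CS) pH.1) (integZ k (integ_njump CS))) => e.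
exact: jsum_le.
Qed.

Lemma clockB s t : s <= t ->
  clock t - clock s = \int[P]_e tint (fun u e => (s < u)%R%:R * ((u <= t)%R%:R * G u e ^+ 2) * b u e) e.
Proof.
move=> st; have bu (p : bool) u e : `|p%:R * G u e ^+ 2| <= c ^+ 2 by exact: maskM_le.
have pu (t' : R) := pred_upto CS t' pG2.
have pb : pred F (fun u e => (s < u)%R%:R * ((u <= t)%R%:R * G u e ^+ 2)) by exact: (pred_after CS).
rewrite -(cs_formula CS pb (fun u e => maskM_le _ (bu _ u e))).2.
rewrite /clock -(ExB (ijs (pu t) (fun u e => bu _ u e)) (ijs (pu s) (fun u e => bu _ u e))).
apply: eq_Ex => e; rewrite /Submission.jsum -sumrB; apply: eq_bigr => i _.
case: (ltP s (jtime (N e) i)) => h; first by rewrite mul0r subr0 mul1r.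
by rewrite (le_trans h st) subrr mul0r.
Qed.

(** Through the compensator the clock has a density, at most c^2 C; the bound gives its
    continuity. *)
Lemma clock_lip s t : 0 <= s -> s <= t -> t <= 1 -> `|clock t - clock s| <= c ^+ 2 * C * (t - s).
Proof.
move=> s0 st t1; rewrite (clockB st).
have [s01 t01] : 0 <= s <= 1 /\ 0 <= t <= 1 by split; apply/andP; split; lra.
have pb : pred F (fun u e => (s < u)%R%:R * ((u <= t)%R%:R * G u e ^+ 2) * b u e).
  exact: (predM (pred_after CS s (pred_upto CS t pG2)).1 (cs_pred CS)).
apply: abs_Ex_le => [|e]; first exact: (meas_tint fF pb).
have bb u : `|(s < u)%R%:R * ((u <= t)%R%:R * G u e ^+ 2) * b u e| <= c ^+ 2 * C.
  by apply: norm_leM; [apply: maskM_le; exact: maskM_le | exact: (cs_bound CS)].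
have ib := integ_pred fF pb bb.
apply: (le_trans (abs_Ex ib)).
have iu (r : R) : integ (@leb01 R) (fun u => (u <= r)%R%:R * (0 <= u <= 1)%R%:R).
  apply: (@integ_bnd _ _ _ _ _ 1) => [|u]; last by apply: maskM_le; exact: norm_b2r_le1.
  apply: mfunM; apply: mb2r; first exact: mfun_ler.
  by apply: measurable_and; exact: mfun_ler.
rewrite -[t in X in _ <= X](Rintegral_leb01_le t01) -[s in X in _ <= X](Rintegral_leb01_le s01).
rewrite -(ExB (iu t) (iu s)) -(ExZ _ (integB (iu t) (iu s))).
apply: le_Ex => [||u]; [exact: integ_abs | exact/integZ/integB |].
have [u01|u01] := boolP (0 <= u <= 1); last by rewrite (pb.2 _ _ u01) normr0 !mulr0 subrr mulr0.
rewrite !mulr1; case: (ltP s u) => h; last first.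
  by rewrite (le_trans h st) subrr mulr0 mul0r mul0r normr0.
rewrite subr0 mul1r -mulrA normrM (ger0_norm (ler0n _ _)) mulrC.
by rewrite ler_wpM2r// norm_leM// (cs_bound CS).
Qed.

Lemma clock0 : clock 0 = 0.
Proof.
rewrite /clock -[RHS](Ex_cst P 0); apply: eq_Ex => e; apply: big1 => i _.
by rewrite leNgt (jtime_gt0 (pN e)) mul0r.
Qed.

Lemma clock_mono s t : s <= t -> clock s <= clock t.
Proof.
move=> st; have bu (p : bool) u e : `|p%:R * G u e ^+ 2| <= c ^+ 2 by exact: maskM_le.
apply: le_Ex => [||e]; [exact: (ijs (pred_upto CS s pG2)) | exact: (ijs (pred_upto CS t pG2)) |].
apply: ler_sum => i _; rewrite ler_wpM2r ?sqr_ge0// ler_nat.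
by case: (leP (jtime (N e) i) s) => // h; rewrite (le_trans h st).
Qed.

Lemma clock_onto y : 0 <= y <= 1 -> exists2 t, 0 <= t <= 1 & clock t = y.
Proof.
(* [cl] clamps x to [0, 1], which makes [f] continuous on the whole line for the intermediate value
   theorem. *)
move=> y01; pose cl (x : R) := (1 + trunc 1 (2 * x - 1)) / 2.
have cl01 x : 0 <= cl x <= 1.
  have /(_ ler01) := @trunc_le R 1 (2 * x - 1); rewrite /cl ler_norml => /andP[h1 h2].
  by apply/andP; split; lra.
have cll x x' : `|cl x - cl x'| <= `|x - x'|.
  have -> : cl x - cl x' = 2^-1 * (trunc 1 (2 * x - 1) - trunc 1 (2 * x' - 1)) by rewrite /cl; lra.
  have -> : x - x' = 2^-1 * ((2 * x - 1) - (2 * x' - 1)) by lra.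
  by rewrite normrM [leRHS]normrM ler_wpM2l//; exact: trunc_lip.
pose f x := clock (cl x); pose k := c ^+ 2 * C.
have k0 : 0 <= k by rewrite mulr_ge0 ?exprn_ge0.
have fl x x' : `|f x - f x'| <= k * `|x - x'|.
  case/andP: (cl01 x) => a1 a2; case/andP: (cl01 x') => b1 b2.
  apply: (@le_trans _ _ (k * `|cl x - cl x'|)); last by rewrite ler_wpM2l.
  case: (leP (cl x) (cl x')) => h.
    by rewrite distrC (distrC (cl x)) (ger0_norm (_ : 0 <= cl x' - cl x)) ?subr_ge0// clock_lip.
  by rewrite (gtr0_norm (_ : 0 < cl x - cl x')) ?subr_gt0// clock_lip// ltW.
have cf : continuous f.
  move=> x; apply/cvgrPdist_le => e e0.
  have k1 : 0 < k + 1 by lra.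
  near=> z; apply: (le_trans (fl x z)); apply: (@le_trans _ _ ((k + 1) * `|x - z|)).
    by rewrite ler_wpM2r//; lra.
  rewrite mulrC -ler_pdivlMr//; near: z.
  by apply: (@cvgr_dist_le _ _ _ _ _ id x) => //; exact: divr_gt0.
have f0 : f 0 = 0.
  rewrite /f (_ : cl 0 = 0) ?clock0// /cl mulr0 add0r trunc_id ?normrN1//; lra.
have f1 : f 1 = 1.
  by rewrite /f (_ : cl 1 = 1) ?clock1// /cl (_ : 2 * 1 - 1 = 1) ?trunc_id ?normr1//; lra.
have [|t _ ft] := @IVT _ f 0 1 y ler01 (continuous_subspaceT cf).
  by rewrite f0 f1 min_l// max_r.
by exists (cl t).
Unshelve. all: end_near.
Qed.

(** The clock may be flat, so its preimages are not unique; the end points are set to 0 and 1 by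
    hand because the cells must cover all of [0, 1]. *)
Lemma exists_clock_grid k : (0 < k)%N -> exists t : nat -> R,
  [/\ t 0%N = 0, t k = 1 & forall l, (l <= k)%N -> 0 <= t l <= 1 /\ clock (t l) = l%:R / k%:R].
Proof.
move=> k0; have kr : 0 < k%:R :> R by rewrite ltr0n.
have ex l : exists t, (l <= k)%N -> 0 <= t <= 1 /\ clock t = l%:R / k%:R.
  case: (leqP l k) => lk; last by exists 0.
  have [|t t01 ft] := @clock_onto (l%:R / k%:R); last by exists t.
  by rewrite divr_ge0//= ler_pdivrMr// mul1r ler_nat.
pose t l := if l == 0%N then 0 else if l == k then 1 else sval (cid (ex l)).
exists t; split => [//||l lk]; first by rewrite /t eqxx; case: eqP k0 => // ->.
rewrite /t; case: eqP => [->|_]; first by rewrite lexx ler01 clock0 mul0r.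
case: eqP => [->|_]; first by rewrite lexx ler01 clock1 divff// gt_eqF.
exact: (svalP (cid (ex l))).
Qed.

Lemma expectation_mart t : \int[P]_e mart G t e = 0.
Proof.
have bH (u : R) e : `|(u <= t)%R%:R * G u e| <= c by exact: maskM_le.
exact: (expectation_mint CS (pred_upto CS t pG) bH (integ_cst P c) (integZ c (integ_njump CS))).2.
Qed.

(** Polarisation of the isometry, 4 a b = (a + b)^2 - (a - b)^2; the two integrands overlap on
    [0, s] only. *)
Lemma mart_covariance s t : s <= t -> \int[P]_e (mart G s e * mart G t e) = clock s.
Proof.
move=> st; have bH (r u : R) e : `|(u <= r)%R%:R * G u e| <= c by exact: maskM_le.
have pu r := pred_upto CS r pG.
have pN' : pred F (fun u e => (-1) * ((u <= s)%R%:R * G u e)) by exact: predZ.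
have bN' u e : `|(-1) * ((u <= s)%R%:R * G u e)| <= c by rewrite normrM normrN1 mul1r.
have [i1 e1] := mint_isometry CS (predD (pu t) (pu s)) (fun u e => norm_leD (bH t u e) (bH s u e)).
have [i2 e2] := mint_isometry CS (predD (pu t) pN') (fun u e => norm_leD (bH t u e) (bN' u e)).
have sq u e : `|((u <= t)%R%:R * G u e + (u <= s)%R%:R * G u e) ^+ 2| <= (c + c) ^+ 2.
  by rewrite normrX lerXn2r ?nnegrE ?addr_ge0//; exact: norm_leD.
have sq' u e : `|((u <= t)%R%:R * G u e + (-1) * ((u <= s)%R%:R * G u e)) ^+ 2| <= (c + c) ^+ 2.
  by rewrite normrX lerXn2r ?nnegrE ?addr_ge0//; exact: norm_leD.
have psq H : pred F H -> pred F (fun u e => H u e ^+ 2).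
  by apply: (pred_comp (f := fun x => x ^+ 2)); [exact: mfunX | rewrite expr0n].
have j1 := ijs (psq _ (predD (pu t) (pu s))) sq; have j2 := ijs (psq _ (predD (pu t) pN')) sq'.
transitivity (\int[P]_e (4^-1 * (Submission.mint N b (fun u e => (u <= t)%R%:R * G u e + (u <= s)%R%:R * G u e) e ^+ 2 -
  Submission.mint N b (fun u e => (u <= t)%R%:R * G u e + (-1) * ((u <= s)%R%:R * G u e)) e ^+ 2))).
  apply: eq_Ex => e.
  rewrite (mintD CS (e := e) (pu t) (pu s) (fun u => bH t u e) (fun u => bH s u e)).
  rewrite (mintD CS (e := e) (pu t) pN' (fun u => bH t u e) (fun u => bN' u e)).
  rewrite (mintZ CS (-1) (e := e) (pu s) (fun u => bH s u e)) /Submission.mart; by field.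
rewrite (ExZ _ (integB i1 i2)) (ExB i1 i2) e1 e2 -(ExB j1 j2) -(ExZ _ (integB j1 j2)).
apply: eq_Ex => e; rewrite /Submission.jsum -sumrB mulr_sumr; apply: eq_bigr => i _.
case: (leP (jtime (N e) i) s) => h; first by rewrite (le_trans h st) !mul1r mulN1r; field.
by rewrite !mul0r !mulr0 addr0 subrr mulr0.
Qed.

Lemma meas_martG t : 0 <= t <= 1 -> meas (mart G t).
Proof. exact: (meas_mart CS pG bG). Qed.

Lemma mart0 e : mart G 0 e = 0.
Proof.
rewrite /Submission.mart /Submission.mint /Submission.jsum big1 => [|i _]; last first.
  by rewrite leNgt (jtime_gt0 (pN e)) mul0r.
rewrite sub0r /tint (Rintegral_leb01_at (a := 0)) ?oppr0// => s s0.
case: (leP s 0) => h; last by rewrite !mul0r.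
by rewrite pG.2 ?mulr0 ?mul0r// negb_and -ltNge lt_neqAle s0 h.
Qed.

Context (n : nat) (n0 : (0 < n)%N).
Let s : R := (Num.sqrt n%:R)^-1.
Let s0 : 0 < s. Proof. by rewrite invr_gt0 sqrtr_gt0 ltr0n. Qed.
Let s2 : s ^+ 2 = n%:R^-1. Proof. by rewrite exprVn sqr_sqrtr// ler0n. Qed.

Definition score t w := s * \sum_(0 <= i < n) mart G t (Y (Some i) w).

Lemma meas_score t : 0 <= t <= 1 -> meas (score t).
Proof.
move=> t01; apply: mfunM => //; apply: measurable_sum => i.
exact: (mcomp (meas_martG t01) (mY _)).
Qed.

Lemma score_rc w t : 0 <= t < 1 -> score u w @[u --> t^'+] --> score t w.
Proof.
move=> _; apply/cvg_at_rightP => u pu; apply: cvgMr; apply: cvg_bigsum => i.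
by have /cvg_at_rightP := mart_rc CS (e := Y (Some i) w) (t := t) pG bG; apply.
Qed.

Let r : seq (option nat) := [seq Some i | i <- iota 0 n].
Let ur : uniq r. Proof. by rewrite map_inj_uniq ?iota_uniq// => i j []. Qed.
Let sizer : size r = n. Proof. by rewrite size_map size_iota. Qed.
Let sumr (f : option nat -> R) : \sum_(j <- r) f j = \sum_(0 <= i < n) f (Some i).
Proof. by rewrite big_map /index_iota subn0. Qed.

Local Notation at_score k t w := (fun l : 'I_k => score (t l.+1) w).

Definition kurt := (c * (1 + C)) ^+ 4 * moment_bound C 4.

(** Fourth moments are essential: the k cells have variance 1/k each, so their fourth moments sum to
    k (3/k^2 + kurt/n), which is small for large k and larger n. Second moments would sum to 1
    whatever the grid. *)
Lemma score_oscillation (k : nat) (t : nat -> R) (zeta : R) : (0 < k)%N -> 0 < zeta ->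
  t 0%N = 0 -> t k = 1 -> (forall l, (l <= k)%N -> 0 <= t l <= 1 /\ clock (t l) = l%:R / k%:R) ->
  exists A : set T, [/\ measurable A,
    fine (Q A) <= k%:R * ((3 / k%:R ^+ 2 + kurt / n%:R) / zeta ^+ 4) &
    forall w u, ~ A w -> 0 <= u <= 1 -> exists2 l, (l <= k)%N & `|score u w - score (t l) w| <= zeta].
Proof.
move=> k0 z0 t0 tk ht; have kr : 0 < k%:R :> R by rewrite ltr0n.
have nr : 0 < n%:R :> R by rewrite ltr0n.
have tS l : (l < k)%N -> t l <= t l.+1.
  move=> lk; rewrite leNgt; apply/negP => h; have := clock_mono (ltW h).
  by rewrite (ht _ lk).2 (ht _ (ltnW lk)).2 ler_pM2r ?invr_gt0// ler_nat ltnn.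
pose H l u e := (t l < u)%R%:R * ((u <= t l.+1)%R%:R * G u e).
have pH l : pred F (H l) by exact: (pred_after CS (t l) (pred_upto CS (t l.+1) pG)).
have bH l u e : `|H l u e| <= c by apply: maskM_le; exact: maskM_le.
pose O l := [set w | exists2 v, 0 <= v <= 1 & zeta / s < `|fold_sum Y N b r (H l) v w|].
have zs : 0 < zeta / s by exact: divr_gt0.
have hO l : (l < k)%N -> measurable (O l) /\ fine (Q (O l)) <= (3 / k%:R ^+ 2 + kurt / n%:R) / zeta ^+ 4.
  move=> lk; have [i4 e4] := mint_fourth CS (pH l) (bH l).
  have [i2 e2] := mint_isometry CS (pH l) (bH l).
  have E0 := (expectation_mint CS (pH l) (bH l) (integ_cst P c) (integZ c (integ_njump CS))).2.
  have mH := meas_mint CS (pH l).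
  have [_ _ i4r e4r] := iid_moments mY indY lawY ur mH i4 E0.
  have [mO qO] := fold_doob mY indY lawY CS (pH l) (bH l) zs (or_intror erefl) i4r.
  split => //; rewrite ler_pdivlMr ?exprn_gt0//.
  have := le_trans qO e4r; rewrite sizer e2.
  have -> : \int[P]_e jsum (fun u e => H l u e ^+ 2) e = k%:R^-1.
    transitivity (clock (t l.+1) - clock (t l)).
      have p2 := pred_after CS (t l) (pred_upto CS (t l.+1) pG2).
      have b2 u e : `|(t l < u)%R%:R * ((u <= t l.+1)%R%:R * G u e ^+ 2)| <= c ^+ 2.
        by apply: maskM_le; exact: maskM_le.
      rewrite (clockB (tS _ lk)) -(cs_formula CS p2 b2).2.
      apply: eq_Ex => e; apply: eq_bigr => i _; rewrite /H.
      by case: (t l < _); case: (_ <= t l.+1); rewrite ?mul1r ?mul0r ?expr0n//= mulr0.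
    by rewrite (ht _ lk).2 (ht _ (ltnW lk)).2 -mulrBl -natrB// subSnn mul1r.
  rewrite expr_div_n (_ : s ^+ 4 = (n%:R ^+ 2)^-1); last by rewrite (exprM s 2 2) s2 exprVn.
  rewrite invrK mulrAC -[zeta ^+ 4 * _]mulrC => h.
  have : fine (Q (O l)) * zeta ^+ 4 * n%:R ^+ 2 <= 3 * (n%:R / k%:R) ^+ 2 + n%:R * kurt.
    by apply: (le_trans h); rewrite lerD2l ler_wpM2l.
  rewrite -ler_pdivlMr ?exprn_gt0// => /le_trans; apply; apply: eq_ler.
  by field; rewrite !gt_eqF.
have [mA qA] := pr_exists_le hO.
exists [set w | exists2 l, (l < k)%N & O l w]; split => // w u nA u01.
have [l [lk lu ul]] : exists l, [/\ (l < k)%N, t l <= u & u <= t l.+1].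
  have h j : (j < k)%N -> u <= t j.+1 -> exists l, [/\ (l < k)%N, t l <= u & u <= t l.+1].
    elim: j => [|j IH] jk uj; first by exists 0%N; rewrite t0; case/andP: u01.
    case: (leP u (t j.+1)) => h; first by apply: IH => //; exact: ltnW.
    by exists j.+1; split => //; exact: ltW.
  apply: (h k.-1); rewrite ?prednK// tk; by case/andP: u01.
exists l; first exact: ltnW.
have hw : `|fold_sum Y N b r (H l) u w| <= zeta / s.
  by rewrite leNgt; apply/negP => h; apply: nA; exists l => //; exists u.
have -> : score u w - score (t l) w = s * fold_sum Y N b r (H l) u w.
  rewrite /score -mulrBr -sumrB /fold_sum (sumr (fun j => mart (H l) u (Y j w))); congr (_ * _).
  apply: eq_bigr => i _; rewrite (martB CS (Y (Some i) w) pG bG lu) /Submission.mart; congr (Submission.mint _ _ _ _).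
  apply/funext => v; apply/funext => e; rewrite /H.
  case: (leP v u) => vu; rewrite ?mul1r ?mul0r ?mulr0//.
  by rewrite (le_trans vu ul) mul1r.
by rewrite normrM (gtr0_norm s0) mulrC -ler_pdivlMr.
Qed.

Context {dB} {TB : measurableType dB} (PB : probability TB R) (B : R -> TB -> R).
Hypothesis hB : standard_brownian_motion PB B.

Local Notation at_B k w := (fun l : 'I_k => B (l.+1%:R / k%:R) w).

(** The two third-moment constants of the exchange, for the observations and for the Gaussian
    blocks, at v = 1. *)
Definition clt_error (k : nat) : R :=
  k%:R ^+ 2 + k%:R ^+ 4 * kurt + (k%:R ^+ 2 + k%:R ^+ 4 * (k%:R ^+ 4 * (2 * 4 ^+ 4 * expR 2^-1))).

Let mart4 t : integ P (fun e => mart G t e ^+ 4) /\ \int[P]_e (mart G t e ^+ 4) <= kurt.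
Proof. exact: (mint_fourth CS (pred_upto CS t pG) (fun u e => maskM_le _ (bG u e))). Qed.

Lemma score_clt (k : nat) (t : nat -> R) (a eta M : R) : (0 < k)%N -> 
  (forall l, (l <= k)%N -> 0 <= t l <= 1 /\ clock (t l) = l%:R / k%:R) ->
  0 <= M -> @has_jet R k M (bump a eta) ->
  `|\int[Q]_w bump a eta (at_score k t w) -
    \int[PB]_w bump a eta (at_B k w)| <= M * clt_error k * s.
Proof.
move=> k0 ht M0 jet; have kr : 0 < k%:R :> R by rewrite ltr0n.
have cov (l l' : 'I_k) : \int[P]_e (mart G (t l.+1) e * mart G (t l'.+1) e) = 1 * (minn l.+1 l'.+1)%:R / k%:R.
  wlog ll : l l' / (l <= l')%N.
    move=> h; case: (leqP l l') => ll; first exact: h.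
    by rewrite minnC -(h l' l (ltnW ll)); apply: eq_Ex => e; rewrite mulrC.
  have tt : t l.+1 <= t l'.+1.
    move: ll; rewrite leq_eqVlt => /orP[/eqP ->//|ll].
    rewrite leNgt; apply/negP => h; have := clock_mono (ltW h).
    by rewrite (ht _ (ltn_ord l)).2 (ht _ (ltn_ord l')).2 ler_pM2r ?invr_gt0// ler_nat ltnS leqNgt ll.
  by rewrite (mart_covariance tt) (ht _ (ltn_ord l)).2 mul1r (minn_idPl _).
have := grid_clt mY indY lawY hB k0 n0 ler01 (fun l : 'I_k => meas_martG (ht _ (ltn_ord l)).1)
  (fun l : 'I_k => (mart4 (t l.+1)).1) (fun l : 'I_k => expectation_mart (t l.+1)) cov
  (fun l : 'I_k => (mart4 (t l.+1)).2) M0 jet.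
rewrite sqrtr1; under [X in `|_ - X|]eq_Ex do under eq_fun do rewrite mul1r.
by move=> /le_trans; apply; rewrite /clt_error mulr1 expr1n !mul1r.
Qed.

Lemma dyadicE m i : (i <= 2 ^ m)%N -> dyadic m i = i%:R / (2 ^ m)%:R :> R.
Proof.
move=> im; rewrite /dyadic -natrX min_r// ler_pdivrMr ?mul1r ?ler_nat//.
Qed.

Let X := score.
Let exceeds a := [set w | exists2 u, 0 <= u <= 1 & a < `|score u w|].

Lemma meas_score_sup a : measurable (exceeds a).
Proof. exact: (meas_dyadic_sup meas_score score_rc). Qed.

Section one_grid.
Variables (m : nat) (eta M : R).
Hypotheses (eta0 : 0 < eta) (M0 : 0 <= M) (jet : forall a, @has_jet R (2 ^ m) M (bump a eta)).
Let k := (2 ^ m)%N.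
Let k0 : (0 < k)%N. Proof. by rewrite expn_gt0. Qed.
Let err := M * clt_error k * s.

Let mBt (l : 'I_k) : meas (B (l.+1%:R / k%:R)).
Proof. by rewrite -(dyadicE (ltn_ord l)); case: hB => h _ _ _; apply: h; exact: dyadic01. Qed.

Let integ_bump {d0} {T0 : measurableType d0} (P0 : probability T0 R) a (h : 'I_k -> T0 -> R) :
  (forall l, meas (h l)) -> integ P0 (fun w => bump a eta (h ^~ w)).
Proof.
move=> mh; apply: (@integ_bnd _ _ _ _ _ 1) => [|w]; first exact: meas_bump.
by case/andP: (bump01 a eta (h ^~ w)) => h1 h2; rewrite ger0_norm.
Qed.

Let iB a : integ PB (fun w => bump a eta (at_B k w)). Proof. exact: integ_bump mBt. Qed.

Let EindC {d0} {T0 : measurableType d0} (P0 : probability T0 R) (A : set T0) : measurable A ->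
  \int[P0]_w (1 - \1_A w) = 1 - fine (P0 A) /\ integ P0 (fun w => 1 - \1_A w : R).
Proof.
move=> mA; split; last exact: integB (integ_cst P0 1) (integ_indic P0 mA).
by rewrite (ExB (integ_cst P0 1) (integ_indic P0 mA)) Ex_cst Ex_indic.
Qed.

(** If the score never exceeds a - 3 eta its bump is 1, and if B exceeds a on the grid its bump is
    0; [score_clt] compares the two expectations. With k = 2^m the points l/k are exactly the dyadic
    grid of B. *)
Lemma grid_le_score a : 0 <= a ->
  fine (PB (grid_gt B m a)) <= fine (Q (exceeds (a - 3 * eta))) + err.
Proof.
move=> a0; have [t [_ _ ht]] := exists_clock_grid k0.
have ms (l : 'I_k) : meas (score (t l.+1)) by exact: meas_score (ht _ (ltn_ord l)).1.
have iS : integ Q (fun w => bump a eta (at_score k t w)) by exact: integ_bump ms.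
have [e1 i1] := EindC Q (meas_score_sup (a - 3 * eta)).
have [e2 i2] := EindC PB (meas_grid hB m a).
have := score_clt k0 ht M0 (jet a); rewrite ler_norml => /andP[_ h].
have h1 : 1 - fine (Q (exceeds (a - 3 * eta))) <= \int[Q]_w bump a eta (at_score k t w).
  rewrite -e1; apply: le_Ex => // w; rewrite indicE; case: (boolP (_ \in _)) => [_|wA].
    by rewrite subrr; case/andP: (bump01 a eta (at_score k t w)).
  rewrite subr0 bump_eq1// => l; rewrite leNgt; apply/negP => h'; move/negP: wA; apply; rewrite inE.
  by exists (t l.+1) => //; exact: (ht _ (ltn_ord l)).1.
have h2 : \int[PB]_w bump a eta (at_B k w) <= 1 - fine (PB (grid_gt B m a)).
  rewrite -e2; apply: le_Ex => // w; rewrite indicE; case: (boolP (_ \in _)) => [wA|_]; last first.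
    by rewrite subr0; case/andP: (bump01 a eta (at_B k w)).
  rewrite subrr bump_eq0//; move: wA; rewrite inE => -[[|i] ik ai].
    by move: ai; rewrite dyadicE// mul0r; case: hB => _ /(_ w)[-> _] _ _; rewrite normr0 ltNge a0.
  by exists (Ordinal ik); rewrite /= -(dyadicE ik) ltW.
by rewrite /err; lra.
Qed.

(** Off the oscillation event, an exceedance of y + zeta forces one of y at a grid time, where the
    bump of the score is 0; the Brownian bump is 1 unless B exceeds y - 3 eta on its grid. *)
Lemma score_le_grid y zeta : 0 <= y -> 0 < zeta ->
  fine (Q (exceeds (y + zeta))) <= fine (PB (grid_gt B m (y - 3 * eta))) + err +
    k%:R * ((3 / k%:R ^+ 2 + kurt / n%:R) / zeta ^+ 4).
Proof.
move=> y0 z0; have [t [t0 tk ht]] := exists_clock_grid k0.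
have ms (l : 'I_k) : meas (score (t l.+1)) by exact: meas_score (ht _ (ltn_ord l)).1.
have iS : integ Q (fun w => bump y eta (at_score k t w)) by exact: integ_bump ms.
have [A [mA qA hA]] := score_oscillation k0 z0 t0 tk ht.
pose D := [set w | exists2 l, (l <= k)%N & y < `|score (t (minn l k)) w|].
have mD : measurable D.
  apply: (@meas_exceeds_fin _ _ _ _ meas_score k (fun l => t (minn l k))) => l.
  exact: (ht _ (geq_minr _ _)).1.
have sub : exceeds (y + zeta) `<=` D `|` A.
  move=> w [u u01 yu]; have [Aw|nA] := pselect (A w); [by right|left].
  have [l lk hl] := hA w u nA u01; exists l => //; rewrite (minn_idPl lk).
  have := ler_normD (score u w - score (t l) w) (score (t l) w); rewrite subrK => h; lra.
apply: (le_trans (pr_le_U Q (meas_score_sup _) mD mA sub)); rewrite lerD//.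
have := score_clt k0 ht M0 (jet y); rewrite ler_norml => /andP[h _].
have [e2 i2] := EindC PB (meas_grid hB m (y - 3 * eta)).
have h1 : fine (Q D) <= 1 - \int[Q]_w bump y eta (at_score k t w).
  rewrite -[1 in leRHS](Ex_cst Q) -(ExB (integ_cst Q 1) iS) -(Ex_indic Q mD).
  apply: le_Ex => [||w]; [exact: integ_indic | exact: integB (integ_cst Q 1) iS |].
  rewrite indicE; case: (boolP (_ \in _)) => [wD|_]; last first.
    by rewrite subr_ge0; case/andP: (bump01 y eta (at_score k t w)).
  rewrite bump_eq0 ?subr0//; move: wD; rewrite inE => -[[|l] lk].
    rewrite min0n t0 /score big1 ?mulr0 ?normr0 ?ltNge ?y0// => i _; exact: mart0.
  by rewrite (minn_idPl lk) => hl; exists (Ordinal lk); exact: ltW.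
have h2 : 1 - fine (PB (grid_gt B m (y - 3 * eta))) <= \int[PB]_w bump y eta (at_B k w).
  rewrite -e2; apply: le_Ex => // w; rewrite indicE; case: (boolP (_ \in _)) => [_|wA].
    by rewrite subrr; case/andP: (bump01 y eta (at_B k w)).
  rewrite subr0 bump_eq1// => l; rewrite leNgt; apply/negP => h'; move/negP: wA; apply; rewrite inE.
  by exists l.+1; [exact: ltn_ord | rewrite dyadicE//; exact: ltn_ord].
by rewrite /err; lra.
Qed.

End one_grid.
End sup_clt.

(** * The uniform limit of the supremum of the score *)

Lemma moment_bound_ge0 {R : realType} (C : R) p : 0 <= C -> 0 <= moment_bound C p.
Proof. by move=> C0; elim: p => //= p IH; rewrite addr_ge0 ?mulr_ge0 ?exprn_ge0. Qed.

Lemma small_inv_sqrt {R : realType} (A e : R) : 0 <= A -> 0 < e ->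
  exists n0 : nat, forall n, (n0 <= n)%N -> (0 < n)%N -> A / Num.sqrt n%:R <= e /\ A / n%:R <= e.
Proof.
move=> A0 e0; pose x := A / e + 1; have x1 : 1 <= x by rewrite lerDr divr_ge0// ltW.
exists (Num.truncn (x ^+ 2)).+1 => n hn n0.
have xn : x ^+ 2 <= n%:R.
  apply: ltW; apply: (lt_le_trans (truncnS_gt _)); by rewrite ler_nat.
have sx : x <= Num.sqrt n%:R by rewrite -(ger0_norm (le_trans ler01 x1)) -sqrtr_sqr ler_sqrt// ler0n.
have key z : x <= z -> A / z <= e.
  move=> xz; rewrite ler_pdivrMr; last by apply: lt_le_trans xz; lra.
  rewrite mulrC -ler_pdivrMr//; apply: le_trans xz; rewrite /x; lra.
split; apply: key => //; apply: le_trans xn; rewrite expr2.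
by rewrite -[leLHS]mulr1 ler_wpM2l//; lra.
Qed.

Lemma bsup_right_continuous {d} {T : measurableType d} {R : realType} (P : probability T R) (B : R -> T -> R)
    (hB : standard_brownian_motion P B) (x e : R) : 0 < e ->
  exists2 dl, 0 < dl & fine (P [set w | x < bsup B w]) <= fine (P [set w | x + dl < bsup B w]) + e.
Proof.
move=> e0; pose A n := [set w | x + n.+1%:R^-1 < bsup B w].
have mA n : measurable (A n) by rewrite /A (bsup_gtE hB); apply: bigcup_measurable => m _; exact: (meas_grid hB).
have AU : [set w | x < bsup B w] = \bigcup_n A n.
  apply/seteqP; split => w; last first.
    by move=> [n _]; apply: le_lt_trans; rewrite lerDl.
  move=> /= xw; have h : 0 < bsup B w - x by rewrite subr_gt0.
  have [n hn] : exists n : nat, n.+1%:R^-1 < bsup B w - x.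
    exists (Num.truncn (bsup B w - x)^-1); rewrite invf_plt ?posrE//; exact: truncnS_gt.
  by exists n => //; rewrite /A/= -ltrBrDl.
have mono : nondecreasing_seq A.
  apply/nondecreasing_seqP => n; apply/subsetPset => w; apply: le_lt_trans.
  by rewrite lerD2l lef_pV2 ?posrE ?ltr0n// ler_nat.
have mU : measurable (\bigcup_n A n) by exact: bigcup_measurable.
have cv : fine (P (A n)) @[n --> \oo] --> fine (P [set w | x < bsup B w]).
  rewrite AU; apply: fine_cvg; rewrite fineK ?fin_num_measure//.
  exact: nondecreasing_cvg_mu.
have [n _ /(_ n (leqnn n))] := (cvgrPdist_le _ _).1 cv _ e0; rewrite /=.
rewrite ler_norml => /andP[_ h]; exists n.+1%:R^-1; first by rewrite invr_gt0.
by rewrite -lerBlDl.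
Qed.

(** [n0] and [delta] are fixed before the spaces, the laws and the integrand: this order of
    quantifiers carries the uniformity over the parameter. *)
Lemma score_limit {dB} {TB : measurableType dB} {R : realType} (PB : probability TB R) (B : R -> TB -> R)
    (hB : standard_brownian_motion PB B) (c C x eps : R) : 0 <= c -> 0 <= C -> 0 < x -> 0 < eps ->
  exists (n0 : nat) (delta : R), 0 < delta /\
  forall (d d' : measure_display) (T : measurableType d) (E : measurableType d')
    (Q : probability T R) (P : probability E R) (Y : option nat -> T -> E) (F : R -> set_system E)
    (N : E -> cumulative R R) (b G : R -> E -> R) (n : nat),
    (forall i, meas (Y i)) -> mutually_independent Q Y ->
    (forall i A, measurable A -> Q (Y i @^-1` A) = P A) ->
    counting_setup P F N b C -> pred F G -> (bdd G c) -> clock P N G 1 = 1 ->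
    (n0 <= n)%N -> (0 < n)%N ->
    let exceeds a := [set w | exists2 u, 0 <= u <= 1 & a < `|score Y N b G n u w|] in
    fine (PB [set w | x < bsup B w]) <= fine (Q (exceeds (x + delta))) + eps /\
    fine (Q (exceeds (x - delta))) <= fine (PB [set w | x < bsup B w]) + eps.
Proof.
move=> c0 C0 x0 e0; have e3 : 0 < eps / 3 by lra.
have e6 : 0 < eps / 6 by lra.
have [k1 k10 hk1] := bsup_right_continuous hB x e3.
have [k2' k20' hk2'] := bsup_no_atom hB x0 e3.
(* The minimum with x keeps the level x - 2 ze nonnegative. *)
pose k2 := Num.min k2' x; have k20 : 0 < k2 by rewrite lt_min k20'.
pose dl := Num.min (k1 / 2) (k2 / 5).
have dl0 : 0 < dl by rewrite lt_min; apply/andP; split; lra.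
have d1 : dl <= k1 / 2 by rewrite ge_min lexx.
have d2 : dl <= k2 / 5 by rewrite ge_min lexx orbT.
have k2x : k2 <= x by rewrite ge_min lexx orbT.
have k2k : k2 <= k2' by rewrite ge_min lexx.
(* The upper bound ends at the Brownian level x - 2 ze - 3 eta; as eta <= ze, a fifth of k2 keeps
   this level above x - k2, within the range where an atom is excluded. *)
pose ze := k2 / 5; have ze0 : 0 < ze by rewrite /ze; lra.
(* With dl <= k1/2 this gives x + dl <= x + k1 - 3 eta, as the lower bound requires. *)
pose eta := Num.min (k1 / 6) ze; have eta0 : 0 < eta by rewrite lt_min ze0 andbT; lra.
have et1 : eta <= k1 / 6 by rewrite ge_min lexx.
have et2 : eta <= ze by rewrite ge_min lexx orbT.
have [m1 hm1] : exists m1, forall m, (m1 <= m)%N ->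
    fine (PB [set w | x + k1 < bsup B w]) <= fine (PB (grid_gt B m (x + k1))) + eps / 3.
  have /cvgrPdist_le /(_ _ e3)[m1 _ h] := @grid_cvg _ _ _ _ _ hB (x + k1).
  by exists m1 => m /h /=; rewrite ler_norml => /andP[_]; rewrite lerBlDl.
have [m2 hm2] : exists m2, forall m, (m2 <= m)%N -> 3 / (2 ^ m)%:R / ze ^+ 4 <= eps / 6.
  have A0 : 0 <= 3 / ze ^+ 4 by rewrite divr_ge0// exprn_ge0// ltW.
  have [m2 h] := small_inv_sqrt A0 e6; exists m2 => m mm.
  have := (h (2 ^ m)%N (leq_trans mm (ltnW (ltn_expl m (ltnSn 1)))) (expn_gt0 2 m)).2.
  by rewrite mulrAC.
(* The grid comes first, then the jet constant M that depends on it, and only then the size of n. *)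
pose m := maxn m1 m2.
have [M [M1 jet]] := @has_jet_bump R (2 ^ m) eta eta0; have M0 : 0 <= M := le_trans ler01 M1.
pose ku := kurt C c.
have ku0 : 0 <= ku by rewrite mulr_ge0 ?moment_bound_ge0// exprn_ge0// mulr_ge0// addr_ge0.
have ce0 : 0 <= M * clt_error C c (2 ^ m).
  have kr : 0 <= (2 ^ m)%:R :> R by exact: ler0n.
  by rewrite mulr_ge0// /clt_error -/ku; repeat apply: addr_ge0;
    repeat (apply: mulr_ge0 || apply: exprn_ge0 || apply: expR_ge0) => //.
have [n1 hn1] := small_inv_sqrt ce0 e3.
have A0 : 0 <= (2 ^ m)%:R * ku / ze ^+ 4 := divr_ge0 (mulr_ge0 (ler0n _ _) ku0) (ltW (exprn_gt0 4 ze0)).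
have [n2 hn2] := small_inv_sqrt A0 e6.
exists (maxn n1 n2), dl; split => // d d' T E Q P Y F N b G n mY indY lawY CS pG bG cl1 nn n0 exceeds.
have [n1n n2n] : (n1 <= n)%N /\ (n2 <= n)%N by move: nn; rewrite geq_max => /andP[].
have [e1 _] := hn1 n n1n n0; have [_ e2] := hn2 n n2n n0.
have mE a : measurable (exceeds a) by exact: (meas_score_sup mY CS pG bG).
have mono a a' : a <= a' -> fine (Q (exceeds a')) <= fine (Q (exceeds a)).
  by move=> aa; apply: pr_le => // w [u u01 h]; exists u => //; exact: le_lt_trans h.
have mBs a : measurable [set w | a < bsup B w].
  by rewrite (bsup_gtE hB); apply: bigcup_measurable => ? _; exact: (meas_grid hB).
split.
  have a0 : 0 <= x + k1 by lra.
  have := grid_le_score mY indY lawY CS pG bG cl1 n0 hB eta0 M0 jet a0.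
  have := hm1 m (leq_maxl _ _); have := mono (x + dl) (x + k1 - 3 * eta).
  have h0 : x + dl <= x + k1 - 3 * eta by clear -d1 et1; lra.
  move=> /(_ h0) h1 h2 h3; rewrite -/(exceeds _) in h3.
  by clear -h1 h2 h3 hk1 e1; lra.
have y0 : 0 <= x - 2 * ze by rewrite /ze; lra.
have := score_le_grid mY indY lawY CS pG bG cl1 n0 hB eta0 M0 jet y0 ze0.
have -> : x - 2 * ze + ze = x - ze by lra.
have h1 : fine (Q (exceeds (x - dl))) <= fine (Q (exceeds (x - ze))) by apply: mono; rewrite lerD2l lerN2.
have h2 : fine (PB (grid_gt B m (x - 2 * ze - 3 * eta))) <= fine (PB [set w | x < bsup B w]) + eps / 3.
  have mI : measurable [set w | x - k2' < bsup B w <= x].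
    have -> : [set w | x - k2' < bsup B w <= x] = [set w | x - k2' < bsup B w] `\` [set w | x < bsup B w].
      by apply/seteqP; split => w /=; [move=> /andP[h h']; split => //; apply/negP; rewrite -leNgt
        | move=> [h /negP]; rewrite -leNgt h].
    exact: measurableD.
  apply: (le_trans (pr_le_U PB (meas_grid hB _ _) (mBs x) mI _)); last by rewrite lerD2l.
  move=> w wg; have : x - k2' < bsup B w.
    have : [set w | x - 2 * ze - 3 * eta < bsup B w] w by rewrite (bsup_gtE hB); exists m.
    by apply: le_lt_trans; rewrite /ze in et2 *; lra.
  by move=> h; case: (leP (bsup B w) x) => h'; [right; rewrite /= h | left].
have h3 : (2 ^ m)%:R * ((3 / (2 ^ m)%:R ^+ 2 + ku / n%:R) / ze ^+ 4) =
    3 / (2 ^ m)%:R / ze ^+ 4 + (2 ^ m)%:R * ku / ze ^+ 4 / n%:R.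
  have kn : (2 ^ m)%:R != 0 :> R by rewrite pnatr_eq0 -lt0n expn_gt0.
  by field; rewrite kn !gt_eqF// ltr0n.
have h4 := hm2 m (leq_maxr _ _).
rewrite -/(exceeds _) -/ku h3 => h5; clear -h1 h2 h4 h5 e1 e2; lra.
Qed.

(** * Good events on one fold *)

Lemma meas_gtset {d} {T : measurableType d} {R : realType} (X : T -> R) (x : R) :
  meas X -> measurable [set w | x < X w].
Proof.
move=> mX; have -> : [set w | x < X w] = ~` [set w | X w <= x].
  by apply/seteqP; split => w /=; [rewrite ltNge => /negP | move=> /negP; rewrite -ltNge].
by apply: measurableC; exact: meas_leset.
Qed.

Lemma Ex_tail {d} {T : measurableType d} {R : realType} (Q : probability T R) (X : T -> R) (a B : R) :
  integ Q X -> (forall w, 0 <= X w) -> 0 < a -> \int[Q]_w X w <= B ->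
  measurable [set w | a < X w] /\ fine (Q [set w | a < X w]) <= a^-1 * B.
Proof.
move=> iX X0 a0 EX; have mA := meas_gtset a (integ_meas iX).
split => //; rewrite mulrC ler_pdivlMr// mulrC.
by apply: le_trans EX; apply: Ex_markov => // w; exact: ltW.
Qed.

(** Cauchy-Schwarz through |f| <= (f^2 / a + a) / 2. One bound holds for every t, which controls the
    supremum over t of the orthogonal remainder. *)
Lemma leb01_sqr {R : realType} (f : R -> R) (a : R) (t : R) : 0 < a -> integ (@leb01 R) (fun s => (s <= t)%R%:R * f s) ->
  integ (@leb01 R) (fun s => f s ^+ 2) -> \int[@leb01 R]_s (f s ^+ 2) <= a ^+ 2 ->
  `|\int[@leb01 R]_s ((s <= t)%R%:R * f s)| <= a.
Proof.
move=> a0 i1 i2 h; apply: (le_trans (abs_Ex i1)).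
apply: (@le_trans _ _ (\int[@leb01 R]_s (2^-1 * (a^-1 * f s ^+ 2 + a)))).
  apply: le_Ex => [||s]; [exact: integ_abs | exact/integZ/integD/integ_cst/integZ |].
  apply: (@le_trans _ _ `|f s|); first by case: (s <= t); rewrite ?mul1r// mul0r normr0.
  rewrite -subr_ge0; have -> : 2^-1 * (a^-1 * f s ^+ 2 + a) - `|f s| = 2^-1 * a^-1 * (`|f s| - a) ^+ 2.
    by rewrite -(real_normK (num_real (f s))); field; rewrite gt_eqF.
  by rewrite mulr_ge0 ?sqr_ge0// mulr_ge0// invr_ge0 ltW.
rewrite (ExZ _ (integD (integZ _ i2) (integ_cst _ a))) (ExD (integZ _ i2) (integ_cst _ a)) (ExZ _ i2) Ex_cst.
have : a^-1 * \int[@leb01 R]_s (f s ^+ 2) <= a.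
  by rewrite mulrC ler_pdivrMr// -expr2.
lra.
Qed.

(** The ideal weight h/g fails when g or h is 0, so both are shifted by 1/s; the result is 2 s g h +
    g + h, at most 4 e. *)
Lemma balanced_error {R : realFieldType} (s g h e g2 h2 : R) : 0 < s -> 0 <= g -> g <= e -> 0 <= h -> h <= e ->
  g2 <= g ^+ 2 -> h2 <= h ^+ 2 -> s * g * h <= e -> exists2 a, 0 < a & s * (a * g2 + a^-1 * h2) <= 4 * e.
Proof.
move=> s0 g0 ge h0 he hg hh sgh; have si : 0 < s^-1 by rewrite invr_gt0.
have hs : 0 < h + s^-1 by rewrite ltr_wpDl.
have gs : 0 < g + s^-1 by rewrite ltr_wpDl.
exists ((h + s^-1) / (g + s^-1)); first exact: divr_gt0.
have k (x y : R) : 0 <= x -> 0 < x + s^-1 -> 0 < y -> y / (x + s^-1) * x ^+ 2 <= y * x.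
  move=> x0 xs y0; rewrite -mulrA ler_wpM2l ?(ltW y0)// mulrC ler_pdivrMr// expr2 ler_wpM2l// lerDl ltW//.
have k1 := le_trans (ler_wpM2l (ltW (divr_gt0 hs gs)) hg) (k _ _ g0 gs hs).
have k2 := le_trans (ler_wpM2l (ltW (divr_gt0 gs hs)) hh) (k _ _ h0 hs gs).
rewrite invf_div; apply: (le_trans (ler_wpM2l (ltW s0) (lerD k1 k2))).
have -> : s * ((h + s^-1) * g + (g + s^-1) * h) = 2 * (s * g * h) + (g + h) by field; rewrite gt_eqF.
lra.
Qed.

Section fold_good.
Context {d d'} {T : measurableType d} {E : measurableType d'} {R : realType}.
Context (Q : probability T R) (P : probability E R) (Y : option nat -> T -> E).
Hypotheses (mY : forall i, meas (Y i)) (indY : mutually_independent Q Y).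
Hypothesis lawY : has_law Q P Y.
Context (F : R -> set_system E) (N : E -> cumulative R R) (b : R -> E -> R) (C : R).
Hypothesis CS : counting_setup P F N b C.
Context {n : nat} (D J : {set 'I_n}) (DJ : forall i, i \in J -> i \notin D).
Context (G : R -> E -> R) (c' : R) (Gh lh : n.-tuple E -> R -> E -> R).
Hypotheses (pG : pred F G) (bG : forall s e, `|G s e| <= c').
Hypotheses (fGh : frozen F D Gh c') (flh : frozen F D lh C).
Hypothesis ort : forall x s, \int[P]_e (G s e * (b s e - lh x s e)) = 0.
Local Notation jsum := (jsum N).
Local Notation mart := (mart N b).
Local Notation data := (@sample_tuple _ _ T E Y n).
Local Notation Yj j w := (Y (Some (val j)) w).
Local Notation prod x s e := ((Gh x s e - G s e) * (b s e - lh x s e)).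
Local Notation cross x s e := (G s e * (b s e - lh x s e)).
Local Notation prod_err w := (\sum_(j in J) tint (fun s e => `|prod (data w) s e|) (Yj j w)).
Local Notation orth_err wt w := (\int[leb01]_s ((\sum_(j in J) wt * cross (data w) s (Yj j w)) ^+ 2)).
Local Notation sqr_err w := (\sum_(j in J) jsum (fun s e => `|Gh (data w) s e ^+ 2 - G s e ^+ 2|) (Yj j w)).
Let fF := cs_fil CS.
Let C0 : 0 <= C := cs_ge0 CS.
Let c'0 : 0 <= c' := le_trans (normr_ge0 _) (bG 0 point).
Let V := \int[P]_e jsum (fun s e => G s e ^+ 2) e.

(** The integral of one observation as decomposed in [fold_representation]. *)
Definition contribution (j : 'I_n) w (t : R) := mart (Gh (data w)) t (Yj j w) +
  tint (fun s e => (s <= t)%R%:R * (Gh (data w) s e * (b s e - lh (data w) s e))) (Yj j w).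

Definition fold_good (wt sn eta : R) w :=
  (forall t, 0 <= t <= 1 ->
    `|\sum_(j in J) (wt * contribution j w t - sn * mart G t (Yj j w))| <= 3 * eta) /\
  `|\sum_(j in J) (jsum (fun s e => Gh (data w) s e ^+ 2) (Yj j w) - V)| <= #|J|%:R * (2 * eta).

(** The deterministic part. The drift Gh (b - lh) is split as (Gh - G)(b - lh) + G (b - lh), a
    product of two errors and a term that is orthogonal by the residual property. *)
Let good_of_bounds (wt sn eta : R) w : 0 < eta -> 0 <= wt ->
  (forall t, 0 <= t <= 1 ->
    `|\sum_(j in J) mart (fun s e => wt * Gh (data w) s e - sn * G s e) t (Yj j w)| <= eta) ->
  wt * prod_err w <= eta ->
  orth_err wt w <= eta ^+ 2 ->
  sqr_err w <= #|J|%:R * eta ->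
  `|\sum_(j in J) (jsum (fun s e => G s e ^+ 2) (Yj j w) - V)| <= #|J|%:R * eta ->
  fold_good wt sn eta w.
Proof.
move=> eta0 wt0 h1 h2 h3 h4 h5; set x := data w.
have pGx := fz_pred fGh x; have plx := fz_pred flh x.
have bGx := fz_bound fGh x; have blx := fz_bound flh x.
have pD H K : pred F H -> pred F K -> pred F (fun s e => H s e - K s e).
  move=> pH pK; have := predD pH (predZ fF (-1) pK); congr (pred F _).
  by apply/funext => s; apply/funext => e; rewrite mulN1r.
have pbl := pD _ _ (cs_pred CS) plx; have pGG := pD _ _ pGx pG.
have bbl s e : `|b s e - lh x s e| <= C + C.
  by apply: (le_trans (ler_normB _ _)); apply: lerD => //; exact: (cs_bound CS).
have bGG s e : `|Gh x s e - G s e| <= c' + c' by apply: (le_trans (ler_normB _ _)); exact: lerD.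
split; last first.
  have -> : \sum_(j in J) (jsum (fun s e => Gh x s e ^+ 2) (Yj j w) - V) =
    \sum_(j in J) jsum (fun s e => Gh x s e ^+ 2 - G s e ^+ 2) (Yj j w) +
    \sum_(j in J) (jsum (fun s e => G s e ^+ 2) (Yj j w) - V).
    by rewrite -big_split; apply: eq_bigr => j _ /=; rewrite /Submission.jsum sumrB; ring.
  apply: (le_trans (ler_normD _ _));
  have -> : #|J|%:R * (2 * eta) = #|J|%:R * eta + #|J|%:R * eta by ring.
  apply: lerD => //; apply: le_trans h4; by apply: norm_sum_le => j _; exact: ler_norm_sum.
move=> t t01.
pose u1 (j : 'I_n) s := (s <= t)%R%:R * (prod x s (Yj j w)).
pose u2 (j : 'I_n) s := (s <= t)%R%:R * (wt * cross x s (Yj j w)).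
have i1 (j : 'I_n) : integ (@leb01 R) (u1 j).
  exact: (integ_pred fF (pred_upto CS t (predM pGG.1 pbl)) (fun s => maskM_le _ (norm_leM (bGG s (Yj j w)) (bbl s (Yj j w))))).
have pGl := predM pG.1 pbl.
have i2' (j : 'I_n) : integ (@leb01 R) (fun s => (s <= t)%R%:R * cross x s (Yj j w)).
  exact: (integ_pred fF (pred_upto CS t pGl) (fun s => maskM_le _ (norm_leM (bG s (Yj j w)) (bbl s (Yj j w))))).
have i2 (j : 'I_n) : integ (@leb01 R) (u2 j).
  have := integZ wt (i2' j); congr (integrable _ _ (EFin \o _)); apply/funext => s; rewrite /u2; ring.
(* The three remainders of one observation: martingale, product of errors, orthogonal term. *)
have e (j : 'I_n) : wt * contribution j w t - sn * mart G t (Yj j w) =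
    mart (fun s e => wt * Gh x s e - sn * G s e) t (Yj j w) + wt * \int[leb01]_s u1 j s + \int[leb01]_s u2 j s.
  have pu r H : pred F H -> pred F (fun s e => (s <= r)%R%:R * H s e) by move=> pH; exact: (pred_upto CS r pH).
  have -> : mart (fun s e => wt * Gh x s e - sn * G s e) t (Yj j w) = wt * mart (Gh x) t (Yj j w) - sn * mart G t (Yj j w).
    have b1 s : `|(s <= t)%R%:R * Gh x s (Yj j w)| <= c' by exact: maskM_le.
    have b2 s : `|(s <= t)%R%:R * G s (Yj j w)| <= c' by exact: maskM_le.
    rewrite /Submission.mart -mulNr -(mintZ CS wt (pu t _ pGx) b1) -(mintZ CS (- sn) (pu t _ pG) b2).
    rewrite -(mintD CS (e := Yj j w) (predZ fF wt (pu t _ pGx)) (predZ fF (- sn) (pu t _ pG))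
      (fun s => norm_leM (lexx `|wt|) (b1 s)) (fun s => norm_leM (lexx `|- sn|) (b2 s))).
    congr (Submission.mint _ _ _ _); apply/funext => s; apply/funext => e; ring.
  have -> : \int[leb01]_s u2 j s = wt * \int[leb01]_s ((s <= t)%R%:R * cross x s (Yj j w)).
    by rewrite -(ExZ _ (i2' j)); apply: eq_Ex => s; rewrite /u2; ring.
  have -> : contribution j w t = mart (Gh x) t (Yj j w) + (\int[leb01]_s u1 j s +
      \int[leb01]_s ((s <= t)%R%:R * cross x s (Yj j w))).
    rewrite /contribution -(ExD (i1 j) (i2' j)); congr (_ + _); apply: eq_Ex => s; rewrite /u1; ring.
  ring.
rewrite (eq_bigr _ (fun j _ => e j)) big_split big_split/=.
have -> : 3 * eta = eta + eta + eta by ring.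
apply: (le_trans (ler_normD _ _)); apply: lerD; first (apply: (le_trans (ler_normD _ _)); apply: lerD).
- exact: h1.
- apply: le_trans h2; rewrite -mulr_sumr normrM ger0_norm// ler_wpM2l//.
  apply: norm_sum_le => j _; apply: (le_trans (abs_Ex (i1 j))).
  apply: le_Ex => [||s]; first exact: integ_abs.
    have h : integ (@leb01 R) (fun s => prod x s (Yj j w)).
      exact: (integ_pred fF (predM pGG.1 pbl) (fun s => norm_leM (bGG s (Yj j w)) (bbl s (Yj j w)))).
    exact: (integ_abs h).
  by rewrite /u1; case: (s <= t); rewrite ?mul1r// mul0r normr0.
- pose f s := \sum_(j in J) wt * cross x s (Yj j w).
  have mf : meas f.
    rewrite /f; under eq_fun do rewrite big_mkcond; apply: measurable_sum => j; case: (j \in J) => //.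
    by apply: mfunM => //; exact: (meas_pred1 fF (Yj j w) pGl).
  have bf s : `|f s| <= \sum_(j in J) `|wt| * (c' * (C + C)).
    by apply: norm_sum_le => j _; apply: norm_leM => //; exact: norm_leM.
  have eqf : \sum_(j in J) \int[leb01]_s u2 j s = \int[leb01]_s ((s <= t)%R%:R * f s).
    by rewrite -(Ex_sum _ _ i2); apply: eq_Ex => s; rewrite /f mulr_sumr.
  rewrite eqf; apply: leb01_sqr h3 => //.
    apply: integ_bnd; last by move=> s; apply: maskM_le; exact: bf.
    by apply: mfunM => //; apply: mb2r; exact: mfun_ler.
  apply: integ_bnd; first exact: mfunX.
  by move=> s; rewrite normrX; apply: lerXn2r (bf s); rewrite nnegrE// (le_trans (normr_ge0 _) (bf s)).
Qed.

(** Adds the coefficients of the five exceptional events in [fold_good_event]; it is free of n and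
    of the parameter. *)
Definition fold_const (eta : R) : R :=
  (eta ^+ 2)^-1 * (C * (4 + 2 * c' ^+ 2) + 2 * c' ^+ 2 + c' ^+ 4 * moment_bound C 2) + eta^-1 * (4 + 2 * (C * c')).

Let g2 := \int[Q]_w err2 P Gh (fun _ => G) (data w).
Let h2 := \int[Q]_w err2 P (fun _ => b) lh (data w).

(** One exceptional event for each hypothesis of [good_of_bounds], bounded by Doob's inequality for
    the martingale remainder and by Markov's or Chebyshev's for the others. *)
Lemma fold_good_event (wt sn eta e g h : R) : 0 < eta -> 0 < e <= 1 -> (0 < #|J|)%N -> 0 <= wt ->
  g2 <= g ^+ 2 -> h2 <= h ^+ 2 -> 0 <= g <= e -> 0 <= h <= e -> Num.sqrt #|J|%:R * g * h <= e ->
  #|J|%:R * wt ^+ 2 <= 2 -> #|J|%:R * (wt - sn) ^+ 2 <= e -> #|J|%:R^-1 <= e ->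
  exists A, [/\ measurable A, fine (Q A) <= fold_const eta * e & forall w, ~ A w -> fold_good wt sn eta w].
Proof.
move=> eta0 /andP[e0 e1] J0 wt0 hg hh /andP[g0 ge] /andP[h0 he] gh wJ ws Je.
have Jr : 0 < #|J|%:R :> R by rewrite ltr0n.
have c2 : 0 <= c' ^+ 2 by exact: sqr_ge0.
have ee : e ^+ 2 <= e by rewrite expr2 -[leRHS]mulr1 ler_wpM2l// ltW.
have ge2 : g2 <= e by apply: (le_trans hg); apply: le_trans ee; rewrite lerXn2r ?nnegrE// ltW.
have he2 : h2 <= e by apply: (le_trans hh); apply: le_trans ee; rewrite lerXn2r ?nnegrE// ltW.
have eta2 : 0 < eta ^+ 2 by exact: exprn_gt0.
have tail (x B : R) : eta ^+ 2 * x <= B -> x <= (eta ^+ 2)^-1 * B by move=> hx; rewrite mulrC ler_pdivlMr// mulrC.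
have [m1 q1] := fold_martingale_error mY indY lawY CS DJ pG bG fGh wt sn eta0.
set A1 := [set w | exists2 t, _ & _] in m1 q1.
have {}q1 : fine (Q A1) <= (eta ^+ 2)^-1 * (C * (4 + 2 * c' ^+ 2) * e).
  apply/tail/(le_trans q1); rewrite -/g2.
  have -> : #|J|%:R * C * (2 * wt ^+ 2 * g2 + 2 * (wt - sn) ^+ 2 * c' ^+ 2) =
    C * (2 * ((#|J|%:R * wt ^+ 2) * g2) + 2 * c' ^+ 2 * (#|J|%:R * (wt - sn) ^+ 2)) by ring.
  rewrite -[leRHS]mulrA ler_wpM2l// [leRHS]mulrDl; apply: lerD; last by rewrite ler_wpM2l// mulr_ge0.
  have : #|J|%:R * wt ^+ 2 * g2 <= 2 * e.
    exact: le_trans (ler_wpM2l (mulr_ge0 (ler0n _ _) (sqr_ge0 wt)) ge2) (ler_wpM2r (ltW e0) wJ).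
  lra.
pose sJ := Num.sqrt #|J|%:R : R; have sJ0 : 0 < sJ by rewrite sqrtr_gt0.
have sJ2 : sJ ^+ 2 = #|J|%:R by rewrite sqr_sqrtr// ltW.
have [a a0 ha] := balanced_error sJ0 g0 ge h0 he hg hh gh.
have [i2 q2] := fold_product_error mY indY lawY CS DJ pG bG fGh flh a0.
have [m2 {}q2] : measurable [set w | eta < wt * prod_err w] /\
    fine (Q [set w | eta < wt * prod_err w]) <= eta^-1 * (4 * e).
  apply: (Ex_tail (integZ wt i2)) => // [w|].
    by rewrite mulr_ge0// sumr_ge0// => j _; apply: ge0_Ex.
  rewrite (ExZ wt i2); apply: (le_trans (ler_wpM2l wt0 q2)); rewrite -/g2 -/h2.
  have k3 : wt * sJ <= 2.
    rewrite -ler_sqr ?nnegrE ?mulr_ge0 ?(ltW sJ0)// exprMn sJ2 mulrC; apply: (le_trans wJ).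
    by rewrite expr2 ler_peMl// ler1n.
  have -> : wt * (#|J|%:R * (2^-1 * (a * g2 + a^-1 * h2))) = 2^-1 * (wt * sJ) * (sJ * (a * g2 + a^-1 * h2)).
    by rewrite -sJ2; ring.
  apply: (@le_trans _ _ (2^-1 * 2 * (4 * e))); last by rewrite mulVf ?mul1r.
  apply: (@le_trans _ _ (2^-1 * (wt * sJ) * (4 * e))).
    by rewrite ler_wpM2l// mulr_ge0// mulr_ge0// ltW.
  by rewrite ler_wpM2r ?mulr_ge0 ?(ltW e0)// ler_wpM2l.
have [i3 q3] := fold_orthogonal_error mY indY lawY CS DJ pG bG flh ort wt.
have [m3 {}q3] : measurable [set w | eta ^+ 2 < orth_err wt w] /\
    fine (Q [set w | eta ^+ 2 < orth_err wt w]) <= (eta ^+ 2)^-1 * (2 * c' ^+ 2 * e).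
  apply: (Ex_tail i3) => // [w|]; first by apply: ge0_Ex => s; exact: sqr_ge0.
  apply: (le_trans q3); rewrite -/h2 (mulrC (wt ^+ 2)).
  apply: (@le_trans _ _ (#|J|%:R * wt ^+ 2 * c' ^+ 2 * e)).
    by rewrite ler_wpM2l// !mulr_ge0// sqr_ge0.
  by rewrite ler_wpM2r ?(ltW e0)// ler_wpM2r.
have [i4 q4] := fold_variance_error mY indY lawY CS DJ pG bG fGh e0.
have Je0 : 0 < #|J|%:R * eta by exact: mulr_gt0.
have [m4 {}q4] : measurable [set w | #|J|%:R * eta < sqr_err w] /\
    fine (Q [set w | #|J|%:R * eta < sqr_err w]) <= (#|J|%:R * eta)^-1 * (#|J|%:R * (2 * (C * c') * e)).
  apply: (Ex_tail i4) => // [w|]; first by apply: sumr_ge0 => j _; exact: sumr_ge0.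
  have hg2 : e^-1 * g2 <= e.
    by rewrite mulrC ler_pdivrMr// -expr2; apply: (le_trans hg); rewrite lerXn2r ?nnegrE// ltW.
  apply: (le_trans q4); rewrite (_ : 2 * (C * c') * e = C * c' * (e + e)); last by ring.
  by apply: (ler_wpM2l (ler0n _ _)); apply: (ler_wpM2l (mulr_ge0 C0 c'0)); rewrite lerD2l.
have [m5 q5] := fold_variance_lln mY indY lawY CS D J pG bG Je0.
set A5 := [set w | #|J|%:R * eta < `|_|] in m5 q5.
have {}q5 : fine (Q A5) <= (eta ^+ 2)^-1 * (c' ^+ 4 * moment_bound C 2 * e).
  apply: tail; have J2 : 0 < #|J|%:R ^+ 2 :> R by exact: exprn_gt0.
  rewrite -(ler_pM2l J2) mulrA -exprMn; apply: (le_trans q5).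
  have -> : #|J|%:R ^+ 2 * (c' ^+ 4 * moment_bound C 2 * e) = #|J|%:R * (c' ^+ 4 * moment_bound C 2) * (e * #|J|%:R) by ring.
  rewrite -[leLHS]mulr1 ler_wpM2l ?mulr_ge0 ?moment_bound_ge0 ?exprn_ge0//.
  by move: Je; rewrite -[X in X <= _]mul1r ler_pdivrMr.
set A2 := [set w | _] in m2 q2; set A3 := [set w | _] in m3 q3; set A4 := [set w | _] in m4 q4.
exists (A1 `|` (A2 `|` (A3 `|` (A4 `|` A5)))).
have m45 := measurableU _ _ m4 m5; have m345 := measurableU _ _ m3 m45; have m2345 := measurableU _ _ m2 m345.
split; first exact: measurableU.
  have u1 := pr_U Q m1 m2345; have u2 := pr_U Q m2 m345; have u3 := pr_U Q m3 m45; have u4 := pr_U Q m4 m5.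
  have e4 : (#|J|%:R * eta)^-1 * (#|J|%:R * (2 * (C * c') * e)) = eta^-1 * (2 * (C * c')) * e.
    by field; rewrite !gt_eqF.
  have -> : fold_const eta * e = (eta ^+ 2)^-1 * (C * (4 + 2 * c' ^+ 2) * e) + (eta^-1 * (4 * e) +
    ((eta ^+ 2)^-1 * (2 * c' ^+ 2 * e) + (eta^-1 * (2 * (C * c')) * e + (eta ^+ 2)^-1 * (c' ^+ 4 * moment_bound C 2 * e)))).
    by rewrite /fold_const; ring.
  rewrite e4 in q4.
  apply: (le_trans u1); apply: lerD => //; apply: (le_trans u2); apply: lerD => //.
  by apply: (le_trans u3); apply: lerD => //; apply: (le_trans u4); exact: lerD.
move=> w nA; have nle (x y : R) : ~ (x < y) -> y <= x by move/negP; rewrite -leNgt.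
apply: good_of_bounds => // [t t01||||]; apply: nle => h'; apply: nA; rewrite /=.
- by left; exists t.
- by right; left.
- by right; right; left.
- by do 3 right; left.
- by do 4 right.
Qed.

End fold_good.

(** Since d1 <= V, the variance estimate lies between V (1 - a) and V (1 + a), and so does its root
    relative to sqrt V because 1 - a <= sqrt(1 - a) and sqrt(1 + a) <= 1 + a. The loss in the level
    is x a plus the error of the numerator. *)
Lemma ratio_transfer {R : realType} (V Vh d1 a rho x dl gn s : R) : 0 < d1 -> d1 <= V -> `|Vh - V| <= d1 * a ->
  0 <= a -> a <= 2^-1 -> 0 <= x -> `|gn - s| <= rho -> x * a + rho / Num.sqrt d1 <= dl ->
  [/\ 0 < Vh, x * Num.sqrt Vh < `|gn| -> x - dl < `|s| / Num.sqrt V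
    & x + dl < `|s| / Num.sqrt V -> x * Num.sqrt Vh < `|gn|].
Proof.
move=> d0 dV hV a0 a1 x0 hg hd; have V0 : 0 < V := lt_le_trans d0 dV.
have sV0 : 0 < Num.sqrt V by rewrite sqrtr_gt0.
have sd0 : 0 < Num.sqrt d1 by rewrite sqrtr_gt0.
have sdV : Num.sqrt d1 <= Num.sqrt V by rewrite ler_sqrt// ltW.
have rho0 : 0 <= rho := le_trans (normr_ge0 _) hg.
have daV : d1 * a <= V * a by rewrite ler_wpM2r.
have [V1 V2] : V * (1 - a) <= Vh /\ Vh <= V * (1 + a).
  by move: hV; rewrite ler_norml => /andP[h1 h2]; split; lra.
have Vh0 : 0 < Vh by apply: lt_le_trans V1; rewrite mulr_gt0//; lra.
have p1 : 0 <= 1 - a by lra.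
have p2 : 0 <= 1 + a by lra.
have s1 : Num.sqrt V * (1 - a) <= Num.sqrt Vh.
  rewrite -[X in _ * X](ger0_norm p1) -sqrtr_sqr -sqrtrM ?(ltW V0)// ler_sqrt ?(ltW Vh0)//.
  by apply: le_trans V1; rewrite ler_wpM2l ?(ltW V0)// expr2 ler_piMl//; lra.
have s2 : Num.sqrt Vh <= Num.sqrt V * (1 + a).
  rewrite -[X in _ * X](ger0_norm p2) -sqrtr_sqr -sqrtrM ?(ltW V0)// ler_sqrt; last first.
    by rewrite mulr_ge0 ?(ltW V0)// sqr_ge0.
  by apply: (le_trans V2); rewrite ler_wpM2l ?(ltW V0)// expr2 ler_peMl//; lra.
have rV : rho <= Num.sqrt V * (dl - x * a).
  apply: (@le_trans _ _ (Num.sqrt V * (rho / Num.sqrt d1))).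
    by rewrite mulrCA ler_peMr// ler_pdivlMr// mul1r.
  by rewrite ler_wpM2l ?(ltW sV0)//; lra.
have [g1 g2] : `|gn| <= `|s| + rho /\ `|s| <= `|gn| + rho.
  have h1 := ler_normD (gn - s) s; have h2 := ler_normD (s - gn) gn.
  by rewrite !subrK (distrC s) in h1 h2; split; lra.
have xs1 := ler_wpM2l x0 s1; have xs2 := ler_wpM2l x0 s2.
split => // h; [rewrite ltr_pdivlMr// | rewrite ltr_pdivlMr// in h].
- have : (x - dl) * Num.sqrt V = x * (Num.sqrt V * (1 - a)) - Num.sqrt V * (dl - x * a) by ring.
  by clear -h g1 xs1 rV; lra.
- have : (x + dl) * Num.sqrt V = x * (Num.sqrt V * (1 + a)) + Num.sqrt V * (dl - x * a) by ring.
  by clear -h g2 xs2 rV; lra.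
Qed.

Lemma fold_partition_sum {R : realType} {n K : nat} (J : 'I_K -> {set 'I_n}) (f : 'I_n -> R) :
  is_fold_partition J -> \sum_k \sum_(j in J k) f j = \sum_j f j.
Proof.
move=> hJ; rewrite (exchange_big_dep predT)//=; apply: eq_bigr => j _.
have [k [jk uk]] := hJ j; rewrite (big_pred1 k)// => k' /=.
by apply/idP/eqP => [/uk ->//|->].
Qed.

(** * The test statistic with truncated estimates *)

Section statistic.
Context {d d'} {T : measurableType d} {E : measurableType d'} {R : realType}.
Context (Y : option nat -> T -> E) (mY : forall i, meas (Y i)).
Context (P : probability E R) (F : R -> set_system E) (N : E -> cumulative R R) (b : R -> E -> R) (C : R).
Hypothesis CS : counting_setup P F N b C.
Context {n K : nat} (J : 'I_K -> {set 'I_n}) (c' : R) (Gh lh : 'I_K -> n.-tuple E -> R -> E -> R).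
Hypotheses (fGh : forall k, frozen F (~: J k) (Gh k) c') (flh : forall k, frozen F (~: J k) (lh k) C).
Local Notation jsum := (jsum N).
Local Notation mart := (mart N b).
Local Notation data := (@sample_tuple _ _ T E Y n).
Local Notation Yj j w := (Y (Some (val j)) w).
Local Notation con k := (contribution Y N b (Gh k) (lh k)).
Let fF := cs_fil CS.
Let pN := cs_path CS.
Let C0 : 0 <= C := cs_ge0 CS.

Definition gam w t := K%:R^-1 * \sum_(k < K) (#|J k|%:R^-1 * \sum_(j in J k) con k j w t).
Definition vhat w := K%:R^-1 * \sum_(k < K)
  (#|J k|%:R^-1 * \sum_(j in J k) jsum (fun s e => Gh k (data w) s e ^+ 2) (Yj j w)).
Definition statistic w := if vhat w == 0 then 0
  else Num.sqrt (n%:R / vhat w) * sup [set `|gam w t| | t in `[0, 1]%classic].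

Let mj D H c : frozen F D H c -> forall j : 'I_n, meas (fun w => jsum (H (data w)) (Yj j w)).
Proof.
move=> fH j; have h := meas_jsum_joint fF pN (cs_adapted CS) (fz_meas fH) (fun x s e => fz_zero x e fH).
apply: (mcomp h (_ : meas (fun w => (data w, Yj j w)))).
by apply: mpair => //; exact: meas_sample_tuple.
Qed.

Let mt D H c : frozen F D H c -> forall j : 'I_n, meas (fun w => tint (H (data w)) (Yj j w)).
Proof.
move=> fH j; apply: (mcomp (meas_tint_joint (fz_meas fH)) (_ : meas (fun w => (data w, Yj j w)))).
by apply: mpair => //; exact: meas_sample_tuple.
Qed.

Let fdl k : frozen F (~: J k) (fun x s e => Gh k x s e * (b s e - lh k x s e)) (c' * (C + C)).
Proof. exact: (frozenM (fGh k) (frozenB CS (frozen_cst CS (~: J k)%SET (cs_pred CS) (cs_bound CS)) (flh k))). Qed.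

Let msum (f : 'I_K -> 'I_n -> T -> R) : (forall k j, meas (f k j)) ->
  meas (fun w => K%:R^-1 * \sum_(k < K) (#|J k|%:R^-1 * \sum_(j in J k) f k j w)).
Proof.
move=> mf; apply: mfunM => //; apply: measurable_sum => k; apply: mfunM => //.
under eq_fun do rewrite big_mkcond; apply: measurable_sum => j; case: (j \in J k) => //; exact: mf.
Qed.

Lemma meas_gam t : meas (gam^~ t).
Proof.
have mf k (j : 'I_n) : meas (fun w => con k j w t).
  have fb := frozen_cst CS (~: J k)%SET (cs_pred CS) (cs_bound CS).
  have fu := frozen_upto CS t (fGh k).
  exact: mfunD (mfunB (mj fu j) (mt (frozenM fu fb) j)) (mt (frozen_upto CS t (fdl k)) j).
exact: (msum mf).
Qed.

Lemma meas_vhat : meas vhat.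
Proof.
have mf k (j : 'I_n) := mj (frozen_sqr (fGh k)) j.
exact: (msum mf).
Qed.

Let tint_rc H c e t : pred F H -> (bdd H c) ->
  tint (fun u e => (u <= s)%R%:R * H u e) e @[s --> t^'+] --> tint (fun u e => (u <= t)%R%:R * H u e) e.
Proof.
move=> pH bH; apply/cvg_at_rightP => u [pu up].
apply: (Ex_cvg (Y := fun=> c)) => [m||m v|v].
- apply: mfunM; last exact: (meas_pred1 fF e pH).
  by apply: mb2r; exact: mfun_ler.
- exact: integ_cst.
- exact: maskM_le.
- by apply: cvgMl; exact: cvg_indic_right.
Qed.

Lemma gam_rc w t : gam w s @[s --> t^'+] --> gam w t.
Proof.
apply/cvg_at_rightP => u pu; apply: cvgMr; apply: cvg_bigsum => k; apply: cvgMr.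
rewrite -big_enum /=; under eq_fun do rewrite -big_enum /=; apply: cvg_bigsum => j; apply: cvgD.
  have /cvg_at_rightP := mart_rc CS (e := Yj j w) (t := t) (fz_pred (fGh k) (data w)) (fz_bound (fGh k) (data w)).
  exact.
have /cvg_at_rightP := tint_rc (e := Yj j w) (t := t) (fz_pred (fdl k) (data w)) (fz_bound (fdl k) (data w)).
exact.
Qed.

Lemma gam_bounded w : exists M, forall t, 0 <= t <= 1 -> `|gam w t| <= M.
Proof.
exists (K%:R^-1 * \sum_(k < K) (#|J k|%:R^-1 *
  \sum_(j in J k) (c' * ((njump (N (Yj j w)))%:R + C) + c' * (C + C)))) => t _.
have ni (m : nat) : 0 <= m%:R^-1 :> R by rewrite invr_ge0.
rewrite normrM ger0_norm// ler_wpM2l//; apply: norm_sum_le => k _.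
rewrite normrM ger0_norm// ler_wpM2l//; apply: norm_sum_le => j _.
apply: norm_leD.
  by apply: (mint_le CS (e := Yj j w) (pred_upto CS t (fz_pred (fGh k) _))) => u; apply: maskM_le; exact: (fz_bound (fGh k)).
by apply: (tint_le fF (pred_upto CS t (fz_pred (fdl k) _))) => u; apply: maskM_le; exact: (fz_bound (fdl k)).
Qed.

Lemma vhat_ge0 w : 0 <= vhat w.
Proof.
rewrite mulr_ge0 ?invr_ge0// sumr_ge0// => k _; rewrite mulr_ge0 ?invr_ge0// sumr_ge0// => j _.
by apply: sumr_ge0 => i _; exact: sqr_ge0.
Qed.

(** [gam w] is bounded in t, so the supremum is a genuine one and is exceeded by x only if some
    value is. The conventional value 0 never exceeds x >= 0. *)
Lemma statistic_gtP x w : 0 <= x -> x < statistic w <->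
  0 < vhat w /\ exists2 t, 0 <= t <= 1 & x * Num.sqrt (vhat w) < `|Num.sqrt n%:R * gam w t|.
Proof.
move=> x0; rewrite /statistic; case: eqP => [->|/eqP v0].
  by split => [|[]]; rewrite ?ltxx// ltNge x0.
have {}v0 : 0 < vhat w by rewrite lt_neqAle eq_sym v0 vhat_ge0.
have sv0 : 0 < Num.sqrt (vhat w) by rewrite sqrtr_gt0.
have qE y : (x < Num.sqrt (n%:R / vhat w) * y) = (x * Num.sqrt (vhat w) < Num.sqrt n%:R * y).
  by rewrite sqrtrM ?ler0n// sqrtrV ?(ltW v0)// mulrAC ltr_pdivlMr.
set A := [set _ | _ in _]; rewrite qE.
have nE t : `|Num.sqrt n%:R * gam w t| = Num.sqrt n%:R * `|gam w t| by rewrite normrM (ger0_norm (sqrtr_ge0 _)).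
have [M hM] := gam_bounded w.
have hA : has_ubound A by exists M => _ [t t01 <-]; apply: hM; move: t01; rewrite /= in_itv.
split => [h|[_ [t t01]]]; last first.
  rewrite nE => /lt_le_trans; apply; rewrite ler_wpM2l ?sqrtr_ge0//.
  by apply: ub_le_sup => //; exists t => //=; rewrite in_itv.
split => //; apply: contrapT => hn; move: h; rewrite ltNge => /negP; apply.
have ht t : 0 <= t <= 1 -> Num.sqrt n%:R * `|gam w t| <= x * Num.sqrt (vhat w).
  by move=> t01; rewrite leNgt; apply/negP => h; apply: hn; exists t; rewrite ?nE.
have := sqrtr_ge0 (n%:R : R); rewrite le_eqVlt => /orP[/eqP <-|n0]; first by rewrite mul0r mulr_ge0 ?sqrtr_ge0.
rewrite mulrC -ler_pdivlMr//; apply: ge_sup.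
  by exists `|gam w 0|; exists 0 => //=; rewrite in_itv/= lexx ler01.
by move=> _ [t t01 <-]; rewrite ler_pdivlMr// mulrC ht//; move: t01; rewrite /= in_itv.
Qed.

Lemma meas_statistic_gt x : 0 <= x -> measurable [set w | x < statistic w].
Proof.
(* The inequality between the roots is squared and coded as the positivity of a process
   right-continuous in t, so that the dyadic argument gives measurability. *)
move=> x0; pose y t w := n%:R * gam w t ^+ 2 - x ^+ 2 * vhat w.
pose X t w := (0 < vhat w)%R%:R * (y t w + `|y t w|).
have XE t w : (0 < `|X t w|) = (0 < vhat w) && (x * Num.sqrt (vhat w) < `|Num.sqrt n%:R * gam w t|).
  rewrite normr_gt0 /X; case: (0 < vhat w); rewrite ?mul0r ?eqxx// mul1r /=.
  rewrite -[RHS]ltr_sqr ?nnegrE ?mulr_ge0 ?sqrtr_ge0// [X in _ = (X < _)]exprMn (sqr_sqrtr (vhat_ge0 w)).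
  rewrite real_normK ?num_real// [X in _ = (_ < X)]exprMn (sqr_sqrtr (ler0n R n)) -subr_gt0.
  rewrite -/(y t w); case: (ltP 0 (y t w)) => h; first by rewrite gtr0_norm// gt_eqF// addr_gt0.
  by rewrite ler0_norm// subrr eqxx.
have -> : [set w | x < statistic w] = [set w | exists2 t, 0 <= t <= 1 & 0 < `|X t w|].
  apply/seteqP; split => w /=; have [h1 h2] := statistic_gtP w x0.
    by move=> /h1[v0 [t t01 h]]; exists t => //; rewrite XE v0.
  by move=> [t t01]; rewrite XE => /andP[v0 h]; apply: h2; split => //; exists t.
have mv := meas_vhat.
have my t : meas (y t).
  apply: mfunB; last exact: mfunM.
  by apply: mfunM => //; apply: mfunX; exact: meas_gam.
have cy w t : y s w @[s --> t^'+] --> y t w.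
  apply: cvgB; last exact: cvg_cst.
  by apply: cvgMr; apply: cvgM; exact: gam_rc.
apply: meas_dyadic_sup => [t t01|w t t01]; last by apply: cvgMr; apply: cvgD (cvg_norm _).
apply: mfunM; first by apply: mb2r; exact: mfun_ltr.
by apply: mfunD => //; exact: (mcomp (@normr_measurable R setT) (my t)).
Qed.

(** In sqrt(n) gamma an observation of fold k has weight sqrt(n) / (K |J_k|), in the score n^(-1/2).
    The folds partition the sample, so the score is also summed fold by fold and the K errors add
    up. *)
Lemma statistic_approx (G : R -> E -> R) (eta : R) w : (0 < n)%N -> (0 < K)%N -> is_fold_partition J ->
  (forall k, (0 < #|J k|)%N) ->
  (forall k, fold_good P Y N b (J k) G (Gh k) (lh k) (Num.sqrt n%:R / (K%:R * #|J k|%:R)) (Num.sqrt n%:R)^-1 eta w) ->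
  (forall t, 0 <= t <= 1 -> `|Num.sqrt n%:R * gam w t - score Y N b G n t w| <= K%:R * (3 * eta)) /\
  `|vhat w - \int[P]_e jsum (fun s e => G s e ^+ 2) e| <= 2 * eta.
Proof.
move=> n0 K0 hJ J0 hg; have Kr : K%:R != 0 :> R by rewrite pnatr_eq0 -lt0n.
have Jr k : #|J k|%:R != 0 :> R by rewrite pnatr_eq0 -lt0n.
split=> [t t01|].
  have -> : score Y N b G n t w = \sum_k \sum_(j in J k) (Num.sqrt n%:R)^-1 * mart G t (Yj j w).
    by rewrite fold_partition_sum// /score mulr_sumr big_mkord.
  have -> : Num.sqrt n%:R * gam w t = \sum_(k < K) Num.sqrt n%:R / K%:R * (#|J k|%:R^-1 * \sum_(j in J k) con k j w t).
    by rewrite /gam mulrA mulr_sumr.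
  rewrite -sumrB; apply: (le_trans (ler_norm_sum _ _ _)).
  apply: (@le_trans _ _ (\sum_(k < K) 3 * eta)); last by rewrite sumr_cst.
  apply: ler_sum => k _; have [h _] := hg k; apply: le_trans (h t t01).
  rewrite mulrA mulr_sumr -sumrB le_eqVlt; apply/orP; left; apply/eqP; congr `|_|.
  by apply: eq_bigr => j _; congr (_ * _ - _); rewrite invfM mulrA.
set V := \int[P]_e _.
have -> : vhat w - V = K%:R^-1 * \sum_(k < K) (#|J k|%:R^-1 *
    \sum_(j in J k) (jsum (fun s e => Gh k (data w) s e ^+ 2) (Yj j w) - V)).
  under [in RHS]eq_bigr do rewrite sumrB mulrBr.
  rewrite sumrB [RHS]mulrBr; congr (_ - _); rewrite (eq_bigr (fun=> V)) ?sumr_cst ?mulKf// => k _.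
  by rewrite sumr_const -[V *+ _]mulr_natl mulKf.
rewrite normrM ger0_norm ?invr_ge0// mulrC ler_pdivrMr ?ltr0n//.
apply: (le_trans (ler_norm_sum _ _ _)).
apply: (@le_trans _ _ (\sum_(k < K) 2 * eta)); last by rewrite sumr_cst mulrC.
apply: ler_sum => k _; have [_ h] := hg k.
by rewrite normrM ger0_norm ?invr_ge0// mulrC ler_pdivrMr ?ltr0n// mulrC.
Qed.

End statistic.

Lemma limn_esup_le {R : realType} (u : nat -> \bar R) (l : R) :
  (forall e : R, 0 < e -> \forall n \near \oo, (u n <= (l + e)%:E)%E) -> (limn_esup u <= l%:E)%E.
Proof.
move=> h; apply/lee_addgt0Pr => e e0; rewrite -EFinD; have [n0 _ hn] := h e e0.
apply: (@le_trans _ _ (ereal_sup [set u n | n in [set n | (n0 <= n)%N]])).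
  by apply: ereal_inf_lbound; exists [set n | (n0 <= n)%N] => //; exists n0.
by apply: ge_ereal_sup => _ [n nn <-]; exact: hn.
Qed.

(** * From tail probabilities to Lipschitz test functions *)

Section step_functions.
Context {R : realType} (f : R -> R).
Hypothesis bl : bounded_lipschitz f.

(** The step function equals f(r h), where r counts the points h, 2h, ..., M h strictly below y. Up
    to M h the Lipschitz bound gives an error h; beyond it |f| <= 1 gives 2. *)
Lemma step_function_le h M y : 0 < h -> 0 <= y ->
  `|f y - (f 0 + \sum_(i < M) (f (i.+1%:R * h) - f (i%:R * h)) * (i.+1%:R * h < y)%R%:R)| <=
  h + 2 * (M%:R * h < y)%R%:R.
Proof.
move=> h0 y0; have [b l] := bl.
have [r [rM -> ry hr]] : exists r : nat, [/\ (r <= M)%N,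
    f 0 + \sum_(i < M) (f (i.+1%:R * h) - f (i%:R * h)) * (i.+1%:R * h < y)%R%:R = f (r%:R * h),
    r%:R * h <= y & y <= r.+1%:R * h \/ r = M].
  elim: M => [|M [r [rM e ry hr]]]; first by exists 0%N; rewrite big_ord0 addr0 mul0r; split => //; right.
  rewrite big_ord_recr addrA e /=; case: (ltP (M.+1%:R * h) y) => hy; last first.
    exists r; rewrite mulr0 addr0; split => //; first exact: leqW.
    by left; case: hr => // ->.
  have rM' : r = M.
    case: hr => // hr; apply/eqP; rewrite eqn_leq rM leqNgt; apply/negP => rl.
    by have := lt_le_trans hy hr; rewrite ltr_pM2r// ltr_nat ltnS ltnNge (ltnW rl).
  by exists M.+1; rewrite rM' mulr1 addrC subrK; split => //; [exact: ltW | right].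
case: hr => [hr|rE].
  apply: (le_trans (l _ _)); rewrite ger0_norm ?subr_ge0//.
  apply: (@le_trans _ _ h); last by rewrite lerDl mulr_ge0.
  by rewrite lerBlDl -[X in _ + X]mul1r -mulrDl natr1.
rewrite rE in ry *; move: ry; rewrite le_eqVlt => /orP[/eqP ->|->].
  by rewrite subrr normr0 addr_ge0 ?mulr_ge0 ?(ltW h0).
by rewrite mulr1; apply: (le_trans (ler_normB _ _)); have := b y; have := b (M%:R * h); lra.
Qed.

Lemma meas_bounded_lipschitz : meas f.
Proof.
have [_ l] := bl; apply: continuous_measurable_fun => x.
apply/cvgrPdist_le => e e0; near=> y; apply: (le_trans (l _ _)); near: y.
by apply: (@cvgr_dist_le _ _ _ _ _ id x).
Unshelve. all: end_near.
Qed.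

Context {d} {T : measurableType d} (Q : probability T R).

Lemma integ_bounded_lipschitz (X : T -> R) : meas X -> integ Q (fun w => f (X w)).
Proof.
move=> mX; have [b _] := bl; apply: (@integ_bnd _ _ _ _ _ 1) => //.
exact: mcomp meas_bounded_lipschitz mX.
Qed.

(** In this form the law of X enters only through finitely many tail probabilities. *)
Lemma step_approximation h M (X : T -> R) : 0 < h -> meas X -> (forall w, 0 <= X w) ->
  `|\int[Q]_w f (X w) - (f 0 + \sum_(i < M) (f (i.+1%:R * h) - f (i%:R * h)) *
     fine (Q [set w | i.+1%:R * h < X w]))| <= h + 2 * fine (Q [set w | M%:R * h < X w]).
Proof.
move=> h0 mX X0.
have mA x := meas_gtset x mX.
have bE x w : ((x < X w)%R%:R : R) = \1_[set w | x < X w] w.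
  by rewrite indicE; case: (boolP (x < X w)) => hx; [rewrite mem_set | rewrite memNset//; exact/negP].
pose D i := f (i.+1%:R * h) - f (i%:R * h).
have i1 (i : nat) : integ Q (fun w => D i * \1_[set w | i.+1%:R * h < X w] w) by exact/integZ/integ_indic.
have iS : integ Q (fun w => f 0 + \sum_(i < M) D i * \1_[set w | i.+1%:R * h < X w] w).
  by apply: (integD (integ_cst Q (f 0))); exact: integ_sum.
have iR : integ Q (fun w => h + 2 * \1_[set w | M%:R * h < X w] w).
  by apply: (integD (integ_cst Q h)); exact/integZ/integ_indic.
have eS : f 0 + \sum_(i < M) D i * fine (Q [set w | i.+1%:R * h < X w]) =
    \int[Q]_w (f 0 + \sum_(i < M) D i * \1_[set w | i.+1%:R * h < X w] w).
  rewrite (ExD (integ_cst Q (f 0)) (integ_sum _ _ _)) ?Ex_cst ?Ex_sum//.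
  by congr (_ + _); apply: eq_bigr => i _; rewrite (ExZ _ (integ_indic Q (mA _))) Ex_indic.
have eR : h + 2 * fine (Q [set w | M%:R * h < X w]) = \int[Q]_w (h + 2 * \1_[set w | M%:R * h < X w] w).
  by rewrite (ExD (integ_cst Q h) (integZ 2 (integ_indic Q (mA _)))) Ex_cst (ExZ _ (integ_indic Q (mA _))) Ex_indic.
have iX := integ_bounded_lipschitz mX.
rewrite eS eR -(ExB iX iS); apply: (le_trans (abs_Ex (integB iX iS))).
apply: le_Ex => // [|w]; first exact: integ_abs (integB iX iS).
rewrite -bE; under eq_bigr do rewrite -bE; exact: step_function_le.
Qed.

End step_functions.

(** Each weight is at most h, so M.+1 tail errors cost M.+1 h e; moving the last tail from Q to P
    costs another 2 e. *)
Lemma step_comparison {R : realType} {d d'} {T : measurableType d} {T' : measurableType d'} (Q : probability T R)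
    (P : probability T' R) (X : T -> R) (Z : T' -> R) (h e : R) (M : nat) (f : R -> R) : 0 < h -> 0 <= e ->
  meas X -> meas Z -> (forall w, 0 <= X w) -> (forall w, 0 <= Z w) ->
  (forall i, (i <= M)%N -> `|fine (Q [set w | i.+1%:R * h < X w]) - fine (P [set w | i.+1%:R * h < Z w])| <= e) ->
  bounded_lipschitz f ->
  `|\int[Q]_w f (X w) - \int[P]_w f (Z w)| <= 2 * h + 4 * fine (P [set w | M.+1%:R * h < Z w]) + (2 + M.+1%:R * h) * e.
Proof.
move=> h0 e0 mX mZ X0 Z0 he bl; have [b l] := bl.
have s1 := step_approximation bl Q M.+1 h0 mX X0; have s2 := step_approximation bl P M.+1 h0 mZ Z0.
set a1 := f 0 + _ in s1; set a2 := f 0 + _ in s2.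
have a12 : `|a1 - a2| <= M.+1%:R * h * e.
  rewrite /a1 /a2 opprD addrACA subrr add0r -sumrB; apply: (le_trans (ler_norm_sum _ _ _)).
  rewrite -mulrA -(sumr_cst M.+1); apply: ler_sum => i _; rewrite -mulrBr; apply: norm_leM; last by apply: he; rewrite -ltnS.
  by apply: (le_trans (l _ _)); rewrite -mulrBl -natrB// subSnn mul1r gtr0_norm.
have := he M (leqnn M); rewrite ler_norml => /andP[_ h2].
have -> : \int[Q]_w f (X w) - \int[P]_w f (Z w) = (\int[Q]_w f (X w) - a1) + (a1 - a2) + (a2 - \int[P]_w f (Z w)) by ring.
rewrite distrC in s2; apply: (le_trans (ler_normD _ _)); apply: (le_trans (lerD (ler_normD _ _) (lexx _))).
by lra.
Qed.

(** * Tightness and quantiles of the limit law *)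

Section brownian_quantile.
Context {dB} {TB : measurableType dB} {R : realType} (PB : probability TB R) (B : R -> TB -> R).
Hypothesis hB : standard_brownian_motion PB B.

Let mBs a : measurable [set w | a < bsup B w] := meas_gtset a (meas_bsup hB).

Lemma bsup_ge0 w : 0 <= bsup B w.
Proof.
have /(bsup_leP hB)/(_ 0) := lexx (bsup B w); rewrite lexx ler01 => /(_ isT).
exact: le_trans (normr_ge0 _).
Qed.

Lemma bsup_tight (e : R) : 0 < e -> \forall n \near \oo, fine (PB [set w | n%:R < bsup B w]) <= e.
Proof.
move=> e0; have i0 : \bigcap_n [set w | n%:R < bsup B w] = set0.
  apply/seteqP; split => // w h; have := h (Num.truncn (bsup B w)).+1 I; rewrite /= ltNge => /negP; apply.
  by apply: ltW; exact: truncnS_gt.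
have cv : fine (PB [set w | n%:R < bsup B w]) @[n --> \oo] --> 0.
  rewrite -[X in _ --> X](_ : fine (PB (\bigcap_n [set w | n%:R < bsup B w])) = 0); last by rewrite i0 measure0.
  apply: fine_cvg; rewrite fineK ?fin_num_measure//; last by rewrite i0.
  apply: nonincreasing_cvg_mu => //; first by rewrite (le_lt_trans (probability_le1 _ _)) ?ltry.
    by rewrite i0.
  by move=> n m nm; apply/subsetPset => w /=; apply: le_lt_trans; rewrite ler_nat.
have /cvgrPdist_le/(_ _ e0) := cv; apply: filterS => n /=.
by rewrite sub0r normrN ger0_norm ?pr_ge0.
Qed.

Context {dS} {TS : measurableType dS} (PS : probability TS R) (S : {RV PS >-> R}).
Hypothesis hS : forall A : set R, measurable A -> PS (S @^-1` A) = PB (bsup B @^-1` A).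

Let hgt x : PS [set w | x < S w] = PB [set w | x < bsup B w].
Proof.
have := hS (measurable_itv `]x, +oo[); congr (PS _ = PB _); apply/seteqP; split => w /=;
  by rewrite in_itv/= andbT.
Qed.

Lemma Ex_law_bsup (f : R -> R) : bounded_lipschitz f -> \int[PS]_w f (S w) = \int[PB]_w f (bsup B w).
Proof.
move=> bl; have mS : meas S by [].
have mf := meas_bounded_lipschitz bl.
have bf x : `|f x| <= 1 by have [] := bl.
have iD := @integ_bnd _ _ _ (distribution PS S) f 1 mf bf.
have [_ ->] := @Ex_law _ _ _ _ _ PS (distribution PS S) S mS (fun A mA => erefl) f iD.
by have [_ ->] := @Ex_law _ _ _ _ _ PB (distribution PS S) (bsup B) (meas_bsup hB) (fun A mA => esym (hS mA)) f iD.
Qed.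

(** z is positive because sup |B| > 0 has probability 1, more than alpha; this matters since tails
    converge at positive levels. The bound at the infimum itself follows from right continuity of
    the tail. *)
Lemma quantile_bsup (alpha : R) : 0 < alpha < 1 -> let z := quantile PS S (1 - alpha) in
  0 < z /\ fine (PB [set w | z < bsup B w]) <= alpha.
Proof.
move=> /andP[a0 a1] z; set A := [set x | ((1 - alpha)%:E <= PS [set w | (S w <= x)%R])%E].
have AE x : A x <-> fine (PB [set w | x < bsup B w]) <= alpha.
  have mS := meas_gtset x (measurable_funPT S).
  have -> : A x = ((1 - alpha)%:E <= 1 - PS [set w | (x < S w)%R])%E.
    rewrite /A/= -probability_setC//; congr (_ <= PS _)%E; apply/seteqP.
    by split => w /=; [rewrite leNgt => /negP | move/negP; rewrite -leNgt].
  rewrite hgt -[PB _]fineK ?fin_num_measure// -EFinB lee_fin.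
  by split => h; lra.
have mono x y : x <= y -> fine (PB [set w | y < bsup B w]) <= fine (PB [set w | x < bsup B w]).
  by move=> xy; apply: pr_le => // w; exact: le_lt_trans.
have b0 : fine (PB [set w | 0 < bsup B w]) = 1.
  have -> : [set w | 0 < bsup B w] = ~` [set w | bsup B w <= 0].
    by apply/seteqP; split => w /=; [rewrite ltNge => /negP | move/negP; rewrite -ltNge].
  have m0 : measurable [set w | bsup B w <= 0] by apply: meas_leset => //; exact: (meas_bsup hB).
  rewrite probability_setC// -[PB _]fineK ?fin_num_measure// (bsup_gt0 hB) sube0//.
have A0 x : A x -> 0 < x.
  move=> /AE h; rewrite ltNge; apply/negP => x0; have := mono _ _ x0; rewrite b0 => h'; lra.
have Ane : A !=set0.
  by have [n _ /(_ n (leqnn n)) h] := bsup_tight a0; exists n%:R; apply/AE.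
have hz : fine (PB [set w | z < bsup B w]) <= alpha.
  apply/ler_addgt0Pr => e e0; have [dl dl0 h] := bsup_right_continuous hB z e0.
  have hA : has_inf A by split => //; exists 0 => x /A0 /ltW.
  have [y Ay yz] := inf_adherent dl0 hA.
  apply: (le_trans h); rewrite lerD2r; apply: le_trans (mono _ _ (ltW yz)) _; exact/AE.
split => //; exact/A0/AE.
Qed.

End brownian_quantile.

(** * Assembling the folds, uniformly over the parameter *)

Section crossfit.
Unset Implicit Arguments.
Context {R : realType} {Theta : Type} (m : Theta -> lct_model R) (K : nat) (J : forall n : nat, 'I_K -> {set 'I_n}).
Context (lhat Ghat : forall (th : Theta) (n : nat), 'I_K -> estimator (m th) n).
Context {dB} {OmegaB : measurableType dB} (PB : probability OmegaB R) (B : R -> OmegaB -> R).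
Hypotheses (hK : (2 <= K)%N) (hm : forall th, lct_setting (m th)) (hJ : forall n, is_fold_partition (J n)).
Hypothesis hJratio : forall k, #|J n k|%:R / n%:R @[n --> \oo] --> (K%:R^-1 : R).
Hypothesis hlhat : forall th n k, fitted_estimator (~: J n k)%SET (fil (m th)) (lhat th n k).
Hypothesis hGhat : forall th n k, fitted_estimator (~: J n k)%SET (big_fil (m th)) (Ghat th n k).
Hypothesis hB : standard_brownian_motion PB B.
Context (C C' : R).
Hypotheses (C0 : 0 < C) (C'0 : 0 < C').
Hypothesis hG : forall th, {ae obs_law (m th), forall e, caglad (Gres (m th) ^~ e) /\
  forall t, 0 <= t <= 1 -> `|Gres (m th) t e| <= C'}.
Hypothesis hest : forall th n k, {ae data_law (m th), forall w t, 0 <= t <= 1 ->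
  `|eval_new (lhat th n k) w t| <= C /\ `|eval_new (Ghat th n k) w t| <= C'}.
Hypothesis hcard : forall k, #|J n k| @[n --> \oo] --> \oo.
Hypothesis rates : forall k, sup_ge0 [set: Theta] (fun th =>
  maxe (L2_error (Gres (m th)) (Ghat th n k)) (maxe (L2_error (lambda (m th)) (lhat th n k))
   ((Num.sqrt #|J n k|%:R)%:E * L2_error (Gres (m th)) (Ghat th n k) *
     L2_error (lambda (m th)) (lhat th n k))%E)) @[n --> \oo] --> 0%E.
Context (d1 : R).
Hypotheses (d10 : 0 < d1) (hvar : forall th, (d1%:E <= variance_function (m th) 1)%E).
Set Implicit Arguments.
Let K0 : (0 < K)%N := ltnW hK.
Let Kr : 0 < K%:R :> R. Proof. by rewrite ltr0n. Qed.
Local Notation wt n k := (Num.sqrt n%:R / (K%:R * #|J n k|%:R) : R).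
Local Notation small_folds n e := (forall k, [/\ (0 < #|J n k|)%N, #|J n k|%:R * wt n k ^+ 2 <= 2,
      #|J n k|%:R * (wt n k - (Num.sqrt n%:R)^-1) ^+ 2 <= e & #|J n k|%:R^-1 <= e]).
Local Notation small_rates th n e k := (exists g h : R,
  [/\ 0 <= g <= e, 0 <= h <= e, Num.sqrt #|J n k|%:R * g * h <= e,
      (L2_error (Gres (m th)) (Ghat th n k) <= g%:E)%E & (L2_error (lambda (m th)) (lhat th n k) <= h%:E)%E]).

(** |J| wt^2 = n / (K^2 |J|) tends to 1/K, which is below 2, and |J| (wt - n^(-1/2))^2 tends to 0,
    both because |J| / n tends to 1/K. *)
Lemma fold_sizes (e : R) : 0 < e -> \forall n \near \oo, small_folds n e.
Proof.
move=> e0; apply: filter_forall => k; pose p n : R := #|J n k|%:R / n%:R.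
have cp : p n @[n --> \oo] --> (K%:R^-1 : R) by exact: hJratio.
have Ki : K%:R^-1 != 0 :> R by rewrite invr_eq0 gt_eqF.
have c1 : (K%:R ^+ 2 * p n)^-1 @[n --> \oo] --> (K%:R^-1 : R).
  rewrite -[X in _ --> X](_ : (K%:R ^+ 2 * K%:R^-1)^-1 = _); last by field; rewrite gt_eqF.
  by apply: cvgV; [rewrite mulf_neq0// expf_neq0// gt_eqF | exact: cvgMr].
have c2 : p n * ((K%:R * p n)^-1 - 1) ^+ 2 @[n --> \oo] --> 0.
  rewrite -[X in _ --> X](_ : K%:R^-1 * ((K%:R * K%:R^-1)^-1 - 1) ^+ 2 = _); last first.
    by rewrite divff ?gt_eqF// invr1 subrr expr0n mulr0.
  have h : ((K%:R * p n)^-1 - 1) @[n --> \oo] --> ((K%:R * K%:R^-1)^-1 - 1 : R).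
    by apply: cvgB; [apply: cvgV; [rewrite mulf_neq0// gt_eqF | exact: cvgMr] | exact: cvg_cst].
  by apply: cvgM => //; apply: cvgM.
have k2 : K%:R^-1 < 2 :> R by apply: (@le_lt_trans _ _ 1); rewrite ?ltr1n// invf_le1// ler1n.
have /cvgnyPge hA := hcard k.
near=> n; have n0 : 0 < n%:R :> R by rewrite ltr0n; near: n; exists 1%N.
have Jn : ((Num.truncn (e^-1)).+1 <= #|J n k|)%N by near: n; exact: hA.
have J0 : (0 < #|J n k|)%N by exact: leq_trans Jn.
have Jr : 0 < #|J n k|%:R :> R by rewrite ltr0n.
pose q : R := Num.sqrt n%:R; have q0 : 0 < q by rewrite sqrtr_gt0.
have q2 : n%:R = q ^+ 2 by rewrite sqr_sqrtr// ltW.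
have pE : p n = #|J n k|%:R / q ^+ 2 by rewrite -q2.
split => //.
- have -> : #|J n k|%:R * wt n k ^+ 2 = (K%:R ^+ 2 * p n)^-1 by rewrite pE -/q; field; rewrite !gt_eqF.
  by near: n; exact: cvgr_le c1 _ k2.
- have -> : #|J n k|%:R * (wt n k - (Num.sqrt n%:R)^-1) ^+ 2 = p n * ((K%:R * p n)^-1 - 1) ^+ 2.
    by rewrite pE -/q; field; rewrite !gt_eqF.
  by near: n; exact: cvgr_le c2 _ e0.
- rewrite -[e]invrK lef_pV2 ?posrE ?invr_gt0//; apply: ltW; apply: (lt_le_trans (truncnS_gt _)).
  by rewrite ler_nat.
Unshelve. all: end_near.
Qed.

Lemma rates_near (e : R) : 0 < e -> \forall n \near \oo, forall k th, small_rates th n e k.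
Proof.
move=> e0; apply: filter_forall => k.
have nb := @nbhs_open_ereal_lt R 0 (fun=> e) e0; have [n0 _ hn0] := rates k _ nb.
exists n0 => // n /hn0 /= hn th.
set g := L2_error _ (Ghat th n k); set h := L2_error _ (lhat th n k).
have : (maxe g (maxe h ((Num.sqrt #|J n k|%:R)%:E * g * h)) <= e%:E)%E.
  by apply: le_trans (ltW hn); apply: ereal_sup_ubound; right; exists th.
rewrite !ge_max => /and3P[ge he].
have g0 : (0 <= g)%E by exact: sqrte_ge0.
have h0 : (0 <= h)%E by exact: sqrte_ge0.
have fin (y : \bar R) : (0 <= y)%E -> (y <= e%:E)%E -> exists2 r, y = r%:E & 0 <= r <= e.
  by case: y => [r| |]//; rewrite !lee_fin => r0 re; exists r; rewrite ?r0.
have [r eg r01] := fin _ g0 ge; have [r' eh r'01] := fin _ h0 he.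
by rewrite eg eh -!EFinM lee_fin => gh; exists r, r'.
Qed.

Section one_distribution.
Variables (th : Theta) (h0 : H0 (m th)).
Local Notation P := (obs_law (m th)).
Local Notation Q := (data_law (m th)).
Local Notation N := (Nproc (m th)).
Local Notation Y := (sample (m th)).
Local Notation F := (big_fil (m th)).
Local Notation b := (clip C (lambda (m th))).
Local Notation G := (clip C' (Gres (m th))).
Local Notation lh n k := (fun x => clip C (lhat th n k x)).
Local Notation Gh n k := (fun x => clip C' (Ghat th n k x)).
Local Notation St n := (statistic Y N b (J n) (fun k => Gh n k) (fun k => lh n k)).
Local Notation jsum := (jsum N).
Let mY := sample_measurable _ (hm th).
Let indY := sample_independent _ (hm th).
Let lawY i A := @sample_law _ _ (hm th) i A.

(** Any fold provides bounded estimates arbitrarily close to lambda, as [intensity_clip] asks; fold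
    0 is taken. *)
Lemma crossfit_counting : counting_setup P F N b C.
Proof.
apply: (model_counting (hm th) (ltW C0)) h0; apply: (intensity_clip (hm th) (ltW C0)) => e e0.
have [n _ /(_ n (leqnn n)) hn] := rates_near e0; pose k := Ordinal K0.
have [g [h [_ /andP[_ he] _ _ hh]]] := hn k th.
exists n, (~: J n k)%SET, (lhat th n k); split => //; last by apply: (le_trans hh); rewrite lee_fin.
by apply: filterS (hest th n k) => w hw t /hw [].
Qed.

Let CS := crossfit_counting.
Let fGh n k : frozen F (~: J n k)%SET (Gh n k) C'.
Proof. exact: (frozen_clip (hm th) (fun H p => p) (hGhat th n k) (ltW C'0)). Qed.
Let flh n k : frozen F (~: J n k)%SET (lh n k) C.
Proof. exact: (frozen_clip (hm th) (predictable_big (hm th)) (hlhat th n k) (ltW C0)). Qed.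
Let pG : pred F G := pred_residual (hm th) (ltW C'0).
Let bG s e : `|G s e| <= C' := clip_le _ s e (ltW C'0).
Let V := \int[P]_e jsum (fun s e => G s e ^+ 2) e.

Lemma statistic_ge0 n w : 0 <= St n w.
Proof.
rewrite leNgt; apply/negP; rewrite /statistic; case: ifP => _; first by rewrite ltxx.
rewrite ltNge mulr_ge0 ?sqrtr_ge0//; set A := [set _ | _ in _].
have [hs|/sup_out ->//] := pselect (has_sup A).
apply: le_trans (normr_ge0 (gam Y N b (J n) (fun k => Gh n k) (fun k => lh n k) w 0)) (ub_le_sup hs.2 _).
by exists 0 => //=; rewrite in_itv/= lexx ler01.
Qed.

Lemma meas_statistic n : meas (St n).
Proof.
apply: meas_ray => x; case: (leP 0 x) => x0.
  have -> : [set w | St n w <= x] = ~` [set w | x < St n w].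
    by apply/seteqP; split => w /=; [rewrite leNgt => /negP | move/negP; rewrite -leNgt].
  by apply: measurableC; exact: (meas_statistic_gt mY CS (fGh n) (flh n)).
rewrite (_ : [set w | _] = set0)//; apply/seteqP; split => w //= h.
by have := le_lt_trans (le_trans (statistic_ge0 n w) h) x0; rewrite ltxx.
Qed.

Lemma T_check_statistic n : {ae Q, forall w, T_check (J n) (lhat th n) (Ghat th n) w = St n w}.
Proof.
have ae : {ae Q, forall w, forall (k : 'I_K) (j : 'I_n), j \in J n k -> let e := Y (Some (val j)) w in
    (forall t, 0 <= t <= 1 -> integral_dM (N e) (eval_obs (lhat th n k) j w) (eval_obs (Ghat th n k) j w) t =
      contribution Y N b (Gh n k) (lh n k) j w t) /\
    \int[ls_measure (N e)]_(s in `]0, 1]) (eval_obs (Ghat th n k) j w s ^+ 2) =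
      jsum (fun s e => clip C' (Ghat th n k (data w)) s e ^+ 2) e}.
  apply: filter_forall => k; apply: filter_forall => j.
  have [jk|jk] := boolP (j \in J n k); last by apply: aeW => w.
  have jD : j \notin (~: J n k)%SET by rewrite inE negbK.
  have := fold_representation (hm th) (ltW C0) (ltW C'0) (hGhat th n k) (hlhat th n k) CS jD (hest th n k).
  by apply: filterS => w hw _.
apply: filterS ae => w hw; rewrite /T_check /statistic.
have -> : V_check (J n) (Ghat th n) w 1 = vhat Y N (J n) (fun k => Gh n k) w.
  rewrite /V_check /vhat; congr (_ * _); apply: eq_bigr => k _; congr (_ * _); apply: eq_bigr => j jk.
  by have [_ ->] := hw k j jk.
case: ifP => // _; congr (_ * sup _); apply: eq_imagel => t /=; rewrite in_itv/= => t01; congr `|_|.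
rewrite /gamma_check /gam; congr (_ * _); apply: eq_bigr => k _; congr (_ * _); apply: eq_bigr => j jk.
by have [-> //] := hw k j jk.
Qed.

(** The statistic is almost surely equal to a measurable one; completeness of the data space
    transfers measurability. *)
Lemma meas_T_check n : meas (T_check (J n) (lhat th n) (Ghat th n)).
Proof.
apply/mEFinP; apply: (ae_measurable_fun (data_complete _ (hm th)) (f := EFin \o St n)).
  by apply: filterS (T_check_statistic n) => w /= -> _.
exact/mEFinP/meas_statistic.
Qed.

Lemma Ex_T_check n (f : R -> R) : integ Q (fun w => f (St n w)) -> meas f ->
  integ Q (fun w => f (T_check (J n) (lhat th n) (Ghat th n) w)) /\
  \int[Q]_w f (T_check (J n) (lhat th n) (Ghat th n) w) = \int[Q]_w f (St n w).
Proof.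
move=> i1 mf; have mT := mcomp mf (meas_T_check n).
have ae : {ae Q, forall w, f (St n w) = f (T_check (J n) (lhat th n) (Ghat th n) w)}.
  by apply: filterS (T_check_statistic n) => w ->.
by have [h ->] := Ex_ae i1 mT ae.
Qed.

Lemma variance_ge : d1 <= V.
Proof.
apply: (model_variance (hm th) (hG th)) (hvar th).
have fG2 := frozen_sqr (frozen_cst CS (finset.set0 : {set 'I_0}) pG bG).
exact: (jsum_formula CS [tuple] fG2).1.
Qed.

Lemma crossfit_good (n : nat) (eta e : R) : 0 < eta -> 0 < e <= 1 ->
  small_folds n e ->
  (forall k, small_rates th n e k) ->
  exists A, [/\ measurable A, fine (Q A) <= K%:R * (fold_const C C' eta * e) &
    forall w, ~ A w -> forall k, fold_good P Y N b (J n k) G (Gh n k) (lh n k) (wt n k) (Num.sqrt n%:R)^-1 eta w].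
Proof.
move=> eta0 e01 hs hr.
have bF := big_filtration (hm th).
have ex k : exists A, [/\ measurable A, fine (Q A) <= fold_const C C' eta * e &
    forall w, ~ A w -> fold_good P Y N b (J n k) G (Gh n k) (lh n k) (wt n k) (Num.sqrt n%:R)^-1 eta w].
  have [J0 s1 s2 s3] := hs k; have [g [h [g01 h01 gh hg hh]]] := hr k.
  have DJ i : i \in J n k -> i \notin (~: J n k)%SET by rewrite !inE negbK.
  have [g0 _] := andP g01; have [h00 _] := andP h01.
  have eG := err2_clip (hm th) (fun H p => p) (hGhat th n k) (predictable_residual (hm th)) (ltW C'0) g0 hg.
  have eL := err2_clip (hm th) (predictable_big (hm th)) (hlhat th n k)
    (predictable_big (hm th) (predictable_lambda (hm th))) (ltW C0) h00 hh.
  have {}eG : \int[Q]_w err2 P (Gh n k) (fun _ => G) (sample_tuple Y w) <= g ^+ 2.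
    apply: le_trans eG; apply: eq_ler; apply: eq_Ex => w.
    by apply: eq_Ex => x; apply: eq_Ex => s; rewrite -sqrrN opprB.
  have ort x s := residual_orthogonal (hm th) (ltW C0) (ltW C'0) (hG th) x s (hlhat th n k).
  have wt0 : 0 <= wt n k by rewrite divr_ge0 ?sqrtr_ge0// mulr_ge0.
  exact: (fold_good_event mY indY lawY CS DJ pG bG (fGh n k) (flh n k) ort eta0 e01 J0 wt0 eG eL g01 h01 gh s1 s2 s3).
(* The fold index is turned into a natural number for [pr_exists_le], with the empty event out of
   range. *)
pose A k := sval (cid (ex k)); pose O l := if insub l is Some k then A k else set0.
have hO l : (l < K)%N -> measurable (O l) /\ fine (Q (O l)) <= fold_const C C' eta * e.
  by move=> lK; rewrite /O insubT/=; have [h1 h2 _] := svalP (cid (ex (Ordinal lK))).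
have [mU qU] := pr_exists_le hO.
exists [set w | exists2 l, (l < K)%N & O l w]; split => // w nA k.
have [_ _] := svalP (cid (ex k)); apply => Aw; apply: nA; exists (val k); rewrite ?ltn_ord//.
by rewrite /O valK.
Qed.

End one_distribution.

Local Notation Q th := (data_law (m th)).
Local Notation P th := (obs_law (m th)).
Local Notation Sc th := (score (sample (m th)) (Nproc (m th)) (clip C (lambda (m th)))).
Local Notation St th n := (statistic (sample (m th)) (Nproc (m th)) (clip C (lambda (m th))) (J n)
  (fun k x => clip C' (Ghat th n k x)) (fun k x => clip C (lhat th n k x))).

Lemma score_scale (th : Theta) (h0 : H0 (m th)) (G : R -> obs_space (m th) -> R) (c a : R) n t w :
  pred (big_fil (m th)) G -> (bdd G c) ->
  Sc th (fun s e => a * G s e) n t w =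
  a * Sc th G n t w.
Proof.
move=> pG bG; have CS := crossfit_counting h0; rewrite /score mulrCA; congr (_ * _).
rewrite mulr_sumr; apply: eq_bigr => i _; set e := sample _ _ w.
have bH u : `|(u <= t)%R%:R * G u e| <= c by exact: maskM_le.
rewrite /mart -(mintZ CS a (pred_upto CS t pG) bH); congr (mint _ _ _ _).
by apply/funext => u; apply/funext => e'; rewrite mulrCA.
Qed.

(** G is divided by sqrt V so that its clock ends at 1, with the common bound C' / sqrt d1. Off an
    event of probability at most eps/2, the statistic at level x is caught between the normalised
    score at levels x - dl and x + dl. *)
Lemma crossfit_tail (x eps : R) : 0 < x -> 0 < eps -> \forall n \near \oo, forall th, H0 (m th) ->
  `|fine (Q th [set w | x < St th n w]) - fine (PB [set w | x < bsup B w])| <= eps.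
Proof.
move=> x0 e0; have eps2 : 0 < eps / 2 by lra.
have sd0 : 0 < Num.sqrt d1 by rewrite sqrtr_gt0.
have c10 : 0 <= C' / Num.sqrt d1 by rewrite divr_ge0 ?ltW.
have [n0 [dl [dl0 hlim]]] := score_limit hB c10 (ltW C0) x0 eps2.
(* q eta is the loss of level x (2 eta / d1) + 3 K eta / sqrt d1 in [ratio_transfer]. The choice of
   [eta] keeps it below dl, and eta <= d1/4 keeps the relative error of the variance at most 1/2. *)
pose q := x * (2 / d1) + 3 * K%:R / Num.sqrt d1.
have q0 : 0 <= q by rewrite addr_ge0// ?mulr_ge0 ?divr_ge0 ?mulr_ge0 ?invr_ge0 ?(ltW x0) ?(ltW d10) ?(ltW sd0).
pose eta := Num.min (d1 / 4) (dl / (q + 1)).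
have q1 : 0 < q + 1 by lra.
have eta0 : 0 < eta by rewrite lt_min !divr_gt0.
pose fc := `|fold_const C C' eta|; have fc0 : 0 <= fc by exact: normr_ge0.
have Kfc : 0 < K%:R * fc + 1 by rewrite ltr_wpDl// mulr_ge0.
pose e := Num.min 1 (eps / 2 / (K%:R * fc + 1)).
have ee : 0 < e by rewrite lt_min ltr01 divr_gt0.
have e01 : 0 < e <= 1 by rewrite ee ge_min lexx.
have hKe : K%:R * (fold_const C C' eta * e) <= eps / 2.
  apply: (@le_trans _ _ ((K%:R * fc + 1) * e)).
    rewrite mulrA ler_wpM2r ?(ltW ee)//; apply: (@le_trans _ _ (K%:R * fc)); last by rewrite lerDl.
    by rewrite ler_wpM2l// ler_norm.
  by rewrite mulrC -ler_pdivlMr// ge_min lexx orbT.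
have hs := fold_sizes ee; have hr := rates_near ee.
near=> n => th h0.
have sn : small_folds n e.
  by near: n; exact: hs.
have rn : forall k th, small_rates th n e k.
  by near: n; exact: hr.
have nn : (n0 <= n)%N by near: n; exists n0.
have np : (0 < n)%N by near: n; exists 1%N.
have CS := crossfit_counting h0.
have mY := sample_measurable _ (hm th); have indY := sample_independent _ (hm th).
have lawY i A := @sample_law _ _ (hm th) i A.
pose G := clip C' (Gres (m th)); have pG : pred (big_fil (m th)) G := pred_residual (hm th) (ltW C'0).
have bG s e' : `|G s e'| <= C' := clip_le _ s e' (ltW C'0).
pose V := \int[P th]_e' jsum (Nproc (m th)) (fun s e' => G s e' ^+ 2) e'.
have dV : d1 <= V := variance_ge h0; have V0 : 0 < V := lt_le_trans d10 dV.
have sV0 : 0 < Num.sqrt V by rewrite sqrtr_gt0.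
pose Gn s e' := (Num.sqrt V)^-1 * G s e'.
have pGn : pred (big_fil (m th)) Gn := predZ (big_filtration (hm th)) (Num.sqrt V)^-1 pG.
have bGn s e' : `|Gn s e'| <= C' / Num.sqrt d1.
  rewrite normrM gtr0_norm ?invr_gt0// mulrC ler_pM ?invr_ge0 ?(ltW sV0)//.
  by rewrite lef_pV2 ?posrE// ler_sqrt// ltW.
have clk : clock (P th) (Nproc (m th)) Gn 1 = 1.
  transitivity (V^-1 * V); last by rewrite mulVf// gt_eqF.
  have iJ : integ (P th) (jsum (Nproc (m th)) (fun s e' => G s e' ^+ 2)).
    have fG2 := frozen_sqr (frozen_cst CS (finset.set0 : {set 'I_0}) pG bG).
    exact: (jsum_formula CS [tuple] fG2).1.
  rewrite -(ExZ _ iJ); apply: eq_Ex => e'; rewrite /jsum mulr_sumr; apply: eq_bigr => i _.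
  by rewrite (jtime_le1 (cs_path CS e')) ltn_ord mul1r /Gn exprMn exprVn sqr_sqrtr// ltW.
have [lo hi] := hlim _ _ _ _ _ _ _ _ _ _ _ n mY indY lawY CS pGn bGn clk nn np.
pose ex a := [set w | exists2 u, 0 <= u <= 1 &
  a < `|Sc th Gn n u w|].
rewrite -/(ex _) in lo hi.
have [U [mU qU hU]] := crossfit_good h0 eta0 e01 sn (fun k => rn k th).
have mE a : measurable (ex a) by exact: (meas_score_sup mY CS pGn bGn).
pose fG k := frozen_clip (hm th) (fun H p => p) (hGhat th n k) (ltW C'0).
pose fl k := frozen_clip (hm th) (predictable_big (hm th)) (hlhat th n k) (ltW C0).
have mS : measurable [set w | x < St th n w] := meas_statistic_gt mY CS fG fl (ltW x0).
have key w : ~ U w -> (x < St th n w -> ex (x - dl) w) /\ (ex (x + dl) w -> x < St th n w).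
  move=> /hU gw; have [hg hv] := statistic_approx np K0 (hJ n) (fun k => let: And4 h _ _ _ := sn k in h) gw.
  set gm := gam _ _ _ _ _ _ w in hg; set v := vhat _ _ _ _ _ in hv.
  have a0 : 0 <= 2 * eta / d1 by rewrite divr_ge0 ?mulr_ge0 ?ltW.
  have a1 : 2 * eta / d1 <= 2^-1.
    have : eta <= d1 / 4 by rewrite ge_min lexx.
    by rewrite ler_pdivrMr//; lra.
  have hva : `|v - V| <= d1 * (2 * eta / d1) by rewrite mulrCA divff ?mulr1// gt_eqF.
  have hd : x * (2 * eta / d1) + K%:R * (3 * eta) / Num.sqrt d1 <= dl.
    have -> : x * (2 * eta / d1) + K%:R * (3 * eta) / Num.sqrt d1 = q * eta by rewrite /q; field; rewrite !gt_eqF.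
    apply: (@le_trans _ _ ((q + 1) * eta)); first by rewrite ler_wpM2r ?(ltW eta0)// lerDl.
    by rewrite mulrC -ler_pdivlMr// ge_min lexx orbT.
  have sE t : `|Sc th Gn n t w| =
      `|Sc th G n t w| / Num.sqrt V.
    by rewrite (score_scale h0 _ n t w pG bG) normrM (gtr0_norm (_ : 0 < (Num.sqrt V)^-1)) ?invr_gt0// mulrC.
  have tr t (t01 : 0 <= t <= 1) := ratio_transfer d10 dV hva a0 a1 (ltW x0) (hg t t01) hd.
  have [s1 s2] := statistic_gtP (sample (m th)) CS fG fl w (ltW x0).
  split => [/s1[v0 [t t01 h]]|[t t01 h]].
    by exists t => //; rewrite sE; have [_ h1 _] := tr t t01; exact: h1.
  have [v0 _ h1] := tr t t01; apply: s2; split => //; exists t => //.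
  by apply: h1; rewrite -sE.
have u1 : fine (Q th [set w | x < St th n w]) <= fine (Q th (ex (x - dl))) + fine (Q th U).
  by apply: pr_le_U => // w h; have [Uw|/key[k1 _]] := pselect (U w); [right | left; exact: k1].
have u2 : fine (Q th (ex (x + dl))) <= fine (Q th [set w | x < St th n w]) + fine (Q th U).
  by apply: pr_le_U => // w h; have [Uw|/key[_ k1]] := pselect (U w); [right | left; exact: k1].
have qU' := le_trans qU hKe.
by rewrite ler_norml; apply/andP; split; lra.
Unshelve. all: end_near.
Qed.

Lemma crossfit_weak_limit (eps : R) : 0 < eps -> \forall n \near \oo, forall th, H0 (m th) -> forall f, bounded_lipschitz f ->
  `|\int[Q th]_w f (St th n w) - \int[PB]_w f (bsup B w)| <= eps.
Proof.
move=> e0; have e16 : 0 < eps / 16 by lra.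
(* The budget of [step_comparison]: 2 h is eps/4, four Brownian tails of eps/16 make eps/4, and [e']
   is chosen for the last term to be eps/4. *)
pose h := eps / 8; have h0 : 0 < h by rewrite /h; lra.
have [n0 _ /(_ n0 (leqnn n0)) hn0] := bsup_tight hB e16.
pose M := Num.truncn (n0%:R / h : R).
have Mh : n0%:R <= M.+1%:R * h by rewrite -ler_pdivrMr//; apply: ltW; exact: truncnS_gt.
have Mh0 : 0 < 2 + M.+1%:R * h by rewrite addr_gt0// mulr_gt0.
pose e' := eps / 4 / (2 + M.+1%:R * h); have e'0 : 0 < e' by rewrite !divr_gt0.
have mBs a := meas_gtset a (meas_bsup hB).
have tail : \forall n \near \oo, forall i : 'I_M.+1, forall th, H0 (m th) ->
    `|fine (Q th [set w | i.+1%:R * h < St th n w]) - fine (PB [set w | i.+1%:R * h < bsup B w])| <= e'.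
  by apply: filter_forall => i; apply: crossfit_tail => //; rewrite mulr_gt0.
apply: filterS tail => n hn th hth f bl.
have mS := meas_statistic hth n; have mB := meas_bsup hB.
have hi i : (i <= M)%N ->
    `|fine (Q th [set w | i.+1%:R * h < St th n w]) - fine (PB [set w | i.+1%:R * h < bsup B w])| <= e'.
  by move=> iM; exact: (hn (Ordinal (iM : (i < M.+1)%N)) th hth).
apply: (le_trans (step_comparison h0 (ltW e'0) mS mB (statistic_ge0 n) (bsup_ge0 hB) hi bl)).
have t1 : fine (PB [set w | M.+1%:R * h < bsup B w]) <= eps / 16.
  by apply: le_trans hn0; apply: pr_le => // w /=; exact: le_lt_trans.
have t2 : (2 + M.+1%:R * h) * e' = eps / 4 by rewrite mulrC divfK// gt_eqF.
by move: t1; rewrite t2 /h; set z := fine _ => t1; lra.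
Qed.

End crossfit.

Theorem theorem5p4 (R : realType) (Theta : Type) (m : Theta -> lct_model R)
  (K : nat) (J : forall n : nat, 'I_K -> {set 'I_n})
  (lhat Ghat : forall (th : Theta) (n : nat), 'I_K -> estimator (m th) n)
  (dB : measure_display) (OmegaB : measurableType dB) (PB : probability OmegaB R)
  (B : R -> OmegaB -> R)
  (dS : measure_display) (OmegaS : measurableType dS) (PS : probability OmegaS R)
  (S : {RV PS >-> R})
  (hK : (2 <= K)%N)
  (hm : forall th, lct_setting (m th))
  (hJ : forall n, is_fold_partition (J n))
  (hJratio : forall k, #|J n k|%:R / n%:R @[n --> \oo] --> (K%:R^-1 : R))
  (hlhat : forall th n k, fitted_estimator (~: J n k)%SET (fil (m th)) (lhat th n k))
  (hGhat : forall th n k,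
     fitted_estimator (~: J n k)%SET (big_fil (m th)) (Ghat th n k))
  (hB : standard_brownian_motion PB B)
  (hS : forall A : set R, measurable A ->
     PS (S @^-1` A) =
     PB ((fun w => sup [set `|B t w| | t in `[0, 1]%classic]) @^-1` A))
  (boundedness : exists C C' : R, [/\ 0 < C, 0 < C' & forall th,
     [/\ {ae obs_law (m th), forall e, caglad (blambda (m th) ^~ e) /\
            forall t, 0 <= t <= 1 -> blambda (m th) t e <= C},
         {ae obs_law (m th), forall e, caglad (Gres (m th) ^~ e) /\
            forall t, 0 <= t <= 1 -> `|Gres (m th) t e| <= C'}
       & forall n k,
         {ae data_law (m th), forall w, forall t, 0 <= t <= 1 ->
            `|eval_new (lhat th n k) w t| <= C /\
            `|eval_new (Ghat th n k) w t| <= C'}]])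
  (rates : forall k,
     #|J n k| @[n --> \oo] --> \oo /\
     (let g th n := L2_error (Gres (m th)) (Ghat th n k) in
      let h th n := L2_error (lambda (m th)) (lhat th n k) in
      sup_ge0 [set: Theta] (fun th =>
        maxe (g th n) (maxe (h th n)
          ((Num.sqrt #|J n k|%:R)%:E * g th n * h th n)%E))
        @[n --> \oo] --> 0%E))
  (variance : exists2 delta1 : R, 0 < delta1 &
     forall th, (delta1%:E <= variance_function (m th) 1)%E) :
  let Theta0 := [set th | H0 (m th)] in
  let T n th := T_check (J n) (lhat th n) (Ghat th n) in
  sup_ge0 Theta0 (fun th => BL_distance (data_law (m th)) (T n th) PS S)
    @[n --> \oo] --> 0%E
  /\
  forall alpha : R, 0 < alpha < 1 ->
    let z := quantile PS S (1 - alpha) in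
    (limn_esup (fun n => sup_ge0 Theta0 (fun th =>
       data_law (m th)
         [set w | XLCT (J n) (lhat th n) (Ghat th n) z w])) <= alpha%:E)%E.
Proof.
move=> Theta0 T; have [C [C' [C0 C'0 hbd]]] := boundedness; have [d1 d10 hvar] := variance.
have hG th : {ae obs_law (m th), forall e, caglad (Gres (m th) ^~ e) /\
    forall t, 0 <= t <= 1 -> `|Gres (m th) t e| <= C'} by have [] := hbd th.
have hest th n k : {ae data_law (m th), forall w, forall t, 0 <= t <= 1 ->
    `|eval_new (lhat th n k) w t| <= C /\ `|eval_new (Ghat th n k) w t| <= C'} by have [_ _] := hbd th; apply.
have hcard k := (rates k).1; have hr k := (rates k).2.
have wl := crossfit_weak_limit hK hm hJ hJratio hlhat hGhat hB C0 C'0 hG hest hcard hr d10 hvar.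
have tail := crossfit_tail hK hm hJ hJratio hlhat hGhat hB C0 C'0 hG hest hcard hr d10 hvar.
have mSt th (h0 : H0 (m th)) n := meas_statistic hK hm hlhat hGhat C0 C'0 hest hr h0 n.
have ExT th (h0 : H0 (m th)) n f := Ex_T_check hK hm hlhat hGhat C0 C'0 hest hr h0 (n := n) (f := f).
split.
  (* The supremum is nonnegative because it includes 0, so an upper limit at most 0 means
     convergence to 0. *)
  apply: limn_esup_le_cvg => [|n]; last by apply: ereal_sup_ubound; left.
  apply: limn_esup_le => e e0; move: (wl e e0); apply: filterS => n hn; rewrite add0r.
  apply: ge_ereal_sup => _ [->|[th h0 <-]]; first by rewrite lee_fin ltW.
  apply: ge_ereal_sup => _ [->|[f bl <-]]; first by rewrite lee_fin ltW.
  have mf := meas_bounded_lipschitz bl.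
  have i1 := integ_bounded_lipschitz bl (data_law (m th)) (mSt th h0 n).
  have [iT eT] := ExT th h0 n f i1 mf.
  have iS := integ_bounded_lipschitz bl PS (measurable_funPT S).
  rewrite unlock -(EFin_Ex iT) -(EFin_Ex iS) eT (Ex_law_bsup hB hS bl) lee_fin.
  exact: hn.
(* As z > 0, tails converge uniformly there, and the rejection probability is at most P(sup |B| > z)
   + e <= alpha + e. *)
move=> alpha a01; have [z0 hz] := quantile_bsup hB hS a01; set z := quantile _ _ _ in z0 hz *.
apply: limn_esup_le => e e0; move: (tail z e z0 e0); apply: filterS => n hn.
apply: ge_ereal_sup => _ [->|[th h0 <-]].
  by rewrite lee_fin; case/andP: a01 => a0 _; rewrite addr_ge0// ltW.
have mT := meas_T_check hK hm hlhat hGhat C0 C'0 hest hr h0 n.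
have f01 (X : data_space (m th) -> R) : meas X ->
    fine (data_law (m th) [set w | z < X w]) = \int[data_law (m th)]_w (z < X w)%R%:R.
  move=> mX; rewrite -(Ex_indic _ (meas_gtset z mX)); apply: eq_Ex => w; rewrite indicE.
  by case: (boolP (z < X w)) => hx; [rewrite mem_set | rewrite memNset//; exact/negP].
have mf : meas (fun y : R => (z < y)%R%:R : R) by apply: mb2r; exact: measurable_fun_ltr.
have i1 : integ (data_law (m th)) (fun w => (z < statistic (sample (m th)) (Nproc (m th)) (clip C (lambda (m th))) (J n)
    (fun k x => clip C' (Ghat th n k x)) (fun k x => clip C (lhat th n k x)) w)%R%:R : R).
  apply: integ_bnd => [|w]; last exact: norm_b2r_le1.
  exact: (mcomp mf (mSt th h0 n)).
have [_ eT] := ExT th h0 n _ i1 mf.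
rewrite -[X in (X <= _)%E]fineK; last by apply: fin_num_measure; exact: (meas_gtset z mT).
rewrite lee_fin (f01 _ mT) eT -(f01 _ (mSt th h0 n)).
have := hn th h0; rewrite ler_norml => /andP[_]; lra.
Qed.
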